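(* Let $(X,\{J,g\})$ be a connected Kähler manifold with $\dim_{\mathbb{R}}X=2n\geq4$ which is not holomorphically isometric to $\mathbb{C}^n$. Then the following hold: (1) There exists a locally conformal Kähler manifold $(X,\{h,J\})$ such that the locally conformal Kähler metric $h$ is conformal to the Kähler metric $g$ and satisfies $$\mathrm{Iso}\left(X,\{h,J\}\right)=\mathrm{Conf}(X,\{g,J\}).$$ (2) Furthermore, the holomorphic isometry group $\mathrm{Iso}(X,\{h,J\})$ is maximal among all (holomorphic) isometry groups $\mathrm{Iso}(X,\{h',J\})$ of Hermitian metrics $h'$ conformal to $g$.
   Context: A Hermitian metric $h$ on a complex manifold $(X,J)$ is called locally conformal Kähler ($lcK$) if there is an open covering $\{U_\ell\}$ of $X$ and functions $u_\ell:U_\ell\to\mathbb{R}^{>0}$ such that $h=u_\ell\cdot g_\ell$ on $U_\ell$ with $g_\ell$ a Kähler metric on $(U_\ell,J)$. For a Hermitian metric $h$ on $(X,J)$, $\mathrm{Iso}(X,\{h,J\})$ is the group of holomorphic isometries of $h$, and $\mathrm{Conf}(X,\{h,J\})$ is the group of biholomorphic diffeomorphisms $\alpha$ with $\alpha^*h=f\cdot h$ for some $f\in C^\infty(X,\mathbb{R}^{>0})$. $\mathbb{C}^n$ carries its standard flat Kähler metric. $h$ is conformal to $g$ if $h=v\cdot g$ with $v\in C^\infty(X,\mathbb{R}^{>0})$. *)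

(* Defs.v *)
From HB Require Import structures.
From mathcomp Require Import all_boot all_order all_algebra.
From mathcomp Require Import all_classical all_reals all_analysis.
From mathcomp.real_closed Require Import complex.

Set Implicit Arguments.
Unset Strict Implicit.
Unset Printing Implicit Defensive.

Import Order.TTheory GRing.Theory Num.Theory.
Import numFieldNormedType.Exports.

Local Open Scope classical_set_scope.
Local Open Scope ring_scope.
Local Open Scope complex_scope.

(** [Cspace R n] is a normed module over the field [R[i]], so [differentiable]
    and ['d] are complex (Frechet) differentiability and the complex-linear
    differential: differentiable on an open set means holomorphic. *)

Definition Cspace (R : realType) (n : nat) : normedModType R[i] := 'rV[R[i]]_n.

Definition along (R : realType) n (f : Cspace R n -> R) (z v : Cspace R n) :
  R -> R := fun t => f (z + t%:C *: v).

Definition dirD (R : realType) n (v : Cspace R n) (f : Cspace R n -> R)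
  (z : Cspace R n) : R := 'D_1 (along f z v) 0.

(** Class C^k on the open set [U], for the real structure of C^n. *)
Fixpoint Ck (R : realType) n (k : nat) (U : set (Cspace R n))
    (f : Cspace R n -> R) : Prop :=
  (forall z, U z -> {for z, continuous f}) /\
  (if k is k'.+1 then
     forall v, (forall z, U z -> derivable (along f z v) 0 1) /\
               Ck k' U (dirD v f)
   else True).

Definition Cinfty (R : realType) n (U : set (Cspace R n))
    (f : Cspace R n -> R) : Prop := forall k, Ck k U f.

(** [chart_map c] and [chart_inv c] are total functions which are only
    meaningful on [chart_dom c] and on its image. *)
Record complexManifold (R : realType) (n : nat) := ComplexManifold {
  space :> topologicalType ;
  chart : Type ;
  chart_dom : chart -> set space ;
  chart_map : chart -> space -> Cspace R n ;
  chart_inv : chart -> Cspace R n -> space ;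
  space_hausdorff : hausdorff_space space ;
  space_second_countable : @second_countable space ;
  chart_dom_open : forall c, open (chart_dom c) ;
  chart_cover : forall x, exists c, chart_dom c x ;
  chart_image_open : forall c, open (chart_map c @` chart_dom c) ;
  chart_mapK : forall c x, chart_dom c x -> chart_inv c (chart_map c x) = x ;
  chart_map_continuous : forall c x, chart_dom c x ->
    {for x, continuous (chart_map c)} ;
  chart_inv_continuous : forall c x, chart_dom c x ->
    {for chart_map c x, continuous (chart_inv c)} ;
  transition_holomorphic : forall c c' x, chart_dom c x -> chart_dom c' x ->
    differentiable (chart_map c' \o chart_inv c) (chart_map c x)
}.

Section Maps.
Context {R : realType} {n m : nat}.
Context {X : complexManifold R n} {Y : complexManifold R m}.

Definition local_rep (F : X -> Y) (c : chart X) (c' : chart Y) :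
    Cspace R n -> Cspace R m :=
  chart_map c' \o F \o chart_inv c.

Definition holomorphic (F : X -> Y) : Prop :=
  continuous F /\
  forall c c' x, chart_dom c x -> chart_dom c' (F x) ->
    differentiable (local_rep F c c') (chart_map c x).

Definition tangent_map (F : X -> Y) (c : chart X) (c' : chart Y) (x : X) :
    Cspace R n -> Cspace R m :=
  'd (local_rep F c c') (chart_map c x).

End Maps.

Definition biholomorphic (R : realType) n (X Y : complexManifold R n)
    (F : X -> Y) : Prop :=
  holomorphic F /\
  exists G : Y -> X, [/\ holomorphic G, cancel F G & cancel G F].

(** [g c x u v] is the value at [x] of the real bilinear form [g] on the two
    tangent vectors whose expressions in the chart [c] are [u] and [v]; it is
    only meaningful if [x] lies in [chart_dom c].  The complex structure [J]
    acts on these expressions as multiplication by ['i]. *)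
Definition tensorField (R : realType) n (X : complexManifold R n) : Type :=
  chart X -> X -> Cspace R n -> Cspace R n -> R.

Section Metrics.
Context {R : realType} {n : nat}.

Definition smooth_on (X : complexManifold R n) (U : set X) (f : X -> R) : Prop :=
  forall c, Cinfty (chart_map c @` (chart_dom c `&` U)) (f \o chart_inv c).

Definition smooth_pos_on (X : complexManifold R n) (U : set X) (f : X -> R) :
    Prop :=
  smooth_on U f /\ forall x, U x -> 0 < f x.

(** Metrics on the complex manifold [(U, J)], for [U] an open subset of [X]; the
    values of [g] outside [U] are irrelevant. *)
Record hermitian_on (X : complexManifold R n) (U : set X) (g : tensorField X) :
    Prop := HermitianOn {
  hermitian_linear : forall c x, chart_dom c x -> U x ->
    forall (a : R) u u' v, g c x (a%:C *: u + u') v = a * g c x u v + g c x u' v ;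
  hermitian_sym : forall c x, chart_dom c x -> U x ->
    forall u v, g c x u v = g c x v u ;
  hermitian_pos : forall c x, chart_dom c x -> U x ->
    forall u, u != 0 -> 0 < g c x u u ;
  hermitian_J : forall c x, chart_dom c x -> U x ->
    forall u v, g c x ('i *: u) ('i *: v) = g c x u v ;
  hermitian_tensor : forall c c' x, chart_dom c x -> chart_dom c' x -> U x ->
    forall u v, g c' x (tangent_map id c c' x u) (tangent_map id c c' x v)
                = g c x u v ;
  hermitian_smooth : forall c u v,
    Cinfty (chart_map c @` (chart_dom c `&` U))
           (fun z => g c (chart_inv c z) u v)
}.

Definition fundamental_form (X : complexManifold R n) (g : tensorField X) :
    tensorField X := fun c x u v => g c x ('i *: u) v.

(** The exterior derivative of a 2-form, in the chart [c], on constant (hence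
    commuting) vector fields [u], [v], [w]. *)
Definition ext_deriv (X : complexManifold R n) (om : tensorField X)
    (c : chart X) (x : X) (u v w : Cspace R n) : R :=
  let om' a b := fun z => om c (chart_inv c z) a b in
  dirD u (om' v w) (chart_map c x) - dirD v (om' u w) (chart_map c x)
  + dirD w (om' u v) (chart_map c x).

Definition kahler_on (X : complexManifold R n) (U : set X) (g : tensorField X) :
    Prop :=
  hermitian_on U g /\
  forall c x, chart_dom c x -> U x ->
    forall u v w, ext_deriv (fundamental_form g) c x u v w = 0.

Definition scaled_on (X : complexManifold R n) (U : set X) (h : tensorField X)
    (f : X -> R) (g : tensorField X) : Prop :=
  forall c x, chart_dom c x -> U x -> forall u v, h c x u v = f x * g c x u v.

Definition hermitian_metric (X : complexManifold R n) (g : tensorField X) :=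
  hermitian_on [set: X] g.

Definition kahler_metric (X : complexManifold R n) (g : tensorField X) :=
  kahler_on [set: X] g.

Definition lcK_metric (X : complexManifold R n) (h : tensorField X) : Prop :=
  hermitian_metric h /\
  exists (I : Type) (U : I -> set X) (u : I -> X -> R) (g : I -> tensorField X),
    [/\ forall i, open (U i),
        \bigcup_i U i = [set: X],
        forall i, smooth_pos_on (U i) (u i),
        forall i, kahler_on (U i) (g i) &
        forall i, scaled_on (U i) h (u i) (g i)].

Definition conformal_to (X : complexManifold R n) (h g : tensorField X) : Prop :=
  exists2 v : X -> R, smooth_pos_on [set: X] v & scaled_on [set: X] h v g.

(** [F^* h = f g] *)
Definition pullback_scaled (X Y : complexManifold R n) (F : X -> Y)
    (h : tensorField Y) (f : X -> R) (g : tensorField X) : Prop :=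
  forall c c' x, chart_dom c x -> chart_dom c' (F x) ->
    forall u v,
      h c' (F x) (tangent_map F c c' x u) (tangent_map F c c' x v)
      = f x * g c x u v.

Definition holomorphic_isometry (X Y : complexManifold R n) (g : tensorField X)
    (h : tensorField Y) (F : X -> Y) : Prop :=
  biholomorphic F /\ pullback_scaled F h (cst 1) g.

Definition holomorphically_isometric (X Y : complexManifold R n)
    (g : tensorField X) (h : tensorField Y) : Prop :=
  exists F : X -> Y, holomorphic_isometry g h F.

(** [Iso(X,{h,J})] and [Conf(X,{h,J})], as sets of self-maps of [X]. *)
Definition Iso (X : complexManifold R n) (h : tensorField X) : set (X -> X) :=
  [set a | holomorphic_isometry h h a].

Definition Conf (X : complexManifold R n) (h : tensorField X) : set (X -> X) :=
  [set a | biholomorphic a /\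
           exists2 f : X -> R,
             smooth_pos_on [set: X] f & pullback_scaled a h f h].

End Metrics.

Section FlatSpace.
Context (R : realType) (n : nat).

Lemma Cspace_hausdorff : hausdorff_space (Cspace R n).
Proof. exact: norm_hausdorff. Qed.

Lemma Cspace_second_countable : @second_countable (Cspace R n).
Proof.
pose q (p : rat * rat) : R[i] := (ratr p.1 +i* ratr p.2)%C.
pose rad (k : nat) : R[i] := (k.+1%:R^-1 : R)%:C.
have rad0 k : 0 < rad k by rewrite ltcR invr_gt0 ltr0n.
pose B (p : 'I_n -> rat * rat) k : set (Cspace R n) :=
  (ball ((\row_j q (p j)) : Cspace R n) (rad k))°.
exists ((fun pk : {ffun 'I_n -> rat * rat} * nat => B pk.1 pk.2) @` setT).
  apply: card_le_trans (card_image_le _ _) _; exact: countableP.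
split; first by move=> _ [? _ <-]; exact: open_interior.
move=> x V /nbhs_ballP [e /= e0 eV].
have [k ke] : exists k, rad k + rad k < e.
  move: (e0); rewrite ltcE /= => /andP[/eqP e_im e_re].
  have [//|k] := @ltr_add_invr R 0 (complex.Re e / 2) _; first by rewrite divr_gt0.
  rewrite add0r ltr_pdivlMr // mulr_natr mulr2n => k_lt; exists k.
  by rewrite ltcE /= addr0 e_im eqxx.
have approx (a d : R) : 0 < d -> exists r : rat, `|a - ratr r| < d.
  move=> d0; have [|r] := @rat_in_itvoo R (a - d) (a + d).
    by rewrite ltrD2l gtrN.
  rewrite in_itv /= => /andP[r1 r2]; exists r.
  by rewrite distrC ltr_distl r1 r2.
have [p px] : exists p : {ffun 'I_n -> rat * rat},
    forall j, `|(x : 'rV_n) 0 j - q (p j)| < rad k / 2.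
  have /choice[p pP] : forall j : 'I_n, exists r : rat * rat,
      `|(x : 'rV_n) 0 j - q r| < rad k / 2.
    move=> j; pose d : R := k.+1%:R^-1 / 2 / 2.
    have d0 : 0 < d by rewrite !divr_gt0 // invr_gt0 ltr0n.
    have [r1 hr1] := approx (complex.Re ((x : 'rV_n) 0 j)) d d0.
    have [r2 hr2] := approx (complex.Im ((x : 'rV_n) 0 j)) d d0.
    exists (r1, r2); rewrite /q /=; move: hr1 hr2.
    case: ((x : 'rV_n) 0 j) => a b /= hr1 hr2.
    have -> : (a +i* b)%C - (ratr r1 +i* ratr r2)%C
      = (a - ratr r1)%:C + 'i * (b - ratr r2)%:C.
      by apply/eqP; rewrite eq_complex /= !(mul0r, mul1r, subr0, sub0r, addr0, add0r, oppr0) !eqxx.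
    apply: le_lt_trans (ler_normD _ _) _.
    have ni : `|'i : R[i]| = 1.
      by rewrite normc_def /= expr0n add0r expr1n sqrtr1.
    rewrite normrM ni mul1r !normc_def /= expr0n /= !addr0 !sqrtr_sqr.
    have -> : rad k / 2 = (d + d)%:C.
      by rewrite -splitr -[in LHS](rmorph_nat (real_complex R)) -fmorphV -rmorphM.
    by rewrite -rmorphD ltcR ltrD.
  by exists [ffun j => p j] => j; rewrite ffunE.
have xB : B p k x.
  apply/nbhs_ballP; exists (rad k / 2); first by rewrite /= divr_gt0.
  move=> y xy; rewrite [rad k]splitr.
  apply: ball_triangle xy; split; first by rewrite divr_gt0.
  by move=> i j; rewrite (ord1 i) mxE /ball /= distrC; exact: px.
exists (B p k); first by split => //; exists (p, k).
move=> y /interior_subset yB; apply: eV.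
apply: (@le_ball _ _ _ _ _ (ltW ke)); apply: ball_triangle yB.
exact: (ball_sym (interior_subset xB)).
Qed.

Lemma flat_image_open (c : unit) : open (id @` [set: Cspace R n]).
Proof. by rewrite image_id; exact: openT. Qed.

Definition flat_space : complexManifold R n :=
  @ComplexManifold R n (Cspace R n) unit (fun=> setT) (fun=> id) (fun=> id)
    Cspace_hausdorff Cspace_second_countable
    (fun=> openT) (fun=> ex_intro _ tt I) flat_image_open (fun _ _ _ => erefl)
    (fun _ x _ => @cvg_id _ (nbhs x)) (fun _ x _ => @cvg_id _ (nbhs x))
    (fun _ _ x _ _ => @ex_diff _ _ _ _ _ _ _ (is_diff_id x)).

Definition flat_metric : tensorField flat_space := fun _ _ u v =>
  complex.Re (\sum_(j < n) (u : 'rV[R[i]]_n) 0 j * ((v : 'rV[R[i]]_n) 0 j)^*).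

End FlatSpace.

(* Main.v *)
(** For n >= 2 the factor f in a^* g = f g is constant for every a in Conf(X, {g, J}): pulling back the
    Kahler form and taking d gives df /\ omega = 0.  So Conf(X, {g, J}) is the group G of holomorphic
    homotheties, and it suffices to find a smooth positive v with l(a)^2 v(a x) = v(x), l(a) being the
    ratio of a: then h = v g has Iso(h) = G, while Iso(h') lies in Conf(g) for each h' conformal to g.

    Let rho(x) be the supremum of the radii of the compact balls around x, so rho(a x) = l(a) rho(x).
    If rho is finite, Arzela-Ascoli shows that {a in G : a x is close to x0} is totally bounded for x
    near any point; hence G carries a Haar functional, and v is a countable combination of the averages
    of l(a)^2 chi(a x) for bumps chi.
    If rho is infinite and some homotheties are not isometric, one of them is a contraction with a fixed
    point p, and the limit of A^-k phi(a^k x), with phi a chart at p and A the differential of a at p,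
    is a holomorphic isometry onto (T_p X, g_p), which is C^n; this is excluded.  Otherwise v = 1.

    Smoothness of holomorphic maps, Cauchy estimates and the Weierstrass theorem are derived from complex
    differentiability alone, through Goursat and the maximum principle. *)

From HB Require Import structures.
Require Import Defs.
From mathcomp Require Import all_boot all_order all_algebra.
From mathcomp Require Import all_classical all_reals all_analysis.
From mathcomp.real_closed Require Import complex.
From mathcomp Require Import ring lra.

Set Implicit Arguments.
Unset Strict Implicit.
Unset Printing Implicit Defensive.

Import Order.TTheory GRing.Theory Num.Theory.
Import numFieldNormedType.Exports.

Local Open Scope classical_set_scope.
Local Open Scope ring_scope.
Local Open Scope complex_scope.

(** * Norms and differentials over the complex numbers *)

Section RealNorm.
Context {R : realType}.
Implicit Types V : normedZmodType R[i].

(** Where [rho] is finite, [rho ^- 2] already solves the equation for [v]; but [rho] is only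
    Lipschitz, and what has to be gained is smoothness. Averaging keeps the equation and gains it:
    in charts the maps [a] with [a x] near [x0] are uniformly bounded holomorphic maps, Cauchy
    estimates bound all their derivatives uniformly in [a], and differentiation passes under the
    average. For this the average needs only linearity and a bound by the supremum norm, so an
    invariant functional on uniformly continuous functions suffices and no measure on the group is
    built. A single average is positive near its base point but may vanish elsewhere. Countably many
    are summed, and the equation survives because it is linear in [v] with a factor independent of
    the base point. The step from [df /\ omega = 0] to [df = 0] evaluates on [u], [w], [J w] with
    [w] complex orthogonal to [u]; such a [w] exists from complex dimension 2 on. A homothety with
    fixed point [p] and ratio [l] forces [l ^+ 2 * v p = v p], so contractions with a fixed point
    rule out any positive [v]: this is the obstruction on [C^n]. *)

Definition rn {V : normedZmodType R[i]} (v : V) : R := complex.Re `|v|.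

(** The norm of a module over [R[i]] takes its values in [R[i]]. Passing to the real number [rn v]
    makes all estimates accessible to the order of [R] and to [lra]. *)
Lemma rnE V (v : V) : `|v| = (rn v)%:C.
Proof. by rewrite /rn RRe_real // normr_real. Qed.

Lemma rn_ge0 V (v : V) : 0 <= rn v.
Proof. by rewrite -lecR -rnE normr_ge0. Qed.

Lemma rnD V (u v : V) : rn (u + v) <= rn u + rn v.
Proof. by rewrite -lecR rmorphD /= -!rnE ler_normD. Qed.

Lemma rnN V (u : V) : rn (- u) = rn u.
Proof. by rewrite /rn normrN. Qed.

Lemma rnB V (u v : V) : rn (u - v) <= rn u + rn v.
Proof. by rewrite -(rnN v) rnD. Qed.

Lemma rn_dist V (u v : V) : rn (u - v) = rn (v - u).
Proof. by rewrite -rnN opprB. Qed.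

Lemma rn0 V : rn (0 : V) = 0.
Proof. by rewrite /rn normr0. Qed.

Lemma rn_eq0 V (v : V) : (rn v == 0) = (v == 0).
Proof. by rewrite -(inj_eq (@complexI R)) -rnE normr_eq0. Qed.

Lemma rn_gt0 V (v : V) : (0 < rn v) = (v != 0).
Proof. by rewrite lt_def rn_ge0 andbT rn_eq0. Qed.

Lemma rnZ (V : normedModType R[i]) (a : R[i]) (v : V) : rn (a *: v) = rn a * rn v.
Proof. by apply: (@complexI R); rewrite rmorphM /= -!rnE normrZ. Qed.

Lemma rnM (a b : R[i]) : rn (a * b) = rn a * rn b.
Proof. by apply: (@complexI R); rewrite rmorphM /= -!rnE normrM. Qed.

Lemma rnV (a : R[i]) : rn a^-1 = (rn a)^-1.
Proof. by apply: (@complexI R); rewrite fmorphV /= -!rnE normfV. Qed.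

Lemma rn_real (a : R) : rn a%:C = `|a|.
Proof. by rewrite /rn normc_def /= expr0n /= addr0 sqrtr_sqr. Qed.

Lemma rn_i : rn ('i : R[i]) = 1.
Proof. by rewrite /rn normc_def /= expr0n add0r expr1n sqrtr1. Qed.

Lemma rn1 : rn (1 : R[i]) = 1.
Proof. by rewrite /rn normr1. Qed.

Lemma rnBD V (u v w : V) : rn (u - w) <= rn (u - v) + rn (v - w).
Proof. by rewrite -(subrKA v) rnD. Qed.

Lemma rn_Re (a : R[i]) : `|complex.Re a| <= rn a.
Proof. by rewrite -lecR -rnE normc_ge_Re. Qed.

Lemma rn_Im (a : R[i]) : `|complex.Im a| <= rn a.
Proof.
have := rn_Re (a * 'i); rewrite ReiNIm normrN => /le_trans; apply.
by rewrite rnM rn_i mulr1.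
Qed.

Lemma rn_ReIm (a : R[i]) : rn a <= `|complex.Re a| + `|complex.Im a|.
Proof.
rewrite {1}[a]complexE (le_trans (rnD _ _)) // rn_real rnM rn_i mul1r rn_real.
by [].
Qed.

Lemma rn_sq (a : R[i]) : rn a ^+ 2 = complex.Re a ^+ 2 + complex.Im a ^+ 2.
Proof.
by rewrite /rn normc_def /= sqr_sqrtr // addr_ge0 // sqr_ge0.
Qed.

Lemma rn_conj (a : R[i]) : rn (a^*)%C = rn a.
Proof. by rewrite /rn normcJ. Qed.

Lemma nbhs_rnP (V : normedModType R[i]) (z : V) (A : set V) :
  nbhs z A <-> exists2 d : R, 0 < d & forall z', rn (z' - z) < d -> A z'.
Proof.
split=> [/nbhs_ballP [e /= e0 eA]|[d d0 dA]].
  have er : e = (complex.Re e)%:C by rewrite RRe_real // gtr0_real.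
  exists (complex.Re e); first by rewrite -ltcR -er.
  move=> z' zz'; apply: eA; rewrite -ball_normE /= rnE er ltcR.
  by rewrite rn_dist.
apply/nbhs_ballP; exists d%:C; first by rewrite /= ltcR.
move=> z'; rewrite -ball_normE /= rnE ltcR rn_dist => h; exact: dA.
Qed.

Lemma near_rnP (V : normedModType R[i]) (z : V) (P : V -> Prop) :
  (\forall z' \near z, P z') <->
  exists2 d : R, 0 < d & forall z', rn (z' - z) < d -> P z'.
Proof. exact: nbhs_rnP. Qed.

Lemma open_rnP (V : normedModType R[i]) (U : set V) : open U <->
  forall z, U z -> exists2 d : R, 0 < d & forall z', rn (z' - z) < d -> U z'.
Proof.
rewrite openE; split=> h z Uz; first by have /nbhs_rnP := h _ Uz.
by apply/nbhs_rnP; exact: h.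
Qed.

Lemma cont_rnP (V : normedModType R[i]) (f : V -> R) (z : V) :
  {for z, continuous f} <->
  forall e : R, 0 < e -> exists2 d : R, 0 < d &
    forall z', rn (z' - z) < d -> `|f z' - f z| < e.
Proof.
split=> [/cvgrPdist_lt h e e0|h].
  have /near_rnP [d d0 hd] := h _ e0.
  by exists d => // z' /hd; rewrite distrC.
apply/cvgrPdist_lt => e e0; apply/near_rnP.
have [d d0 hd] := h _ e0; exists d => // z' /hd.
by rewrite distrC.
Qed.

Lemma contv_rnP (V W : normedModType R[i]) (f : V -> W) (z : V) :
  {for z, continuous f} <->
  forall e : R, 0 < e -> exists2 d : R, 0 < d &
    forall z', rn (z' - z) < d -> rn (f z' - f z) < e.
Proof.
split=> [h e e0|h].
  have /h /nbhs_rnP [d d0 hd] : nbhs (f z) [set w | rn (w - f z) < e].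
    by apply/nbhs_rnP; exists e.
  by exists d.
move=> A /nbhs_rnP [e e0 he]; apply/nbhs_rnP.
have [d d0 hd] := h _ e0; exists d => // z' /hd; exact: he.
Qed.

End RealNorm.

Section Differential.
Context {R : realType} {V W : normedModType R[i]}.

Lemma diff_rn (f : V -> W) (z : V) : differentiable f z ->
  forall e : R, 0 < e -> exists2 d : R, 0 < d & forall h, rn h < d ->
    rn (f (z + h) - f z - 'd f z h) <= e * rn h.
Proof.
move=> /diff_locallyP [_ /eqaddoP H] e e0.
have e0' : 0 < e%:C by rewrite ltcR.
have := H _ e0' => /near_rnP [d d0 hd]; exists d => // h hh.
have := hd h; rewrite subr0 => /(_ hh) /=.
rewrite !rnE -rmorphM lecR.
by rewrite -[(_ - _) h]/(f (h + z) - (f z + 'd f z h)) opprD addrA [h + z]addrC.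
Qed.

(** Yields the differential together with differentiability. The bound by [C] provides the
    continuity of [L] on which uniqueness of the differential rests; the other hypothesis is the
    little-o estimate in real form. *)
Lemma rn_diff (f : V -> W) (z : V) (L : {linear V -> W}) (C : R) :
  (forall h, rn (L h) <= C * rn h) ->
  (forall e : R, 0 < e -> exists2 d : R, 0 < d & forall h, rn h < d ->
    rn (f (z + h) - f z - L h) <= e * rn h) ->
  differentiable f z /\ forall v, 'd f z v = L v.
Proof.
move=> LC H.
have cL : continuous L.
  move=> x; apply/contv_rnP => e e0; exists (e / (1 + `|C|)).
    by rewrite divr_gt0 // ltr_pwDl.
  move=> z' hz'; rewrite -linearB; apply: le_lt_trans (LC _) _.
  rewrite ltr_pdivlMr ?ltr_pwDl // in hz'.
  apply: le_lt_trans hz'; rewrite mulrC ler_wpM2l ?rn_ge0 //.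
  by rewrite (le_trans (ler_norm _)) // lerDr.
have E : f \o shift z = cst (f z) + L +o_ 0 id.
  apply/eqaddoP => e e0.
  have er : e = (complex.Re e)%:C by rewrite RRe_real // gtr0_real.
  have e0' : 0 < complex.Re e by rewrite -ltcR -er.
  have [d d0 hd] := H _ e0'.
  apply/near_rnP; exists d => // h; rewrite subr0 => /hd.
  rewrite -[(_ - _) h]/(f (h + z) - (f z + L h)) opprD addrA [h + z]addrC.
  by rewrite er /= !rnE -rmorphM lecR.
have dE : 'd f z = L :> (V -> W) by apply: diff_unique.
split; last by move=> v; rewrite dE.
by apply/diff_locallyP; rewrite dE.
Qed.

(** Continuity of the differential at 0 bounds it by 1 on some ball of radius [d]; rescaling a
    vector to length [d / 2] gives the constant [2 / d]. *)
Lemma diff_bound (f : V -> W) (z : V) : differentiable f z ->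
  exists2 C : R, 0 < C & forall h, rn ('d f z h) <= C * rn h.
Proof.
move=> df.
have [d d0 hd] : exists2 d : R, 0 < d & forall z', rn (z' - 0) < d ->
   rn ('d f z z' - 'd f z 0) < 1.
  by apply: (contv_rnP _ _).1 => //; exact: diff_continuous.
exists (2 / d); first by rewrite divr_gt0.
move=> h; have [->|h0] := eqVneq h 0; first by rewrite linear0 !rn0 mulr0.
have rh : 0 < rn h by rewrite rn_gt0.
pose a : R := d / 2 / rn h.
have a0 : 0 < a by rewrite !divr_gt0.
have := hd (a%:C *: h); rewrite subr0 linear0 subr0 linearZ /= !rnZ rn_real.
rewrite (gtr0_norm a0) /a divfK ?gt_eqF //.
have -> : d / 2 < d by rewrite ltr_pdivrMr // ltr_pMr // ltr1n.
move=> /(_ isT) /ltW; rewrite mulrAC ler_pdivrMr // mul1r => H.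
rewrite mulrAC ler_pdivlMr //.
by move: H; rewrite mulrAC ler_pdivrMr // [rn _ * d]mulrC [2 * _]mulrC.
Qed.

End Differential.

(** * Goursat lemma and mean values *)

Section Integral.
Context {R : realType}.
Implicit Types (f g : R -> R) (a b c : R).

Definition cont_on a b f := forall x, a <= x <= b -> {for x, continuous f}.

Definition Int a b f : R := Rintegral (@lebesgue_measure R) `[a, b] f.

Lemma cont_on_integrable a b f : cont_on a b f ->
  (@lebesgue_measure R).-integrable `[a, b] (EFin \o f).
Proof.
move=> cf; apply: continuous_compact_integrable; first exact: segment_compact.
by apply: continuous_in_subspaceT => x; rewrite inE /= in_itv /= => /cf.
Qed.

Lemma cont_onB a b f g : cont_on a b f -> cont_on a b g ->
  cont_on a b (fun x => f x - g x).
Proof. by move=> cf cg x xab; apply: cvgB; [exact: cf|exact: cg]. Qed.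

Lemma cont_on_sub a b a' b' f : a <= a' -> b' <= b -> cont_on a b f ->
  cont_on a' b' f.
Proof.
move=> aa bb cf x /andP[h1 h2]; apply: cf.
by rewrite (le_trans aa h1) (le_trans h2 bb).
Qed.

Lemma IntB a b f g : cont_on a b f -> cont_on a b g ->
  Int a b (fun x => f x - g x) = Int a b f - Int a b g.
Proof.
by move=> cf cg; rewrite /Int RintegralB //; exact: cont_on_integrable.
Qed.

Lemma Int_cst a b (k : R) : a <= b -> Int a b (fun=> k) = k * (b - a).
Proof.
move=> ab; rewrite /Int Rintegral_cst //= lebesgue_measure_itv /= lte_fin.
case: ifPn => //; rewrite -leNgt => ba; have -> : b = a by lra.
by rewrite subrr.
Qed.

Lemma le_Int a b f g : cont_on a b f -> cont_on a b g ->
  (forall x, a <= x <= b -> f x <= g x) -> Int a b f <= Int a b g.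
Proof.
by move=> cf cg fg; apply: le_Rintegral => //; exact: cont_on_integrable.
Qed.

Lemma cont_on_cst a b (k : R) : cont_on a b (fun=> k).
Proof. by move=> x _; exact: cvg_cst. Qed.

Lemma Int_near a b f (k M : R) : a <= b -> cont_on a b f ->
  (forall x, a <= x <= b -> `|f x - k| <= M) ->
  `|Int a b f - k * (b - a)| <= M * (b - a).
Proof.
move=> ab cf fM.
rewrite -(Int_cst k ab) -IntB //; last exact: cont_on_cst.
have cfk : cont_on a b (fun x => f x - k).
  by apply: cont_onB => //; exact: cont_on_cst.
rewrite ler_norml -mulNr -!Int_cst //; apply/andP; split; apply: le_Int => //;
  try exact: cont_on_cst; by move=> x /fM; rewrite ler_norml => /andP[].
Qed.

Lemma Int_chasles a b c f : a <= c -> c <= b -> cont_on a b f ->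
  Int a b f = Int a c f + Int c b f.
Proof.
move=> ac cb cf; apply/eqP; rewrite addrC -subr_eq; apply/eqP.
rewrite /Int Rintegral_itvB ?bnd_simp //; last exact: cont_on_integrable.
apply: Rintegral_itv_obnd_cbnd.
have : (@lebesgue_measure R).-integrable `[c, b] (EFin \o f).
  by apply: cont_on_integrable; exact: cont_on_sub cf.
by apply: integrableS => //; apply: subset_itvr; rewrite bnd_simp.
Qed.

End Integral.

Section Goursat.
Context {R : realType}.
Implicit Types p q : R -> R -> R.

(** Differentiability at one point, with nothing said about continuity of the partial derivatives:
    the argument has to start from complex differentiability alone. *)
Definition frechet2 p (s t P1 P2 : R) := forall e : R, 0 < e ->
  exists2 d : R, 0 < d & forall h k, `|h| < d -> `|k| < d ->
    `|p (s + h) (t + k) - p s t - P1 * h - P2 * k| <= e * (`|h| + `|k|).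

Lemma frechet2_cont p s t P1 P2 : frechet2 p s t P1 P2 ->
  {for s, continuous (p ^~ t)} /\ {for t, continuous (p s)}.
Proof.
move=> H; have [d d0 hd] := H _ ltr01.
have key (Q h x e : R) : 0 < e -> `|x - Q * h| <= `|h| ->
    `|h| < e / (2 + `|Q|) -> `|x| < e.
  move=> e0 h1 h2; have Q0 : 0 < 2 + `|Q| by rewrite ltr_pwDl.
  rewrite ltr_pdivlMr // in h2.
  have -> : x = (x - Q * h) + Q * h by rewrite subrK.
  apply: le_lt_trans (ler_normD _ _) _; rewrite normrM.
  have := normr_ge0 h; have := normr_ge0 Q; nra.
have pos (Q e : R) : 0 < e -> 0 < Num.min d (e / (2 + `|Q|)).
  by move=> e0; rewrite lt_min d0 divr_gt0 // ltr_pwDl.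
split; apply/cvgrPdist_lt => e e0; apply/nbhs_ballP.
- exists (Num.min d (e / (2 + `|P1|))); first exact: pos.
  move=> s'; rewrite /ball /= lt_min => /andP[h1 h2]; rewrite distrC in h1 h2.
  have := hd (s' - s) 0; rewrite h1 normr0 => /(_ isT d0).
  rewrite addrCA subrr !addr0 mulr0 subr0 mul1r => H1.
  rewrite distrC; exact: (key P1 (s' - s)).
- exists (Num.min d (e / (2 + `|P2|))); first exact: pos.
  move=> s'; rewrite /ball /= lt_min => /andP[h1 h2]; rewrite distrC in h1 h2.
  have := hd 0 (s' - t); rewrite h1 normr0 => /(_ d0 isT).
  rewrite addrCA subrr !addr0 mulr0 subr0 add0r mul1r => H1.
  rewrite distrC; exact: (key P2 (s' - t)).
Qed.

(** The integral of the form [p ds + q dt] along the boundary of the rectangle, counterclockwise. *)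
Definition circ p q (a b c d : R) : R :=
  Int a b (fun s => p s c - p s d) + Int c d (fun t => q b t - q a t).

(** Closedness is expressed by the shared [P2], which is at once the [t]-derivative of [p] and the
    [s]-derivative of [q]. *)
Definition closed_form p q (A B C D : R) := forall s t,
  A <= s <= B -> C <= t <= D ->
  exists P1 P2 Q2, frechet2 p s t P1 P2 /\ frechet2 q s t P2 Q2.

Lemma closed_form_sub p q A B C D A' B' C' D' : closed_form p q A B C D ->
  A <= A' -> B' <= B -> C <= C' -> D' <= D -> closed_form p q A' B' C' D'.
Proof.
move=> h h1 h2 h3 h4 s t /andP[s1 s2] /andP[t1 t2].
by apply: h; apply/andP; split; lra.
Qed.

Lemma closed_form_cont1 p q A B C D t : closed_form p q A B C D ->
  C <= t <= D -> cont_on A B (p ^~ t).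
Proof.
move=> H tCD s sAB; have [P1 [P2 [Q2 [h _]]]] := H _ _ sAB tCD.
exact: (frechet2_cont h).1.
Qed.

Lemma closed_form_cont2 p q A B C D s : closed_form p q A B C D ->
  A <= s <= B -> cont_on C D (q s).
Proof.
move=> H sAB t tCD; have [P1 [P2 [Q2 [_ h]]]] := H _ _ sAB tCD.
exact: (frechet2_cont h).2.
Qed.

Lemma circ_splitx p q A B C D m : closed_form p q A B C D ->
  A <= m <= B -> C <= D ->
  circ p q A B C D = circ p q A m C D + circ p q m B C D.
Proof.
move=> H /andP[Am mB] CD; rewrite /circ.
have AB := le_trans Am mB.
rewrite (@Int_chasles _ A B m) //; last first.
  by apply: cont_onB; apply: (closed_form_cont1 H); rewrite ?lexx ?CD.
have c2 s : A <= s <= B -> cont_on C D (q s) by exact: closed_form_cont2 H.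
have E x y : A <= x <= B -> A <= y <= B ->
    Int C D (fun t => q x t - q y t) = Int C D (q x) - Int C D (q y).
  by move=> hx hy; rewrite IntB //; exact: c2.
by rewrite !E ?lexx ?Am ?mB ?AB //; ring.
Qed.

Lemma circ_splity p q A B C D m : closed_form p q A B C D ->
  C <= m <= D -> A <= B ->
  circ p q A B C D = circ p q A B C m + circ p q A B m D.
Proof.
move=> H /andP[Am mB] CD; rewrite /circ.
have AB := le_trans Am mB.
rewrite (@Int_chasles _ C D m) //; last first.
  by apply: cont_onB; apply: (closed_form_cont2 H); rewrite ?lexx ?CD.
have c2 s : C <= s <= D -> cont_on A B (p ^~ s) by exact: closed_form_cont1 H.
have E x y : C <= x <= D -> C <= y <= D ->
    Int A B (fun s => p s x - p s y) = Int A B (p ^~ x) - Int A B (p ^~ y).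
  by move=> hx hy; rewrite IntB //; exact: c2.
by rewrite !E ?lexx ?Am ?mB ?AB //; ring.
Qed.

Lemma sup_nested (a b : nat -> R) : (forall i j, a i <= b j) ->
  exists x, forall k, a k <= x <= b k.
Proof.
move=> ab; pose E := range a.
have hE : has_sup E.
  by split; [exists (a 0%N), 0%N|exists (b 0%N) => _ [i _ <-]].
exists (sup E) => k; apply/andP; split.
  by apply: ub_le_sup; [exact: hE.2|exists k].
by apply: ge_sup; [exact: hE.1|move=> _ [i _ <-]].
Qed.

Lemma bisection_corner (A B a l y : R) : 0 <= l -> A <= a -> a + (l + l) <= B ->
  (y = a \/ y = a + l) -> [/\ A <= y, y + l <= B, a <= y & y + l <= a + (l + l)].
Proof. by move=> l0 Aa aB [] ->; split; lra. Qed.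

(** Bisection: one of the four quarters carries at least a quarter of the circulation. The chosen
    rectangles shrink to a point, and there differentiability bounds the circulation by an
    arbitrarily small multiple of the squared size. *)
Lemma goursat p q A B C D : A <= B -> C <= D -> closed_form p q A B C D ->
  circ p q A B C D = 0.
Proof.
move=> AB CD H; apply: contrapT => /eqP; rewrite -normr_gt0.
set m := `|_| => m0.
pose W := B - A; pose Hh := D - C.
have W0 : 0 <= W by rewrite subr_ge0.
have H0 : 0 <= Hh by rewrite subr_ge0.
pose z (k : nat) : R := 2^-1 ^+ k.
have z0 k : 0 < z k by rewrite exprn_gt0 // invr_gt0.
have zS k : z k = 2 * z k.+1 by rewrite /z exprS mulrA divff ?mul1r // pnatr_eq0.
pose P k (x : R * R) := [/\ A <= x.1, x.1 + W * z k <= B, C <= x.2,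
  x.2 + Hh * z k <= D &
  m * z k ^+ 2 <= `|circ p q x.1 (x.1 + W * z k) x.2 (x.2 + Hh * z k)|].
pose rel k (x y : R * R) := [/\ x.1 <= y.1, y.1 + W * z k.+1 <= x.1 + W * z k,
  x.2 <= y.2 & y.2 + Hh * z k.+1 <= x.2 + Hh * z k].
have step k (x : R * R) : exists y, P k x -> P k.+1 y /\ rel k x y.
  case: x => a b.
  case: (pselect (P k (a, b))) => [[/= h1 h2 h3 h4 h5]|nP]; last by exists (a, b).
  have zw := zS k; move: h2 h4 h5; rewrite zw; set w := z k.+1 in zw * => h2 h4 h5.
  have w0 : 0 < w by exact: z0.
  have Ww : 0 <= W * w by rewrite mulr_ge0 // ltW.
  have Hw : 0 <= Hh * w by rewrite mulr_ge0 // ltW.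
  have HH : closed_form p q a (a + W * (2 * w)) b (b + Hh * (2 * w)).
    by apply: closed_form_sub H _ _ _ _.
  have E : circ p q a (a + W * (2 * w)) b (b + Hh * (2 * w)) =
      circ p q a (a + W * w) b (b + Hh * w) +
      circ p q a (a + W * w) (b + Hh * w) (b + Hh * w + Hh * w) +
      (circ p q (a + W * w) (a + W * w + W * w) b (b + Hh * w) +
      circ p q (a + W * w) (a + W * w + W * w) (b + Hh * w) (b + Hh * w + Hh * w)).
    have -> : b + Hh * (2 * w) = b + Hh * w + Hh * w by ring.
    have -> : a + W * (2 * w) = a + W * w + W * w by ring.
    have WW : W * (2 * w) = W * w + W * w by ring.
    have HHw : Hh * (2 * w) = Hh * w + Hh * w by ring.
    rewrite WW HHw !addrA in HH.
    have a1 : a <= a + W * w by rewrite lerDl.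
    have a2 : a + W * w <= a + W * w + W * w by rewrite lerDl.
    have b1 : b <= b + Hh * w by rewrite lerDl.
    have b2 : b + Hh * w <= b + Hh * w + Hh * w by rewrite lerDl.
    have b3 := le_trans b1 b2.
    have Hl := closed_form_sub HH (lexx _) a2 (lexx _) (lexx _).
    have Hr := closed_form_sub HH a1 (lexx _) (lexx _) (lexx _).
    rewrite (circ_splitx HH (m := a + W * w)) ?a1 ?a2 //.
    by rewrite (circ_splity Hl (m := b + Hh * w)) ?b1 ?b2 //
               (circ_splity Hr (m := b + Hh * w)) ?b1 ?b2.
  rewrite E in h5.
  suff [y Py] : exists y : R * R, [/\ (y.1 = a \/ y.1 = a + W * w),
      (y.2 = b \/ y.2 = b + Hh * w) & m * w ^+ 2 <=
        `|circ p q y.1 (y.1 + W * w) y.2 (y.2 + Hh * w)|].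
    have [y1 y2 hc] := Py.
    have WW : W * (2 * w) = W * w + W * w by ring.
    have HHw : Hh * (2 * w) = Hh * w + Hh * w by ring.
    exists y => _; rewrite /P /rel zw -/w /=.
    move: h2 h4; rewrite WW HHw => h2 h4.
    have [? ? ? ?] := bisection_corner Ww h1 h2 y1.
    have [? ? ? ?] := bisection_corner Hw h3 h4 y2.
    by split.

  apply: contrapT => /forallNP hN.
  have lt c1 c2 : (c1 = a \/ c1 = a + W * w) -> (c2 = b \/ c2 = b + Hh * w) ->
     `|circ p q c1 (c1 + W * w) c2 (c2 + Hh * w)| < m * w ^+ 2.
    move=> e1 e2; have := hN (c1, c2) => /=; rewrite ltNge => h; apply/negP => h'.
    by apply: h; split.
  have l1 := lt _ _ (or_introl erefl) (or_introl erefl).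
  have l2 := lt _ _ (or_introl erefl) (or_intror erefl).
  have l3 := lt _ _ (or_intror erefl) (or_introl erefl).
  have l4 := lt _ _ (or_intror erefl) (or_intror erefl).
  move: h5; apply/negP; rewrite -ltNge.
  apply: le_lt_trans (ler_normD _ _) _.
  apply: le_lt_trans (lerD (ler_normD _ _) (ler_normD _ _)) _.
  have -> : m * (2 * w) ^+ 2 = m * w ^+ 2 + m * w ^+ 2 + (m * w ^+ 2 + m * w ^+ 2).
    by ring.
  by rewrite !ltrD.
have {step} [F hF] := choice (fun kx : nat * (R * R) => step kx.1 kx.2).
pose x := fix x k := if k is k'.+1 then F (k', x k') else (A, C).
have Px k : P k (x k).
  elim: k => [|k IH]; last by have [] := hF (k, x k) IH.
  rewrite /P /= /z expr0 !mulr1 expr1n mulr1.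
  have -> : A + W = B by rewrite /W; ring.
  by have -> : C + Hh = D by rewrite /Hh; ring.
have rx k : rel k (x k) (x k.+1) by have [] := hF (k, x k) (Px k).
have mono j k : (x k).1 <= (x (k + j)%N).1 /\
    (x (k + j)%N).1 + W * z (k + j)%N <= (x k).1 + W * z k /\
    (x k).2 <= (x (k + j)%N).2 /\
    (x (k + j)%N).2 + Hh * z (k + j)%N <= (x k).2 + Hh * z k.
  elim: j => [|j [I1 [I2 [I3 I4]]]]; first by rewrite addn0 !lexx.
  rewrite addnS; have [r1 r2 r3 r4] := rx (k + j)%N.
  by split; [|split; [|split]]; [exact: le_trans I1 r1|exact: le_trans r2 I2|
    exact: le_trans I3 r3|exact: le_trans r4 I4].
have nn k : 0 <= W * z k /\ 0 <= Hh * z k by rewrite !mulr_ge0 // ltW.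
have [a ha] : exists a, forall k, (x k).1 <= a <= (x k).1 + W * z k.
  apply: sup_nested => i j.
  have [h1 _] := mono j i; have [_ [h2 _]] := mono i j.
  rewrite addnC in h2; have := (nn (i + j)%N).1; lra.
have [b hb] : exists b, forall k, (x k).2 <= b <= (x k).2 + Hh * z k.
  apply: sup_nested => i j.
  have [_ [_ [h1 _]]] := mono j i; have [_ [_ [_ h2]]] := mono i j.
  rewrite addnC in h2; have := (nn (i + j)%N).2; lra.
have aAB : A <= a <= B.
  by have := ha 0%N; rewrite /= /z expr0 mulr1 /W; lra.
have bCD : C <= b <= D.
  by have := hb 0%N; rewrite /= /z expr0 mulr1 /Hh; lra.
have [P1 [P2 [Q2 [hp hq]]]] := H _ _ aAB bCD.
(* [S] dominates width plus height, and the 1 keeps it positive for a degenerate rectangle. With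
   [e = m / (4 * S ^+ 2)] the two errors below add up to at most half of [m * z k ^+ 2]. *)
pose S := W + Hh + 1.
have S0 : 0 < S by rewrite /S; lra.
pose e := m / (4 * S ^+ 2).
have e0 : 0 < e by rewrite divr_gt0 // mulr_gt0 // exprn_gt0.
have [d1 d10 {}hp] := hp _ e0.
have [d2 d20 {}hq] := hq _ e0.
have [k hk] : exists k, S * z k < Num.min d1 d2.
  have dd : 0 < Num.min d1 d2 / S by rewrite divr_gt0 // lt_min d10 d20.
  have cz : z k @[k --> \oo] --> (0 : R).
    by apply: cvg_expr; rewrite ger0_norm ?invr_ge0 // invf_lt1 // ltr1n.
  have /cvgrPdist_lt /(_ _ dd) [k _ hk] := cz.
  exists k; have := hk k (leqnn _); rewrite sub0r normrN gtr0_norm //.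
  by rewrite ltr_pdivlMr // mulrC.
move: hk; rewrite lt_min => /andP[hk1 hk2].
have [p1 p2 p3 p4 p5] := Px k.
have := ha k; have := hb k.
move: p1 p2 p3 p4 p5; case: (x k) => a' b' /=.
have [] := nn k; have := z0 k.
set zk := z k in hk1 hk2 * => zk0.
have wS : W * zk <= S * zk by rewrite ler_wpM2r ?(ltW zk0) // /S; lra.
have hS : Hh * zk <= S * zk by rewrite ler_wpM2r ?(ltW zk0) // /S; lra.
have sumS : W * zk + Hh * zk <= S * zk.
  by rewrite -mulrDl ler_wpM2r ?(ltW zk0) // /S; lra.
set w := W * zk in wS sumS *; set h := Hh * zk in hS sumS *.
move=> w0 h0 p1 p2 p3 p4 p5 hb' ha'.
have HH : closed_form p q a' (a' + w) b' (b' + h) by exact: closed_form_sub H _ _ _ _.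
(* Between opposite horizontal sides the [P1] terms cancel and [- P2 * h] remains; the vertical
   sides leave [P2 * w] with the same [P2], so the main terms cancel in the sum. *)
have B1 : `|Int a' (a' + w) (fun s => p s b' - p s (b' + h)) - (- P2 * h) * (a' + w - a')|
    <= (2 * (e * (S * zk))) * (a' + w - a').
  apply: Int_near; first by lra.
    by apply: cont_onB; apply: (closed_form_cont1 HH); lra.
  move=> s hs.
  have q1 := hp (s - a) (b' - b); have q2 := hp (s - a) (b' + h - b).
  move: q1 q2; rewrite !(addrC a) !(addrC b) !subrK => q1 q2.
  have n1 : `|s - a| <= w by rewrite ler_norml; lra.
  have n2 : `|b' - b| <= h by rewrite ler_norml; lra.
  have n3 : `|b' + h - b| <= h by rewrite ler_norml; lra.
  have {}q1 := q1 ltac:(lra) ltac:(lra).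
  have {}q2 := q2 ltac:(lra) ltac:(lra).
  have -> : p s b' - p s (b' + h) - - P2 * h =
     (p s b' - p a b - P1 * (s - a) - P2 * (b' - b)) -
     (p s (b' + h) - p a b - P1 * (s - a) - P2 * (b' + h - b)) by ring.
  apply: le_trans (ler_normB _ _) _.
  have : e * (`|s - a| + `|b' - b|) <= e * (S * zk) by rewrite ler_pM2l //; lra.
  have : e * (`|s - a| + `|b' + h - b|) <= e * (S * zk) by rewrite ler_pM2l //; lra.
  lra.
have B2 : `|Int b' (b' + h) (fun t => q (a' + w) t - q a' t) - (P2 * w) * (b' + h - b')|
    <= (2 * (e * (S * zk))) * (b' + h - b').
  apply: Int_near; first by lra.
    by apply: cont_onB; apply: (closed_form_cont2 HH); lra.
  move=> s hs.
  have q1 := hq (a' - a) (s - b); have q2 := hq (a' + w - a) (s - b).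
  move: q1 q2; rewrite !(addrC a) !(addrC b) !subrK => q1 q2.
  have n1 : `|s - b| <= h by rewrite ler_norml; lra.
  have n2 : `|a' - a| <= w by rewrite ler_norml; lra.
  have n3 : `|a' + w - a| <= w by rewrite ler_norml; lra.
  have {}q1 := q1 ltac:(lra) ltac:(lra).
  have {}q2 := q2 ltac:(lra) ltac:(lra).
  have -> : q (a' + w) s - q a' s - P2 * w =
     (q (a' + w) s - q a b - P2 * (a' + w - a) - Q2 * (s - b)) -
     (q a' s - q a b - P2 * (a' - a) - Q2 * (s - b)) by ring.
  apply: le_trans (ler_normB _ _) _.
  have : e * (`|a' - a| + `|s - b|) <= e * (S * zk) by rewrite ler_pM2l //; lra.
  have : e * (`|a' + w - a| + `|s - b|) <= e * (S * zk) by rewrite ler_pM2l //; lra.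
  lra.
move: p5; rewrite /circ.
set I1 := Int _ _ _ in B1 *; set I2 := Int _ _ _ in B2 *.
have -> : I1 + I2 = (I1 - (- P2 * h) * (a' + w - a')) + (I2 - (P2 * w) * (b' + h - b')).
  by ring.
apply/negP; rewrite -ltNge.
apply: le_lt_trans (ler_normD _ _) _.
apply: le_lt_trans (lerD B1 B2) _.
have -> : 2 * (e * (S * zk)) * (a' + w - a') + 2 * (e * (S * zk)) * (b' + h - b')
   = 2 * (e * (S * zk) * (w + h)) by ring.
have -> : m = 4 * e * S ^+ 2 by rewrite /e; field; rewrite gt_eqF.
have -> : 4 * e * S ^+ 2 * zk ^+ 2 = 4 * e * (S * zk) * (S * zk) by ring.
have eS : 0 < e * (S * zk) by rewrite mulr_gt0 // mulr_gt0.
have Sz : 0 < S * zk by rewrite mulr_gt0.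
have : e * (S * zk) * (w + h) <= e * (S * zk) * (S * zk) by rewrite ler_pM2l.
have : 0 < e * (S * zk) * (S * zk) by rewrite mulr_gt0.
lra.
Qed.

End Goursat.

(* The complex numbers as a numFieldType, so that they carry the canonical normed module structure over themselves. *)
Definition Cplx (R : realType) : numFieldType := R[i].

Lemma rnCE (R : realType) (z : Cplx R) :
  @rn R ((Cplx R : normedModType R[i]) : normedZmodType R[i]) z = @rn R R[i] z.
Proof. by []. Qed.

Section RealDerivative.
Context {R : realType}.

Lemma is_derive_eps (g : R -> R) (x d : R) : is_derive x 1 g d ->
  forall e : R, 0 < e -> exists2 r : R, 0 < r & forall h, `|h| < r ->
    `|g (x + h) - g x - d * h| <= e * `|h|.
Proof.
move=> [/derivable_nbhs H dE] e e0.
have /eqaddoP /(_ _ e0) /nbhs_ballP [r r0 hr] := H.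
exists r => // h hh; have := hr h; rewrite /ball /= sub0r normrN => /(_ hh).
rewrite -[(_ - _) h]/(g (h *: 1 + x) - (g x + h *: 'D_1 g x)) dE.
by rewrite /GRing.scale /= mulr1 opprD addrA [h + x]addrC [h * d]mulrC.
Qed.

(** The exponential of [s + i t]. In these coordinates an annulus around a point becomes a
    rectangle, so that the lemma on rectangles applies to circles. *)
Definition cexp (s t : R) : R[i] := (expR s)%:C * (cos t +i* sin t).

Lemma cexpD s t h k : cexp (s + h) (t + k) = cexp s t * cexp h k.
Proof.
by rewrite /cexp expRD sinD cosD; apply/eqP; rewrite eq_complex /=;
  apply/andP; split; apply/eqP; ring.
Qed.

Lemma rn_cexp s t : rn (cexp s t) = expR s.
Proof.
rewrite /cexp rnM rn_real gtr0_norm ?expR_gt0 //.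
have -> : rn (cos t +i* sin t) = 1; last by rewrite mulr1.
apply/eqP; rewrite -(@eqrXn2 _ 2) ?rn_ge0 //.
by rewrite rn_sq /= cos2Dsin2 expr1n.
Qed.

Lemma cexp_expand (e : R) : 0 < e -> exists2 r : R, 0 < r &
  forall h k, `|h| < r -> `|k| < r ->
    rn (cexp h k - 1 - (h +i* k)) <= e * (`|h| + `|k|).
Proof.
move=> e0; have [e1 [e10 e1e e1h]] : exists e1, [/\ 0 < e1, e1 <= e / 8 & e1 <= 1 / 2].
  exists (Num.min (e / 8) (1 / 2)); split; last 2 first.
  - by rewrite ge_min lexx.
  - by rewrite ge_min lexx orbT.
  by rewrite lt_min; apply/andP; split; lra.
have [r1 r10 hr1] := is_derive_eps (is_derive_expR 0) e10.
have [r2 r20 hr2] := is_derive_eps (is_derive_cos 0) e10.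
have [r3 r30 hr3] := is_derive_eps (is_derive_sin 0) e10.
exists (Num.min (Num.min r1 e1) (Num.min r2 r3)).
  by rewrite !lt_min r10 e10 r20 r30.
move=> h k; rewrite !lt_min => /andP[/andP[h1 h2] _] /andP[/andP[_ k0] /andP[k1 k2]].
have := hr1 _ h1; have := hr2 _ k1; have := hr3 _ k2.
rewrite !add0r expR0 sin0 cos0 oppr0 mul0r !subr0 !mul1r ?addr0 => H3 H2 H1.
apply: le_trans (rn_ReIm _) _; rewrite /cexp /= !mul0r subr0 addr0.
have hn := normr_ge0 h; have kn := normr_ge0 k.
have E1 : `|expR h - 1| <= 2 * `|h|.
  have -> : expR h - 1 = (expR h - 1 - h) + h by ring.
  apply: le_trans (ler_normD _ _) _.
  have : e1 * `|h| <= 1 / 2 * `|h| by rewrite ler_wpM2r.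
  lra.
have E2 : expR h <= 2.
  have := ler_norm (expR h - 1); lra.
have E0 := expR_gt0 h.
have A1 : `|expR h * cos k - 1 - h| <= 2 * (e1 * `|k|) + e1 * `|h|.
  have -> : expR h * cos k - 1 - h = expR h * (cos k - 1) + (expR h - 1 - h) by ring.
  apply: le_trans (ler_normD _ _) _; rewrite normrM (gtr0_norm E0); apply: lerD => //.
  by apply: ler_pM => //; exact: ltW.
have A2 : `|expR h * sin k - 0 - k| <= 2 * (e1 * `|k|) + 2 * `|h| * `|k|.
  have -> : expR h * sin k - 0 - k = expR h * (sin k - k) + (expR h - 1) * k by ring.
  apply: le_trans (ler_normD _ _) _; rewrite !normrM (gtr0_norm E0); apply: lerD => //.
    by apply: ler_pM => //; exact: ltW.
  by rewrite ler_wpM2r.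
have A3 : `|h| * `|k| <= e1 * `|k| by rewrite ler_wpM2r // ltW.
have A4 : e1 * `|k| <= e / 8 * `|k| by rewrite ler_wpM2r.
have A5 : e1 * `|h| <= e / 8 * `|h| by rewrite ler_wpM2r.
move: A1 A2; rewrite ?subr0; have := mulr_ge0 (ltW e0) hn; have := mulr_ge0 (ltW e0) kn. lra.
Qed.

End RealDerivative.

Section MeanValue.
Context {R : realType}.
Local Notation C := (Cplx R).
Implicit Types f : C -> C.

Lemma diff_scalar f (z : C) : differentiable f z ->
  forall h, 'd f z h = h * 'd f z 1.
Proof.
by move=> df h; rewrite -[in LHS](mulr1 h) -[h * 1]/(h *: (1 : C)) linearZ /=.
Qed.

(** Chain rule for [z0 + exp (s + i t)]. The Cauchy-Riemann pattern of the four partial derivatives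
    says that [Im f ds + Re f dt] is closed; this form is the imaginary part of
    [f dz / (z - z0)]. *)
Lemma diff_polar f (z0 : C) (s t : R) (d := 'd f (z0 + cexp s t) 1 : R[i]) :
  differentiable f (z0 + cexp s t) ->
  frechet2 (fun s t => complex.Re (f (z0 + cexp s t) : R[i])) s t
    (complex.Re (d * cexp s t)) (- complex.Im (d * cexp s t)) /\
  frechet2 (fun s t => complex.Im (f (z0 + cexp s t) : R[i])) s t
    (complex.Im (d * cexp s t)) (complex.Re (d * cexp s t)).
Proof.
move=> df; set w := z0 + cexp s t in d df *.
suff H (e : R) : 0 < e -> exists2 r : R, 0 < r & forall h k, `|h| < r -> `|k| < r ->
    rn (f (z0 + cexp (s + h) (t + k)) - f w - d * cexp s t * (h +i* k) : C)
      <= e * (`|h| + `|k|).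
  split=> e e0; have [r r0 hr] := H e e0; exists r => // h k hh hk;
    apply: le_trans (hr h k hh hk).
    apply: le_trans (rn_Re _); rewrite le_eqVlt; apply/orP; left; apply/eqP.
    congr `|_|; rewrite -/w; case: (d * cexp s t) => a b.
    case: (f w) => c1 c2; case: (f _) => c3 c4 /=; ring.
  apply: le_trans (rn_Im _); rewrite le_eqVlt; apply/orP; left; apply/eqP.
  congr `|_|; rewrite -/w; case: (d * cexp s t) => a b.
  case: (f w) => c1 c2; case: (f _) => c3 c4 /=; ring.
move=> e0.
pose E := expR s; have E0 : 0 < E := expR_gt0 s.
pose D := rn d; have D0 : 0 <= D := rn_ge0 d.
pose e1 := e / (4 * E).
have e10 : 0 < e1 by rewrite divr_gt0 // mulr_gt0.
have [r1 r10 hr1] := diff_rn df e10.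
have DE : 0 < E * D + 1 by rewrite ltr_wpDl // mulr_ge0 // ltW.
have [e2 [e20 e21 e2b]] : exists e2, [/\ 0 < e2, e2 <= 1 & e2 <= e / (2 * (E * D + 1))].
  exists (Num.min 1 (e / (2 * (E * D + 1)))); split; last 2 first.
  - by rewrite ge_min lexx.
  - by rewrite ge_min lexx orbT.
  by rewrite lt_min ltr01 divr_gt0 // mulr_gt0.
have [r2 r20 hr2] := cexp_expand e20.
exists (Num.min r2 (r1 / (4 * E))).
  by rewrite lt_min r20 divr_gt0 // mulr_gt0.
move=> h k; rewrite !lt_min => /andP[h1 h2] /andP[k1 k2].
have := hr2 _ _ h1 k1; set eta := _ - _ - _ => Heta.
set N := `|h| + `|k| in Heta *.
have N0 : 0 <= N by rewrite addr_ge0.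
have nhk : rn (h +i* k) <= N by exact: rn_ReIm.
pose K := cexp s t * (h +i* k + eta).
have eK : z0 + cexp (s + h) (t + k) = w + K.
  by rewrite cexpD /w /K /eta -addrA; congr (_ + _); ring.
have nK : rn K <= E * (2 * N).
  rewrite /K rnM rn_cexp -/E ler_pM2l //; apply: le_trans (rnD _ _) _.
  have : e2 * N <= 1 * N by rewrite ler_wpM2r.
  lra.
have nN : N < r1 / (2 * E).
  have -> : r1 / (2 * E) = r1 / (4 * E) + r1 / (4 * E).
    by field; rewrite gt_eqF.
  by rewrite ltrD.
have Kr : rn K < r1.
  apply: le_lt_trans nK _; rewrite ltr_pdivlMr in nN; last by rewrite mulr_gt0.
  by have -> : E * (2 * N) = N * (2 * E) by ring.
have := hr1 K Kr; rewrite eK diff_scalar // => H1.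
have -> : f (w + K) - f w - d * cexp s t * (h +i* k) =
   (f (w + K) - f w - K * 'd f w 1) + d * cexp s t * eta.
  rewrite -/d /K; ring.
apply: le_trans (rnD _ _) _.
have H2 : rn (d * cexp s t * eta : R[i]) <= D * E * (e2 * N).
  by rewrite 2!rnM rn_cexp ler_wpM2l // mulr_ge0 // ltW.
have H3 : e1 * rn K <= e / 2 * N.
  apply: (@le_trans _ _ (e1 * (E * (2 * N)))); first by rewrite ler_pM2l.
  by rewrite le_eqVlt; apply/orP; left; apply/eqP; rewrite /e1; field; rewrite gt_eqF.
have H4 : D * E * (e2 * N) <= e / 2 * N.
  rewrite mulrA ler_wpM2r //.
  apply: (@le_trans _ _ (D * E * (e / (2 * (E * D + 1))))).
    by rewrite ler_wpM2l // mulr_ge0 // ltW.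
  rewrite mulrA ler_pdivrMr ?mulr_gt0 //; have := mulr_ge0 D0 (ltW E0); nra.
lra.
Qed.

(** The sides [t = 0] and [t = 2 pi] of the rectangle cancel by periodicity, so the mean over the
    circle of radius [exp s] does not depend on [s]; letting [s] tend to minus infinity leaves the
    value at the center. The center enters through continuity, which is what is known of a
    difference quotient at its base point. *)
Lemma mean_value f (z0 : C) (r0 : R) :
  (forall z, 0 < rn (z - z0) < r0 -> differentiable f z) ->
  {for z0, continuous f} ->
  forall s : R, expR s < r0 ->
    Int 0 (2 * pi) (fun t => complex.Re (f (z0 + cexp s t) : R[i])) =
    complex.Re (f z0 : R[i]) * (2 * pi).
Proof.
move=> df cf s sr0.
have pi2 : 0 <= 2 * pi :> R by rewrite mulr_ge0 // pi_ge0.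
have dfE u t : expR u < r0 -> differentiable f (z0 + cexp u t).
  by move=> ur; apply: df; rewrite addrAC subrr add0r rnCE rn_cexp expR_gt0 ur.
have cl a : a <= s -> closed_form
    (fun s t => complex.Im (f (z0 + cexp s t) : R[i]))
    (fun s t => complex.Re (f (z0 + cexp s t) : R[i])) a s 0 (2 * pi).
  move=> _ u t /andP[_ us] _.
  have ur : expR u < r0 by apply: le_lt_trans sr0; rewrite ler_expR.
  have [h1 h2] := diff_polar (dfE u t ur).
  exists (complex.Im ('d f (z0 + cexp u t) 1 * cexp u t : R[i])).
  exists (complex.Re ('d f (z0 + cexp u t) 1 * cexp u t : R[i])).
  by exists (- complex.Im ('d f (z0 + cexp u t) 1 * cexp u t : R[i])).
pose A u := Int 0 (2 * pi) (fun t => complex.Re (f (z0 + cexp u t) : R[i])).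
have cA a : a <= s ->
    cont_on 0 (2 * pi) (fun t => complex.Re (f (z0 + cexp a t) : R[i])).
  by move=> as_; apply: (closed_form_cont2 (cl a as_)); rewrite lexx.
have As a : a <= s -> A s = A a.
  move=> as_; have := goursat as_ pi2 (cl a as_).
  rewrite /circ.
  have -> : (fun u => complex.Im (f (z0 + cexp u 0) : R[i]) -
      complex.Im (f (z0 + cexp u (2 * pi)) : R[i])) = fun=> 0.
    apply/funext => u; have -> : cexp u (2 * pi) = cexp u 0; last by rewrite subrr.
    by rewrite /cexp !mulr_natl cos2pi sin2pi cos0 sin0.
  rewrite (Int_cst _ as_) mul0r add0r (IntB (cA s (lexx s)) (cA a as_)).
  by move=> /eqP; rewrite subr_eq0 => /eqP.
apply/eqP; rewrite -subr_eq0 -normr_le0; apply/ler_addgt0Pr => e e0; rewrite add0r.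
pose e1 := e / (2 * pi + 1).
have p1 : 0 < 2 * pi + 1 :> R by rewrite ltr_wpDl.
have e10 : 0 < e1 by rewrite divr_gt0.
have [d d0 hd] := (contv_rnP _ _).1 cf _ e10.
(* A circle inside the continuity radius, and inside the circle it is compared with. *)
have [a as_ ad] : exists2 a, a <= s & expR a < d.
  exists (Num.min s (ln (d / 2))); first by rewrite ge_min lexx.
  apply: (@le_lt_trans _ _ (expR (ln (d / 2)))).
    by rewrite ler_expR ge_min lexx orbT.
  by rewrite lnK ?posrE ?divr_gt0 // ltr_pdivrMr // ltr_pMr // ltr1n.
rewrite -/(A s) (As a as_).
have := @Int_near _ _ _ _ (complex.Re (f z0 : R[i])) e1 pi2 (cA a as_).
rewrite subr0 => H; apply: le_trans (H _) _.
  move=> t _; apply: (@le_trans _ _ (rn (f (z0 + cexp a t) - f z0 : C))).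
    by apply: le_trans (rn_Re _); case: (f _) => ? ?; case: (f _).
  by apply/ltW/hd; rewrite addrAC subrr add0r rnCE rn_cexp.
rewrite /e1 mulrAC ler_pdivrMr // ler_pM2l //; lra.
Qed.

End MeanValue.

(** * Maximum principle, Cauchy and Taylor estimates in one variable *)

Section OneVariable.
Context {R : realType}.
Local Notation C := (Cplx R).
Implicit Types f : C -> C.

Lemma cont_pt (c : C) (phi : C -> R) (p : R * R) :
  {for (c + (p.1 +i* p.2) : C), continuous phi} ->
  {for p, continuous (fun p : R * R => phi (c + (p.1 +i* p.2)))}.
Proof.
move=> cf; apply/cvgrPdist_lt => e e0.
have [d d0 hd] := (cont_rnP _ _).1 cf _ e0.
have d2 : 0 < d / 2 by rewrite divr_gt0.
apply: filterS (nbhsx_ballx p (d / 2) d2) => q [] /=.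
rewrite /ball /= => h1 h2; rewrite distrC; apply: hd.
rewrite opprD addrACA subrr add0r rnCE.
apply: le_lt_trans (rn_ReIm _) _.
by rewrite /= distrC [`|q.2 - _|]distrC [d]splitr ltrD.
Qed.

Lemma compact_square (r : R) :
  compact [set p : R * R | p.1 ^+ 2 + p.2 ^+ 2 <= r ^+ 2].
Proof.
apply: (@subclosed_compact _ _ (`[- `|r|, `|r|] `*` `[- `|r|, `|r|])).
- pose g (p : R * R) : R := p.1 ^+ 2 + p.2 ^+ 2.
  have cg : continuous g.
    move=> p; rewrite /g; apply: cvgD; rewrite !expr2; apply: cvgM;
      solve [exact: cvg_fst | exact: cvg_snd].
  have -> : [set p : R * R | p.1 ^+ 2 + p.2 ^+ 2 <= r ^+ 2] =
            g @^-1` [set x | x <= r ^+ 2] by [].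
  by apply: preimage_closed => //; exact: closed_le.
- by apply: compact_setX; exact: segment_compact.
move=> [x y] /= h; split => /=; rewrite in_itv /= -ler_norml -ler_sqr ?nnegrE //
  -!normrX !ger0_norm ?sqr_ge0 //; have := sqr_ge0 x; have := sqr_ge0 y; lra.
Qed.

Lemma differentiable_subc f (a z : C) : differentiable f z ->
  differentiable (fun z => f z - a) z.
Proof. by move=> df; exact: (differentiableB df (differentiable_cst a z)). Qed.

Lemma differentiable_idsub (a z : C) : differentiable (fun z : C => z - a) z.
Proof. by apply: (@differentiable_subc id). Qed.

Lemma continuous_subc f (a z : C) : {for z, continuous f} ->
  {for z, continuous (fun z => f z - a)}.
Proof. by move=> cf; apply: (continuousB cf); exact: cst_continuous. Qed.

Lemma continuous_idsub (a z : C) : {for z, continuous (fun z : C => z - a)}.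
Proof. by apply: (@continuous_subc id); exact: cvg_id. Qed.

(** After a rotation making [f z1] real and nonnegative, the term [e * |z - c|^2] is added to the
    real part: an interior maximum of the sum contradicts the mean value property. Differentiability
    in punctured neighborhoods is the form available for difference quotients. *)
Lemma max_principle f (c : C) (r B : R) : 0 < r ->
  (forall z, rn (z - c) <= r -> {for z, continuous f}) ->
  (forall z, rn (z - c) < r -> exists2 d : R, 0 < d &
     forall z', 0 < rn (z' - z) < d -> differentiable f z') ->
  (forall z, rn (z - c) = r -> rn (f z) <= B) ->
  forall z, rn (z - c) <= r -> rn (f z) <= B.
Proof.
move=> r0 cf df fB z1 z1r.
pose w : R[i] := f z1.
have [w0|w0] := eqVneq w 0.
  have : rn (f (c + r%:C)) <= B.
    by apply: fB; rewrite addrAC subrr add0r rnCE rn_real gtr0_norm.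
  by apply: le_trans; rewrite -/w w0 rn0 rn_ge0.
pose u : R[i] := w^* / (rn w)%:C.
have rw0 : 0 < rn w by rewrite rn_gt0.
have ru : rn u = 1.
  by rewrite /u rnM rn_conj rnV rn_real gtr0_norm // divff // gt_eqF.
have uw : complex.Re (u * w) = rn w.
  have E : u * w = (rn w)%:C.
    rewrite /u mulrAC.
    have -> : w^* * w = (rn w)%:C ^+ 2 by rewrite mulrC -sqr_normc rnE.
    by rewrite expr2 mulfK // -[0]/((0 : R)%:C) (inj_eq (@complexI R)) gt_eqF.
  by rewrite E.
suff key (e : R) : 0 < e -> rn w <= B + e * r ^+ 2.
  apply/ler_addgt0Pr => e e0; apply: le_trans (key (e / r ^+ 2) _) _.
    by rewrite divr_gt0 // exprn_gt0.
  by rewrite divfK // expf_neq0 // gt_eqF.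
move=> e0.
pose phi (z : C) : R := complex.Re (u * (f z : R[i])) + e * rn (z - c) ^+ 2.
have cphi z : rn (z - c) <= r -> {for z, continuous phi}.
  move=> /cf cfz.
  have c1 : {for z, continuous (fun z : C => complex.Re (u * (f z : R[i])))}.
    apply/cont_rnP => e1 e10; have [d d0 hd] := (contv_rnP _ _).1 cfz _ e10.
    exists d => // z' /hd H; apply: le_lt_trans H.
    have -> : complex.Re (u * (f z' : R[i])) - complex.Re (u * (f z : R[i])) =
      complex.Re (u * ((f z' : R[i]) - f z)).
      by rewrite mulrBr; case: (u * _) => ? ?; case: (u * _).
    by apply: le_trans (rn_Re _) _; rewrite rnM ru mul1r.
  have crn : {for z, continuous (fun z : C => rn (z - c))}.
    apply/cont_rnP => e1 e10; exists e1 => // z' H; apply: le_lt_trans H.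
    rewrite ler_norml lerBlDl lerBrDl.
    have := rnBD z' z c; have := rnBD z z' c; rewrite [rn (z - z')]rn_dist; lra.
  have c2 : {for z, continuous (fun z : C => e * rn (z - c) ^+ 2)}.
    have c0 : {for z, continuous (fun _ : C => e)} by exact: cst_continuous.
    exact: continuousM c0 (continuousM crn crn).
  exact: continuousD c1 c2.
pose K := [set p : R * R | p.1 ^+ 2 + p.2 ^+ 2 <= r ^+ 2].
pose pt (p : R * R) : C := c + (p.1 +i* p.2).
have ptK p : K p -> rn (pt p - c) <= r.
  rewrite /K /= /pt addrAC subrr add0r rnCE => h.
  by rewrite -ler_sqr ?nnegrE ?rn_ge0 // ?rn_sq // ltW.
have ptE z : exists p, pt p = z /\ (rn (z - c) <= r -> K p).
  exists (complex.Re (z - c : R[i]), complex.Im (z - c : R[i])); split.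
    by rewrite /pt /=; have -> : forall a : R[i], (complex.Re a +i* complex.Im a) = a;
      [by case|rewrite addrCA subrr addr0].
  rewrite /K /= -rn_sq -rnCE => h; rewrite ler_sqr ?nnegrE ?rn_ge0 //; exact: ltW.
have [p0 Kp0 p0max] : exists2 p0, K p0 & forall p, K p -> phi (pt p) <= phi (pt p0).
  have [||p0 Kp0 Hp0] := @compact_EVT_max _ R (phi \o pt) K _ (@compact_square r).
  - by exists (0, 0); rewrite /K /= expr0n /= addr0 sqr_ge0.
  - apply: continuous_in_subspaceT => p; rewrite inE => Kp.
    by apply: (@cont_pt c phi); apply: cphi; exact: ptK.
  - exists p0; first by rewrite inE in Kp0.
    by move=> p Kp; apply: Hp0; rewrite inE.
set zM := pt p0 in p0max.
have zMr : rn (zM - c) <= r by exact: ptK.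
have phimax z : rn (z - c) <= r -> phi z <= phi zM.
  by move=> zr; have [p [E Kp]] := ptE z; have := p0max p (Kp zr); rewrite E.
have phi1 : rn w <= phi zM.
  apply: le_trans (phimax _ z1r); rewrite /phi -/w uw lerDl.
  exact: mulr_ge0 (ltW e0) (sqr_ge0 _).
move: zMr; rewrite le_eqVlt => /predU1P[zMr|zMr].
  apply: le_trans phi1 _; rewrite /phi zMr lerD2r.
  apply: le_trans (ler_norm _) _; apply: le_trans (rn_Re _) _.
  by rewrite rnM ru mul1r; exact: fB.
exfalso.
have [d d0 hd] := df _ zMr.
pose a : C := zM - c.
pose rho := Num.min d (r - rn a) / 2.
have rr : 0 < r - rn a by rewrite subr_gt0.
have mm : 0 < Num.min d (r - rn a) by rewrite lt_min d0 rr.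
have rho0 : 0 < rho by rewrite divr_gt0.
have rhom : rho < Num.min d (r - rn a).
  by rewrite ltr_pdivrMr // ltr_pMr // ltr1n.
move: (rhom); rewrite lt_min => /andP[rhod rhor].
(* The part of [e * |a + k|^2] linear in [k] is [Re (b * k)], again the real part of a holomorphic
   function. Adding it to [u * f] gives [F], whose real part on the circle stays below its central
   value by [e * rho ^+ 2]. *)
pose b : C := (2 * e)%:C * (a : R[i])^*.
pose F : C -> C := fun z => (u : C) * f z + b * (z - zM).
have dF z : 0 < rn (z - zM) < d -> differentiable F z.
  move=> hz; apply: differentiableD; apply: differentiableM;
    first [exact: differentiable_cst|exact: differentiable_idsub|exact: hd].
have cF : {for zM, continuous F}.
  apply: continuousD; apply: continuousM; try exact: cst_continuous.
    by apply: cf; exact: ltW.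
  exact: continuous_idsub.
have lr : expR (ln rho) = rho by rewrite lnK.
have := mean_value dF cF (s := ln rho); rewrite lr => /(_ rhod) MV.
have pi0 : 0 < pi :> R by exact: pi_gt0.
have cont : cont_on 0 (2 * pi) (fun t => complex.Re (F (zM + cexp (ln rho) t) : R[i])).
  move=> t _.
  have dt : differentiable F (zM + cexp (ln rho) t).
    by apply: dF; rewrite addrAC subrr add0r rnCE rn_cexp lr rho0.
  exact: (frechet2_cont (diff_polar dt).1).2.
have : complex.Re (F zM : R[i]) * (2 * pi) <=
    Int 0 (2 * pi) (fun=> complex.Re (F zM : R[i]) - e * rho ^+ 2).
  rewrite -MV; apply: le_Int => //; first exact: cont_on_cst.
  move=> t _; set k := cexp (ln rho) t.
  have rk : rn (k : C) = rho by rewrite rnCE rn_cexp lr.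
  have zk : rn (zM + k - c) <= r.
    rewrite addrAC; apply: le_trans (rnD _ _) _; rewrite rk -/a; lra.
  have := phimax _ zk.
  have E1 : zM + k - zM = k by rewrite addrAC subrr add0r.
  have E2 : zM + k - c = a + k by rewrite /a addrAC.
  rewrite /phi /F E1 E2 subrr mulr0 addr0 -/a.
  have -> : rn (a + k) ^+ 2 = rn a ^+ 2 + rho ^+ 2 + 2 * complex.Re ((a : R[i])^* * k).
    rewrite -rk !rnCE !rn_sq.
    by case: (a : R[i]) => a1 a2; move: (k : R[i]) => [k1 k2] /=; ring.
  have -> : complex.Re ((u * (f (zM + k) : R[i])) + (b : R[i]) * k) =
      complex.Re (u * (f (zM + k) : R[i])) + 2 * e * complex.Re ((a : R[i])^* * k).
    rewrite /b -mulrA; case: (u * _) => ? ?; case: (_ * k) => ? ? /=; ring.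
  lra.
have pi2 : 0 <= 2 * pi :> R by rewrite mulr_ge0 // ltW.
rewrite (Int_cst _ pi2) subr0.
rewrite ler_pM2r ?mulr_gt0 //.
have : 0 < e * rho ^+ 2 by rewrite mulr_gt0 // exprn_gt0.
lra.
Qed.

Definition dd f (a z : C) : C :=
  if z == a then 'd f a 1 else (f z - f a) / (z - a).

Lemma dd_near f (a z : C) : z != a ->
  \forall z' \near z, (fun z' => (f z' - f a) / (z' - a)) z' = dd f a z'.
Proof.
move=> za; apply/near_rnP; exists (rn (a - z)).
  by rewrite rn_gt0 subr_eq0 eq_sym.
move=> z' h; rewrite /dd ifF //; apply/negP => /eqP E.
by rewrite E ltxx in h.
Qed.

Lemma dd_cont_off f (a z : C) : z != a -> {for z, continuous f} ->
  {for z, continuous (dd f a)}.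
Proof.
move=> za cf; have E := dd_near f za.
have H : {for z, continuous (fun z' => (f z' - f a) / (z' - a))}.
  apply: continuousM; first exact: continuous_subc.
  by apply: continuousV; [rewrite subr_eq0|exact: continuous_idsub].
have H' : (f z' - f a) / (z' - a) @[z' --> z] --> dd f a z.
  by rewrite -(nbhs_singleton E); exact: H.
exact: cvg_trans (near_eq_cvg E) H'.
Qed.

Lemma dd_cont_at f (a : C) : differentiable f a -> {for a, continuous (dd f a)}.
Proof.
move=> df; apply/contv_rnP => e e0.
have [d d0 hd] := diff_rn df (divr_gt0 e0 (ltr0n _ 2) : 0 < e / 2).
exists d => // z zd; rewrite {2}/dd eqxx /dd.
case: eqVneq => [_|za]; first by rewrite subrr rn0.
have := hd _ zd; rewrite addrCA subrr addr0 (diff_scalar df (z - a)) => H.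
have rz : 0 < rn (z - a) by rewrite rn_gt0 subr_eq0.
rewrite [X in rn X](_ : _ = ((f z - f a - (z - a) * 'd f a 1) / (z - a) : C)).
  2: by rewrite [RHS]mulrBl mulrAC divff ?mul1r // subr_eq0.
rewrite rnCE rnM rnV ltr_pdivrMr //. apply: le_lt_trans H _.
by rewrite ltr_pM2r // ltr_pdivrMr // ltr_pMr // ltr1n.
Qed.

Lemma dd_diff f (a z : C) : z != a -> differentiable f z ->
  differentiable (dd f a) z.
Proof.
move=> za df; apply/derivable1_diffP.
apply: (near_eq_derivable (dd_near f za)).
apply/derivable1_diffP; apply: differentiableM; first exact: differentiable_subc.
apply: differentiableV; first exact: differentiable_idsub.
by rewrite subr_eq0.
Qed.

(** By the maximum principle it suffices to bound the quotient on the circle, where the denominator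
    has modulus [r]. *)
Lemma dd_circle f (r M : R) : 0 < r ->
  (forall z, rn z <= r -> differentiable f z) ->
  (forall z, rn z <= r -> rn (f z) <= M) ->
  forall z, rn z <= r -> rn (dd f 0 z) <= 2 * M / r.
Proof.
move=> r0 df fM z zr.
have df0 : differentiable f 0 by apply: df; rewrite rn0 ltW.
apply: (@max_principle (dd f 0) 0 r) => //; rewrite ?subr0 // => {zr}z.
- rewrite subr0 => zr; have [->|z0] := eqVneq z 0; first exact: dd_cont_at.
  by apply: dd_cont_off => //; apply: differentiable_continuous; exact: df.
- rewrite subr0 => zr; exists (if z == 0 then r else Num.min (rn z) (r - rn z)).
    by case: eqVneq => // z0; rewrite lt_min rn_gt0 z0 subr_gt0 zr.
  move=> z' /andP[zz' h]; apply: dd_diff.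
    apply/eqP => E; move: zz' h; rewrite E sub0r rnN; case: eqVneq => [->|_ _].
      by rewrite rn0 ltxx.
    by rewrite lt_min ltxx.
  apply: df; move: h; case: eqVneq => [->|z0]; first by rewrite subr0 => /ltW.
  rewrite lt_min => /andP[_]; have := rnD (z' - z) z; rewrite subrK; lra.
rewrite subr0 => zr.
have z0 : z != 0 by rewrite -rn_gt0 zr.
rewrite /dd (negPf z0) subr0 rnCE rnM rnV -!rnCE zr ler_pM2r ?invr_gt0 //.
apply: le_trans (rnB _ _) _.
have := fM z; rewrite zr => /(_ (lexx _)); have := fM 0; rewrite rn0.
move=> /(_ (ltW r0)); lra.
Qed.

Lemma cauchy1 f (r M : R) : 0 < r ->
  (forall z, rn z <= r -> differentiable f z) ->
  (forall z, rn z <= r -> rn (f z) <= M) ->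
  rn ('d f 0 1) <= 2 * M / r.
Proof.
move=> r0 df fM.
have := dd_circle r0 df fM (z := 0); rewrite /dd eqxx rn0; apply; exact: ltW.
Qed.

(** The maximum principle is applied to the second difference quotient [dd (dd f 0) a], whose value
    at 0 encodes the remainder. On the circle its numerator is at most [4 * M / r] and its
    denominator at least [r / 2], whence the constant 8. *)
Lemma taylor1 f (r M : R) : 0 < r ->
  (forall z, rn z <= r -> differentiable f z) ->
  (forall z, rn z <= r -> rn (f z) <= M) ->
  forall a, rn a <= r / 2 -> rn (f a - f 0 - a * 'd f 0 1) <=
     8 * M / r ^+ 2 * rn a ^+ 2.
Proof.
move=> r0 df fM a ar.
have [->|a0] := eqVneq a 0.
  by rewrite subrr mul0r subr0 !rn0 expr0n mulr0.
pose g := dd f 0.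
have r2 : r / 2 < r by rewrite ltr_pdivrMr // ltr_pMr // ltr1n.
have ar' : rn a <= r by lra.
have M0 : 0 <= M by apply: le_trans (fM 0 _); rewrite ?rn_ge0 // rn0 ltW.
have cg z : rn z <= r -> {for z, continuous g}.
  move=> zr; have [->|z0] := eqVneq z 0.
    by apply: dd_cont_at; apply: df; rewrite rn0 ltW.
  by apply: dd_cont_off => //; apply: differentiable_continuous; exact: df.
have dg z : rn z <= r -> z != 0 -> differentiable g z.
  by move=> zr z0; apply: dd_diff => //; exact: df.
have gM : forall z, rn z <= r -> rn (g z) <= 2 * M / r.
  exact: dd_circle.
have H : rn (dd g a 0) <= 8 * M / r ^+ 2.
  apply: (@max_principle (dd g a) 0 r) => //; last by rewrite subr0 rn0 ltW.
  - move=> z; rewrite subr0 => zr; have [->|za] := eqVneq z a.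
      by apply: dd_cont_at; exact: dg.
    by apply: dd_cont_off => //; exact: cg.
  - move=> z; rewrite subr0 => zr.
    have [d [d0 dr hd]] : exists d : R, [/\ 0 < d, d <= r - rn z &
        forall z', 0 < rn (z' - z) < d -> z' != 0 /\ z' != a].
      exists (Num.min (r - rn z) (Num.min (if z == 0 then 1 else rn z)
         (if z == a then 1 else rn (z - a)))); split.
      - rewrite !lt_min subr_gt0 zr /=; apply/andP; split; case: eqVneq => // h.
          by rewrite rn_gt0.
        by rewrite rn_gt0 subr_eq0.
      - by rewrite ge_min lexx.
      move=> z'; rewrite !lt_min => /andP[h1 /andP[_ /andP[h2 h3]]]; split;
        apply/eqP => E; move: h1 h2 h3; rewrite E.
        case: eqVneq => [->|_ _]; first by rewrite subrr rn0 ltxx.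
        by rewrite sub0r rnN ltxx.
      case: (eqVneq z a) => [->|_ _ _]; first by rewrite subrr rn0 ltxx.
      by rewrite rn_dist ltxx.
    exists d => // z' h; have [z'0 z'a] := hd _ h.
    apply: dd_diff => //; apply: dg => //.
    move: h => /andP[_ h]; have := rnD (z' - z) z; rewrite subrK; lra.
  - move=> z; rewrite subr0 => zr.
    have dza : r / 2 <= rn (z - a).
      have := rnD (z - a) a; rewrite subrK zr; lra.
    have za : z != a.
      by rewrite -subr_eq0 -rn_gt0; apply: lt_le_trans dza; rewrite divr_gt0.
    rewrite /dd (negPf za) rnCE rnM rnV -!rnCE.
    rewrite ler_pdivrMr; last by rewrite rn_gt0 subr_eq0.
    apply: (@le_trans _ _ (8 * M / r ^+ 2 * (r / 2))); last first.
      by rewrite ler_wpM2l // divr_ge0 ?mulr_ge0 ?exprn_ge0 // ltW.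
    have -> : 8 * M / r ^+ 2 * (r / 2) = 2 * M / r + 2 * M / r.
      by field; rewrite gt_eqF.
    apply: le_trans (rnB _ _) _; apply: lerD; apply: gM => //.
    by rewrite zr.
move: H; rewrite /dd eq_sym (negPf a0) sub0r {1}/g /dd eqxx {1}/g /dd (negPf a0) subr0.
rewrite rnCE rnM rnV rnN -!rnCE ler_pdivrMr ?rn_gt0 // => H.
rewrite [X in rn X](_ : _ = (- (a * ('d f 0 1 - (f a - f 0) / a)) : C)).
  2: by rewrite mulrBr mulrCA divff // mulr1 opprB.
rewrite rnN rnCE rnM -!rnCE expr2 mulrCA.
by apply: ler_wpM2l; first exact: rn_ge0.
Qed.

End OneVariable.

(** * Cauchy estimates and Weierstrass theorem in several variables *)

Section Linear.
Context {R : realType} {V W : normedModType R[i]}.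

Lemma rn_diff_lin (f : V -> W) (z : V) (L : V -> W) (C : R) : linear L ->
  (forall h, rn (L h) <= C * rn h) ->
  (forall e : R, 0 < e -> exists2 d : R, 0 < d & forall h, rn h < d ->
    rn (f (z + h) - f z - L h) <= e * rn h) ->
  differentiable f z /\ forall v, 'd f z v = L v.
Proof.
move=> linL LC H.
pose mL := GRing.isLinear.Build _ _ _ _ _ linL.
pose L' : {linear V -> W} := HB.pack L mL.
exact: (@rn_diff _ _ _ f z L' C).
Qed.

End Linear.

Section Coordinates.
Context {R : realType} {n : nat}.
Implicit Types u v : Cspace R n.
Local Notation C := (Cplx R).

Definition co u (j : 'I_n) : C := (u : 'rV[R[i]]_n) ord0 j.

Lemma rn_co u j : rn (co u j) <= rn u.
Proof.
rewrite -lecR -!rnE /co [leRHS]/Num.norm /= mx_normE.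
exact: (@le_bigmax _ _ _ (0%:nng) (fun i => `|(u : 'rV[R[i]]_n) i.1 i.2|%:nng) (ord0, j)).
Qed.

Lemma rn_le_co u (M : R) : 0 <= M -> (forall j, rn (co u j) <= M) -> rn u <= M.
Proof.
move=> M0 H; rewrite -lecR -!rnE [leLHS]/Num.norm /=.
have [->|/eqP/mx_norm_neq0 [[i j] /= ->]] := mx_norm (u : 'rV[R[i]]_n) =P 0.
  by rewrite ler0c.
by rewrite (ord1 i) (rnE ((u : 'rV[R[i]]_n) ord0 j)) lecR; exact: H.
Qed.

Lemma coD u v j : co (u + v) j = co u j + co v j.
Proof. by rewrite /co mxE. Qed.
Lemma coN u j : co (- u) j = - co u j.
Proof. by rewrite /co mxE. Qed.
Lemma coB u v j : co (u - v) j = co u j - co v j.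
Proof. by rewrite coD coN. Qed.
Lemma coZ (a : R[i]) u j : co (a *: u) j = a * co u j.
Proof. by rewrite /co mxE. Qed.
Lemma co0 j : co (0 : Cspace R n) j = 0.
Proof. by rewrite /co mxE. Qed.

End Coordinates.

Section SeveralVariables.
Context {R : realType} {n m : nat}.
Local Notation C := (Cplx R).
Local Notation V := (Cspace R n).
Local Notation W := (Cspace R m).
Implicit Types f : V -> W.

(** Restriction to a complex line and projection to a coordinate reduce the estimates in several
    variables to one variable; for the maximum norm they keep their constants. *)
Lemma diff_line f (z v : V) (j : 'I_m) (x : C) :
  differentiable f (z + x *: v) ->
  differentiable (fun y : C => co (f (z + y *: v)) j) x /\
  'd (fun y : C => co (f (z + y *: v)) j) x 1 = co ('d f (z + x *: v) v) j.
Proof.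
move=> df; set c := co ('d f _ v) j.
have [//|||dphi ->] := @rn_diff_lin R C C (fun y : C => co (f (z + y *: v)) j) x
   (fun h => h * c) (rn c).
- by move=> a y y'; rewrite mulrDl -mulrA.
- by move=> h; rewrite !rnCE rnM mulrC.
- move=> e e0; have e1 : 0 < e / (rn v + 1) by rewrite divr_gt0 // ltr_wpDl // rn_ge0.
  have [d d0 hd] := diff_rn df e1.
  have v1 : 0 < rn v + 1 by rewrite ltr_wpDl // rn_ge0.
  exists (d / (rn v + 1)); first by rewrite divr_gt0.
  move=> h; rewrite ltr_pdivlMr // => hh.
  have hv : rn (h *: v) <= (rn v + 1) * rn h.
    by rewrite rnZ mulrC ler_wpM2r ?rn_ge0 // lerDl.
  have := hd (h *: v); rewrite mulrC in hh; move=> /(_ (le_lt_trans hv hh)) H.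
  rewrite scalerDl addrA /c.
  have -> : h * co ('d f (z + x *: v) v) j = co ('d f (z + x *: v) (h *: v)) j.
    by rewrite linearZ coZ.
  have <- : co (f (z + x *: v + h *: v) - f (z + x *: v) - 'd f (z + x *: v) (h *: v)) j =
     co (f (z + x *: v + h *: v)) j - co (f (z + x *: v)) j - co ('d f (z + x *: v) (h *: v)) j.
    by rewrite !coB.
  apply: le_trans (rn_co _ _) _; apply: le_trans H _.
  rewrite mulrAC ler_pdivrMr // -mulrA ler_pM2l //; rewrite mulrC in hv.
  exact: hv.
by rewrite mul1r.
Qed.

Variables (f : V -> W) (z : V) (r M : R).
Hypotheses (r0 : 0 < r) (df : forall z', rn (z' - z) <= r -> differentiable f z')
  (fM : forall z', rn (z' - z) <= r -> rn (f z') <= M).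

Let line_ok (v : V) (y : C) : rn v = 1 -> rn y <= r -> rn (z + y *: v - z) <= r.
Proof. by move=> v1 yr; rewrite addrAC subrr add0r rnZ v1 mulr1. Qed.

Let M0 : 0 <= M.
Proof. by apply: le_trans (rn_ge0 (f z)) _; apply: fM; rewrite subrr rn0 ltW. Qed.

Let unit_decomp (h : V) : h != 0 -> exists v : V, rn v = 1 /\ h = (rn h)%:C *: v.
Proof.
move=> h0; exists (((rn h)^-1)%:C *: h); have hh : 0 < rn h by rewrite rn_gt0.
split; first by rewrite rnZ rn_real ger0_norm ?invr_ge0 ?rn_ge0 // mulVf // gt_eqF.
by rewrite scalerA -rmorphM mulfV ?scale1r // gt_eqF.
Qed.

Lemma cauchy_estimate h : rn ('d f z h) <= 2 * M / r * rn h.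
Proof.
have [->|h0] := eqVneq h 0; first by rewrite linear0 !rn0 mulr0.
have [v [v1 hv]] := unit_decomp h0.
rewrite [X in 'd f z X]hv linearZ rnZ rn_real ger0_norm ?rn_ge0 // mulrC.
rewrite ler_pM2r ?rn_gt0 //.
have C0 : 0 <= 2 * M / r by rewrite divr_ge0 ?mulr_ge0 // ltW.
apply: rn_le_co => [|j]; first by rewrite ?(mulr_ge0 C0) ?rn_ge0.
pose phi := fun y : C => co (f (z + y *: v)) j.
have := @cauchy1 R phi r M r0 _ _.
have dz : differentiable f (z + (0 : C) *: v).
  by apply: df; apply: line_ok; rewrite ?rn0 // ltW.
rewrite (diff_line j dz).2 scale0r addr0; apply.
- by move=> y yr; apply: (diff_line _ _).1; apply: df; exact: line_ok.
- by move=> y yr; apply: le_trans (rn_co _ _) _; apply: fM; exact: line_ok.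
Qed.

Lemma taylor_estimate h : rn h <= r / 2 ->
  rn (f (z + h) - f z - 'd f z h) <= 8 * M / r ^+ 2 * rn h ^+ 2.
Proof.
move=> hr; have [->|h0] := eqVneq h 0.
  by rewrite addr0 linear0 subrr subr0 !rn0 expr0n mulr0.
have [v [v1 hv]] := unit_decomp h0.
have C0 : 0 <= 8 * M / r ^+ 2 by exact: divr_ge0 (mulr_ge0 (ler0n _ 8) M0) (sqr_ge0 _).
apply: rn_le_co => [|j]; first exact: mulr_ge0 C0 (sqr_ge0 _).
pose phi := fun y : C => co (f (z + y *: v)) j.
have := @taylor1 R phi r M r0 _ _ (rn h)%:C.
have rh : @rn R (C : normedModType R[i]) (rn h)%:C = rn h.
  by rewrite rnCE rn_real ger0_norm // rn_ge0.
have dz : differentiable f (z + (0 : C) *: v).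
  by apply: df; apply: line_ok; rewrite ?rn0 // ltW.
rewrite rh (diff_line j dz).2 /phi scale0r addr0 -hv.
have E : 'd f z h = (rn h)%:C *: 'd f z v by rewrite [in LHS]hv linearZ.
rewrite !coB E coZ; apply => //.
- by move=> y yr; apply: (diff_line _ _).1; apply: df; exact: line_ok.
- by move=> y yr; apply: le_trans (rn_co _ _) _; apply: fM; exact: line_ok.
Qed.

End SeveralVariables.

Section Completeness.
Context {R : realType}.

Lemma real_cauchy (u : nat -> R) :
  (forall e : R, 0 < e -> exists N, forall k, (N <= k)%N -> `|u k - u N| <= e) ->
  exists l, forall e : R, 0 < e -> exists N, forall k, (N <= k)%N -> `|u k - l| <= e.
Proof.
move=> H.
have : cvg (u @ \oo).
  apply: cauchy_cvg; apply: cauchy_exP => e e0.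
  have [N hN] := H (e / 2) (divr_gt0 e0 (ltr0n _ 2)).
  exists (u N); exists N => // k /= Nk; rewrite /ball /= distrC.
  by apply: le_lt_trans (hN k Nk) _; rewrite ltr_pdivrMr // ltr_pMr // ltr1n.
move=> /cvgrPdist_le cu; exists (lim (u @ \oo)) => e e0.
have [N _ hN] := cu _ e0; exists N => k Nk; rewrite distrC; exact: hN.
Qed.

Lemma complex_cauchy (u : nat -> R[i]) :
  (forall e : R, 0 < e -> exists N, forall k, (N <= k)%N -> rn (u k - u N) <= e) ->
  exists l, forall e : R, 0 < e -> exists N, forall k, (N <= k)%N -> rn (u k - l) <= e.
Proof.
move=> H.
have [e e0|a ha] := @real_cauchy (fun k => complex.Re (u k)).
  have [N hN] := H e e0; exists N => k /hN; apply: le_trans.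
  by apply: le_trans (rn_Re _); case: (u k) => ? ?; case: (u N).
have [e e0|b hb] := @real_cauchy (fun k => complex.Im (u k)).
  have [N hN] := H e e0; exists N => k /hN; apply: le_trans.
  by apply: le_trans (rn_Im _); case: (u k) => ? ?; case: (u N).
exists (a +i* b) => e e0.
have e2 : 0 < e / 2 by rewrite divr_gt0.
have [N hN] := ha _ e2; have [N' hN'] := hb _ e2.
exists (maxn N N') => k; rewrite geq_max => /andP[/hN h1 /hN' h2].
apply: le_trans (rn_ReIm _) _; rewrite [e]splitr.
by move: h1 h2; case: (u k) => ? ? /= h1 h2; exact: lerD.
Qed.

Lemma fin_cauchy_idx (I : finType) (P : I -> nat -> Prop) :
  (forall i, exists N, forall k, (N <= k)%N -> P i k) ->
  exists N, forall i k, (N <= k)%N -> P i k.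
Proof.
move=> /choice[N hN]; exists (\max_i N i) => i k h.
by apply: hN; apply: leq_trans h; exact: leq_bigmax.
Qed.

Lemma Cspace_cauchy m (u : nat -> Cspace R m) :
  (forall e : R, 0 < e -> exists N, forall k, (N <= k)%N -> rn (u k - u N) <= e) ->
  exists l, forall e : R, 0 < e -> exists N, forall k, (N <= k)%N -> rn (u k - l) <= e.
Proof.
move=> H.
have /choice[l hl] : forall j : 'I_m, exists l : R[i],
    forall e : R, 0 < e -> exists N, forall k, (N <= k)%N -> rn ((co (u k) j : R[i]) - l) <= e.
  move=> j; apply: complex_cauchy => e e0; have [N hN] := H e e0; exists N => k /hN.
  apply: le_trans; have := rn_co (u k - u N) j.
  by rewrite coB.
exists ((\row_j l j) : 'rV[R[i]]_m) => e e0.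
have [j|N hN] := @fin_cauchy_idx 'I_m (fun j k => rn ((co (u k) j : R[i]) - l j) <= e).
  exact: hl.
exists N => k Nk; apply: rn_le_co; first exact: ltW.
move=> j; rewrite coB [co (\row__ _ : 'rV[R[i]]_m) j]mxE; exact: hN.
Qed.

Lemma lim_rn_unique (V : normedModType R[i]) (u : nat -> V) (a b : V) :
  (forall e : R, 0 < e -> exists N, forall k, (N <= k)%N -> rn (u k - a) <= e) ->
  (forall e : R, 0 < e -> exists N, forall k, (N <= k)%N -> rn (u k - b) <= e) ->
  a = b.
Proof.
move=> ha hb; apply/eqP; rewrite -subr_eq0 -rn_eq0 -[_ == _]/(_ == _).
rewrite eq_le rn_ge0 andbT; apply/ler_addgt0Pr => e e0; rewrite add0r.
have e2 : 0 < e / 2 by rewrite divr_gt0.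
have [N hN] := ha _ e2; have [N' hN'] := hb _ e2.
have h1 := hN (maxn N N') (leq_maxl _ _); have h2 := hN' (maxn N N') (leq_maxr _ _).
apply: le_trans (rnBD _ (u (maxn N N')) _) _.
by rewrite [e]splitr rn_dist lerD.
Qed.

End Completeness.

(** * Weierstrass theorem and holomorphy of derivatives *)

Section Weierstrass.
Context {R : realType} {n m : nat}.
Local Notation C := (Cplx R).
Local Notation V := (Cspace R n).
Local Notation W := (Cspace R m).

Lemma diff_subC (f g : V -> W) (z h : V) :
  differentiable f z -> differentiable g z ->
  differentiable (fun x => f x - g x) z /\
  'd (fun x => f x - g x) z h = 'd f z h - 'd g z h.
Proof.
move=> df dg; split; first exact: (differentiableB df dg).
by have := congr1 (fun F : V -> W => F h) (diffB df dg).
Qed.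

Lemma cauchy_sub (f g : V -> W) (z : V) (r B : R) : 0 < r ->
  (forall z', rn (z' - z) <= r -> differentiable f z') ->
  (forall z', rn (z' - z) <= r -> differentiable g z') ->
  (forall z', rn (z' - z) <= r -> rn (f z' - g z') <= B) ->
  forall h, rn ('d f z h - 'd g z h) <= 2 * B / r * rn h.
Proof.
move=> r0 df dg H h.
have zr : rn (z - z) <= r by rewrite subrr rn0 ltW.
have E := (@diff_subC f g z h (df z zr) (dg z zr)).2; rewrite -E.
have dfg z' : rn (z' - z) <= r -> differentiable (fun x => f x - g x) z'.
  by move=> hz'; exact: (@diff_subC f g z' z' (df z' hz') (dg z' hz')).1.
exact: (@cauchy_estimate R n m (fun x => f x - g x) z r B r0 dfg H h).
Qed.

Lemma weierstrass (F : nat -> V -> W) (f : V -> W) (z : V) (r M : R) : 0 < r ->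
  (forall k z', rn (z' - z) <= r -> differentiable (F k) z') ->
  (forall e : R, 0 < e -> exists N, forall k, (N <= k)%N -> forall z',
     rn (z' - z) <= r -> rn (F k z' - f z') <= e) ->
  (forall z', rn (z' - z) <= r -> rn (f z') <= M) ->
  differentiable f z /\
  forall h (e : R), 0 < e -> exists N, forall k, (N <= k)%N ->
    rn ('d (F k) z h - 'd f z h) <= e.
Proof.
move=> r0 dF Ff fM.
have zr : rn (z - z) <= r by rewrite subrr rn0 ltW.
have /choice[L hL] : forall h, exists l, forall e : R, 0 < e ->
    exists N, forall k, (N <= k)%N -> rn ('d (F k) z h - l) <= e.
  move=> h; apply: Cspace_cauchy => e e0.
  pose e1 := e * r / (4 * (rn h + 1)).
  have h1 : 0 < rn h + 1 by rewrite ltr_wpDl // rn_ge0.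
  have e10 : 0 < e1 by rewrite divr_gt0 ?mulr_gt0.
  have [N hN] := Ff _ e10; exists N => k Nk.
  have B z' : rn (z' - z) <= r -> rn (F k z' - F N z') <= 2 * e1.
    move=> hz'; apply: le_trans (rnBD _ (f z') _) _.
    rewrite [rn (f z' - _)]rn_dist mulrDl mul1r.
    by apply: lerD; apply: hN.
  apply: le_trans (@cauchy_sub (F k) (F N) z r _ r0 (dF k) (dF N) B h) _.
  have -> : 2 * (2 * e1) / r * rn h = e * (rn h / (rn h + 1)).
    by rewrite /e1; field; rewrite !gt_eqF.
  by rewrite ler_piMr ?(ltW e0) // ler_pdivrMr // mul1r lerDl.
have M0 : 0 <= M by apply: le_trans (rn_ge0 (f z)) (fM _ zr).
pose D := 8 * (M + 1) / r ^+ 2.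
have D0 : 0 < D by rewrite divr_gt0 ?mulr_gt0 ?exprn_gt0 // ltr_wpDl.
have [N1 hN1] := Ff _ ltr01.
have FM k z' : (N1 <= k)%N -> rn (z' - z) <= r -> rn (F k z') <= M + 1.
  move=> hk hz'; rewrite -[F k z'](subrK (f z')); apply: le_trans (rnD _ _) _.
  by rewrite addrC lerD //; [exact: fM|exact: hN1].
have est h : rn h <= r / 2 -> rn (f (z + h) - f z - L h) <= D * rn h ^+ 2.
  move=> hr; apply/ler_addgt0Pr => e e0.
  have e3 : 0 < e / 3 by rewrite divr_gt0.
  have [N2 hN2] := Ff _ e3; have [N3 hN3] := hL h _ e3.
  pose k := maxn N1 (maxn N2 N3).
  have k1 : (N1 <= k)%N by rewrite leq_maxl.
  have k2 : (N2 <= k)%N by rewrite /k maxnC -maxnA leq_maxl.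
  have k3 : (N3 <= k)%N by rewrite /k maxnA leq_maxr.
  have T := @taylor_estimate R n m (F k) z r (M + 1) r0 (dF k) (FM k ^~ k1) h hr.
  have hr' : rn (z + h - z) <= r.
    rewrite addrAC subrr add0r; apply: le_trans hr _.
    by rewrite ler_pdivrMr // ler_pMr // ler1n.
  have a1 := hN2 k k2 _ hr'; have a2 := hN2 k k2 _ zr; have a3 := hN3 k k3.
  rewrite (_ : f (z + h) - f z - L h = (F k (z + h) - F k z - 'd (F k) z h) -
    (F k (z + h) - f (z + h)) + (F k z - f z) + ('d (F k) z h - L h)); last first.
    by apply/rowP => j; rewrite !mxE; ring.
  apply: le_trans (rnD _ _) _; apply: le_trans (lerD (rnD _ _) a3) _.
  have := rnB (F k (z + h) - F k z - 'd (F k) z h) (F k (z + h) - f (z + h)).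
  rewrite -/D in T; clear - a1 a2 T; lra.
have linL : linear L.
  move=> a x y.
  apply: (@lim_rn_unique R W (fun k => 'd (F k) z (a *: x + y))); first exact: hL.
  move=> e e0; pose e1 := e / (2 * (rn a + 1)).
  have a1 : 0 < rn a + 1 by rewrite ltr_wpDl // rn_ge0.
  have e10 : 0 < e1 by rewrite divr_gt0 ?mulr_gt0.
  have e2 : 0 < e / 2 by rewrite divr_gt0.
  have [N1' h1] := hL x _ e10; have [N2 h2] := hL y _ e2.
  exists (maxn N1' N2) => k; rewrite geq_max => /andP[k1 k2].
  have -> : 'd (F k) z (a *: x + y) - (a *: L x + L y) =
      a *: ('d (F k) z x - L x) + ('d (F k) z y - L y).
    by rewrite linearP scalerBr opprD addrACA.
  apply: le_trans (rnD _ _) _; rewrite rnZ [e]splitr; apply: lerD; last exact: h2.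
  apply: (@le_trans _ _ ((rn a + 1) * e1)).
    by apply: ler_pM => //; rewrite ?rn_ge0 ?lerDl //; exact: h1.
  by rewrite le_eqVlt; apply/orP; left; apply/eqP; rewrite /e1; field; rewrite gt_eqF.
have LC h : rn (L h) <= 2 * (M + 1) / r * rn h.
  apply/ler_addgt0Pr => e e0.
  have [N2 h2] := hL h _ e0.
  have k1 : (N1 <= maxn N1 N2)%N by rewrite leq_maxl.
  have := h2 (maxn N1 N2) (leq_maxr _ _); set G := F _ => H.
  have := @cauchy_estimate R n m G z r (M + 1) r0 (dF _) (FM _ ^~ k1) h.
  rewrite -[L h](subrK ('d G z h)) => H'; apply: le_trans (rnD _ _) _.
  by rewrite rn_dist addrC lerD.
have [e e0|df dE] := rn_diff_lin linL LC (f := f) (z := z).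
  exists (Num.min (r / 2) (e / D)); first by rewrite lt_min (divr_gt0 r0) // (divr_gt0 e0 D0).
  move=> h; rewrite lt_min => /andP[/ltW h1 h2]; apply: le_trans (est h h1) _.
  rewrite expr2 mulrA ler_wpM2r ?rn_ge0 //.
  by rewrite mulrC -ler_pdivlMr // ltW.
by split; [exact: df|move=> h; have := hL h; rewrite -(dE h)].
Qed.

Lemma diff_locally_bounded (f : V -> W) (z : V) : differentiable f z ->
  exists2 d : R, 0 < d & forall z' : V, rn (z' - z) < d -> rn (f z') <= (1 + rn (f z) : R).
Proof.
move=> df; have cf : {for z, continuous f} by exact: (@differentiable_continuous _ _ _ z f df).
have [d d0 hd] := (@contv_rnP R V W f z).1 cf 1 ltr01.
exists d => // z' /hd /ltW h; rewrite -[f z'](subrK (f z)).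
by apply: le_trans (rnD _ _) _; rewrite lerD2r.
Qed.

Lemma diff_translate (f : V -> W) (z b h : V) : differentiable f (z + b) ->
  differentiable (fun x => f (x + b)) z /\ 'd (fun x => f (x + b)) z h = 'd f (z + b) h.
Proof.
move=> df; have [C C0 hC] := diff_bound df.
have [e e0|d1 d2] := @rn_diff R V W (fun x => f (x + b)) z ('d f (z + b)) C hC.
  have [d d0 hd] := diff_rn df e0; exists d => // k /hd.
  by rewrite [z + b + k]addrAC.
by split; [exact: d1|exact: d2].
Qed.

Lemma diff_scaleC (f : V -> W) (z h : V) (a : C) : differentiable f z ->
  differentiable (fun x => a *: f x) z /\ 'd (fun x => a *: f x) z h = a *: 'd f z h.
Proof.
move=> df; split; first exact: (differentiableZ a df).
by have := congr1 (fun F : V -> W => F h) (diffZ a df).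
Qed.

Lemma diff_scale (f : V -> W) (z v : V) (a : R[i]) :
  'd f z (a *: v) = a *: 'd f z v.
Proof. by rewrite linearZ. Qed.

Lemma archi_inv (x : R) : exists N, forall k, (N <= k)%N -> x <= k.+1%:R.
Proof.
exists (Num.Def.archi_bound `|x|) => k hk.
have /ltW h := archi_boundP (normr_ge0 x).
apply: le_trans (ler_norm _) _; apply: le_trans h _.
by rewrite ler_nat (leq_trans hk).
Qed.

Definition dquot (f : V -> W) (v : V) (k : nat) (z : V) : W :=
  (k.+1%:R : R)%:C *: (f (z + ((k.+1%:R)^-1 : R)%:C *: v) - f z).

Lemma dquot_diff (f : V -> W) (v z h : V) k :
  differentiable f z -> differentiable f (z + ((k.+1%:R)^-1 : R)%:C *: v) ->
  differentiable (dquot f v k) z /\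
  'd (dquot f v k) z h = dquot (fun z => 'd f z h) v k z.
Proof.
move=> df1 df2.
have [d1 e1] := @diff_translate f z _ h df2.
have [d3 e3] := @diff_subC (fun x => f (x + _)) f z h d1 df1.
have [d4 e4] := @diff_scaleC (fun x => f (x + _) - f x) z h (k.+1%:R : R)%:C d3.
split; first exact: d4.
exact: (etrans e4 (congr1 (fun y : W => (k.+1%:R : R)%:C *: y)
  (etrans e3 (congr1 (fun y => y - 'd f z h) e1)))).
Qed.

Lemma dquot_err (f : V -> W) (v z : V) k :
  rn (dquot f v k z - 'd f z v) =
  k.+1%:R * rn (f (z + ((k.+1%:R)^-1 : R)%:C *: v) - f z -
                'd f z (((k.+1%:R)^-1 : R)%:C *: v)).
Proof.
have k0 : (k.+1%:R : R) != 0 by rewrite pnatr_eq0.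
have -> : dquot f v k z - 'd f z v = (k.+1%:R : R)%:C *:
   (f (z + ((k.+1%:R)^-1 : R)%:C *: v) - f z - 'd f z (((k.+1%:R)^-1 : R)%:C *: v)).
  by rewrite [RHS]scalerBr diff_scale scalerA -rmorphM mulfV // scale1r.
by rewrite rnZ rn_real ger0_norm.
Qed.

Lemma dquot_cvg (f : V -> W) (v z : V) : differentiable f z ->
  forall e : R, 0 < e -> exists N, forall k, (N <= k)%N ->
    rn (dquot f v k z - 'd f z v) <= e.
Proof.
move=> df e e0.
have v1 : 0 < rn v + 1 by rewrite ltr_wpDl // rn_ge0.
have e1 : 0 < e / (rn v + 1) by rewrite divr_gt0.
have [d d0 hd] := diff_rn df e1.
have [N hN] := archi_inv ((rn v + 1) / d).
exists N => k /hN; rewrite ler_pdivrMr // => hk.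
have k0 : 0 < k.+1%:R :> R by rewrite ltr0n.
rewrite dquot_err mulrC -ler_pdivlMr //.
have nv : rn (((k.+1%:R)^-1 : R)%:C *: v) = rn v / k.+1%:R.
  by rewrite rnZ rn_real ger0_norm ?invr_ge0 // mulrC.
have lt : rn (((k.+1%:R)^-1 : R)%:C *: v) < d.
  by rewrite nv ltr_pdivrMr // mulrC; apply: lt_le_trans hk; rewrite ltrDl.
apply: le_trans (hd _ lt) _; rewrite nv mulrA ler_pM2r ?invr_gt0 //.
by rewrite mulrAC ler_pdivrMr // ler_pM2l // lerDl.
Qed.

(** The Taylor estimate makes the difference quotients of [f] converge uniformly to its directional
    derivative, so Weierstrass applies. The second conclusion exhibits the second derivative as a
    limit of difference quotients of ['d f z h], which is what its symmetry needs. *)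
Lemma holo_deriv (f : V -> W) (z v : V) (r : R) : 0 < r ->
  (forall z', rn (z' - z) < r -> differentiable f z') ->
  differentiable (fun z' => 'd f z' v) z /\
  forall h (e : R), 0 < e -> exists N, forall k, (N <= k)%N ->
    rn (dquot (fun z => 'd f z h) v k z - 'd (fun z' => 'd f z' v) z h) <= e.
Proof.
move=> r0 df.
have dz : differentiable f z by apply: df; rewrite subrr rn0.
have [d0 d00 hd0] := diff_locally_bounded dz.
set M := 1 + rn (f z) in hd0.
have M0 : 0 <= M by rewrite addr_ge0 // rn_ge0.
have [s [s0 sr sd]] : exists s : R, [/\ 0 < s, s * 4 <= r & s * 4 <= d0].
  exists (Num.min r d0 / 4); rewrite divfK // divr_gt0 // ?lt_min ?r0 //.
  by rewrite !ge_min !lexx orbT.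
have v1 : 0 < rn v + 1 by rewrite ltr_wpDl // rn_ge0.
have in2 z1 z2 : rn (z1 - z) <= s -> rn (z2 - z1) <= s -> rn (z2 - z) <= s * 2.
  by move=> h1 h2; apply: le_trans (rnBD _ z1 _) _; rewrite mulr_natr mulr2n lerD.
have df2 z' : rn (z' - z) <= s * 2 -> differentiable f z'.
  by move=> h; apply: df; apply: le_lt_trans h _; clear - s0 sr; lra.
have fM2 z' : rn (z' - z) <= s * 2 -> rn (f z') <= M.
  by move=> h; apply: hd0; apply: le_lt_trans h _; clear - s0 sd; lra.
have [N0 hN0] := archi_inv ((rn v + 1) * 2 / s).
have nv k : rn (((k.+1%:R)^-1 : R)%:C *: v) = rn v / k.+1%:R.
  by rewrite rnZ rn_real ger0_norm ?invr_ge0 // mulrC.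
have small k : (N0 <= k)%N -> rn (((k.+1%:R)^-1 : R)%:C *: v) <= s / 2.
  move=> /hN0; rewrite ler_pdivrMr // => h.
  rewrite nv ler_pdivrMr ?ltr0n // mulrAC ler_pdivlMr // mulrC.
  rewrite [s * _]mulrC; apply: le_trans h; clear; rewrite mulrC ler_pM2r //; lra.
have step z' k : (N0 <= k)%N -> rn (z' - z) <= s ->
   rn (z' + ((k.+1%:R)^-1 : R)%:C *: v - z) <= s * 2.
  move=> hk hz'; apply: (in2 z') => //; rewrite addrAC subrr add0r.
  by apply: le_trans (small _ hk) _; clear - s0; lra.
have sub1 z' : rn (z' - z) <= s -> rn (z' - z) <= s * 2.
  by move=> h; apply: le_trans h _; clear - s0; lra.
(* The shift by [N0] makes the step short enough for the displaced point to stay in the larger ball,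
   for every index. *)
pose F k := dquot f v (k + N0).
have dF k z' : rn (z' - z) <= s -> differentiable (F k) z'.
  move=> hz'; have d1 := df2 z' (sub1 z' hz').
  have d2 := df2 _ (step z' (k + N0)%N (leq_addl _ _) hz').
  exact: (@dquot_diff f v z' v (k + N0) d1 d2).1.
pose D := 8 * M / s ^+ 2.
have D0 : 0 <= D by exact: divr_ge0 (mulr_ge0 (ler0n _ 8) M0) (sqr_ge0 _).
have Ff (e : R) : 0 < e -> exists N, forall k, (N <= k)%N -> forall z',
     rn (z' - z) <= s -> rn (F k z' - 'd f z' v) <= e.
  move=> e0; have [N hN] := archi_inv (D * rn v ^+ 2 / e).
  exists N => k hk z' hz'.
  have hkN : (N <= k + N0)%N by apply: leq_trans hk (leq_addr _ _).
  rewrite /F dquot_err; set j := (k + N0)%N in hkN *.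
  have jN0 : (N0 <= j)%N by rewrite leq_addl.
  have j0 : 0 < j.+1%:R :> R by rewrite ltr0n.
  have df' y : rn (y - z') <= s -> differentiable f y.
    by move=> hy; apply: df2; exact: in2 hz' hy.
  have fM' y : rn (y - z') <= s -> rn (f y) <= M.
    by move=> hy; apply: fM2; exact: in2 hz' hy.
  have T := @taylor_estimate R n m f z' s M s0 df' fM' _ (small _ jN0).
  rewrite mulrC -ler_pdivlMr //; apply: le_trans T _.
  rewrite -/D nv; have -> : D * (rn v / j.+1%:R) ^+ 2 = D * rn v ^+ 2 / j.+1%:R / j.+1%:R.
    by field; rewrite gt_eqF.
  rewrite ler_pM2r ?invr_gt0 // ler_pdivrMr //.
  by have := hN j hkN; rewrite ler_pdivrMr // [e * _]mulrC.
have dM z' : rn (z' - z) <= s -> rn ('d f z' v) <= 2 * M / s * rn v.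
  move=> hz'; apply: (@cauchy_estimate R n m f z' s M s0).
    by move=> y hy; apply: df2; exact: in2 hz' hy.
  by move=> y hy; apply: fM2; exact: in2 hz' hy.
have [d1 d2] := @weierstrass F (fun z' => 'd f z' v) z s _ s0 dF Ff dM.
split=> // h e e0; have [N hN] := d2 h e e0.
exists (N + N0)%N => k hk.
have kE : k = (k - N0 + N0)%N by rewrite subnK // (leq_trans (leq_addl _ _) hk).
have := hN (k - N0)%N; rewrite leq_subRL ?(leq_trans (leq_addl _ _) hk) //.
rewrite addnC => /(_ hk).
have zz : rn (z - z) <= s by rewrite subrr rn0 ltW.
have kN0 : (N0 <= k)%N by exact: leq_trans (leq_addl _ _) hk.
have E := (@dquot_diff f v z h k (df2 _ (sub1 _ zz)) (df2 _ (step z k kN0 zz))).2.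
by rewrite -E /F -kE.
Qed.

(** One and the same sequence of difference quotients converges to both sides: to the left one by
    [holo_deriv], to the right one by the definition of the derivative of ['d f z h] along [v]. *)
Lemma holo_deriv_sym (f : V -> W) (z v h : V) (r : R) : 0 < r ->
  (forall z', rn (z' - z) < r -> differentiable f z') ->
  'd (fun z' => 'd f z' v) z h = 'd (fun z' => 'd f z' h) z v.
Proof.
move=> r0 df.
have [_ H1] := @holo_deriv f z v r r0 df.
have [dh _] := @holo_deriv f z h r r0 df.
apply: (@lim_rn_unique R W (fun k => dquot (fun z => 'd f z h) v k z)).
  exact: H1.
exact: dquot_cvg.
Qed.

End Weierstrass.

(** * Functions of class C^k, families and composition *)

Section Along.
Context {R : realType} {n : nat}.
Local Notation V := (Cspace R n).
Implicit Types (f : V -> R) (z v : V).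

Lemma eps_is_derive (g : R -> R) (x c : R) :
  (forall e : R, 0 < e -> exists2 r : R, 0 < r & forall h, `|h| < r ->
    `|g (x + h) - g x - c * h| <= e * `|h|) -> is_derive x 1 g c.
Proof.
move=> H.
have L : h^-1 *: (g (h *: 1 + x) - g x) @[h --> 0^'] --> c.
  apply/cvgrPdist_le => e e0; have [r r0 hr] := H e e0.
  rewrite near_withinE; apply/nbhs_ballP; exists r => // h.
  rewrite /ball /= sub0r normrN => hh h0; have := hr h hh.
  move=> H1; rewrite -[h *: 1]/(h * 1) mulr1 -[_ *: _]/(h^-1 * _) [h + x]addrC distrC.
  rewrite [X in `|X|](_ : _ = (g (x + h) - g x - c * h) / h).
    by rewrite normrM normfV ler_pdivrMr ?normr_gt0.
  by rewrite mulrBl mulfK // mulrC.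
by split; [apply/cvg_ex; exists c|apply: cvg_lim].
Qed.

Lemma shift_is_derive (g k : R -> R) (t : R) : (forall h, g (h + t) = k h) ->
  derivable k 0 1 -> is_derive t 1 g ('D_1 k 0).
Proof.
move=> gk /derivableP dk; apply: eps_is_derive => e e0.
have [r r0 hr] := is_derive_eps dk e0; exists r => // h /hr.
by rewrite add0r -!gk [t + h]addrC (add0r t).
Qed.

Lemma along_is_derive f z v (t : R) : derivable (along f (z + t%:C *: v) v) 0 1 ->
  is_derive t 1 (along f z v) (dirD v f (z + t%:C *: v)).
Proof.
move=> d.
have A (h : R) : along f z v (h + t) = along f (z + t%:C *: v) v h.
  rewrite /along.
  by rewrite -addrA -scalerDl -rmorphD [t + h]addrC.
exact: shift_is_derive A d.
Qed.

Lemma dir_MVT f z v (s : R) :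
  (forall t : R, `|t| <= `|s| -> derivable (along f (z + t%:C *: v) v) 0 1) ->
  exists2 t : R, `|t| <= `|s| & f (z + s%:C *: v) - f z = s * dirD v f (z + t%:C *: v).
Proof.
move=> H.
have E0 : along f z v 0 = f z.
  by rewrite /along (rmorph0 (real_complex R)) scale0r addr0.
have D (t : R) : `|t| <= `|s| -> is_derive t 1 (along f z v) (dirD v f (z + t%:C *: v)).
  by move=> /H; exact: along_is_derive.
have key (a b : R) : a <= b -> (forall t, a <= t <= b -> `|t| <= `|s|) ->
  exists2 t, `|t| <= `|s| &
    along f z v b - along f z v a = dirD v f (z + t%:C *: v) * (b - a).
  move=> ab hab.
  have [||t tab ->] := @MVT_segment R (along f z v) (fun t => dirD v f (z + t%:C *: v)) a b ab.
  - move=> t; rewrite in_itv /= => /andP[h1 h2]; apply: D; apply: hab.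
    by rewrite !ltW.
  - apply: derivable_within_continuous => t; rewrite in_itv /= => /hab /D d.
    exact: ex_derive.
  - by exists t => //; apply: hab; move: tab; rewrite in_itv.
have [s0|s0] := leP 0 s.
  have [t|t t1 E] := key 0 s s0; first by move=> /andP[h1 h2]; rewrite !ger0_norm.
  by exists t => //; move: E; rewrite E0 subr0 mulrC.
have [t|t t1 E] := key s 0 (ltW s0).
  by move=> /andP[h1 h2]; rewrite !ler0_norm ?lerN2 // ltW.
exists t => //; move: E; rewrite E0 /along sub0r mulrN mulrC => E.
by rewrite -opprB E opprK.
Qed.

End Along.

(** * Real coordinates, and differentiability from partial derivatives *)

Section RealBasis.
Context {R : realType} {n : nat}.
Local Notation V := (Cspace R n).
Local Notation J := ('I_n * bool)%type.

Definition eb (p : J) : V :=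
  (if p.2 then 'i else 1 : R[i]) *: (delta_mx ord0 p.1 : 'rV[R[i]]_n).
Definition rc (p : J) (h : V) : R :=
  if p.2 then complex.Im (co h p.1 : R[i]) else complex.Re (co h p.1 : R[i]).

Lemma rcD p (u v : V) : rc p (u + v) = rc p u + rc p v.
Proof. by rewrite /rc coD; case: p => j [] /=; case: (co u j); case: (co v j). Qed.

Lemma rcN p (u : V) : rc p (- u) = - rc p u.
Proof. by rewrite /rc coN; case: p => j [] /=; case: (co u j). Qed.

Lemma rcZ p (a : R) (u : V) : rc p (a%:C *: u) = a * rc p u.
Proof.
by rewrite /rc coZ; case: p => j [] /=; case: (co u j) => x y /=; rewrite mul0r ?subr0 ?addr0.
Qed.

Lemma rc_le p (u : V) : `|rc p u| <= rn u.
Proof.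
by rewrite /rc; case: p.2; apply: le_trans (rn_co u p.1);
  [exact: rn_Im|exact: rn_Re].
Qed.

Lemma rn_eb p : rn (eb p) <= 1.
Proof.
apply: rn_le_co => // j; rewrite coZ rnM.
have -> : rn ((if p.2 then 'i else 1) : R[i]) = 1.
  by case: p.2; rewrite ?rn_i ?rn1.
rewrite mul1r /co mxE eqxx /=; case: (_ == _); first by rewrite rn1.
by rewrite rn0.
Qed.

Lemma real_basis (h : V) : h = \sum_(p : J) (rc p h)%:C *: eb p.
Proof.
apply/rowP => j; rewrite summxE.
rewrite -(pair_bigA _ (fun i b => (((rc (i, b) h)%:C *: eb (i, b)) : 'rV[R[i]]_n) ord0 j)) /=.
rewrite (bigD1 j) //= [X in _ + X]big1 ?addr0 => [|i ij].
  rewrite big_bool /= !mxE !eqxx /= !mulr1 /rc /= /co addrC.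
  by rewrite mulrC -complexE.
by rewrite big_bool /= !mxE eqxx eq_sym (negPf ij) /= !mulr0 addr0.
Qed.

(** The broken path from 0 to a vector that runs parallel to one real coordinate axis at a time. *)
Fixpoint stepv (t : J -> R) (s : seq J) : V :=
  if s is p :: s' then (t p)%:C *: eb p + stepv t s' else 0.

Lemma stepvE (h : V) : stepv (rc ^~ h) (index_enum J) = h.
Proof.
rewrite [RHS]real_basis; elim: (index_enum J) => [|p s IH] /=; first by rewrite big_nil.
by rewrite big_cons IH.
Qed.

(** The mean value theorem along each segment of the broken path: control of the partial derivatives
    near [z0] controls the total increment. The budget [d] is spent by the lengths of the
    segments. *)
Lemma step_estimate (f : V -> R) (z0 : V) (D : J -> R) (d e : R) (s : seq J) (t : J -> R) :
  (forall p z, rn (z - z0) < d ->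
     derivable (along f z (eb p)) 0 1 /\ `|dirD (eb p) f z - D p| <= e) ->
  forall z, rn (z - z0) + \sum_(p <- s) `|t p| < d ->
  `|f (z + stepv t s) - f z - \sum_(p <- s) t p * D p|
    <= e * \sum_(p <- s) `|t p|.
Proof.
move=> H; elim: s => [|p s IH] z.
  move=> _; rewrite !big_nil (_ : z + stepv t [::] = z); last exact: addr0.
  by rewrite subrr subr0 normr0 mulr0.
rewrite !big_cons -[stepv t (p :: s)]/((t p)%:C *: eb p + stepv t s) => hz.
pose z1 := z + (t p)%:C *: eb p.
have S0 : 0 <= \sum_(p <- s) `|t p| by apply: sumr_ge0.
have near u : `|u| <= `|t p| -> rn (z + u%:C *: eb p - z0) <= rn (z - z0) + `|t p|.
  move=> hu; rewrite addrAC; apply: le_trans (rnD _ _) _; rewrite lerD2l.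
  rewrite rnZ rn_real; apply: le_trans hu.
  by rewrite ler_piMr // rn_eb.
have hz1 : rn (z1 - z0) + \sum_(p <- s) `|t p| < d.
  by apply: le_lt_trans hz; rewrite addrA lerD2r; exact: near.
have near2 u : `|u| <= `|t p| -> rn (z + u%:C *: eb p - z0) < d.
  move=> hu; apply: le_lt_trans (near _ hu) _; apply: le_lt_trans hz.
  by rewrite addrA lerDl.
have [u hu|u hu E] := @dir_MVT R n f z (eb p) (t p).
  exact: (H p _ (near2 _ hu)).1.
have I1 := IH _ hz1.
have I2 := (H p _ (near2 _ hu)).2.
rewrite addrA -/z1.
set A := f _ in I1 *; set S := \sum_(p <- s) t p * D p in I1 *.
have -> : A - f z - (t p * D p + S) =
   (A - f z1 - S) + (t p * (dirD (eb p) f (z + u%:C *: eb p) - D p)).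
  have -> : f z = f z1 - t p * dirD (eb p) f (z + u%:C *: eb p) by rewrite -E opprB addrC subrK.
  ring.
apply: le_trans (ler_normD _ _) _; rewrite [leRHS]mulrDr [leRHS]addrC; apply: lerD; first exact: I1.
by rewrite normrM mulrC ler_wpM2r.
Qed.

Lemma sum_rc_le (h : V) : \sum_(p : J) `|rc p h| <= (2 * n)%:R * rn h.
Proof.
apply: (@le_trans _ _ (\sum_(p : J) rn h)); first by apply: ler_sum => p _; exact: rc_le.
by rewrite sumr_const card_prod card_ord card_bool mulr_natl mulnC.
Qed.

Lemma frechet_estimate (f : V -> R) (z0 : V) (D : J -> R) (d e : R) :
  (forall p z, rn (z - z0) < d ->
     derivable (along f z (eb p)) 0 1 /\ `|dirD (eb p) f z - D p| <= e) ->
  forall z h, rn (z - z0) + (2 * n)%:R * rn h < d ->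
  `|f (z + h) - f z - \sum_p rc p h * D p| <= e * ((2 * n)%:R * rn h).
Proof.
move=> H z h hz; rewrite -{1}[h]stepvE.
(* For [n = 0] there is no direction from which [0 <= e] could be read off; both sides then
   vanish. *)
have e0 : 0 <= e \/ forall j : 'I_n, False.
  case: (pickP (fun _ : 'I_n => true)) => [j _|no]; last by right => j; have := no j.
  left; have h0 : rn (z0 - z0) < d.
    rewrite subrr rn0; apply: le_lt_trans hz.
    by rewrite addr_ge0 ?mulr_ge0 ?rn_ge0.
  exact: le_trans (normr_ge0 _) (H (j, true) z0 h0).2.
have hs : rn (z - z0) + \sum_(p : J) `|rc p h| < d.
  by apply: le_lt_trans hz; rewrite lerD2l sum_rc_le.
apply: le_trans (step_estimate H hs) _.
case: e0 => [e0|no]; first by rewrite ler_wpM2l // sum_rc_le.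
have -> : \sum_(p : J) `|rc p h| = 0 by apply: big1 => -[j ?] _; have := no j.
have -> : (2 * n)%:R = 0 :> R; last by rewrite mul0r.
by case: n no => [|k] no; [rewrite muln0|have := no ord0].
Qed.

End RealBasis.

Section Families.
Context {R : realType} {n : nat} {S : Type}.
Local Notation V := (Cspace R n).
Implicit Types (U : set V) (F G : S -> V -> R).

Definition loc_bounded U F := forall z, U z -> exists M d : R, 0 < d /\
  forall s z', rn (z' - z) < d -> `|F s z'| <= M.

(* Families of class C^k on [U] all of whose derivatives up to order [k] are locally bounded uniformly in the parameter. *)
Fixpoint BC (k : nat) U F : Prop :=
  [/\ forall s z, U z -> {for z, continuous (F s)}, loc_bounded U F &
   if k is k'.+1 then
     forall v, (forall s z, U z -> derivable (along (F s) z v) 0 1) /\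
               BC k' U (fun s => dirD v (F s))
   else True].

Lemma BC_Ck k U F : BC k U F -> forall s, Ck k U (F s).
Proof.
elim: k F => [|k IH] F /= [c _ h] s; split => //; first exact: c.
  exact: c.
by move=> v; have [d b] := h v; split; [exact: d|exact: (IH _ b)].
Qed.

Lemma BC_S k U F : BC k.+1 U F -> BC k U F.
Proof.
elim: k F => [|k IH] F; first by case=> c l _; split.
case=> c l h; split=> // v; have [d b] := h v; split => //; exact: IH.
Qed.

Lemma BC_lb k U F : BC k U F -> loc_bounded U F.
Proof. by case: k => [|k] []. Qed.

Lemma BC_subset k U U' F : U' `<=` U -> BC k U F -> BC k U' F.
Proof.
move=> U'U; elim: k F => [|k IH] F [c l h]; split.
- by move=> s z /U'U; exact: c.
- by move=> z /U'U; exact: l.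
- by [].
- by move=> s z /U'U; exact: c.
- by move=> z /U'U; exact: l.
- move=> v; have [d b] := h v; split; last exact: IH.
  by move=> s z /U'U; exact: d.
Qed.

Lemma BC_local k U F : (forall z, U z -> exists N, N z /\ BC k N F) -> BC k U F.
Proof.
elim: k F => [|k IH] F H; split => //.
- by move=> s z /H [N [Nz [c _ _]]]; exact: c.
- by move=> z /H [N [Nz [_ l _]]]; exact: l.
- by move=> s z /H [N [Nz [c _ _]]]; exact: c.
- by move=> z /H [N [Nz [_ l _]]]; exact: l.
- move=> v; split.
    by move=> s z /H [N [Nz [_ _ /(_ v)[d _]]]]; exact: d.
  by apply: IH => z /H [N [Nz [_ _ /(_ v)[_ b]]]]; exists N.
Qed.

Lemma along0 (f : V -> R) z v : along f z v 0 = f z.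
Proof.
rewrite /along (rmorph0 (real_complex R)) scale0r.
by congr f; exact: addr0.
Qed.

Lemma dirD_ext (f g : V -> R) (z v : V) (d : R) : 0 < d ->
  (forall z', rn (z' - z) < d -> f z' = g z') ->
  (derivable (along f z v) 0 1 -> derivable (along g z v) 0 1) /\
  (derivable (along f z v) 0 1 -> dirD v f z = dirD v g z).
Proof.
move=> d0 fg.
suff H : derivable (along f z v) 0 1 -> is_derive (0 : R) 1 (along g z v) (dirD v f z).
  by split=> /H [a b]; [exact: a|exact: esym b].
move=> /derivableP df; apply: eps_is_derive => e e0.
have [r r0 hr] := is_derive_eps df e0.
have v1 : 0 < rn v + 1 by rewrite ltr_wpDl // rn_ge0.
exists (Num.min r (d / (rn v + 1))); first by rewrite lt_min r0 divr_gt0.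
move=> h; rewrite lt_min ltr_pdivlMr // => /andP[h1 h2].
have A0 : along f z v 0 = along g z v 0.
  by rewrite !along0; apply: fg; rewrite subrr rn0.
have A1 : along f z v h = along g z v h.
  apply: fg; rewrite (_ : z + h%:C *: v - z = h%:C *: v); last first.
    by rewrite addrAC subrr add0r.
  rewrite rnZ rn_real; apply: le_lt_trans h2.
  by rewrite ler_wpM2l // lerDl.
by have := hr h h1; rewrite (_ : 0 + h = h) ?add0r // A0 A1.
Qed.

Lemma BC_ext k U F G : open U -> (forall s z, U z -> F s z = G s z) ->
  BC k U F -> BC k U G.
Proof.
move=> /open_rnP oU.
elim: k F G => [|k IH] F G FG [c l h].
- split => //.
  + move=> s z Uz; apply/cont_rnP => e e0; have [d d0 hd] := oU z Uz.
    have [r r0 hr] := (@cont_rnP R V (F s) z).1 (c s z Uz) e e0.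
    exists (Num.min d r); first by rewrite lt_min d0.
    move=> z'; rewrite lt_min => /andP[h1 h2].
    by rewrite -(FG s z' (hd _ h1)) -(FG s z Uz); exact: hr.
  + move=> z Uz; have [d d0 hd] := oU z Uz; have [M [r [r0 hr]]] := l z Uz.
    exists M, (Num.min d r); split; first by rewrite lt_min d0.
    by move=> s z'; rewrite lt_min => /andP[h1 h2]; rewrite -FG; [exact: hr|exact: hd].
- split => //.
  + move=> s z Uz; apply/cont_rnP => e e0; have [d d0 hd] := oU z Uz.
    have [r r0 hr] := (@cont_rnP R V (F s) z).1 (c s z Uz) e e0.
    exists (Num.min d r); first by rewrite lt_min d0.
    move=> z'; rewrite lt_min => /andP[h1 h2].
    by rewrite -(FG s z' (hd _ h1)) -(FG s z Uz); exact: hr.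
  + move=> z Uz; have [d d0 hd] := oU z Uz; have [M [r [r0 hr]]] := l z Uz.
    exists M, (Num.min d r); split; first by rewrite lt_min d0.
    by move=> s z'; rewrite lt_min => /andP[h1 h2]; rewrite -FG; [exact: hr|exact: hd].
  + move=> v; have [dF bF] := h v; split.
      move=> s z Uz; have [d d0 hd] := oU z Uz.
      have [E _] := @dirD_ext (F s) (G s) z v d d0 (fun z' hz' => FG s z' (hd z' hz')).
      by apply: E; exact: dF.
    apply: IH bF => s z Uz; have [d d0 hd] := oU z Uz.
    have [_ E] := @dirD_ext (F s) (G s) z v d d0 (fun z' hz' => FG s z' (hd z' hz')).
    by apply: E; exact: dF.
Qed.

Lemma loc_boundedD U F G : loc_bounded U F -> loc_bounded U G ->
  loc_bounded U (fun s z => F s z + G s z).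
Proof.
move=> lF lG z Uz; have [M [d [d0 hd]]] := lF z Uz; have [M' [d' [d0' hd']]] := lG z Uz.
exists (M + M'), (Num.min d d'); split; first by rewrite lt_min d0.
move=> s z'; rewrite lt_min => /andP[h1 h2].
by apply: le_trans (ler_normD _ _) _; apply: lerD; [exact: hd|exact: hd'].
Qed.

Lemma loc_boundedM U F G : loc_bounded U F -> loc_bounded U G ->
  loc_bounded U (fun s z => F s z * G s z).
Proof.
move=> lF lG z Uz; have [M [d [d0 hd]]] := lF z Uz; have [M' [d' [d0' hd']]] := lG z Uz.
exists (M * M'), (Num.min d d'); split; first by rewrite lt_min d0.
move=> s z'; rewrite lt_min => /andP[h1 h2].
by rewrite normrM; apply: ler_pM => //; [exact: hd|exact: hd'].
Qed.

Lemma dirDD (f g : V -> R) (z v : V) :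
  derivable (along f z v) 0 1 -> derivable (along g z v) 0 1 ->
  derivable (along (fun z => f z + g z) z v) 0 1 /\
  dirD v (fun z => f z + g z) z = dirD v f z + dirD v g z.
Proof.
move=> df dg; split; first exact: (derivableD df dg).
exact: (deriveD df dg).
Qed.

Lemma dirDM (f g : V -> R) (z v : V) :
  derivable (along f z v) 0 1 -> derivable (along g z v) 0 1 ->
  derivable (along (fun z => f z * g z) z v) 0 1 /\
  dirD v (fun z => f z * g z) z = dirD v f z * g z + f z * dirD v g z.
Proof.
move=> df dg; split; first exact: (derivableM df dg).
have := deriveM df dg; rewrite !along0 => E.
by rewrite addrC [dirD v f z * _]mulrC; exact: E.
Qed.

Lemma BCD k U F G : open U -> BC k U F -> BC k U G ->
  BC k U (fun s z => F s z + G s z).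
Proof.
move=> oU; elim: k F G => [|k IH] F G [cF lF hF] [cG lG hG].
  split=> //; last exact: loc_boundedD.
  by move=> s z Uz; apply: continuousD; [exact: cF|exact: cG].
split.
- by move=> s z Uz; apply: continuousD; [exact: cF|exact: cG].
- exact: loc_boundedD.
- move=> v; have [dF bF] := hF v; have [dG bG] := hG v; split.
    by move=> s z Uz; exact: (dirDD (dF s z Uz) (dG s z Uz)).1.
  apply: BC_ext (IH _ _ bF bG) => // s z Uz.
  by have [_ ->] := dirDD (dF s z Uz) (dG s z Uz).
Qed.

Lemma BCM k U F G : open U -> BC k U F -> BC k U G ->
  BC k U (fun s z => F s z * G s z).
Proof.
move=> oU; elim: k F G => [|k IH] F G HF HG; have [cF lF hF] := HF; have [cG lG hG] := HG.
  split=> //; last exact: loc_boundedM.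
  by move=> s z Uz; apply: continuousM; [exact: cF|exact: cG].
split.
- by move=> s z Uz; apply: continuousM; [exact: cF|exact: cG].
- exact: loc_boundedM.
- move=> v; have [dF bF] := hF v; have [dG bG] := hG v; split.
    by move=> s z Uz; exact: (dirDM (dF s z Uz) (dG s z Uz)).1.
  have H1 := IH _ _ bF (BC_S HG); have H2 := IH _ _ (BC_S HF) bG.
  apply: BC_ext (BCD oU H1 H2) => // s z Uz.
  by have [_ ->] := dirDM (dF s z Uz) (dG s z Uz).
Qed.

Lemma dirD_cst (c : R) (z v : V) :
  derivable (along (fun=> c) z v) 0 1 /\ dirD v (fun=> c) z = 0.
Proof. by split; [exact: derivable_cst|exact: derive_cst]. Qed.

Lemma BC_cst k U (c : S -> R) (M : R) : (forall s, `|c s| <= M) -> BC k U (fun s _ => c s).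
Proof.
elim: k c M => [|k IH] c M cM.
  split => //; first by move=> s z _; exact: cst_continuous.
  by move=> z _; exists M, 1.
split => //; first by move=> s z _; exact: cst_continuous.
  by move=> z _; exists M, 1.
move=> v; split; first by move=> s z _; exact: (dirD_cst _ _ _).1.
rewrite (_ : (fun s => _) = (fun s _ => 0)).
  by apply: (IH _ 0) => s; rewrite normr0.
by apply/funext => s; apply/funext => z; exact: (dirD_cst _ _ _).2.
Qed.

Lemma BC_sum k U (I : finType) (F : I -> S -> V -> R) : open U ->
  (forall i, BC k U (F i)) -> BC k U (fun s z => \sum_(i : I) F i s z).
Proof.
move=> oU H.
suff K (r : seq I) : BC k U (fun s z => \sum_(i <- r) F i s z) by exact: K.
elim: r => [|i r IH].
  apply: (@BC_ext k U (fun _ _ => 0)) => //; first by move=> s z _; rewrite big_nil.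
  by apply: (@BC_cst k U (fun=> 0) 0) => s; rewrite normr0.
apply: BC_ext (BCD oU (H i) IH) => // s z _.
by rewrite big_cons.
Qed.

End Families.

Section Single.
Context {R : realType} {n : nat}.
Local Notation V := (Cspace R n).

(** For a constant family the uniform bounds come from continuity, so the calculus of families also
    serves single functions. *)
Lemma Ck_BC k (U : set V) (f : V -> R) (T : Type) : Ck k U f -> BC k U (fun _ : T => f).
Proof.
have lb (g : V -> R) : (forall z, U z -> {for z, continuous g}) ->
    loc_bounded U (fun _ : T => g).
  move=> cg z Uz; have [d d0 hd] := (@cont_rnP R V g z).1 (cg z Uz) 1 ltr01.
  exists (`|g z| + 1), d; split=> // _ z' /hd h.
  by have := ler_normD (g z' - g z) (g z); rewrite subrK; lra.
elim: k f => [|k IH] f /= [c h]; split => //; try exact: lb.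
by move=> v; have [d b] := h v; split => //; exact: IH.
Qed.

Lemma dirDV (f : V -> R) (z v : V) : f z != 0 ->
  derivable (along f z v) 0 1 ->
  derivable (along (fun z => (f z)^-1) z v) 0 1 /\
  dirD v (fun z => (f z)^-1) z = - dirD v f z * ((f z)^-1 * (f z)^-1).
Proof.
move=> f0 df.
have f0' : along f z v 0 != 0 by rewrite along0.
split; first exact: (derivableV f0' df).
have E := deriveV f0' df; rewrite along0 in E.
apply: etrans E _.
by rewrite mulNr -mulNr /GRing.scale /= -exprVn expr2 mulrC mulrN mulNr.
Qed.

Lemma BC_inv k (U : set V) (f : V -> R) : open U -> (forall z, U z -> f z != 0) ->
  BC k U (fun _ : unit => f) -> BC k U (fun _ : unit => (fun z => (f z)^-1)).
Proof.
move=> oU f0; elim: k => [|k IH] H; have [c l h] := H.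
  by apply: Ck_BC; split=> // z Uz; apply: continuousV; [exact: f0|exact: (c tt)].
have Hk := IH (BC_S H).
have cV z : U z -> {for z, continuous (fun z => (f z)^-1)}.
  by move=> Uz; apply: continuousV; [exact: f0|exact: (c tt)].
split; first by move=> s z Uz; exact: cV.
  by apply: BC_lb Hk.
move=> v; have [d b] := h v; split.
  by move=> s z Uz; exact: (dirDV (f0 z Uz) (d tt z Uz)).1.
have N : BC k U (fun _ : unit => fun _ : V => -1 : R).
  by apply: (@BC_cst _ _ _ k U (fun=> -1) 1) => _; rewrite normrN normr1.
have P := BCM oU (BCM oU N b) (BCM oU Hk Hk).
apply: BC_ext P => // s z Uz.
by rewrite (dirDV (f0 z Uz) (d tt z Uz)).2 mulN1r.
Qed.

End Single.

Section Chain.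
Context {R : realType} {n m : nat}.
Local Notation V := (Cspace R n).
Local Notation W := (Cspace R m).

Lemma fin_radius (I : finType) (Q : I -> R -> Prop) :
  (forall i r r', 0 < r' -> r' <= r -> Q i r -> Q i r') ->
  (forall i, exists2 r, 0 < r & Q i r) -> exists2 r, 0 < r & forall i, Q i r.
Proof.
move=> mono H.
suff K (s : seq I) : exists2 r, 0 < r & forall i, i \in s -> Q i r.
  by have [r r0 hr] := K (enum I); exists r => // i; apply: hr; rewrite mem_enum.
elim: s => [|i s [r r0 hr]]; first by exists 1.
have [r' r'0 hr'] := H i.
have m0 : 0 < Num.min r r' by rewrite lt_min r0.
exists (Num.min r r') => // j; rewrite inE => /predU1P[->|/hr Qj].
  by apply: mono hr' => //; rewrite ge_min lexx orbT.
by apply: mono Qj => //; rewrite ge_min lexx.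
Qed.

Lemma fin_bound (I : finType) (T : Type) (U : set V) (F : I -> T -> V -> R) :
  (forall i, loc_bounded U (F i)) ->
  forall z, U z -> exists M d : R, [/\ 0 <= M, 0 < d &
    forall i s z', rn (z' - z) < d -> `|F i s z'| <= M].
Proof.
move=> H z Uz.
have /choice[M hM] : forall i, exists M, exists2 d : R, 0 < d &
    forall s z', rn (z' - z) < d -> `|F i s z'| <= M.
  by move=> i; have [M [d [d0 hd]]] := H i z Uz; exists M, d.
have [i r r' _ rr' h s z' h'|d d0 hd] := @fin_radius I (fun i r => forall s z',
    rn (z' - z) < r -> `|F i s z'| <= M i) _ hM.
  exact: h (lt_le_trans h' rr').
exists (\sum_i `|M i|), d; split=> //; first by apply: sumr_ge0.
move=> i s z' h; apply: le_trans (hd i s z' h) _; apply: le_trans (ler_norm _) _.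
by rewrite (bigD1 i) //= lerDl sumr_ge0.
Qed.

(** A real function with continuous partial derivatives is totally differentiable by
    [frechet_estimate]; the deviation of [a] from its differential is absorbed by [SD], the sum of
    the sizes of the partial derivatives. *)
Lemma chain_rule (f : W -> R) (a : V -> W) (z v : V) (r : R) : 0 < r ->
  (forall p w, rn (w - a z) < r -> derivable (along f w (eb p)) 0 1) ->
  (forall p, {for a z, continuous (dirD (eb p) f)}) ->
  differentiable a z ->
  is_derive (0 : R) 1 (along (fun z => f (a z)) z v)
    (\sum_p rc p ('d a z v) * dirD (eb p) f (a z)).
Proof.
move=> r0 df cf da; apply: eps_is_derive => e e0.
pose w1 := 'd a z v.
pose D p := dirD (eb p) f (a z).
pose SD := \sum_p `|D p|.
have SD0 : 0 <= SD by apply: sumr_ge0.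
pose N : R := (2 * m)%:R; have N0 : 0 <= N by exact: ler0n.
pose A := rn w1 + 1; have A0 : 0 < A by rewrite ltr_wpDl // rn_ge0.
pose e1 := e / (2 * (N * A + 1)).
have NA : 0 < N * A + 1 by rewrite ltr_wpDl // mulr_ge0 // ltW.
have e10 : 0 < e1 by rewrite divr_gt0 // mulr_gt0.
have [d1 d10 hd1] : exists2 d : R, 0 < d & forall p w, rn (w - a z) < d ->
    `|dirD (eb p) f w - D p| <= e1.
  apply: (@fin_radius _ (fun p r => forall w, rn (w - a z) < r ->
    `|dirD (eb p) f w - D p| <= e1)).
    by move=> p u u' _ uu' h w h'; apply: h; exact: lt_le_trans h' uu'.
  move=> p; have [d d0 hd] := (@cont_rnP R W (dirD (eb p) f) (a z)).1 (cf p) e1 e10.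
  by exists d => // w /hd /ltW.
pose d2 := Num.min r d1; have d20 : 0 < d2 by rewrite lt_min r0.
have H p w : rn (w - a z) < d2 -> derivable (along f w (eb p)) 0 1 /\
   `|dirD (eb p) f w - D p| <= e1.
  by rewrite lt_min => /andP[h1 h2]; split; [exact: df|exact: hd1].
pose B := rn v + 1; have B0 : 0 < B by rewrite ltr_wpDl // rn_ge0.
have [e2 [e20 e2S e21]] : exists e2 : R, [/\ 0 < e2, SD * e2 <= e / 2 & e2 <= 1].
  have S1 : 0 < SD + 1 by rewrite ltr_wpDl.
  exists (Num.min 1 (e / 2 / (SD + 1))); split.
  - by rewrite lt_min ltr01 !divr_gt0.
  - apply: (@le_trans _ _ (SD * (e / 2 / (SD + 1)))).
      by rewrite ler_wpM2l // ge_min lexx orbT.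
    rewrite mulrA ler_pdivrMr // mulrC ler_wpM2l ?lerDl //.
    by rewrite divr_ge0 // ltW.
  - by rewrite ge_min lexx.
have e2B : 0 < e2 / B by rewrite divr_gt0.
have [d3 d30 hd3] := diff_rn da e2B.
exists (Num.min (d3 / B) (d2 / (N + 1) / A)).
  by rewrite lt_min !divr_gt0 // ltr_wpDl.
move=> h; rewrite lt_min !ltr_pdivlMr // ?ltr_wpDl // => /andP[h1 h2].
pose w := a (z + h%:C *: v) - a z.
have nhv : rn (h%:C *: v) <= `|h| * B.
  by rewrite rnZ rn_real ler_wpM2l // lerDl.
have E1 : rn (w - h%:C *: w1) <= e2 * `|h|.
  have := hd3 _ (le_lt_trans nhv h1); rewrite diff_scale -/w -/w1 => H1.
  apply: le_trans H1 _; rewrite -mulrA ler_pM2l // mulrC ler_pdivrMr //.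
have E2 : rn w <= A * `|h|.
  rewrite -[w](subrK (h%:C *: w1)); apply: le_trans (rnD _ _) _.
  rewrite rnZ rn_real /A mulrDl addrC mul1r; apply: lerD.
    by rewrite mulrC.
  by apply: le_trans E1 _; rewrite ler_piMl.
have E3 : rn (a z - a z) + N * rn w < d2.
  rewrite subrr rn0 add0r.
  apply: (@le_lt_trans _ _ ((N + 1) * (A * `|h|))).
    by apply: ler_pM => //; rewrite ?rn_ge0 // lerDl.
  by move: h2; rewrite mulrC [A * _]mulrC.
have F := frechet_estimate H E3; rewrite -/N in F.
have -> : along (fun z => f (a z)) z v (0 + h) = f (a z + w).
  rewrite (_ : 0 + h = h); last exact: add0r.
  rewrite /along /w; congr f; by rewrite [RHS]addrC subrK.
rewrite (along0 (fun z => f (a z)) z v).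
have -> : f (a z + w) - f (a z) - (\sum_p rc p w1 * D p) * h =
   (f (a z + w) - f (a z) - \sum_p rc p w * D p) +
   \sum_p rc p (w - h%:C *: w1) * D p.
  have -> : \sum_p rc p (w - h%:C *: w1) * D p =
      \sum_p rc p w * D p - (\sum_p rc p w1 * D p) * h.
    rewrite mulr_suml -sumrB; apply: eq_bigr => p _.
    by rewrite rcD rcN rcZ; ring.
  ring.
apply: le_trans (ler_normD _ _) _.
have G : `|\sum_p rc p (w - h%:C *: w1) * D p| <= SD * e2 * `|h|.
  apply: le_trans (ler_norm_sum _ _ _) _.
  rewrite /SD !mulr_suml; apply: ler_sum => p _.
  rewrite normrM mulrC -mulrA ler_wpM2l //.
  exact: le_trans (rc_le _ _) E1.
have G2 : e1 * (N * rn w) <= e / 2 * `|h|.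
  apply: (@le_trans _ _ (e1 * (N * (A * `|h|)))).
    by rewrite ler_pM2l // ler_wpM2l.
  have -> : e1 * (N * (A * `|h|)) = e / 2 * (N * A / (N * A + 1)) * `|h|.
    rewrite /e1 (mulrA N A); move: (N * A) NA => q q1.
    by field; rewrite gt_eqF.
  rewrite ler_wpM2r // ler_piMr ?divr_ge0 ?(ltW e0) //.
  by rewrite ler_pdivrMr // mul1r lerDl.
have G3 : SD * e2 * `|h| <= e / 2 * `|h| by rewrite ler_wpM2r.
by rewrite [e]splitr mulrDl; apply: lerD; [exact: le_trans F G2|exact: le_trans G G3].
Qed.

End Chain.

Section Composition.
Context {R : realType} {n m : nat} {S : Type}.
Local Notation V := (Cspace R n).
Local Notation W := (Cspace R m).

(** Local boundedness uniform in the parameter is all that is asked: for holomorphic maps Cauchy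
    estimates propagate it to every derivative. *)
Definition holo_family (U : set V) (a : S -> V -> W) :=
  (forall s z, U z -> differentiable (a s) z) /\
  (forall z, U z -> exists M d : R, 0 < d /\
     forall s z', rn (z' - z) < d -> rn (a s z') <= M).

(** Cauchy's estimate on balls of a quarter of the available radius: balls around nearby points stay
    where the common bound holds. *)
Lemma holo_family_deriv (U : set V) (a : S -> V -> W) (v : V) : open U ->
  holo_family U a -> holo_family U (fun s z => 'd (a s) z v).
Proof.
move=> /open_rnP oU [da la]; split.
  move=> s z Uz; have [d d0 hd] := oU z Uz.
  have H z' : rn (z' - z) < d -> differentiable (a s) z' by move=> h; apply: da; exact: hd.
  exact: (@holo_deriv R n m (a s) z v d d0 H).1.
move=> z Uz; have [d d0 hd] := oU z Uz; have [M [d' [d'0 hd']]] := la z Uz.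
pose r := Num.min d d' / 4.
have r0 : 0 < r by rewrite divr_gt0 // lt_min d0.
have rd : r * 4 <= d by rewrite divfK // ge_min lexx.
have rd' : r * 4 <= d' by rewrite divfK // ge_min lexx orbT.
exists (2 * M / r * rn v), r; split=> // s z' zz'.
have near w : rn (w - z') <= r -> rn (w - z) < r * 4.
  move=> h; apply: le_lt_trans (rnBD w z' z) _; clear - h zz' r0; lra.
apply: (@cauchy_estimate R n m (a s) z' r M r0).
- by move=> w /near h; apply: da; apply: hd; exact: lt_le_trans h rd.
- by move=> w /near h; apply: hd'; exact: lt_le_trans h rd'.
Qed.

Lemma dirD_rc (a : V -> W) (z v : V) (p : 'I_m * bool) : differentiable a z ->
  is_derive (0 : R) 1 (along (fun z => rc p (a z)) z v) (rc p ('d a z v)).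
Proof.
move=> da; apply: eps_is_derive => e e0.
have v1 : 0 < rn v + 1 by rewrite ltr_wpDl // rn_ge0.
have e1 : 0 < e / (rn v + 1) by rewrite divr_gt0.
have [d d0 hd] := diff_rn da e1.
exists (d / (rn v + 1)); first by rewrite divr_gt0.
move=> h; rewrite ltr_pdivlMr // => hh.
have nhv : rn (h%:C *: v) <= `|h| * (rn v + 1).
  by rewrite rnZ rn_real ler_wpM2l // lerDl.
rewrite (along0 (fun z => rc p (a z)) z v).
rewrite (_ : 0 + h = h); last exact: add0r.
rewrite /along.
have -> : rc p (a (z + h%:C *: v)) - rc p (a z) - rc p ('d a z v) * h =
   rc p (a (z + h%:C *: v) - a z - 'd a z (h%:C *: v)).
  by rewrite diff_scale !rcD !rcN rcZ [h * _]mulrC.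
apply: le_trans (rc_le _ _) _; apply: le_trans (hd _ (le_lt_trans nhv hh)) _.
by rewrite mulrAC ler_pdivrMr // -mulrA ler_pM2l.
Qed.

Lemma rc_continuous (a : V -> W) z p : differentiable a z ->
  {for z, continuous (fun z => rc p (a z))}.
Proof.
move=> da; have ca : {for z, continuous a} by exact: (@differentiable_continuous _ _ _ z a da).
apply/cont_rnP => e e0; have [d d0 hd] := (@contv_rnP R V W a z).1 ca e e0.
exists d => // z' /hd h; apply: le_lt_trans h.
by rewrite -rcN -rcD rc_le.
Qed.

Lemma holo_BC k (U : set V) (a : S -> V -> W) p : open U -> holo_family U a ->
  BC k U (fun s z => rc p (a s z)).
Proof.
move=> oU; elim: k a => [|k IH] a ha; have [da la] := ha.
  split=> //; first by move=> s z Uz; apply: rc_continuous; exact: da.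
  move=> z Uz; have [M [d [d0 hd]]] := la z Uz; exists M, d; split=> // s z' h.
  exact: le_trans (rc_le _ _) (hd s z' h).
split; first by move=> s z Uz; apply: rc_continuous; exact: da.
  move=> z Uz; have [M [d [d0 hd]]] := la z Uz; exists M, d; split=> // s z' h.
  exact: le_trans (rc_le _ _) (hd s z' h).
move=> v; split; first by move=> s z Uz; have [] := dirD_rc v p (da s z Uz).
have B := IH _ (holo_family_deriv v oU ha).
apply: BC_ext B => // s z Uz.
by have [_ E] := dirD_rc v p (da s z Uz); exact: esym E.
Qed.

(** The hypotheses on [F] under which composition with the family [a] is of class C^k. Bounds on
    derivatives are asked along the moving points [a s z] only, since nothing keeps these near one
    point of [O] when [s] varies. *)
Fixpoint PC (k : nat) (U : set V) (O : set W) (F : S -> W -> R) (a : S -> V -> W) : Prop :=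
  [/\ forall s w, O w -> {for w, continuous (F s)},
      loc_bounded U (fun s z => F s (a s z)) &
      if k is k'.+1 then
        forall v, (forall s w, O w -> derivable (along (F s) w v) 0 1) /\
                  PC k' U O (fun s => dirD v (F s)) a
      else True].

(** By the chain rule a directional derivative is a finite sum of products of a coordinate of
    ['d (a s) z v], again a holomorphic family, with a partial derivative of [F], for which the
    induction hypothesis holds. *)
Lemma BC_comp k (U : set V) (O : set W) (F : S -> W -> R) (a : S -> V -> W) :
  open U -> open O -> (forall s z, U z -> O (a s z)) -> holo_family U a ->
  PC k U O F a -> BC k U (fun s z => F s (a s z)).
Proof.
move=> oU oO UO ha; have [da la] := ha.
have cFa (G : S -> W -> R) : (forall s w, O w -> {for w, continuous (G s)}) ->
   forall s z, U z -> {for z, continuous (fun z => G s (a s z))}.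
  move=> cG s z Uz.
  have ca : {for z, continuous (a s)}.
    by exact: (@differentiable_continuous _ _ _ z (a s) (da s z Uz)).
  apply/cont_rnP => e e0.
  have [d d0 hd] := (@cont_rnP R W (G s) (a s z)).1 (cG s _ (UO s z Uz)) e e0.
  have [d' d'0 hd'] := (@contv_rnP R V W (a s) z).1 ca d d0.
  by exists d' => // z' /hd' /hd.
elim: k F => [|k IH] F H; have [c l h] := H; split => //; try exact: cFa.
have ch s z v : U z -> is_derive (0 : R) 1 (along (fun z => F s (a s z)) z v)
    (\sum_p rc p ('d (a s) z v) * dirD (eb p) (F s) (a s z)).
  move=> Uz; have [r r0 hr] := (@open_rnP R W O).1 oO _ (UO s z Uz).
  apply: (@chain_rule R n m (F s) (a s) z v r r0).
  - by move=> p w /hr Ow; exact: (h (eb p)).1.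
  - move=> p; have [_ P] := h (eb p); case: k {IH H h} P => [|k] [cP _ _];
      by apply: cP; exact: UO.
  - exact: da.
move=> v; split; first by move=> s z Uz; have [] := ch s z v Uz.
have B : BC k U (fun s z => \sum_p rc p ('d (a s) z v) * dirD (eb p) (F s) (a s z)).
  apply: (@BC_sum R n S k U _ (fun p s z => rc p ('d (a s) z v) * dirD (eb p) (F s) (a s z))) => // p.
  apply: (@BCM R n S k U (fun s z => rc p ('d (a s) z v)) (fun s z => dirD (eb p) (F s) (a s z))) => //.
    exact: (holo_BC k p oU (holo_family_deriv v oU ha)).
  exact: IH (h (eb p)).2.
apply: BC_ext B => // s z Uz.
by have [_ E] := ch s z v Uz; exact: esym E.
Qed.

Lemma BC_PC k (U : set V) (O : set W) (F : S -> W -> R) (a : V -> W) :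
  (forall z, U z -> O (a z) /\ {for z, continuous a}) ->
  BC k O F -> PC k U O F (fun _ => a).
Proof.
move=> ha.
have lb (G : S -> W -> R) : loc_bounded O G -> loc_bounded U (fun s z => G s (a z)).
  move=> l z Uz; have [Oa ca] := ha z Uz; have [M [d [d0 hd]]] := l _ Oa.
  have [d' d'0 hd'] := (@contv_rnP R V W a z).1 ca d d0.
  by exists M, d'; split=> // s z' /hd' /hd; apply.
elim: k F => [|k IH] F [c l h]; split=> //; try exact: lb.
by move=> v; have [d b] := h v; split=> //; exact: IH.
Qed.

(** For one function and many maps, the uniform bounds come from compact sets that contain the
    values of all the maps near a given point. *)
Lemma Ck_PC_compact k (U : set V) (O : set W) (f : W -> R) (a : S -> V -> W) :
  (forall z, U z -> exists2 d : R, 0 < d & exists L : set W, [/\ compact L, L `<=` O &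
     forall s z', rn (z' - z) < d -> L (a s z')]) ->
  Ck k O f -> PC k U O (fun _ => f) a.
Proof.
move=> ha.
have lb (g : W -> R) : (forall w, O w -> {for w, continuous g}) ->
    loc_bounded U (fun s z => g (a s z)).
  move=> cg z Uz; have [d d0 [L [cL LO hL]]] := ha z Uz.
  have [[w Lw]|L0] := pselect (L !=set0); last first.
    exists 0, d; split=> // s z' /hL Lz; exfalso; apply: L0.
    by exists (a s z').
  have [||w0 _ hw0] := @compact_EVT_max W R (fun w => `|g w|) L _ cL.
  - by exists w.
  - apply: continuous_in_subspaceT => x; rewrite inE => /LO Ox.
    by apply: (@continuous_comp W R R g Num.norm x (cg x Ox)); exact: norm_continuous.
  - by exists `|g w0|, d; split=> // s z' /hL Lz; apply: hw0; rewrite inE.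
elim: k f => [|k IH] f [c h]; split=> //; try exact: lb.
by move=> v; have [d b] := h v; split=> //; exact: IH.
Qed.

End Composition.

Section Equilipschitz.
Context {R : realType} {n : nat} {S : Type}.
Local Notation V := (Cspace R n).

Lemma BC1_equilip (U : set V) (F : S -> V -> R) z : open U -> BC 1 U F -> U z ->
  exists L d : R, [/\ 0 <= L, 0 < d & forall s z', rn (z' - z) < d ->
    `|F s z' - F s z| <= L * rn (z' - z)].
Proof.
move=> /open_rnP oU [c l h] Uz.
have [d d0 hd] := oU z Uz.
have lbd (p : 'I_n * bool) : loc_bounded U (fun s => dirD (eb p) (F s)).
  by have [_ [_ l' _]] := h (eb p).
have [M [d' [M0 d'0 hM]]] := fin_bound lbd Uz.
pose N : R := (2 * n)%:R; have N0 : 0 <= N by exact: ler0n.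
pose r := Num.min d d'; have r0 : 0 < r by rewrite lt_min d0.
exists (M * N), (r / (N + 1)); split; first by rewrite mulr_ge0.
  by rewrite divr_gt0 // ltr_wpDl.
move=> s z'; rewrite ltr_pdivlMr ?ltr_wpDl // => hz'.
have H p w : rn (w - z) < r ->
    derivable (along (F s) w (eb p)) 0 1 /\ `|dirD (eb p) (F s) w - 0| <= M.
  rewrite lt_min => /andP[h1 h2]; split; first by apply: (h (eb p)).1; exact: hd.
  by rewrite subr0; exact: hM.
have hzz : rn (z - z) + N * rn (z' - z) < r.
  rewrite subrr rn0 add0r; apply: le_lt_trans hz'.
  by rewrite mulrC ler_wpM2l ?rn_ge0 // lerDl.
have := @frechet_estimate R n (F s) z (fun=> 0) r M H z (z' - z) hzz.
rewrite big1 => [|p _]; last by rewrite mulr0.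
by rewrite subr0 -mulrA; have -> : z + (z' - z) = z' by rewrite addrC subrK.
Qed.

End Equilipschitz.

(** * Differentiation under a bounded linear functional *)

Section Functional.
Context {R : realType} {n : nat} {S : Type}.
Local Notation V := (Cspace R n).
Variables (L : set (S -> R)) (J : (S -> R) -> R) (C : R).
Hypotheses (C0 : 0 <= C)
  (LB : forall f g, L f -> L g ->
     L (fun s => f s - g s) /\ J (fun s => f s - g s) = J f - J g)
  (LZ : forall t f, L f -> L (fun s => t * f s) /\ J (fun s => t * f s) = t * J f)
  (Lb : forall f (M : R), 0 <= M -> L f -> (forall s, `|f s| <= M) -> `|J f| <= C * M)
  (Lc : forall f, (forall e : R, 0 < e -> exists2 g, L g & forall s, `|f s - g s| <= e) -> L f).

Lemma functional_cont (U : set V) (F : S -> V -> R) : open U -> BC 1 U F ->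
  (forall z, U z -> L (F ^~ z)) ->
  forall z, U z -> {for z, continuous (fun z => J (F ^~ z))}.
Proof.
move=> oU B HL z Uz; apply/cont_rnP => e e0.
have [d d0 hd] := (@open_rnP R V U).1 oU z Uz.
have [Li [d' [Li0 d'0 hL]]] := BC1_equilip oU B Uz.
have D : 0 < C * Li + 1 by rewrite ltr_wpDl // mulr_ge0.
exists (Num.min (Num.min d d') (e / (C * Li + 1))).
  by rewrite !lt_min d0 d'0 divr_gt0.
move=> z'; rewrite !lt_min ltr_pdivlMr // => /andP[/andP[h1 h2] h3].
have Uz' := hd _ h1.
have [Ls <-] := LB (HL _ Uz') (HL _ Uz).
have := Lb _ Ls (fun s => hL s z' h2).
move=> /(_ (mulr_ge0 Li0 (rn_ge0 _))) H; apply: le_lt_trans H _.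
apply: le_lt_trans h3; rewrite mulrA [leRHS]mulrC ler_wpM2r ?rn_ge0 // lerDl //.
Qed.

(** The first derivatives are Lipschitz uniformly in [s], so difference quotients converge uniformly
    in [s]. Closedness of [L] under uniform limits puts the derivative into the domain of [J], and
    the supremum bound on [J] carries the error estimate over. *)
Lemma functional_deriv (U : set V) (F : S -> V -> R) (v : V) : open U -> BC 2 U F ->
  (forall z, U z -> L (F ^~ z)) -> forall z, U z ->
  L (fun s => dirD v (F s) z) /\
  is_derive (0 : R) 1 (along (fun z => J (F ^~ z)) z v) (J (fun s => dirD v (F s) z)).
Proof.
move=> oU B HL z Uz.
have [d d0 hd] := (@open_rnP R V U).1 oU z Uz.
have [_ _ /(_ v)[dF B1]] := B.
have [Li [d' [Li0 d'0 hL]]] := BC1_equilip oU B1 Uz.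
pose A := rn v + 1; have A0 : 0 < A by rewrite ltr_wpDl // rn_ge0.
pose r := Num.min d d' / A; have r0 : 0 < r by rewrite divr_gt0 // lt_min d0.
have near (h t : R) : `|h| < r -> `|t| <= `|h| ->
    rn (z + t%:C *: v - z) <= `|h| * A /\ `|h| * A < Num.min d d'.
  move=> hr th; split; last by rewrite -ltr_pdivlMr.
  rewrite addrAC subrr add0r rnZ rn_real ler_pM ?rn_ge0 //.
  by rewrite lerDl.
have Uh (h t : R) : `|h| < r -> `|t| <= `|h| -> U (z + t%:C *: v).
  move=> hr th; have [h1 h2] := near h t hr th.
  by apply: hd; apply: le_lt_trans h1 _; apply: lt_le_trans h2 _; rewrite ge_min lexx.
have est (h : R) : `|h| < r -> forall s,
    `|F s (z + h%:C *: v) - F s z - h * dirD v (F s) z| <= `|h| * (Li * (`|h| * A)).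
  move=> hr s.
  have [t th|t th ->] := @dir_MVT R n (F s) z v h; first exact: dF (Uh h t hr th).
  rewrite -mulrBr normrM ler_wpM2l //.
  have [h1 h2] := near h t hr th.
  have := hL s (z + t%:C *: v); move=> H; apply: le_trans (H _) _.
    by apply: le_lt_trans h1 _; apply: lt_le_trans h2 _; rewrite ge_min lexx orbT.
  by rewrite ler_wpM2l.
have LD (h : R) : `|h| < r -> L (fun s => F s (z + h%:C *: v) - F s z).
  by move=> hr; exact: (LB (HL _ (Uh h h hr (lexx _))) (HL _ Uz)).1.
have LA0 : 0 < Li * A + 1 by rewrite ltr_wpDl // mulr_ge0 // ltW.
have Ld : L (fun s => dirD v (F s) z).
  apply: Lc => e e0.
  pose h := Num.min (r / 2) (e / (Li * A + 1)).
  have h0 : 0 < h by rewrite lt_min (divr_gt0 r0) // (divr_gt0 e0 LA0).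
  have hr : `|h| < r.
    rewrite gtr0_norm //; apply: (@le_lt_trans _ _ (r / 2)); first by rewrite ge_min lexx.
    by rewrite ltr_pdivrMr // ltr_pMr // ltr1n.
  exists (fun s => h^-1 * (F s (z + h%:C *: v) - F s z)).
    exact: (LZ h^-1 (LD h hr)).1.
  move=> s; have := est h hr s; rewrite (gtr0_norm h0) => E.
  have -> : dirD v (F s) z - h^-1 * (F s (z + h%:C *: v) - F s z) =
     - (h^-1 * (F s (z + h%:C *: v) - F s z - h * dirD v (F s) z)).
    by field; rewrite gt_eqF.
  rewrite normrN normrM gtr0_norm ?invr_gt0 // mulrC ler_pdivrMr // mulrC [e * _]mulrC.
  rewrite mulrC; apply: le_trans E _; rewrite ler_pM2l //.
  apply: (@le_trans _ _ ((Li * A + 1) * h)).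
    by rewrite [h * A]mulrC mulrA ler_pM2r // lerDl.
  by rewrite mulrC -ler_pdivlMr // ge_min lexx orbT.
split=> //; apply: eps_is_derive => e e0.
have CL : 0 < C * Li * A + 1 by rewrite ltr_wpDl // !mulr_ge0 // ltW.
exists (Num.min r (e / (C * Li * A + 1))); first by rewrite lt_min r0 (divr_gt0 e0 CL).
move=> h; rewrite lt_min => /andP[hr]; rewrite ltr_pdivlMr // => he.
rewrite (along0 (fun z => J (F ^~ z)) z v).
rewrite (_ : 0 + h = h); last exact: add0r.
rewrite /along.
have [L1 J1] := LB (HL _ (Uh h h hr (lexx _))) (HL _ Uz).
have [L2 J2] := LZ h Ld.
have [L3 J3] := LB L1 L2.
have -> : J (F ^~ (z + h%:C *: v)) - J (F ^~ z) - J (fun s => dirD v (F s) z) * h =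
   J (fun s => F s (z + h%:C *: v) - F s z - h * dirD v (F s) z).
  by rewrite J3 J1 J2 [h * _]mulrC.
have M0 : 0 <= `|h| * (Li * (`|h| * A)) by rewrite !mulr_ge0 // ltW.
apply: le_trans (Lb M0 L3 (est h hr)) _.
have -> : C * (`|h| * (Li * (`|h| * A))) = `|h| * (C * Li * A) * `|h| by ring.
rewrite ler_wpM2r //; apply: le_trans (ltW he).
by rewrite ler_wpM2l // lerDl.
Qed.

(** One order is lost because each derivative must be controlled by a uniform Lipschitz bound, that
    is by the derivative after it; for smooth families this costs nothing. *)
Lemma functional_Ck k (U : set V) (F : S -> V -> R) : open U -> BC k.+1 U F ->
  (forall z, U z -> L (F ^~ z)) -> Ck k U (fun z => J (F ^~ z)).
Proof.
move=> oU; elim: k F => [|k IH] F B HL.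
  by split=> // z Uz; exact: (functional_cont oU B HL).
have B1 : BC 1 U F by elim: k {IH} B => [|k IHk] B; [exact: BC_S B|apply: IHk; exact: BC_S B].
have B2 : BC 2 U F by elim: k {IH} B => [|k IHk] B; [exact: B|apply: IHk; exact: BC_S B].
split; first by move=> z Uz; exact: (functional_cont oU B1 HL).
move=> v; split.
  by move=> z Uz; have [_ []] := functional_deriv v oU B2 HL Uz.
have [_ _ /(_ v)[_ Bv]] := B.
have HLv z : U z -> L (fun s => dirD v (F s) z).
  by move=> Uz; have [] := functional_deriv v oU B2 HL Uz.
have C1 := IH _ Bv HLv.
have := Ck_BC unit C1 => /(@BC_ext R n unit k U _ (fun _ => dirD v (fun z => J (F ^~ z))) oU).
move=> H; apply: (BC_Ck (H _) tt) => _ z Uz.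
by have [_ [_ E]] := functional_deriv v oU B2 HL Uz; exact: esym E.
Qed.

End Functional.

(** * Bump functions *)

Section HeineBorel.
Context {R : realType} {n : nat}.
Local Notation V := (Cspace R n).

Lemma rn_triangle_cont (w0 : V) : continuous (fun w : V => rn (w - w0)).
Proof.
move=> w; apply/(@cont_rnP R V) => e e0; exists e => // w' h; apply: le_lt_trans h.
rewrite ler_norml lerBlDl lerBrDl.
have := rnBD w' w w0; have := rnBD w w' w0; rewrite [rn (w - w')]rn_dist.
move: (rn _) (rn _) (rn _) => a b c; lra.
Qed.

Lemma closed_rn_ball (w0 : V) (s : R) : closed [set w : V | rn (w - w0) <= s].
Proof.
have -> : [set w : V | rn (w - w0) <= s] = (fun w : V => rn (w - w0)) @^-1` [set x | x <= s].
  by [].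
by apply: preimage_closed; [move=> w _; exact: rn_triangle_cont|exact: closed_le].
Qed.

(** A closed ball is a closed subset of the image of a real cube under the [2 * n] real
    coordinates. *)
Lemma compact_rn_ball (w0 : V) (s : R) : compact [set w : V | rn (w - w0) <= s].
Proof.
pose N := #|{: 'I_n * bool}|.
pose phi (x : 'rV[R]_N) : V :=
  w0 + \sum_(p : 'I_n * bool) (x ord0 (enum_rank p))%:C *: eb p.
pose K := [set x : 'rV[R]_N | forall i, `[- s, s]%classic (x ord0 i)].
have cK : compact K.
  by apply: (@rV_compact R N (fun=> `[- s, s]%classic)) => i; exact: segment_compact.
have cphi : continuous phi.
  move=> x; apply: (@cvg_trans _ (phi @ nbhs x)) => //.
  move=> A /(@nbhs_rnP R V) [e e0 he].
  pose d := e / (N%:R + 1).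
  have N1 : 0 < N%:R + 1 :> R by rewrite ltr_wpDl.
  have d0 : 0 < d by rewrite divr_gt0.
  apply: filterS (nbhsx_ballx x d d0) => y xy; apply: he.
  have E : phi y - phi x = \sum_(p : 'I_n * bool) ((y - x) ord0 (enum_rank p))%:C *: eb p.
    rewrite /phi opprD addrACA subrr add0r -sumrB; apply: eq_bigr => p _.
    by rewrite !mxE rmorphB /= scalerBl.
  rewrite E.
  have B (r : seq ('I_n * bool)) : rn (\sum_(p <- r) ((y - x) ord0 (enum_rank p))%:C *: eb p : V)
     <= \sum_(p <- r) d.
    elim: r => [|p r IH]; first by rewrite !big_nil rn0.
    rewrite !big_cons; apply: le_trans (rnD _ _) _; apply: lerD => //.
    rewrite rnZ rn_real.
    have h : `|(y - x) ord0 (enum_rank p)| <= d.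
      have [_ H] := xy; have := H ord0 (enum_rank p); rewrite /ball /= distrC !mxE.
      exact: ltW.
    by apply: le_trans h; rewrite ler_piMr // rn_eb.
  apply: le_lt_trans (B _) _.
  rewrite sumr_const -/N -mulr_natl /d mulrA ltr_pdivrMr // mulrC ltr_pM2l //.
  by rewrite ltrDl.
have cI : compact (phi @` K).
  by apply: continuous_compact => //; exact: continuous_subspaceT.
apply: subclosed_compact cI _; first exact: closed_rn_ball.
move=> w /= ws; exists (\row_i rc (enum_val i) (w - w0)).
  move=> i /=; rewrite mxE in_itv /= -ler_norml.
  exact: le_trans (rc_le _ _) ws.
rewrite /phi.
have -> : \sum_p ((\row_i rc (enum_val i) (w - w0)) ord0 (enum_rank p))%:C *: eb p = w - w0.
  by rewrite [RHS]real_basis; apply: eq_bigr => p _; rewrite mxE enum_rankK.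
by rewrite addrC subrK.
Qed.

End HeineBorel.

Section FlatFunction.
Context {R : realType}.

(** The function [t^-N * exp (-1/t)], extended by 0. The powers are included because the family is
    closed under differentiation, up to linear combinations, so that smoothness is an induction over
    all [N] at once. *)
Definition flatf (N : nat) (t : R) : R := if 0 < t then t^-1 ^+ N * expR (- t^-1) else 0.

Lemma flatf_ge0 N t : 0 <= flatf N t.
Proof.
rewrite /flatf; case: ltP => // t0.
by rewrite mulr_ge0 ?expR_ge0 // exprn_ge0 // invr_ge0 ltW.
Qed.

(** With [x = 1/t] and [k = N + 2], the inequality [exp x >= (x / k)^k] leaves a factor [t^2].
    Quadratic decay makes the derivative at 0 vanish. *)
Lemma flatf_bound N : exists2 K : R, 0 <= K & forall t, flatf N t <= K * t ^+ 2.
Proof.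
pose k : R := N.+2%:R.
have k0 : 0 < k by rewrite ltr0n.
exists (k ^+ N.+2) => [|t]; first by rewrite exprn_ge0 // ltW.
rewrite /flatf; case: ltP => [t0|_]; last first.
  by rewrite mulr_ge0 ?sqr_ge0 // exprn_ge0 // ltW.
pose x := t^-1; have x0 : 0 < x by rewrite invr_gt0.
have E : (x / k) ^+ N.+2 <= expR x.
  have -> : expR x = expR (x / k) ^+ N.+2.
    by rewrite -expRM_natl -/k mulrC divfK // gt_eqF.
  rewrite lerXn2r ?nnegrE ?expR_ge0 ?divr_ge0 ?(ltW x0) ?(ltW k0) //.
  by apply: le_trans (expR_ge1Dx _); rewrite lerDr.
rewrite -/x expRN ler_pdivrMr ?expR_gt0 //.
have -> : t = x^-1 by rewrite invrK.
apply: (@le_trans _ _ (k ^+ N.+2 * x^-1 ^+ 2 * (x / k) ^+ N.+2)).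
  rewrite le_eqVlt; apply/orP; left; apply/eqP.
  have K (y a : R) : y != 0 -> a != 0 -> y ^+ N = a * y^-1 ^+ 2 * (y ^+ N.+2 * a^-1).
    by move=> y0 a0; rewrite !exprS expr0; field; rewrite y0 a0.
  by rewrite exprMn (exprVn k); apply: K; rewrite ?expf_neq0 ?gt_eqF.
by apply: ler_wpM2l => //; rewrite mulr_ge0 // exprn_ge0 // ?invr_ge0 ltW.
Qed.

Lemma flatf_derive N (t : R) : is_derive t 1 (flatf N) (flatf N.+2 t - N%:R * flatf N.+1 t).
Proof.
have [t0|t0|t0] := ltrgtP 0 t.
- have H : is_derive t 1 (fun t : R => t^-1 ^+ N * expR (- t^-1))
      (flatf N.+2 t - N%:R * flatf N.+1 t).
    have t0' : t != 0 by rewrite gt_eqF.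
    have dV : is_derive t 1 (fun t : R => t^-1) (- t ^- 2).
      apply: DeriveDef; first exact: derivableV.
      by rewrite deriveV // derive_id /GRing.scale /= mulr1.
    have dX : is_derive t 1 (fun t : R => t^-1 ^+ N) (N%:R * t^-1 ^+ N.-1 * - t ^- 2).
      have dn : is_derive (t^-1) 1 (fun x : R => x ^+ N) (N%:R * t^-1 ^+ N.-1).
        apply: DeriveDef; first exact: exprn_derivable.
        by rewrite exp_derive /GRing.scale /= mulr1.
      exact: (is_derive1_comp dn dV).
    have dN : is_derive t 1 (fun t : R => - t^-1) (t ^- 2).
      by rewrite -[t ^- 2]opprK; exact: is_deriveN dV.
    have dE : is_derive t 1 (fun t : R => expR (- t^-1)) (expR (- t^-1) * t ^- 2).
      exact: (@is_derive1_comp R expR (fun t : R => - t^-1) t _ _ (is_derive_expR (- t^-1)) dN).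
    have := is_deriveM dX dE => H; apply: is_derive_eq H _.
    rewrite /flatf t0 /GRing.scale /=.
    case: N {dX} => [|N]; rewrite /= !exprS ?expr0; first by field.
    by move: (t^-1 ^+ N) (N.+1%:R) => y c; field.
  have N1 : \forall s \near t, (fun t : R => t^-1 ^+ N * expR (- t^-1)) s = flatf N s.
    near=> s; rewrite /flatf ifT //; near: s; exact: lt_nbhsr.
  have [d1 d2] := H; apply: DeriveDef; first exact: near_eq_derivable N1 d1.
  by rewrite -(near_eq_derive _ N1).
- have H : is_derive t 1 (fun _ : R => 0 : R) 0 by exact: is_derive_cst.
  have N1 : \forall s \near t, (fun _ : R => 0) s = flatf N s.
    near=> s; rewrite /flatf ifN // -leNgt ltW //; near: s; exact: lt_nbhsl.
  rewrite /flatf ltNge (ltW t0) /= mulr0 subr0.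
  have [d1 d2] := H; apply: DeriveDef; first exact: near_eq_derivable N1 d1.
  by rewrite -(near_eq_derive _ N1).
- rewrite -t0 {2 3}/flatf ltxx mulr0 subr0; apply: eps_is_derive => e e0.
  have [K K0 hK] := flatf_bound N.
  exists (e / (K + 1)); first by rewrite divr_gt0 // ltr_wpDl.
  move=> h; rewrite ltr_pdivlMr ?ltr_wpDl // => hh.
  rewrite add0r mul0r {2}/flatf ltxx !subr0 ger0_norm ?flatf_ge0 //.
  apply: le_trans (hK h) _; rewrite -real_normK ?num_real // expr2 mulrA ler_wpM2r //.
  by apply: le_trans (ltW hh); rewrite mulrC ler_wpM2l // lerDl.
Unshelve. all: by end_near.
Qed.

End FlatFunction.

Section Bump.
Context {R : realType} {n : nat}.
Local Notation V := (Cspace R n).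

Lemma dirD_comp1 (f : R -> R) (q : V -> R) (z v : V) (c : R) :
  is_derive (q z) 1 f c -> derivable (along q z v) 0 1 ->
  is_derive (0 : R) 1 (along (fun z => f (q z)) z v) (c * dirD v q z).
Proof.
move=> df dq; rewrite -(along0 q z v) in df.
exact: (@is_derive1_comp R f (along q z v) 0 _ _ df (derivableP dq)).
Qed.

Lemma flatf_continuous N : continuous (@flatf R N).
Proof.
move=> t; have [d _] := flatf_derive N t.
have d' : differentiable (@flatf R N) t by exact/derivable1_diffP.
exact: (@differentiable_continuous _ _ _ t (flatf N) d').
Qed.

Lemma flatf_Ck (q : V -> R) : (forall k, Ck k setT q) ->
  forall k N, Ck k setT (fun z => flatf N (q z)).
Proof.
move=> Cq.
have cont N : forall z, setT z -> {for z, continuous (fun z => flatf N (q z))}.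
  move=> z _; have [cq _] := Cq 0%N.
  by apply: (@continuous_comp V R R q (flatf N) z (cq z I)); exact: flatf_continuous.
elim=> [|k IH] N; split => //; first exact: cont.
  exact: cont.
have der z v : is_derive (0 : R) 1 (along (fun z => flatf N (q z)) z v)
   ((flatf N.+2 (q z) - N%:R * flatf N.+1 (q z)) * dirD v q z).
  apply: dirD_comp1; first exact: flatf_derive.
  by have [_ /(_ v)[d _]] := Cq 1%N; exact: d.
move=> v; split; first by move=> z _; have [] := der z v.
have oT : open [set: V] by exact: openT.
have B1 := Ck_BC unit (IH N.+2); have B2 := Ck_BC unit (IH N.+1).
have B3 : BC k setT (fun _ : unit => fun _ : V => - N%:R : R).
  by apply: (@BC_cst _ _ _ k setT (fun=> - N%:R) N%:R) => _; rewrite normrN normr_nat.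
have B4 : BC k setT (fun _ : unit => dirD v q).
  by have [_ /(_ v)[_ c]] := Cq k.+1; exact: Ck_BC.
have P := BCM oT (BCD oT B1 (BCM oT B3 B2)) B4.
apply: (BC_Ck (@BC_ext R n unit k setT _ (fun _ => dirD v (fun z => flatf N (q z))) oT _ P) tt).
by move=> _ z _; have [_ E] := der z v; rewrite mulNr; exact: esym E.
Qed.

Lemma diff_shift (w0 z : V) : differentiable (fun w : V => w - w0) z /\
  forall h, 'd (fun w : V => w - w0) z h = h.
Proof.
have [||e e0|d1 d2] := @rn_diff_lin R V V (fun w => w - w0) z id 1.
- by [].
- by move=> h; rewrite mul1r.
- exists 1 => // h _; have -> : z + h - w0 - (z - w0) - h = 0.
    by apply/rowP => j; rewrite !mxE; ring.
  by rewrite rn0 mulr_ge0 ?rn_ge0 // ltW.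
- by split.
Qed.

Lemma shift_holo_family (T : Type) (w0 : V) :
  holo_family setT (fun (_ : T) (w : V) => w - w0).
Proof.
split; first by move=> _ z _; exact: (diff_shift w0 z).1.
move=> z _; exists (rn (z - w0) + 1), 1; split => // _ z' h.
by apply: le_trans (rnBD _ z _) _; rewrite addrC lerD2l ltW.
Qed.

(** The maximum norm is not smooth, so the sum of squares of the real coordinates is used; it
    dominates the square of the maximum norm, hence the value is at most 0 off the ball of radius
    [s]. *)
Definition bumpq (w0 : V) (s : R) (w : V) : R := s ^+ 2 - \sum_p rc p (w - w0) ^+ 2.

Lemma bumpq_Ck w0 s k : Ck k setT (bumpq w0 s).
Proof.
have oT : open [set: V] by exact: openT.
have B1 p : BC k setT (fun (_ : unit) w => rc p (w - w0)).
  exact: (holo_BC k p oT (shift_holo_family unit w0)).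
have B2 := @BC_sum R n unit k setT _ (fun p _ w => rc p (w - w0) * rc p (w - w0)) oT
   (fun p => BCM oT (B1 p) (B1 p)).
have B3 (c : R) : BC k setT (fun _ : unit => fun _ : V => c).
  by apply: (@BC_cst _ _ _ k setT (fun=> c) `|c|).
have P := BCD oT (B3 (s ^+ 2)) (BCM oT (B3 (-1)) B2).
apply: (BC_Ck (@BC_ext R n unit k setT _ (fun _ => bumpq w0 s) oT _ P) tt).
by move=> _ z _; rewrite mulN1r.
Qed.

Lemma rn_sum_rc (w : V) : rn w ^+ 2 <= \sum_p rc p w ^+ 2.
Proof.
set A := \sum_p _.
have A0 : 0 <= A by apply: sumr_ge0 => p _; exact: sqr_ge0.
suff H : rn w <= Num.sqrt A.
  by rewrite -(sqr_sqrtr A0) ler_sqr ?nnegrE ?rn_ge0 ?sqrtr_ge0.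
apply: rn_le_co => [|j]; first exact: sqrtr_ge0.
have -> : rn (co w j) = Num.sqrt (rn (co w j) ^+ 2) by rewrite sqrtr_sqr ger0_norm // rn_ge0.
apply: ler_wsqrtr; rewrite (rn_sq (co w j : R[i])) /A.
rewrite (bigD1 (j, false)) //=; apply: lerD => //.
rewrite (bigD1 (j, true)) ?xpair_eqE ?andbF // -[complex.Im _]/(rc (j, true) w) lerDl.
by apply: sumr_ge0 => p _; exact: sqr_ge0.
Qed.

Lemma bump_exists (w0 : V) (s : R) : 0 < s -> exists b : V -> R,
  [/\ Cinfty setT b, forall w, 0 <= b w, 0 < b w0,
      forall w, s <= rn (w - w0) -> b w = 0 &
      exists2 K : R, 0 < K & forall w w', `|b w - b w'| <= K * rn (w - w')].
Proof.
move=> s0; pose b w := flatf 0 (bumpq w0 s w).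
have Cb k : Ck k setT b by apply: flatf_Ck => j; exact: bumpq_Ck.
have b0 w : s <= rn (w - w0) -> b w = 0.
  move=> h; rewrite /b /flatf ifN // -leNgt /bumpq subr_le0.
  by apply: le_trans (rn_sum_rc _); rewrite ler_sqr // nnegrE ?(ltW s0) ?rn_ge0.
exists b; split => //.
- by move=> w; exact: flatf_ge0.
- rewrite /b /flatf /bumpq subrr big1 => [|p _]; last first.
    by rewrite /rc co0; case: p.2; rewrite expr0n.
  by rewrite subr0 exprn_gt0 // expr0 mul1r expR_gt0.
have [_ H] := Cb 1%N.
(* Off the closed ball the bump vanishes on a neighborhood, so the bound of a derivative on the
   compact ball is global; this gives a global Lipschitz constant. *)
have /choice[M hM] : forall p : 'I_n * bool, exists M, forall w : V,
    `|dirD (eb p) b w| <= M.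
  move=> p; have [_ [cD _]] := H (eb p).
  have [||w1 _ hw1] := @compact_EVT_max V R (fun w => `|dirD (eb p) b w|)
     [set w | rn (w - w0) <= s] _ (@compact_rn_ball R n w0 s).
  - by exists w0; rewrite /= subrr rn0 ltW.
  - apply: continuous_in_subspaceT => x _.
    by apply: (@continuous_comp V R R _ Num.norm x (cD x I)); exact: norm_continuous.
  - exists `|dirD (eb p) b w1| => w.
    have [h|h] := leP (rn (w - w0)) s; first by apply: hw1; rewrite inE.
    have d0 : 0 < rn (w - w0) - s by rewrite subr_gt0.
    have E z' : rn (z' - w) < rn (w - w0) - s -> (fun _ : V => 0 : R) z' = b z'.
      move=> h'; rewrite b0 //; have := rnBD w z' w0; rewrite rn_dist in h'.
      by move: (rn _) (rn _) (rn _) h' => x y t; lra.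
    have [D1 D2] := dirD_cst (0 : R) w (eb p).
    have [_ E2] := @dirD_ext R n (fun _ => 0) b w (eb p) _ d0 E.
    by rewrite -(E2 D1) D2 normr0.
pose A := \sum_p `|M p|.
have A0 : 0 <= A by apply: sumr_ge0.
pose N : R := (2 * n)%:R; have N0 : 0 <= N by exact: ler0n.
exists (A * N + 1) => [|w w']; first by rewrite ltr_wpDl // mulr_ge0.
have hw : rn (w' - w') + N * rn (w - w') < N * rn (w - w') + 1.
  by rewrite subrr rn0 add0r ltrDl.
have HA p z : rn (z - w') < N * rn (w - w') + 1 ->
    derivable (along b z (eb p)) 0 1 /\ `|dirD (eb p) b z - 0| <= A.
  move=> _; split; first by exact: (H (eb p)).1.
  rewrite subr0; apply: le_trans (hM p z) _; apply: le_trans (ler_norm _) _.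
  by rewrite /A (bigD1 p) //= lerDl sumr_ge0.
have := @frechet_estimate R n b w' (fun=> 0) _ A HA w' (w - w') hw.
rewrite big1 => [|p _]; last by rewrite mulr0.
have -> : w' + (w - w') = w by rewrite addrC subrK.
rewrite subr0 => h; apply: le_trans h _.
by rewrite -/N mulrA ler_wpM2r ?rn_ge0 // lerDl.
Qed.

End Bump.

(** * An invariant functional on a group *)

Section UltraLimit.
Context {R : realType}.

Lemma ultra_nat : exists U : set_system nat, UltraFilter U /\ (\oo `<=` U).
Proof. by have [U [UU sU]] := ultraFilterLemma (F := \oo) _; exists U. Qed.

(** An ultrafilter containing all cofinal segments: every bounded sequence of reals has a limit
    along it, and that limit is linear and monotone. *)
Definition ultra : set_system nat := projT1 (cid ultra_nat).

Lemma ultra_ultra : UltraFilter ultra.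
Proof. by have [] := projT2 (cid ultra_nat). Qed.

Lemma ultra_near (P : nat -> Prop) N : (forall k, (N <= k)%N -> P k) -> ultra [set k | P k].
Proof. by move=> H; have [_] := projT2 (cid ultra_nat); apply; exists N. Qed.

Global Instance ultra_proper : ProperFilter ultra.
Proof. by have := ultra_ultra; case. Qed.

Definition ulim (u : nat -> R) : R := lim (u @ ultra).

Definition bdd (u : nat -> R) := exists M, forall k, `|u k| <= M.

(** The image of an ultrafilter is an ultrafilter, and on a compact interval it converges. *)
Lemma ulim_cvg u : bdd u -> u @ ultra --> ulim u.
Proof.
move=> [M hM]; have UF : UltraFilter (u @ ultra).
  split => [|G PG sG]; first exact: fmap_proper_filter.
  have [_ H] := ultra_ultra.
  apply/seteqP; split=> // A GA.
  have [//|nA] := in_ultra_setVsetC (u @^-1` A) ultra_ultra.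
  have : G (~` A) by apply: sG.
  by move=> /(filterI GA); rewrite setICr => /filter_ex [].
have := @segment_compact R (- M) M; rewrite compact_ultra => /(_ _ UF) [].
  by apply: (@ultra_near _ 0%N) => k _ /=; rewrite in_itv /= -ler_norml.
move=> l [_ ul]; rewrite /ulim (cvg_lim _ ul) //; exact: Rhausdorff.
Qed.

Lemma ulimE u l : u @ ultra --> l -> ulim u = l.
Proof. by move=> ul; rewrite /ulim (cvg_lim _ ul) //; exact: Rhausdorff. Qed.

Lemma ulimD u v : bdd u -> bdd v -> ulim (fun k => u k + v k) = ulim u + ulim v.
Proof. by move=> bu bv; apply: ulimE; apply: cvgD; exact: ulim_cvg. Qed.

Lemma ulimZ (c : R) u : bdd u -> ulim (fun k => c * u k) = c * ulim u.
Proof. by move=> bu; apply: ulimE; apply: cvgM; [exact: cvg_cst|exact: ulim_cvg]. Qed.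

Lemma ulim_cst (c : R) : ulim (fun=> c) = c.
Proof. by apply: ulimE; exact: cvg_cst. Qed.

Lemma ulim_le u v N : bdd u -> bdd v -> (forall k, (N <= k)%N -> u k <= v k) ->
  ulim u <= ulim v.
Proof.
move=> bu bv uv; apply: (ler_cvg_to (ulim_cvg bu) (ulim_cvg bv)).
exact: ultra_near uv.
Qed.

End UltraLimit.

(** * Covering numbers and the Haar functional of a group *)

Section Covering.
Context {R : realType} {G : Type} (mul : G -> G -> G) (inv : G -> G) (one : G).
Hypotheses (mulA : forall a b c, mul a (mul b c) = mul (mul a b) c)
  (mul1 : forall a, mul a one = a) (mul1l : forall a, mul one a = a)
  (mulV : forall a, mul a (inv a) = one) (mulVl : forall a, mul (inv a) a = one).
Variable V : R -> G -> Prop.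
Hypotheses (V1 : forall e : R, 0 < e -> V e one)
  (Vmono : forall (e e' : R) a, e <= e' -> V e a -> V e' a).
Implicit Types (f g : G -> R) (S : G -> Prop) (s : seq (R * G)).

Definition ind (P : Prop) : R := if `[< P >] then 1 else 0.

Lemma ind_ge0 P : 0 <= ind P. Proof. by rewrite /ind; case: ifP. Qed.
Lemma ind_le1 P : ind P <= 1. Proof. by rewrite /ind; case: ifP. Qed.
Lemma indT (P : Prop) : P -> ind P = 1. Proof. by move=> p; rewrite /ind asboolT. Qed.
Lemma indF (P : Prop) : ~ P -> ind P = 0. Proof. by move=> p; rewrite /ind asboolF. Qed.
Lemma ind_impl (P Q : Prop) : (P -> Q) -> ind P <= ind Q.
Proof.
move=> PQ; have [p|np] := pselect P; first by rewrite !indT //; exact: PQ.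
by rewrite indF // ind_ge0.
Qed.

(** Total boundedness: finitely many translates of [V e] cover [S]. A sum of indicators of at least
    1 states this in the form in which the covering numbers use it. *)
Definition tb S := forall e : R, 0 < e -> exists r : seq G,
  forall a, S a -> 1 <= \sum_(b <- r) ind (V e (mul a b)).

Definition covering e f s := all (fun x => 0 <= x.1) s /\
  forall a, f a <= \sum_(x <- s) x.1 * ind (V e (mul a x.2)).
Definition mass s : R := \sum_(x <- s) x.1.
(** Haar's covering number of [f] by translates of [V e], with real coefficients. *)
Definition cov e f : R := inf [set t | exists2 s, covering e f s & t = mass s].

(** The role of functions with compact support: domination by a multiple of a totally bounded
    indicator guarantees that a covering exists at every scale. *)
Definition small f := exists M S, [/\ 0 <= M, tb S & forall a, f a <= M * ind (S a)].

Lemma mass_ge0 s : all (fun x => 0 <= x.1) s -> 0 <= mass s.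
Proof.
rewrite /mass; elim: s => [|x s IH] /=; first by rewrite big_nil.
by move=> /andP[x0 /IH h]; rewrite big_cons addr_ge0.
Qed.

Lemma small_covering e f : 0 < e -> small f -> exists s, covering e f s.
Proof.
move=> e0 [M [S [M0 /(_ e e0)[r hr] fM]]].
exists [seq (M, b) | b <- r]; split; first by elim: r {hr} => //= b r ->; rewrite M0.
move=> a; rewrite big_map /= -mulr_sumr; apply: le_trans (fM a) _.
rewrite ler_wpM2l //; have [Sa|nS] := pselect (S a); first by rewrite indT //; exact: hr.
by rewrite indF //; apply: sumr_ge0 => b _; exact: ind_ge0.
Qed.

Lemma cov_le e f s : covering e f s -> cov e f <= mass s.
Proof.
move=> c; apply: ge_inf; last by exists s.
by exists 0 => _ [s' [h _] ->]; exact: mass_ge0.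
Qed.

Lemma le_cov e f (t : R) : 0 < e -> small f ->
  (forall s, covering e f s -> t <= mass s) -> t <= cov e f.
Proof.
move=> e0 sf H; apply: lb_le_inf.
  by have [s c] := small_covering e0 sf; exists (mass s), s.
by move=> _ [s c ->]; exact: H.
Qed.

Lemma cov_ge0 e f : 0 < e -> small f -> 0 <= cov e f.
Proof. by move=> e0 sf; apply: le_cov => // s [h _]; exact: mass_ge0. Qed.

Lemma covM e f g : 0 < e -> small g -> (forall a, f a <= g a) -> cov e f <= cov e g.
Proof.
move=> e0 sg fg; apply: le_cov => // s [h1 h2]; apply: cov_le; split=> // a.
exact: le_trans (fg a) (h2 a).
Qed.

Lemma covD e f g : 0 < e -> small f -> small g ->
  cov e (fun a => f a + g a) <= cov e f + cov e g.
Proof.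
move=> e0 sf sg; rewrite -lerBlDr; apply: le_cov => // s [h1 h2].
rewrite lerBlDr -lerBlDl; apply: le_cov => // s' [h1' h2']; rewrite lerBlDl.
have -> : mass s + mass s' = mass (s ++ s') by rewrite /mass big_cat.
apply: cov_le; split; first by rewrite all_cat h1.
by move=> a; rewrite big_cat /=; apply: lerD.
Qed.

Lemma covZ e f (c : R) : 0 < e -> small f -> 0 <= c ->
  cov e (fun a => c * f a) <= c * cov e f.
Proof.
move=> e0 sf; rewrite le_eqVlt => /predU1P[<-|c0].
  apply: le_trans (@cov_le e _ [::] _) _; last by rewrite /mass big_nil mul0r.
  by split=> // a; rewrite mul0r big_nil.
rewrite mulrC -ler_pdivrMr //; apply: le_cov => // s [h1 h2].
rewrite ler_pdivrMr //.
have -> : mass s * c = mass [seq (c * x.1, x.2) | x <- s].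
  by rewrite /mass big_map /= -mulr_sumr mulrC.
apply: cov_le; split.
  by rewrite all_map; apply: sub_all h1 => x /= x0; rewrite mulr_ge0 // ltW.
move=> a; rewrite big_map /=.
have -> : \sum_(j <- s) c * j.1 * ind (V e (mul a j.2)) =
    c * \sum_(j <- s) j.1 * ind (V e (mul a j.2)).
  by rewrite mulr_sumr; apply: eq_bigr => x _; rewrite mulrA.
by rewrite ler_pM2l.
Qed.

(** A right translation carries each translate of [V e] to another one, so a covering of [f] becomes
    a covering of its translate with the same mass. *)
Lemma cov_translate e f b : 0 < e -> small f ->
  cov e (fun a => f (mul a b)) <= cov e f.
Proof.
move=> e0 sf; apply: le_cov => // s [h1 h2].
have -> : mass s = mass [seq (x.1, mul b x.2) | x <- s] by rewrite /mass big_map.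
apply: cov_le; split; first by rewrite all_map; apply: sub_all h1.
move=> a; rewrite big_map /=; apply: le_trans (h2 _) _.
by apply: ler_sum => x _; rewrite mulA.
Qed.

Lemma tb_translate S b : tb S -> tb (fun a => S (mul a b)).
Proof.
move=> tS e e0; have [r hr] := tS e e0; exists [seq mul b x | x <- r] => a /hr.
rewrite big_map => h; apply: le_trans h _; apply: ler_sum => x _.
by rewrite mulA.
Qed.

Lemma small_translate f b : small f -> small (fun a => f (mul a b)).
Proof.
move=> [M [S [M0 tS fM]]]; exists M, (fun a => S (mul a b)); split=> //.
exact: tb_translate.
Qed.

Lemma tbU S S' : tb S -> tb S' -> tb (fun a => S a \/ S' a).
Proof.
move=> tS tS' e e0; have [r hr] := tS e e0; have [r' hr'] := tS' e e0.
exists (r ++ r') => a; rewrite big_cat /=.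
have p (q : seq G) : 0 <= \sum_(b <- q) ind (V e (mul a b)).
  by apply: sumr_ge0 => b _; exact: ind_ge0.
case=> [/hr|/hr'] h; apply: le_trans h _; first by rewrite lerDl.
by rewrite lerDr.
Qed.

Lemma smallD f g : small f -> small g -> small (fun a => f a + g a).
Proof.
move=> [M [S [M0 tS fM]]] [M' [S' [M'0 tS' gM]]].
exists (M + M'), (fun a => S a \/ S' a); split; [exact: addr_ge0|exact: tbU|].
move=> a; rewrite mulrDl; apply: lerD.
  by apply: le_trans (fM a) _; rewrite ler_wpM2l //; apply: ind_impl; left.
by apply: le_trans (gM a) _; rewrite ler_wpM2l //; apply: ind_impl; right.
Qed.

Lemma smallZ f (c : R) : 0 <= c -> small f -> small (fun a => c * f a).
Proof.
move=> c0 [M [S [M0 tS fM]]]; exists (c * M), S; split=> //; first exact: mulr_ge0.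
by move=> a; rewrite -mulrA ler_wpM2l.
Qed.

Lemma small_le f g : (forall a, f a <= g a) -> small g -> small f.
Proof.
move=> fg [M [S [M0 tS fM]]]; exists M, S; split=> // a.
exact: le_trans (fg a) (fM a).
Qed.

Lemma small_ind S : tb S -> small (fun a => ind (S a)).
Proof. by move=> tS; exists 1, S; split=> // a; rewrite mul1r. Qed.

Lemma small_sum (r : seq G) (f : G -> G -> R) : (forall b, small (f b)) ->
  small (fun a => \sum_(b <- r) f b a).
Proof.
move=> sf; elim: r => [|b r IH].
  exists 0, (fun _ => False); split=> // [e e0|a]; first by exists [::].
  by rewrite big_nil mul0r.
by apply: small_le (smallD (sf b) IH) => a; rewrite big_cons.
Qed.

Section Reference.
Variables (e0 : R).
Hypotheses (e0_gt0 : 0 < e0) (tbV : tb (V e0)).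

Definition f0 a : R := ind (V e0 a).

Lemma small_f0 : small f0. Proof. exact: small_ind. Qed.

Lemma cov_f0 e : 0 < e -> 1 <= cov e f0.
Proof.
move=> h; apply: (le_cov h small_f0) => s [h1 /(_ one)].
rewrite /f0 indT; last exact: V1.
move=> H; apply: le_trans H _; rewrite /mass.
elim: s h1 => [|x s IH] /=; first by rewrite !big_nil.
move=> /andP[x0 /IH h']; rewrite !big_cons; apply: lerD => //.
by rewrite ler_piMr // ind_le1.
Qed.

(** Submultiplicativity: a covering of [f] by translates of [V e0] bounds [f] by a combination of
    translates of [f0], each of which is then covered at the finer scale [e]. It bounds the
    normalized ratios uniformly in the scale. *)
Lemma cov_compare e f : 0 < e -> small f -> cov e f <= cov e0 f * cov e f0.
Proof.
move=> h sf; have c1 : 0 < cov e f0 by apply: lt_le_trans (cov_f0 h).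
rewrite -ler_pdivrMr //; apply: le_cov => // s [h1 h2]; rewrite ler_pdivrMr //.
have K s' : all (fun x => 0 <= x.1) s' ->
    small (fun a => \sum_(x <- s') x.1 * f0 (mul a x.2)) /\
    cov e (fun a => \sum_(x <- s') x.1 * f0 (mul a x.2)) <= mass s' * cov e f0.
  elim: s' => [|x s' IH] /=.
    move=> _; split.
      by apply: small_le (smallZ (lexx 0) small_f0) => a; rewrite big_nil mul0r.
    apply: le_trans (@cov_le e _ [::] _) _; last by rewrite /mass big_nil mul0r.
    by split=> // a; rewrite !big_nil.
  move=> /andP[x0 /IH [i1 i2]].
  have sx : small (fun a => x.1 * f0 (mul a x.2)).
    by apply: smallZ => //; apply: small_translate; exact: small_f0.
  have E : (fun a => \sum_(y <- x :: s') y.1 * f0 (mul a y.2)) =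
     (fun a => x.1 * f0 (mul a x.2) + \sum_(y <- s') y.1 * f0 (mul a y.2)).
    by apply/funext => a; rewrite big_cons.
  rewrite E; split; first exact: smallD.
  apply: le_trans (covD h sx i1) _; rewrite /mass big_cons mulrDl; apply: lerD => //.
  have s1 := small_translate x.2 small_f0.
  apply: le_trans (covZ h s1 x0) _; rewrite ler_wpM2l //.
  exact: cov_translate small_f0.
have [k1 k2] := K s h1.
exact: le_trans (covM h k1 h2) k2.
Qed.

Definition ek (k : nat) : R := k.+1%:R^-1.
Lemma ek_gt0 k : 0 < ek k. Proof. by rewrite invr_gt0 ltr0n. Qed.

Definition ratio f k : R := cov (ek k) f / cov (ek k) f0.

Lemma den_gt0 k : 0 < cov (ek k) f0.
Proof. by apply: lt_le_trans (cov_f0 (ek_gt0 k)). Qed.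

Lemma ratio_ge0 f k : small f -> 0 <= ratio f k.
Proof. by move=> sf; exact: divr_ge0 (cov_ge0 (ek_gt0 k) sf) (ltW (den_gt0 k)). Qed.

Lemma ratio_le f k : small f -> ratio f k <= cov e0 f.
Proof. by move=> sf; rewrite ler_pdivrMr ?den_gt0 // cov_compare // ek_gt0. Qed.

Lemma ratio_bdd f : small f -> bdd (ratio f).
Proof. by move=> sf; exists (cov e0 f) => k; rewrite ger0_norm ?ratio_ge0 // ratio_le. Qed.

(* Weil's construction: the covering numbers [cov e f], normalized by [f0], converge along an ultrafilter. *)
Definition haar f : R := ulim (ratio f).

Lemma haar_ge0 f : small f -> 0 <= haar f.
Proof.
move=> sf; rewrite -(ulim_cst 0); apply: (@ulim_le _ _ _ 0%N).
- by exists 0 => k; rewrite normr0.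
- exact: ratio_bdd.
- by move=> k _; exact: ratio_ge0.
Qed.

Lemma haar_le f g : small f -> small g -> (forall a, f a <= g a) -> haar f <= haar g.
Proof.
move=> sf sg fg; apply: (@ulim_le _ _ _ 0%N); try exact: ratio_bdd.
move=> k _; rewrite ler_pM2r ?invr_gt0 ?den_gt0 //.
by apply: covM => //; exact: ek_gt0.
Qed.

Lemma haarD_le f g : small f -> small g ->
  haar (fun a => f a + g a) <= haar f + haar g.
Proof.
move=> sf sg; rewrite -ulimD; try exact: ratio_bdd.
have [M hM] := ratio_bdd sf; have [M' hM'] := ratio_bdd sg.
apply: (@ulim_le _ _ _ 0%N).
- exact: ratio_bdd (smallD sf sg).
- by exists (M + M') => k; apply: le_trans (ler_normD _ _) _; exact: lerD.
- move=> k _; rewrite /ratio -mulrDl ler_pM2r ?invr_gt0 ?den_gt0 //.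
  by apply: covD => //; exact: ek_gt0.
Qed.

Lemma haarZ_le f (c : R) : 0 <= c -> small f -> haar (fun a => c * f a) <= c * haar f.
Proof.
move=> c0 sf; rewrite -ulimZ; last exact: ratio_bdd.
have [M hM] := ratio_bdd sf.
apply: (@ulim_le _ _ _ 0%N).
- exact: ratio_bdd (smallZ c0 sf).
- by exists (c * M) => k; rewrite normrM ger0_norm // ler_wpM2l.
- move=> k _; rewrite /ratio mulrA ler_pM2r ?invr_gt0 ?den_gt0 //.
  by apply: covZ => //; exact: ek_gt0.
Qed.

Lemma haarZ f (c : R) : 0 <= c -> small f -> haar (fun a => c * f a) = c * haar f.
Proof.
move=> c0 sf; apply/eqP; rewrite eq_le haarZ_le //=.
have := c0; rewrite [0 <= c]le_eqVlt => /predU1P[<-|{}c0].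
  by rewrite mul0r; apply: haar_ge0; apply: smallZ.
have := @haarZ_le (fun a => c * f a) c^-1.
rewrite invr_ge0 ltW // => /(_ isT (smallZ (ltW c0) sf)).
have -> : (fun a => c^-1 * (c * f a)) = f.
  by apply/funext => a; rewrite mulKf // gt_eqF.
by rewrite mulrC ler_pdivlMr // mulrC.
Qed.

Lemma haar_translate f b : small f -> haar (fun a => f (mul a b)) = haar f.
Proof.
move=> sf.
have K g c : small g -> haar (fun a => g (mul a c)) <= haar g.
  move=> sg; apply: (@ulim_le _ _ _ 0%N).
  - exact: ratio_bdd (small_translate c sg).
  - exact: ratio_bdd.
  - move=> k _; rewrite ler_pM2r ?invr_gt0 ?den_gt0 //.
    by apply: cov_translate => //; exact: ek_gt0.
apply/eqP; rewrite eq_le K //=.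
have := K _ (inv b) (small_translate b sf).
have -> // : (fun a => f (mul (mul a (inv b)) b)) = f.
by apply/funext => a; rewrite -mulA mulVl mul1.
Qed.

Lemma haar_f0 : haar f0 = 1.
Proof.
rewrite /haar (_ : ratio f0 = fun=> 1) ?ulim_cst //; apply/funext => k.
by rewrite /ratio divff // gt_eqF // den_gt0.
Qed.

(** Finitely many translates of a multiple of [f] dominate [f0], whose value is 1; a zero value for
    [f] would be inherited by [f0]. *)
Lemma haar_gt0 f (c e : R) b : small f -> 0 < c -> 0 < e ->
  (forall a, c * ind (V e (mul a b)) <= f a) -> 0 < haar f.
Proof.
move=> sf c0 h H; rewrite lt_neqAle haar_ge0 // andbT; apply/eqP => hf0.
have [r hr] := tbV h.
pose g x a := c^-1 * f (mul a (mul x (inv b))).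
have sg x : small (g x).
  by apply: smallZ; [rewrite invr_ge0 ltW|exact: small_translate].
have hg x : haar (g x) = 0.
  rewrite haarZ ?haar_translate -?hf0 ?mulr0 // ?invr_ge0 ?ltW //.
  exact: small_translate.
have : haar f0 <= haar (fun a => \sum_(x <- r) g x a).
  apply: haar_le; [exact: small_f0|exact: small_sum|] => a.
  rewrite /f0; have [Va|nVa] := pselect (V e0 a); last first.
    rewrite indF //; apply: sumr_ge0 => x _.
    rewrite mulr_ge0 ?invr_ge0 ?(ltW c0) //; apply: le_trans (H _).
    by rewrite mulr_ge0 ?ind_ge0 // ltW.
  rewrite indT //; apply: le_trans (hr a Va) _; apply: ler_sum => x _.
  rewrite /g ler_pdivlMl //; apply: le_trans (H _).
  by rewrite -!mulA mulVl mul1.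
have : haar (fun a => \sum_(x <- r) g x a) <= 0.
  elim: r {hr} => [|x r IH].
    have E : (fun a => \sum_(x <- [::]) g x a) = (fun a => 0 * f0 a).
      by apply/funext => a; rewrite big_nil mul0r.
    by rewrite E haarZ ?mul0r //; exact: small_f0.
  have E : (fun a => \sum_(y <- x :: r) g y a) = (fun a => g x a + \sum_(y <- r) g y a).
    by apply/funext => a; rewrite big_cons.
  rewrite E; apply: le_trans (haarD_le (sg x) (small_sum r sg)) _.
  by rewrite hg add0r.
by rewrite haar_f0 => h1 h2; have := le_trans h2 h1; rewrite ler10.
Qed.

Definition uc f := forall eta : R, 0 < eta -> exists2 e : R, 0 < e &
  forall x, V e x -> forall a, `|f (mul x a) - f a| <= eta.

(** The summand [d * ind (S a)] keeps the denominator away from 0 on [S]. It jumps, but only between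
    a point of [S] and a point off [S]; at the latter [f1] vanishes, so at the former [f1] is at
    most [eta * d / 3] and the quotient is small at both. *)
Lemma uc_quotient (f1 f2 : G -> R) S (d : R) : 0 < d ->
  (forall a, 0 <= f1 a) -> (forall a, 0 <= f2 a) ->
  (forall a, ~ S a -> f1 a = 0) -> (forall a, ~ S a -> f2 a = 0) ->
  uc f1 -> uc f2 -> uc (fun a => f1 a / (f1 a + f2 a + d * ind (S a))).
Proof.
move=> d0 p1 p2 s1 s2 u1 u2 eta eta0.
have eta1 : 0 < eta * d / 3 by rewrite divr_gt0 // mulr_gt0.
have [x1 x10 h1] := u1 _ eta1; have [x2 x20 h2] := u2 _ eta1.
exists (Num.min x1 x2); first by rewrite lt_min x10.
move=> x Vx a.
have {}h1 := h1 x (Vmono _ Vx) a; have {}h2 := h2 x (Vmono _ Vx) a.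
have {h1} := h1 ltac:(by rewrite ge_min lexx).
have {h2} := h2 ltac:(by rewrite ge_min lexx orbT).
have := s1 a; have := s2 a; have := p1 a; have := p2 a.
have := s1 (mul x a); have := s2 (mul x a); have := p1 (mul x a); have := p2 (mul x a).
set a1 := f1 a; set a2 := f2 a; set b1 := f1 (mul x a); set b2 := f2 (mul x a).
move=> b20 b10 sb2 sb1 a20 a10 sa2 sa1 h2 h1.
have bnd (y1 y2 z1 : R) : 0 <= y1 -> 0 <= y2 -> `|y1 - z1| <= eta * d / 3 -> z1 = 0 ->
    `|y1 / (y1 + y2 + d * 1)| <= eta.
  move=> h3 h4 h5 z0; rewrite z0 subr0 ger0_norm // in h5.
  have D : 0 < y1 + y2 + d * 1 by rewrite mulr1; lra.
  rewrite ger0_norm ?divr_ge0 ?(ltW D) // ler_pdivrMr // mulr1.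
  have := mulr_gt0 eta0 d0; nra.
have [Sb|nSb] := pselect (S (mul x a)); have [Sa|nSa] := pselect (S a).
- rewrite !indT // !mulr1.
  have A : 0 < a1 + a2 + d by lra.
  have B : 0 < b1 + b2 + d by lra.
  have -> : b1 / (b1 + b2 + d) - a1 / (a1 + a2 + d) =
     ((b1 - a1) * (a2 + d) - a1 * (b2 - a2)) / ((b1 + b2 + d) * (a1 + a2 + d)).
    by field; rewrite !gt_eqF.
  rewrite normrM normfV (gtr0_norm (mulr_gt0 B A)) ler_pdivrMr ?mulr_gt0 //.
  apply: le_trans (ler_normB _ _) _; rewrite !normrM.
  have E1 : `|b1 - a1| * `|a2 + d| <= eta * d / 3 * (a1 + a2 + d).
    apply: ler_pM => //; rewrite ger0_norm; lra.
  have E2 : `|a1| * `|b2 - a2| <= (a1 + a2 + d) * (eta * d / 3).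
    apply: ler_pM => //; rewrite ger0_norm; lra.
  have E3 : eta * d * (a1 + a2 + d) <= eta * (b1 + b2 + d) * (a1 + a2 + d).
    by rewrite ler_pM2r // ler_pM2l //; lra.
  have E4 : 0 <= eta * d * (a1 + a2 + d) by rewrite !mulr_ge0 // ltW.
  rewrite mulrA; move: E1 E2 E3 E4; move: (a1 + a2 + d) => Q; lra.
- rewrite (indT Sb) (indF nSa) (sa1 nSa) mul0r subr0; apply: (bnd _ _ a1) => //.
  exact: sa1.
- rewrite (indF nSb) (indT Sa) (sb1 nSb) mul0r sub0r normrN; apply: (bnd _ _ b1) => //.
    by rewrite distrC.
  exact: sb1.
- by rewrite (sa1 nSa) (sb1 nSb) !mul0r subr0 normr0 ltW.
Qed.

(** Weil's argument. With [F = f1 + f2 + eta * ind S], the quotients [g1 = f1 / F] and [g2 = f2 / F]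
    are nearly constant on small translates, so a covering of [F], reweighted by them, covers [f1]
    and [f2] separately. Since [g1 + g2 <= 1], the two masses add up to at most [1 + 2 * eta] times
    the original one. *)
Lemma haarD f1 f2 S : tb S -> small f1 -> small f2 ->
  (forall a, 0 <= f1 a) -> (forall a, 0 <= f2 a) ->
  (forall a, ~ S a -> f1 a = 0) -> (forall a, ~ S a -> f2 a = 0) ->
  uc f1 -> uc f2 -> haar (fun a => f1 a + f2 a) = haar f1 + haar f2.
Proof.
move=> tS sf1 sf2 p1 p2 s1 s2 u1 u2; apply/eqP; rewrite eq_le haarD_le //=.
have sS := small_ind tS.
have s12 := smallD sf1 sf2.
pose K := haar (fun a => ind (S a)).
have K0 : 0 <= K by exact: haar_ge0.
have H0 : 0 <= haar (fun a => f1 a + f2 a) by exact: haar_ge0.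
suff key (eta : R) : 0 < eta -> eta <= 1 ->
    haar f1 + haar f2 <= (1 + 2 * eta) * (haar (fun a => f1 a + f2 a) + eta * K).
  apply/ler_addgt0Pr => e eg0.
  pose H := haar (fun a => f1 a + f2 a).
  have D : 0 < 2 * H + 3 * K + 1 by rewrite -/H in H0; lra.
  (* For [eta <= 1] the excess of [(1 + 2 * eta) * (H + eta * K)] over [H] is at most
     [eta * (2 * H + 3 * K)]. *)
  pose eta := Num.min 1 (e / (2 * H + 3 * K + 1)).
  have eta0 : 0 < eta by rewrite lt_min ltr01 divr_gt0.
  have eta1 : eta <= 1 by rewrite ge_min lexx.
  have eta2 : eta * (2 * H + 3 * K + 1) <= e.
    by rewrite -ler_pdivlMr // ge_min lexx orbT.
  apply: le_trans (key eta eta0 eta1) _; rewrite -/H.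
  have X : eta * eta * K <= eta * K by rewrite ler_wpM2r // ler_piMr // ltW.
  move: eta2 X; rewrite -/H in H0; nra.
move=> eta0 eta1.
pose F a := f1 a + f2 a + eta * ind (S a).
have sF : small F by apply: smallD => //; apply: smallZ => //; exact: ltW.
have [x1 x10 h1] := uc_quotient eta0 p1 p2 s1 s2 u1 u2 eta0.
have [x2 x20 h2] := uc_quotient eta0 p2 p1 s2 s1 u2 u1 eta0.
have haarF : haar F <= haar (fun a => f1 a + f2 a) + eta * K.
  apply: le_trans (haarD_le s12 (smallZ (ltW eta0) sS)) _; rewrite lerD2l.
  by rewrite haarZ // ltW.
have c0 : 0 <= 1 + 2 * eta by lra.
apply: (@le_trans _ _ ((1 + 2 * eta) * haar F)); last by rewrite ler_wpM2l.
rewrite -ulimZ; last exact: ratio_bdd.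
rewrite /haar -ulimD; try exact: ratio_bdd.
have [N hN] : exists N, forall k, (N <= k)%N -> ek k <= Num.min x1 x2.
  have m0 : 0 < Num.min x1 x2 by rewrite lt_min x10.
  exists (Num.Def.archi_bound (Num.min x1 x2)^-1) => k hk.
  rewrite /ek -[leRHS]invrK lef_pV2 ?posrE ?invr_gt0 ?ltr0n //.
  have := archi_boundP (ltW (_ : 0 < (Num.min x1 x2)^-1)); rewrite invr_gt0 => /(_ m0) /ltW.
  by move=> h; apply: le_trans h _; rewrite ler_nat (leq_trans hk).
have [M1 hM1] := ratio_bdd sf1; have [M2 hM2] := ratio_bdd sf2.
have [M3 hM3] := ratio_bdd sF.
apply: (@ulim_le _ _ _ N).
- by exists (M1 + M2) => k; apply: le_trans (ler_normD _ _) _; exact: lerD.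
- by exists ((1 + 2 * eta) * M3) => k; rewrite normrM ger0_norm // ler_wpM2l.
move=> k /hN; rewrite le_min => /andP[k1 k2].
rewrite /ratio -mulrDl mulrA ler_pM2r ?invr_gt0 ?den_gt0 //.
have ck : 0 < 1 + 2 * eta by lra.
rewrite mulrC -ler_pdivrMr //; apply: le_cov => //; first exact: ek_gt0.
move=> s [q1 q2]; rewrite ler_pdivrMr //.
pose g1 a := f1 a / (f1 a + f2 a + eta * ind (S a)).
pose g2 a := f2 a / (f2 a + f1 a + eta * ind (S a)).
have g0 (f : G -> R) a : 0 <= f a -> 0 <= f a / F a.
  by move=> h; rewrite divr_ge0 // !addr_ge0 // mulr_ge0 ?ind_ge0 // ltW.
have F21 a : f2 a + f1 a + eta * ind (S a) = F a by rewrite /F [f2 a + _]addrC.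
have g10 a : 0 <= g1 a by exact: g0.
have g20 a : 0 <= g2 a by rewrite /g2 F21; exact: g0.
have gs a : g1 a + g2 a <= 1.
  rewrite /g1 /g2 F21 -/(F a) -mulrDl; have [F0|F0] := eqVneq (F a) 0.
    by rewrite F0 invr0 mulr0.
  have Fp : 0 < F a by rewrite lt_neqAle eq_sym F0 !addr_ge0 // mulr_ge0 ?ind_ge0 // ltW.
  by rewrite ler_pdivrMr // mul1r lerDl mulr_ge0 ?ind_ge0 // ltW.
have fF a : f1 a = g1 a * F a /\ f2 a = g2 a * F a.
  rewrite /g1 /g2 F21 -/(F a); have [F0|F0] := eqVneq (F a) 0; last by rewrite !divfK.
  have E : 0 <= eta * ind (S a) by rewrite mulr_ge0 ?ind_ge0 // ltW.
  have := p1 a; have := p2 a; rewrite F0 !mulr0; move: F0 E; rewrite /F => *; split; lra.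
(* Where the indicator is 1, [a] is a small left multiple of [inv y.2], so [g a] is at most
   [g (inv y.2) + eta]. *)
have bnd (g : G -> R) (f : G -> R) (x : R) : ek k <= x ->
    (forall y, V x y -> forall a, `|g (mul y a) - g a| <= eta) ->
    (forall a, 0 <= g a) -> (forall a, f a = g a * F a) ->
    cov (ek k) f <= \sum_(y <- s) y.1 * (g (inv y.2) + eta).
  move=> kx hg gg fg.
  have -> : \sum_(y <- s) y.1 * (g (inv y.2) + eta) =
      mass [seq (y.1 * (g (inv y.2) + eta), y.2) | y <- s].
    by rewrite /mass big_map.
  apply: cov_le; split.
    by rewrite all_map; apply: sub_all q1 => y /= y0; rewrite mulr_ge0 // addr_ge0 // ltW.
  move=> a; rewrite big_map /= fg.
  apply: le_trans (ler_wpM2l (gg a) (q2 a)) _; rewrite mulr_sumr.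
  elim: s q1 {q2} => [|y s IH] /=; first by rewrite !big_nil.
  move=> /andP[y0 /IH IH']; rewrite !big_cons; apply: lerD => //.
  have [Vy|nVy] := pselect (V (ek k) (mul a y.2)); last by rewrite indF // !mulr0.
  rewrite indT // !mulr1 mulrC ler_wpM2l //.
  have := hg _ (Vmono kx Vy) (inv y.2).
  rewrite -mulA mulV mul1 => h; have := ler_norm (g a - g (inv y.2)); lra.
have B1 := bnd g1 f1 x1 k1 h1 g10 (fun a => (fF a).1).
have B2 := bnd g2 f2 x2 k2 h2 g20 (fun a => (fF a).2).
apply: le_trans (lerD B1 B2) _; rewrite -big_split /= /mass mulr_suml.
elim: s q1 {q2 bnd B1 B2} => [|y s IH] /=; first by rewrite !big_nil.
move=> /andP[y0 /IH IH']; rewrite !big_cons; apply: lerD => //.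
rewrite -mulrDr ler_wpM2l //; have := gs (inv y.2); lra.
Qed.

Definition posp f a : R := Num.max (f a) 0.
Definition negp f a : R := Num.max (- f a) 0.
(** The covering functional is additive only on nonnegative functions; the difference over positive
    and negative parts extends it linearly. *)
Definition haarJ f : R := haar (posp f) - haar (negp f).
Definition Lsp S f := [/\ uc f, (forall a, ~ S a -> f a = 0) & exists M, forall a, `|f a| <= M].

Lemma max0_lip (x y : R) : `|Num.max x 0 - Num.max y 0| <= `|x - y|.
Proof.
case: (leP x 0) => hx; case: (leP y 0) => hy.
- by rewrite subrr normr0.
- rewrite sub0r normrN (gtr0_norm hy) ler_normr; apply/orP; right; lra.
- rewrite subr0 (gtr0_norm hx) ler_normr; apply/orP; left; lra.
- by [].
Qed.

Lemma Lsp_comp S f (h : R -> R) : h 0 = 0 -> (forall x y, `|h x - h y| <= `|x - y|) ->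
  Lsp S f -> Lsp S (fun a => h (f a)).
Proof.
move=> h0 lip [u s [M hM]]; split.
- move=> eta /u [e eg0 he]; exists e => // x Vx a; exact: le_trans (lip _ _) (he x Vx a).
- by move=> a /s ->.
- by exists M => a; rewrite -[h _]subr0 -h0; apply: le_trans (lip _ _) _; rewrite subr0.
Qed.

Lemma Lsp_posp S f : Lsp S f -> Lsp S (posp f).
Proof. by apply: (@Lsp_comp S f (fun x => Num.max x 0)); [rewrite maxxx|exact: max0_lip]. Qed.

Lemma Lsp_negp S f : Lsp S f -> Lsp S (negp f).
Proof.
apply: (@Lsp_comp S f (fun x => Num.max (- x) 0)); first by rewrite oppr0 maxxx.
by move=> x y; apply: le_trans (max0_lip _ _) _; rewrite -opprD normrN.
Qed.

Lemma LspD S f g : Lsp S f -> Lsp S g -> Lsp S (fun a => f a + g a).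
Proof.
move=> [u s [M hM]] [u' s' [M' hM']]; split.
- move=> eta eta0; have e2 : 0 < eta / 2 by rewrite divr_gt0.
  have [x x0 hx] := u _ e2; have [y y0 hy] := u' _ e2.
  exists (Num.min x y); first by rewrite lt_min x0.
  move=> z Vz a; rewrite opprD addrACA [eta]splitr.
  apply: le_trans (ler_normD _ _) _; apply: lerD.
    by apply: hx; apply: Vmono Vz; rewrite ge_min lexx.
  by apply: hy; apply: Vmono Vz; rewrite ge_min lexx orbT.
- by move=> a na; rewrite s // s' // addr0.
- by exists (M + M') => a; apply: le_trans (ler_normD _ _) _; exact: lerD.
Qed.

Lemma LspZ S f (c : R) : Lsp S f -> Lsp S (fun a => c * f a).
Proof.
move=> [u s [M hM]]; split.
- move=> eta eta0; have c0 : 0 < `|c| + 1 by rewrite ltr_wpDl.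
  have [x x0 hx] := u _ (divr_gt0 eta0 c0); exists x => // y Vy a.
  rewrite -mulrBr normrM; apply: le_trans (ler_wpM2l (normr_ge0 c) (hx y Vy a)) _.
  by rewrite mulrA ler_pdivrMr // mulrC ler_wpM2l ?ltW // ltrDl.
- by move=> a /s ->; rewrite mulr0.
- by exists (`|c| * M) => a; rewrite normrM ler_wpM2l.
Qed.

Lemma Lsp_small S f : tb S -> Lsp S f -> small f.
Proof.
move=> tS [_ s [M hM]]; exists `|M|, S; split=> // a.
have [Sa|nSa] := pselect (S a).
  by rewrite indT // mulr1; apply: le_trans (ler_norm _) _;
    apply: le_trans (hM a) (ler_norm _).
by rewrite (s a nSa) mulr_ge0 // ind_ge0.
Qed.

Lemma LspHD S f g : tb S -> Lsp S f -> Lsp S g -> (forall a, 0 <= f a) ->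
  (forall a, 0 <= g a) -> haar (fun a => f a + g a) = haar f + haar g.
Proof.
move=> tS lf lg pf pg; have [u s _] := lf; have [u' s' _] := lg.
by apply: (@haarD f g S) => //; apply: (Lsp_small tS).
Qed.

Lemma haarJB S f g : tb S -> Lsp S f -> Lsp S g ->
  Lsp S (fun a => f a - g a) /\ haarJ (fun a => f a - g a) = haarJ f - haarJ g.
Proof.
move=> tS lf lg; have l : Lsp S (fun a => f a - g a).
  have -> : (fun a => f a - g a) = (fun a => f a + (-1) * g a).
    by apply/funext => a; rewrite mulN1r.
  by apply: LspD lf (LspZ _ lg).
split=> //.
have pp h a : 0 <= posp h a by rewrite /posp le_max lexx orbT.
have pn h a : 0 <= negp h a by rewrite /negp le_max lexx orbT.
set h := fun a => f a - g a.
(* An identity between nonnegative functions equivalent to [h = f - g], so that the additivity of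
   [haar] applies to both sides. *)
have E : (fun a => posp h a + (negp f a + posp g a)) =
         (fun a => negp h a + (posp f a + negp g a)).
  apply/funext => a; rewrite /posp /negp /h.
  case: (leP (f a) 0); case: (leP (g a) 0); case: (leP (f a - g a) 0);
  case: (leP (- f a) 0); case: (leP (- g a) 0); case: (leP (- (f a - g a)) 0); lra.
have lpf := Lsp_posp lf; have lnf := Lsp_negp lf; have lpg := Lsp_posp lg.
have lng := Lsp_negp lg; have lph := Lsp_posp l; have lnh := Lsp_negp l.
have := congr1 haar E.
rewrite (@LspHD S) //; last 2 first.
- exact: LspD.
- by move=> a; rewrite addr_ge0.
rewrite (@LspHD S (negp f)) // (@LspHD S (negp h)) //; last 2 first.
- exact: LspD.
- by move=> a; rewrite addr_ge0.
rewrite (@LspHD S (posp f)) // /haarJ -/h; lra.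
Qed.

Lemma haarJ_ge0 f : (forall a, 0 <= f a) -> haarJ f = haar f.
Proof.
move=> pf; rewrite /haarJ.
have -> : posp f = f by apply/funext => a; rewrite /posp max_l.
have -> : negp f = (fun a => 0 * f0 a).
  by apply/funext => a; rewrite /negp mul0r max_r // oppr_le0.
by rewrite haarZ ?mul0r ?subr0 //; exact: small_f0.
Qed.

Lemma haarJZ S f (t : R) : tb S -> Lsp S f ->
  Lsp S (fun a => t * f a) /\ haarJ (fun a => t * f a) = t * haarJ f.
Proof.
move=> tS lf; split; first exact: LspZ.
have sp := Lsp_small tS (Lsp_posp lf); have sn := Lsp_small tS (Lsp_negp lf).
rewrite /haarJ; have [t0|t0] := leP 0 t.
  have -> : posp (fun a => t * f a) = (fun a => t * posp f a).
    by apply/funext => a; rewrite /posp maxr_pMr // mulr0.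
  have -> : negp (fun a => t * f a) = (fun a => t * negp f a).
    by apply/funext => a; rewrite /negp maxr_pMr // mulr0 mulrN.
  by rewrite !haarZ // mulrBr.
have nt : 0 <= - t by rewrite oppr_ge0 ltW.
have -> : posp (fun a => t * f a) = (fun a => - t * negp f a).
  by apply/funext => a; rewrite /negp maxr_pMr // mulr0 mulrNN.
have -> : negp (fun a => t * f a) = (fun a => - t * posp f a).
  by apply/funext => a; rewrite /posp maxr_pMr // mulr0 mulNr.
by rewrite !haarZ //; ring.
Qed.

Lemma haarJ_bound S f (M : R) : tb S -> 0 <= M -> Lsp S f -> (forall a, `|f a| <= M) ->
  `|haarJ f| <= (2 * haar (fun a => ind (S a))) * M.
Proof.
move=> tS M0 lf fM; have sS := small_ind tS.
have K (g : G -> R) : Lsp S g -> (forall a, 0 <= g a <= M) ->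
    0 <= haar g <= haar (fun a => ind (S a)) * M.
  move=> lg gM; have sg := Lsp_small tS lg; rewrite haar_ge0 //= mulrC -haarZ //.
  apply: haar_le => //; first exact: smallZ.
  move=> a; have [Sa|nSa] := pselect (S a).
    by rewrite indT // mulr1; have /andP[] := gM a.
  by have [_ s _] := lg; rewrite s // mulr_ge0 // ind_ge0.
have /andP[a1 a2] : 0 <= haar (posp f) <= haar (fun a => ind (S a)) * M.
  apply: K (Lsp_posp lf) _ => a.
  rewrite /posp le_max lexx orbT ge_max M0 andbT /=.
  exact: le_trans (ler_norm _) (fM a).
have /andP[b1 b2] : 0 <= haar (negp f) <= haar (fun a => ind (S a)) * M.
  apply: K (Lsp_negp lf) _ => a.
  rewrite /negp le_max lexx orbT ge_max M0 andbT /=.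
  by have := fM a; rewrite ler_norml => /andP[? _]; rewrite lerNl.
rewrite /haarJ -mulrA; move: a1 a2 b1 b2.
move: (haar (posp f)) (haar (negp f)) (haar (fun a => ind (S a)) * M) => A B Q.
by move=> ? ? ? ?; rewrite ler_norml; apply/andP; split; lra.
Qed.

(** Stability under uniform limits is what admits derivatives of a family, as limits of difference
    quotients, to the domain of the functional. *)
Lemma Lsp_closed S f : (forall e : R, 0 < e -> exists2 g, Lsp S g &
  forall a, `|f a - g a| <= e) -> Lsp S f.
Proof.
move=> H; split.
- move=> eta eta0; have e3 : 0 < eta / 3 by rewrite divr_gt0.
  have [g [u _ _] fg] := H _ e3; have [x x0 hx] := u _ e3.
  exists x => // y Vy a.
  have := fg (mul y a); have := fg a; have := hx y Vy a.
  rewrite !ler_norml => /andP[? ?] /andP[? ?] /andP[? ?]; apply/andP; split; lra.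
- move=> a na; apply/eqP; rewrite -normr_le0; apply/ler_addgt0Pr => e eg0; rewrite add0r.
  by have [g [_ s _] fg] := H _ eg0; have := fg a; rewrite s // subr0.
- have [g [_ _ [M hM]] fg] := H _ ltr01; exists (1 + M) => a.
  by rewrite -[f a](subrK (g a)); apply: le_trans (ler_normD _ _) _; exact: lerD.
Qed.

End Reference.
End Covering.

(** * The norm and the distance of a Hermitian metric *)

Section ChartNbhs.
Context {R : realType} {n : nat} {X : complexManifold R n}.
Implicit Types (c : chart X) (x : X).

Lemma chart_imageK c z : (chart_map c @` chart_dom c) z ->
  chart_dom c (chart_inv c z) /\ chart_map c (chart_inv c z) = z.
Proof. by move=> [x cx <-]; rewrite chart_mapK. Qed.

Lemma chart_image c x : chart_dom c x -> (chart_map c @` chart_dom c) (chart_map c x).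
Proof. by move=> cx; exists x. Qed.

Lemma chart_ball c x : chart_dom c x -> exists2 d : R, 0 < d &
  forall z, rn (z - chart_map c x) < d -> (chart_map c @` chart_dom c) z.
Proof.
by move=> cx; have /open_rnP := @chart_image_open R n X c; apply; exact: chart_image.
Qed.

Lemma near_chart c x (P : X -> Prop) : chart_dom c x ->
  (exists2 d : R, 0 < d & forall z, rn (z - chart_map c x) < d -> P (chart_inv c z)) ->
  \forall y \near x, P y.
Proof.
move=> cx [d d0 hP].
have H1 : nbhs x (chart_dom c) by apply: open_nbhs_nbhs; split=> //; exact: chart_dom_open.
have H2 : nbhs x (chart_map c @^-1` [set z | rn (z - chart_map c x) < d]).
  apply: (@chart_map_continuous R n X c x cx); apply/nbhs_rnP; by exists d.
apply: filterS (filterI H1 H2) => y [cy hy].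
by rewrite -(chart_mapK cy); exact: hP.
Qed.

Lemma near_chart_inv c x (P : X -> Prop) : chart_dom c x -> (\forall y \near x, P y) ->
  exists2 d : R, 0 < d & forall z, rn (z - chart_map c x) < d ->
    [/\ chart_dom c (chart_inv c z), chart_map c (chart_inv c z) = z & P (chart_inv c z)].
Proof.
move=> cx nP; have [d d0 hd] := chart_ball cx.
have /nbhs_rnP [e e0 he] : nbhs (chart_map c x) (chart_inv c @^-1` P).
  by apply: (@chart_inv_continuous R n X c x cx); rewrite chart_mapK.
exists (Num.min d e); first by rewrite lt_min d0.
move=> z; rewrite lt_min => /andP[zd ze].
by have [h1 h2] := chart_imageK (hd z zd); split => //; exact: he.
Qed.
End ChartNbhs.

Section MetricNorm.
Context {R : realType} {n : nat} {X : complexManifold R n} {g : tensorField X}.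
Hypothesis hg : hermitian_metric g.
Implicit Types (c : chart X) (x : X) (u v : Cspace R n).

Section Point.
Context {c : chart X} {x : X}.
Hypothesis cx : chart_dom c x.

Lemma gDl u u' v : g c x (u + u') v = g c x u v + g c x u' v.
Proof.
have := hermitian_linear hg cx I 1 u u' v; rewrite mul1r => <-; congr (g c x _ v).
by apply/rowP => j; rewrite !mxE rmorph1 mul1r.
Qed.

Lemma g0l v : g c x 0 v = 0.
Proof. by have := gDl 0 0 v; rewrite (_ : (0 : Cspace R n) + 0 = 0) ?addr0 //; lra. Qed.

Lemma gZl (a : R) u v : g c x (a%:C *: u) v = a * g c x u v.
Proof.
have := hermitian_linear hg cx I a u 0 v; rewrite g0l (_ : a%:C *: u + 0 = a%:C *: u); last first.
  by apply/rowP => j; rewrite !mxE addr0.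
by rewrite addr0.
Qed.

Lemma gC u v : g c x u v = g c x v u. Proof. exact: (hermitian_sym hg cx I). Qed.
Lemma gDr u v v' : g c x u (v + v') = g c x u v + g c x u v'.
Proof. by rewrite gC gDl !(gC u). Qed.
Lemma gZr (a : R) u v : g c x u (a%:C *: v) = a * g c x u v.
Proof. by rewrite gC gZl (gC u). Qed.
Lemma g0r u : g c x u 0 = 0. Proof. by rewrite gC g0l. Qed.
Lemma gJ u v : g c x ('i *: u) ('i *: v) = g c x u v.
Proof. exact: (hermitian_J hg cx I). Qed.
Lemma g_gt0 u : u != 0 -> 0 < g c x u u. Proof. exact: (hermitian_pos hg cx I). Qed.

Lemma g_ge0 u : 0 <= g c x u u.
Proof. by have [->|/g_gt0/ltW//] := eqVneq u 0; rewrite g0l. Qed.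

Lemma gNl u v : g c x (- u) v = - g c x u v.
Proof.
rewrite -mulN1r -gZl; congr (g c x _ v).
by apply/rowP => j; rewrite !mxE rmorphN rmorph1 mulN1r.
Qed.
Lemma gNr u v : g c x u (- v) = - g c x u v. Proof. by rewrite gC gNl gC. Qed.

Lemma g_suml (I : Type) (s : seq I) (P : pred I) (F : I -> Cspace R n) v :
  g c x (\sum_(i <- s | P i) F i) v = \sum_(i <- s | P i) g c x (F i) v.
Proof.
by elim/big_rec2: _ => [|i a b _ <-]; [exact: g0l|exact: gDl].
Qed.

Lemma g_expand u v : g c x u v =
  \sum_p \sum_q (rc p u * rc q v) * g c x (eb p) (eb q).
Proof.
rewrite {1}[u]real_basis g_suml; apply: eq_bigr => p _.
rewrite gZl {1}[v]real_basis gC g_suml mulr_sumr; apply: eq_bigr => q _.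
by rewrite gZl gC mulrA.
Qed.

End Point.

Definition gnorm c x u : R := Num.sqrt (g c x u u).
Local Notation N := gnorm.

Lemma gnorm_ge0 c x u : 0 <= N c x u. Proof. exact: sqrtr_ge0. Qed.

Lemma gnorm_sq c x u : chart_dom c x -> N c x u ^+ 2 = g c x u u.
Proof. by move=> cx; rewrite sqr_sqrtr // g_ge0. Qed.

Lemma gnorm0 c x : chart_dom c x -> N c x 0 = 0.
Proof. by move=> cx; rewrite /N g0l // sqrtr0. Qed.

Lemma gnorm_gt0 c x u : chart_dom c x -> u != 0 -> 0 < N c x u.
Proof. by move=> cx u0; rewrite sqrtr_gt0 g_gt0. Qed.

Lemma gnormZ c x (a : R) u : chart_dom c x -> N c x (a%:C *: u) = `|a| * N c x u.
Proof.
move=> cx; rewrite /N gZl // gZr // mulrA -expr2 sqrtrM ?sqr_ge0 // sqrtr_sqr //.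
Qed.

Lemma gnormN c x u : chart_dom c x -> N c x (- u) = N c x u.
Proof. by move=> cx; rewrite /N gNl // gNr // opprK. Qed.

Lemma CauchySchwarz c x u v : chart_dom c x -> g c x u v <= N c x u * N c x v.
Proof.
move=> cx; have [->|v0] := eqVneq v 0; first by rewrite g0r // gnorm0 // mulr0.
have gv := g_gt0 cx v0; set t := g c x u v / g c x v v.
have := g_ge0 cx (u + (- t)%:C *: v).
rewrite gDl // !gDr // gZl // !gZr // gZl // (gC cx v u) => H.
have K : g c x u v ^+ 2 <= g c x u u * g c x v v.
  rewrite -subr_ge0 (_ : _ - _ = g c x v v * (g c x u u - g c x u v ^+ 2 / g c x v v)); last first.
    by field; rewrite gt_eqF.
  apply: mulr_ge0; first exact: ltW.
  move: H; rewrite (_ : _ + _ = g c x u u - g c x u v ^+ 2 / g c x v v) // /t.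
  by field; rewrite gt_eqF.
rewrite -sqrtrM ?g_ge0 //; apply: le_trans (ler_norm _) _.
by rewrite -sqrtr_sqr ler_wsqrtr.
Qed.

Lemma gnormD c x u v : chart_dom c x -> N c x (u + v) <= N c x u + N c x v.
Proof.
move=> cx; rewrite -ler_sqr ?nnegrE ?addr_ge0 ?gnorm_ge0 // gnorm_sq // gDl // !gDr // (gC cx v u).
rewrite sqrrD !gnorm_sq //; have := CauchySchwarz u v cx; move: (N c x u * N c x v) (g c x u v).
by move=> a b; lra.
Qed.

Lemma g_bound c x : chart_dom c x -> exists2 K : R, 0 < K &
  forall u v, `|g c x u v| <= K * (rn u * rn v).
Proof.
move=> cx; exists (1 + \sum_p \sum_q `|g c x (eb p) (eb q)|).
  by rewrite ltr_pwDl //; apply: sumr_ge0 => p _; apply: sumr_ge0.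
move=> u v; rewrite g_expand // mulrDl mul1r; apply: le_trans (_ : _ <= 0 + _) _; last first.
  by apply: lerD; [rewrite mulr_ge0 ?rn_ge0|exact: lexx].
rewrite add0r mulr_suml; apply: le_trans (ler_norm_sum _ _ _) _; apply: ler_sum => p _.
rewrite mulr_suml; apply: le_trans (ler_norm_sum _ _ _) _; apply: ler_sum => q _.
by rewrite normrM mulrC ler_wpM2l // normrM ler_pM // rc_le.
Qed.

Lemma gnorm_upper c x : chart_dom c x -> exists2 C : R, 0 < C & forall u, N c x u <= C * rn u.
Proof.
move=> cx; have [K K0 hK] := g_bound cx; exists (Num.sqrt K); first by rewrite sqrtr_gt0.
move=> u; apply: le_trans (ler_wsqrtr (le_trans (ler_norm _) (hK u u))) _.
by rewrite -expr2 sqrtrM ?(ltW K0) // sqrtr_sqr ger0_norm ?rn_ge0 //.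
Qed.

(** The continuous positive function [N] attains a positive minimum on the compact unit sphere. *)
Lemma gnorm_lower c x : chart_dom c x -> exists2 m : R, 0 < m & forall u, m * rn u <= N c x u.
Proof.
move=> cx; have [C C0 hC] := gnorm_upper cx.
have cN : continuous (fun u => N c x u).
  move=> u; apply/cont_rnP => e e0; exists (e / C); first exact: divr_gt0.
  move=> z hz; apply: le_lt_trans (_ : _ <= N c x (z - u)) _.
    have h1 := gnormD (z - u) u cx; have h2 := gnormD (u - z) z cx.
    rewrite subrK in h1; rewrite subrK -(gnormN (u - z) cx) opprB in h2.
    by rewrite ler_norml; apply/andP; split; lra.
  by apply: le_lt_trans (hC _) _; rewrite mulrC -ltr_pdivlMr.
(* Without unit vectors the space is zero and any constant works. *)
have [[u0 u01]|none] := pselect (exists u, rn u = 1); last first.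
  exists 1 => // u; have [->|u0] := eqVneq u 0; first by rewrite rn0 mulr0 gnorm_ge0.
  exfalso; apply: none; exists (((rn u)^-1)%:C *: u).
  by rewrite rnZ rn_real ger0_norm ?invr_ge0 ?rn_ge0 // mulVf // rn_eq0.
have cS : compact [set u : Cspace R n | rn u = 1].
  apply: (@subclosed_compact _ _ [set w | rn (w - 0) <= 1]); first 2 last.
  - by move=> w /= h; rewrite subr0 h.
  - rewrite (_ : mkset _ = (fun w => rn (w - 0)) @^-1` [set 1]); last first.
      by apply/seteqP; split=> w /=; rewrite subr0.
    apply: preimage_closed; last exact: closed_eq.
    by move=> w _; exact: (@rn_triangle_cont R n 0 w).
  - exact: (@compact_rn_ball R n 0 1).
have [||w w1 hw] := @compact_EVT_min (Cspace R n) R (fun u => N c x u) _ _ cS.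
- by exists u0.
- exact: continuous_subspaceT.
have w0 : w != 0.
  by apply/eqP => w0; move: w1; rewrite inE /= w0 rn0 => /esym/eqP; rewrite oner_eq0.
exists (N c x w); first exact: gnorm_gt0.
move=> u; have [->|un0] := eqVneq u 0; first by rewrite rn0 mulr0 gnorm_ge0.
have ru : 0 < rn u by rewrite rn_gt0.
have := hw (((rn u)^-1)%:C *: u); rewrite gnormZ // ger0_norm ?invr_ge0 ?rn_ge0 //.
rewrite mulrC ler_pdivlMr //; apply.
by rewrite inE /= rnZ rn_real ger0_norm ?invr_ge0 ?rn_ge0 // mulVf ?gt_eqF.
Qed.

Lemma g_near c x (e : R) : chart_dom c x -> 0 < e -> exists2 d : R, 0 < d & forall z,
  rn (z - chart_map c x) < d -> chart_dom c (chart_inv c z) /\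
  forall u v, `|g c (chart_inv c z) u v - g c x u v| <= e * (rn u * rn v).
Proof.
move=> cx e0; have [d d0 hd] := chart_ball cx.
pose J := ('I_n * bool)%type.
pose Nn : R := 1 + #|{: J}|%:R * #|{: J}|%:R.
have Nn0 : 0 < Nn by rewrite ltr_pwDl // mulr_ge0.
pose Q (pq : J * J) (r : R) := forall z, rn (z - chart_map c x) < r ->
  `|g c (chart_inv c z) (eb pq.1) (eb pq.2) - g c x (eb pq.1) (eb pq.2)| <= e / Nn.
have Q1 pq r r' : 0 < r' -> r' <= r -> Q pq r -> Q pq r'.
  by move=> _ h H z hz; exact: H z (lt_le_trans hz h).
have Q2 pq : exists2 r, 0 < r & Q pq r.
  have [H _] := hermitian_smooth hg c (eb pq.1) (eb pq.2) 0%N.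
  have Ux : (chart_map c @` (chart_dom c `&` setT)) (chart_map c x) by exists x.
  have /cont_rnP Hz := H _ Ux.
  have [r r0 hr] := Hz _ (divr_gt0 e0 Nn0); exists r => // z /hr.
  by rewrite chart_mapK //; exact: ltW.
have [r r0 hr] := fin_radius Q1 Q2.
exists (Num.min d r); first by rewrite lt_min d0.
move=> z; rewrite lt_min => /andP[zd zr]; have [cz _] := chart_imageK (hd z zd).
split=> // u v; rewrite !g_expand // -sumrB.
apply: le_trans (ler_norm_sum _ _ _) _.
apply: (@le_trans _ _ (\sum_(p : J) \sum_(q : J) (e / Nn) * (rn u * rn v))).
  apply: ler_sum => p _; rewrite -sumrB; apply: le_trans (ler_norm_sum _ _ _) _.
  apply: ler_sum => q _; rewrite -mulrBr normrM mulrC ler_pM //; first exact: (hr (p, q)).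
  by rewrite normrM ler_pM // rc_le.
rewrite !sumr_const -mulrnA -mulr_natl natrM.
rewrite [leLHS](_ : _ = (#|{: J}|%:R * #|{: J}|%:R) / Nn * (e * (rn u * rn v))); last by ring.
by rewrite ler_piMl ?mulr_ge0 ?rn_ge0 ?(ltW e0) // ler_pdivrMr // mul1r /Nn lerDr.
Qed.

Lemma gnorm_ratio c x (e : R) : chart_dom c x -> 0 < e -> exists2 d : R, 0 < d & forall z,
  rn (z - chart_map c x) < d -> [/\ chart_dom c (chart_inv c z),
    chart_map c (chart_inv c z) = z &
    forall u, N c (chart_inv c z) u <= (1 + e) * N c x u /\
              N c x u <= (1 + e) * N c (chart_inv c z) u].
Proof.
move=> cx e0; have [m m0 hm] := gnorm_lower cx; have [d d0 hd] := chart_ball cx.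
(* Chosen so that [1 - eta] is the inverse of [1 + e] while [1 + eta] is still at most [1 + e]: the
   comparison then holds in both directions with one factor. *)
pose eta := e / (1 + e); have e1 : 0 < 1 + e by rewrite ltr_wpDl // ltW.
have eta0 : 0 < eta by exact: divr_gt0.
have [r r0 hr] := g_near cx (mulr_gt0 eta0 (exprn_gt0 2 m0)).
exists (Num.min d r); first by rewrite lt_min d0.
move=> z; rewrite lt_min => /andP[zd zr]; have [cz hz] := chart_imageK (hd z zd).
split=> // u; have [_ /(_ u u)] := hr z zr.
have : (m * rn u) ^+ 2 <= g c x u u.
  by rewrite -(gnorm_sq u cx) ler_sqr ?nnegrE ?gnorm_ge0 ?mulr_ge0 ?rn_ge0 // ltW.
rewrite -expr2 -mulrA -exprMn => h1 h2.
have h3 : `|g c (chart_inv c z) u u - g c x u u| <= eta * g c x u u.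
  by apply: le_trans h2 _; rewrite ler_wpM2l // ltW.
have g1 := g_ge0 cx u; have g2 := g_ge0 cz u.
have E : eta * (1 + e) = e by rewrite divfK // gt_eqF.
have q0 : 0 <= (1 + e) ^+ 2 by rewrite sqr_ge0.
have K (A B : R) : 0 <= A -> 0 <= B -> A <= (1 + e) * B -> Num.sqrt A <= (1 + e) * Num.sqrt B.
  move=> A0 B0 AB; rewrite -[1 + e]ger0_norm ?(ltW e1) // -sqrtr_sqr -sqrtrM //.
  apply: ler_wsqrtr; apply: le_trans AB _; rewrite ler_wpM2r // expr2 ler_peMl ?(ltW e1) //.
  by rewrite lerDl ltW.
move: h3; rewrite ler_norml => /andP[h3 h4]; split; apply: K => //.
- have : eta * g c x u u <= e * g c x u u.
    by rewrite ler_wpM2r // ler_pdivrMr // ler_peMr ?(ltW e0) // lerDl (ltW e0).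
  by move: h4; clear; lra.
- have h5 : (1 - eta) * (1 + e) = 1 by rewrite mulrBl E; ring.
  rewrite [leLHS](_ : _ = (1 + e) * ((1 - eta) * g c x u u)); last first.
    by rewrite mulrA [_ * (1 - eta)]mulrC h5 mul1r.
  by rewrite ler_wpM2l ?(ltW e1) //; move: h3; clear; lra.
Qed.

End MetricNorm.

Section Preliminaries.
Context {R : realType}.

(** The set of points related to [x] is open by transitivity, and so is its complement, since the
    relation holds locally in both directions. *)
Lemma connected_class (T : topologicalType) (Q : T -> T -> Prop) :
  connected [set: T] -> (forall x, \forall y \near x, Q x y /\ Q y x) ->
  (forall x y z, Q x y -> Q y z -> Q x z) -> forall x y, Q x y.
Proof.
move=> cT near_Q Qtr x y.
pose B := [set y | Q x y].
have Bo : open B.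
  rewrite openE => z Bz; apply: filterS (near_Q z) => w [h _]; exact: Qtr Bz h.
have Bc : closed B.
  rewrite -[B]setCK; apply: open_closedC; rewrite openE => z nBz.
  by apply: filterS (near_Q z) => w [_ h] Bw; apply: nBz; exact: Qtr Bw h.
have B0 : B !=set0.
  by have [h _] := nbhs_singleton (near_Q x); exists x.
have E : B = setT by apply: (cT B B0); exists B; rewrite ?setTI.
by have : B y by rewrite E.
Qed.

(* The supremum of the [t] up to which the bound with constant [K + e] holds is [1]. *)
Lemma lipschitz_unit_interval (h : R -> R) (K : R) : 0 <= K ->
  (forall t e : R, 0 <= t <= 1 -> 0 < e -> exists2 d : R, 0 < d & forall s,
     `|s - t| < d -> `|h s - h t| <= (K + e) * `|s - t|) ->
  `|h 1 - h 0| <= K.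
Proof.
move=> K0 H; apply/ler_addgt0Pr => e e0.
pose P s := `|h s - h 0| <= (K + e) * s.
have Ke : 0 < K + e by rewrite ltr_wpDl.
pose A := [set t : R | 0 <= t <= 1 /\ forall s, 0 <= s <= t -> P s].
have A0 : A 0.
  split; first by rewrite lexx ler01.
  move=> s; rewrite -eq_le => /eqP <-; by rewrite /P subrr normr0 mulr0.
have uA : has_ubound A by exists 1 => t [/andP[]].
have hA : has_sup A by split; [exists 0|].
pose S := sup A.
have S0 : 0 <= S by exact: ub_le_sup.
have S1 : S <= 1 by apply: ge_sup; [exists 0|move=> t [/andP[]]].
have [d d0 hd] := H S e (ltac:(by rewrite S0 S1)) e0.
have PS0 s : 0 <= s < S -> P s.
  move=> /andP[s0 sS]; have [t [_ hP] st] : exists2 t, A t & s < t by apply: sup_gt => //; exists 0.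
  by apply: hP; rewrite s0 ltW.
have PS : P S.
  have [->|Sn0] := eqVneq S 0; first by rewrite /P subrr normr0 mulr0.
  have Sp : 0 < S by rewrite lt_neqAle eq_sym Sn0.
  have [t At St] := sup_adherent d0 hA; have [/andP[t0 t1] hP] := At.
  have tS : t <= S by exact: ub_le_sup uA _ At.
  have := hd t; rewrite distrC ger0_norm ?subr_ge0 // ltrBlDr addrC -ltrBlDr => /(_ St) h1.
  have := hP t; rewrite t0 lexx => /(_ isT) h2.
  rewrite /P -[h S](subrK (h t)) -addrA; apply: le_trans (ler_normD _ _) _.
  rewrite distrC; apply: le_trans (lerD h1 h2) _; rewrite -mulrDr subrK //.
have PS2 s : S < s -> s < S + d -> P s.
  move=> Ss sd; rewrite /P -[h s](subrK (h S)) -addrA; apply: le_trans (ler_normD _ _) _.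
  have := hd s; rewrite ger0_norm ?subr_ge0 ?(ltW Ss) // ltrBlDl => /(_ sd) h1.
  by apply: le_trans (lerD h1 PS) _; rewrite -mulrDr subrK.
have -> : K + e = (K + e) * 1 by rewrite mulr1.
suff -> : 1 = S by [].
apply/eqP; rewrite eq_le S1 andbT leNgt; apply/negP => S_lt1.
pose t := Num.min 1 (S + d / 2).
have d2 : 0 < d / 2 by exact: divr_gt0.
have St : S < t by rewrite /t lt_min S_lt1 ltrDl.
suff At : A t by have := ub_le_sup uA At; rewrite leNgt St.
have t1 : t <= 1 by rewrite /t ge_min lexx.
have td : t <= S + d / 2 by rewrite /t ge_min lexx orbT.
split; first by rewrite t1 (le_trans S0 (ltW St)).
move=> s /andP[s0 st]; have [sS|sS|->] := ltgtP s S => //; first by apply: PS0; rewrite s0.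
by apply: PS2 => //; apply: le_lt_trans (le_trans st td) _; rewrite ltrD2l; lra.
Qed.
End Preliminaries.

(** * Riemannian distance by duality with Lipschitz functions *)

Section Distance.
Context {R : realType} {n : nat} {X : complexManifold R n} {g : tensorField X}.
Hypothesis hg : hermitian_metric g.
Implicit Types (c : chart X) (x y : X) (f : X -> R).
Local Notation N := (@gnorm R n X g).

(** To first order at [x], the function is [K]-Lipschitz for the norm frozen at [x]. The error is a
    factor [1 + e] rather than a summand, so that constants simply multiply under composition. *)
Definition LB (K : R) c x f := forall e : R, 0 < e ->
  \forall y \near x, `|f y - f x| <= K * (1 + e) * N c x (chart_map c y - chart_map c x).

Lemma transfer (F : X -> X) c c' x (l : R) : chart_dom c x -> chart_dom c' (F x) ->
  differentiable (local_rep F c c') (chart_map c x) -> 0 < l ->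
  (forall u, N c' (F x) (tangent_map F c c' x u) = l * N c x u) ->
  forall e : R, 0 < e -> \forall y \near x,
    N c' (F x) (chart_map c' (F y) - chart_map c' (F x)) <=
    (1 + e) * l * N c x (chart_map c y - chart_map c x).
Proof.
move=> cx cx' dF l0 hN e e0; apply: (near_chart cx).
have [C C0 hC] := gnorm_upper hg cx'; have [m m0 hm] := gnorm_lower hg cx.
have e1 : 0 < e * l * m / C by rewrite divr_gt0 // !mulr_gt0.
have [d d0 hd] := diff_rn dF e1; have [r r0 hr] := chart_ball cx.
exists (Num.min d r); first by rewrite lt_min d0.
move=> z; rewrite lt_min => /andP[zd zr]; have [cz hz] := chart_imageK (hr z zr).
rewrite hz; set h := z - chart_map c x; have := hd h zd.
have -> : chart_map c x + h = z by rewrite /h addrC subrK.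
rewrite /local_rep /= chart_mapK // -/(local_rep F c c').
set D := chart_map c' _ - _ => hD.
have E : D = tangent_map F c c' x h + (D - tangent_map F c c' x h).
  by rewrite addrC subrK.
rewrite E; apply: le_trans (gnormD hg _ _ cx') _; rewrite hN.
apply: (@le_trans _ _ (l * N c x h + C * (e * l * m / C * rn h))).
  by rewrite lerD2l; apply: le_trans (hC _) _; rewrite ler_wpM2l // ltW.
rewrite (_ : C * _ = e * l * (m * rn h)); last by field; rewrite gt_eqF.
have : e * l * (m * rn h) <= e * l * N c x h by rewrite ler_wpM2l // mulr_ge0 // ltW.
by move: (N c x h) (e * l * (m * rn h)) => A B; lra.
Qed.

Lemma LB_comp (F : X -> X) c c' x (l K : R) f : chart_dom c x -> chart_dom c' (F x) ->
  {for x, continuous F} ->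
  differentiable (local_rep F c c') (chart_map c x) -> 0 < l -> 0 < K ->
  (forall u, N c' (F x) (tangent_map F c c' x u) = l * N c x u) ->
  LB K c' (F x) f -> LB (K * l) c x (f \o F).
Proof.
move=> cx cx' cF dF l0 K0 hN hf e e0.
pose e1 := Num.min 1 (e / 3); have e10 : 0 < e1 by rewrite lt_min ltr01 divr_gt0.
have e1s : (1 + e1) * (1 + e1) <= 1 + e.
  have h1 : e1 <= 1 by rewrite ge_min lexx.
  have h2 : e1 <= e / 3 by rewrite ge_min lexx orbT.
  have : e1 * e1 <= e1 by rewrite ler_piMl // ltW.
  by move: h1 h2; nra.
have H1 : \forall y \near x, `|f (F y) - f (F x)| <= K * (1 + e1) *
    N c' (F x) (chart_map c' (F y) - chart_map c' (F x)) by exact: cF (hf e1 e10).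
have H2 := transfer cx cx' dF l0 hN e10.
apply: filterS (filterI H1 H2) => y [h1 h2]; apply: le_trans h1 _.
have a0 : 0 <= K * (1 + e1) by rewrite mulr_ge0 ?addr_ge0 ?ler01 // ltW.
apply: le_trans (ler_wpM2l a0 h2) _.
rewrite [leLHS](_ : _ = K * l * ((1 + e1) * (1 + e1)) * N c x (chart_map c y - chart_map c x)); last by ring.
by rewrite ler_wpM2r ?gnorm_ge0 // ler_wpM2l // ltW // mulr_gt0.
Qed.

(* Infinitesimally 1-Lipschitz functions. They define the Riemannian distance by duality, so that no curves are needed. *)
Definition FF f := forall c x, chart_dom c x -> LB 1 c x f.

Lemma gnorm_tensor c c' x u : chart_dom c x -> chart_dom c' x ->
  N c' x (tangent_map id c c' x u) = N c x u.
Proof. by move=> cx cx'; rewrite /gnorm (hermitian_tensor hg cx cx' I). Qed.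

(** One chart at each point suffices: a change of charts is an isometry of the tangent norms, and
    [LB_comp] for the identity transfers the estimate. *)
Lemma FF_of f : (forall x, exists2 c, chart_dom c x & LB 1 c x f) -> FF f.
Proof.
move=> H c x cx; have [c' cx' hf] := H x.
have -> : 1 = 1 * 1 :> R by rewrite mulr1.
have dF := @transition_holomorphic R n X c c' x cx cx'.
have hN u : N c' x (tangent_map id c c' x u) = 1 * N c x u by rewrite gnorm_tensor // mul1r.
exact: (@LB_comp id c c' x 1 1 f cx cx' (@cvg_id _ (nbhs x)) dF ltr01 ltr01 hN hf).
Qed.

Definition homothety (l : R) (F : X -> X) := [/\ holomorphic F, 0 < l &
  pullback_scaled F g (cst (l ^+ 2)) g].

Lemma homothety_N l F c c' x u : homothety l F -> chart_dom c x -> chart_dom c' (F x) ->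
  N c' (F x) (tangent_map F c c' x u) = l * N c x u.
Proof.
move=> [_ l0 hF] cx cx'; rewrite /gnorm (hF c c' x cx cx') /cst sqrtrM ?sqr_ge0 //.
by rewrite sqrtr_sqr gtr0_norm.
Qed.

Lemma FF_comp l F f : homothety l F -> FF f -> FF (fun x => l^-1 * f (F x)).
Proof.
move=> hF hf; have [[cF dF] l0 _] := hF.
move=> c x cx e e0; have [c' cx'] := chart_cover (F x).
have := @LB_comp F c c' x l 1 f cx cx' (cF x) (dF c c' x cx cx') l0 ltr01
  (fun u => homothety_N u hF cx cx') (hf c' (F x) cx') e e0.
apply: filterS => y; rewrite /= mul1r => h.
rewrite -mulrBr normrM gtr0_norm ?invr_gt0 // ler_pdivrMl //.
by apply: le_trans h _; rewrite !mulrA mulr1.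
Qed.

Lemma FFN f : FF f -> FF (fun x => - f x).
Proof.
move=> hf c x cx e e0; apply: filterS (hf c x cx e e0) => y.
by rewrite -opprD normrN.
Qed.

Lemma FF0 : FF (fun _ => 0).
Proof.
move=> c x cx e e0; apply: nearW => y; rewrite subrr normr0 !mulr_ge0 ?gnorm_ge0 //.
by rewrite addr_ge0 // ltW.
Qed.

Lemma convex_identity (a b p t : R[i]) :
  a + t * (b - a) - p = (1 - t) * (a - p) + t * (b - p).
Proof. ring. Qed.

(** In a chart ball where the norms are comparable to the norm at the center, a function of [FF] is
    followed along the straight segment; its pointwise Lipschitz bound integrates by
    [lipschitz_unit_interval]. The constants are common to all of [FF]. *)
Lemma FF_chart c x : chart_dom c x -> exists C r : R, [/\ 0 < C, 0 < r &
  forall z, rn (z - chart_map c x) < r ->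
    [/\ chart_dom c (chart_inv c z), chart_map c (chart_inv c z) = z,
      (forall u, N c (chart_inv c z) u <= C * rn u) &
      forall f z', FF f -> rn (z' - chart_map c x) < r ->
        `|f (chart_inv c z') - f (chart_inv c z)| <= C * rn (z' - z)]].
Proof.
move=> cx; have [C C0 hC] := gnorm_upper hg cx.
have [r r0 hr] := gnorm_ratio hg cx (ltr01 : (0 : R) < 1).
have C2 : 0 < 2 * C by rewrite mulr_gt0.
have HC z u : rn (z - chart_map c x) < r -> N c (chart_inv c z) u <= 2 * C * rn u.
  move=> hz; have [_ _ /(_ u) [h _]] := hr z hz; apply: le_trans h _.
  by rewrite -mulrA (_ : 1 + 1 = 2) // ler_wpM2l.
exists (2 * C), r; split => // z hz; have [cz Kz _] := hr z hz; split => //.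
  by move=> u; exact: HC.
move=> f z' hf hz'.
pose w (t : R) : Cspace R n := z + t%:C *: (z' - z).
have wb t : 0 <= t <= 1 -> rn (w t - chart_map c x) < r.
  move=> /andP[t0 t1].
  have -> : w t - chart_map c x = (1 - t)%:C *: (z - chart_map c x) + t%:C *: (z' - chart_map c x).
    by apply/rowP => j; rewrite !mxE rmorphB rmorph1; exact: convex_identity.
  apply: le_lt_trans (rnD _ _) _; rewrite !rnZ !rn_real !ger0_norm ?subr_ge0 //.
  have [->|t1'] := eqVneq t 1; first by rewrite subrr mul0r add0r mul1r.
  have t2 : 0 < 1 - t by rewrite subr_gt0 lt_neqAle t1'.
  have : (1 - t) * rn (z - chart_map c x) < (1 - t) * r by rewrite ltr_pM2l.
  have : t * rn (z' - chart_map c x) <= t * r by rewrite ler_wpM2l // ltW.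
  by move: (_ * rn _) (_ * rn _) => A B; lra.
have w0 : w 0 = z by apply/rowP => j; rewrite !mxE rmorph0 mul0r addr0.
have w1 : w 1 = z' by apply/rowP => j; rewrite !mxE rmorph1 mul1r addrC subrK.
have ww s t : w s - w t = (s - t)%:C *: (z' - z).
  by apply/rowP => j; rewrite !mxE rmorphB; ring.
rewrite -{1}w0 -{1}w1; set B := 2 * C * rn (z' - z).
have B0 : 0 <= B by rewrite mulr_ge0 ?rn_ge0 // ltW.
apply: (@lipschitz_unit_interval R (fun t => f (chart_inv c (w t))) B B0) => t e t01 e0.
have wt := wb t t01; have [cw Kw _] := hr (w t) wt.
have e1 : 0 < e / (B + 1) by rewrite divr_gt0 // ltr_wpDl.
have [d d0 hd] := near_chart_inv cw (hf c _ cw _ e1).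
rewrite Kw in hd.
have L0 : 0 < rn (z' - z) + 1 by rewrite ltr_wpDl // rn_ge0.
exists (d / (rn (z' - z) + 1)); first exact: divr_gt0.
move=> s hs; have hws : rn (w s - w t) < d.
  rewrite ww rnZ rn_real; apply: le_lt_trans (_ : _ <= `|s - t| * (rn (z' - z) + 1)) _.
    by rewrite ler_wpM2l // lerDl.
  by rewrite -ltr_pdivlMr.
have [_ Ks] := hd (w s) hws; rewrite Ks => h; apply: le_trans h _.
apply: (@le_trans _ _ (1 * (1 + e / (B + 1)) * (2 * C * rn (w s - w t)))).
  rewrite ler_wpM2l ?HC // mul1r addr_ge0 // ltW //.
rewrite ww rnZ rn_real mul1r (_ : _ * _ = (1 + e / (B + 1)) * B * `|s - t|); last by rewrite /B; ring.
rewrite ler_wpM2r // mulrDl mul1r lerD2l mulrAC ler_pdivrMr ?ltr_wpDl //.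
by rewrite ler_wpM2l ?(ltW e0) // lerDl.
Qed.

Section Connected.
Hypothesis Xc : connected [set: X].

(** Finiteness of the supremum that defines the distance: local bounds from [FF_chart] are chained
    by connectedness. *)
Lemma FF_bound x y : exists M : R, forall f, FF f -> `|f y - f x| <= M.
Proof.
move: x y; apply: (connected_class Xc) => [x|x y z [M hM] [M' hM']].
  have [c cx] := chart_cover x; have [C [r [C0 r0 hr]]] := FF_chart cx.
  have hx : rn (chart_map c x - chart_map c x) < r by rewrite subrr rn0.
  apply: (near_chart cx); exists r => // z hz.
  have [_ _ _ H] := hr _ hx; split; exists (C * rn (z - chart_map c x)) => f hf.
    by have := H f z hf hz; rewrite chart_mapK.
  by have := H f z hf hz; rewrite chart_mapK // distrC.
exists (M' + M) => f hf; rewrite -[f z](subrK (f y)) -addrA.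
by apply: le_trans (ler_normD _ _) _; apply: lerD; [exact: hM'|exact: hM].
Qed.

Definition dist x y : R := sup [set t : R | exists2 f, FF f & t = f y - f x].

Lemma dist_le x y (M : R) : (forall f, FF f -> f y - f x <= M) -> dist x y <= M.
Proof.
move=> H; apply: ge_sup; first by exists 0, (fun _ => 0); [exact: FF0|rewrite subrr].
by move=> _ [f hf ->]; exact: H.
Qed.

Lemma le_dist x y f : FF f -> f y - f x <= dist x y.
Proof.
move=> hf; apply: ub_le_sup; last by exists f.
have [M hM] := FF_bound x y; exists M => _ [k hk ->].
by apply: le_trans (ler_norm _) (hM k hk).
Qed.

Lemma le_dist_abs x y f : FF f -> `|f y - f x| <= dist x y.
Proof.
move=> hf; rewrite ler_norml le_dist // andbT lerNl.
by apply: le_trans (le_dist x y (FFN hf)); rewrite opprB opprK addrC.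
Qed.

Lemma dist_ge0 x y : 0 <= dist x y.
Proof. by apply: le_trans (le_dist x y FF0); rewrite subrr. Qed.

Lemma distxx x : dist x x = 0.
Proof.
by apply/eqP; rewrite eq_le dist_ge0 andbT; apply: dist_le => f _; rewrite subrr.
Qed.

Lemma distC x y : dist x y = dist y x.
Proof.
suff H a b : dist a b <= dist b a by apply/eqP; rewrite eq_le !H.
apply: dist_le => f hf.
by apply: le_trans (le_dist b a (FFN hf)); rewrite opprK addrC.
Qed.

Lemma dist_triangle y x z : dist x z <= dist x y + dist y z.
Proof.
apply: dist_le => f hf; rewrite -[f z](subrK (f y)) -addrA addrC.
by apply: lerD; exact: le_dist.
Qed.

Lemma dist_homothety l F x y : homothety l F -> dist (F x) (F y) <= l * dist x y.
Proof.
move=> hF; have [_ l0 _] := hF; apply: dist_le => f hf.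
by have := le_dist x y (FF_comp hF hf); rewrite -mulrBr ler_pdivrMl.
Qed.

Lemma dist_chart c x : chart_dom c x -> exists C r : R, [/\ 0 < C, 0 < r &
  forall z, rn (z - chart_map c x) < r ->
    [/\ chart_dom c (chart_inv c z), chart_map c (chart_inv c z) = z,
      (forall u, N c (chart_inv c z) u <= C * rn u) &
      forall z', rn (z' - chart_map c x) < r ->
        dist (chart_inv c z) (chart_inv c z') <= C * rn (z' - z)]].
Proof.
move=> cx; have [C [r [C0 r0 hr]]] := FF_chart cx; exists C, r; split=> // z hz.
have [h1 h2 h3 h4] := hr z hz; split=> // z' hz'; apply: dist_le => f hf.
by apply: le_trans (ler_norm _) (h4 f z' hf hz').
Qed.

Lemma near_dist x (e : R) : 0 < e -> \forall y \near x, dist x y < e.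
Proof.
move=> e0; have [c cx] := chart_cover x; have [C [r [C0 r0 hr]]] := dist_chart cx.
apply: (near_chart cx); exists (Num.min r (e / C)); first by rewrite lt_min r0 divr_gt0.
move=> z; rewrite lt_min => /andP[zr ze].
have [_ _ _] := hr (chart_map c x) (ltac:(by rewrite subrr rn0)).
rewrite chart_mapK // => /(_ z zr) h; apply: le_lt_trans h _.
by rewrite mulrC -ltr_pdivlMr.
Qed.

(** A bump supported in a chart, extended by 0, belongs to [FF] after scaling. It shows that the
    distance separates a point from the complement of a neighborhood, and it is the function
    averaged later over the group. *)
Lemma dist_bump c x (U : set X) : chart_dom c x -> nbhs x U -> exists chi (b : Cspace R n -> R) (k : R),
  [/\ Cinfty setT b, 0 < k, FF (fun y => k * chi y), 0 < chi x & forall y,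
   [/\ 0 <= chi y, chart_dom c y -> chi y = b (chart_map c y) &
   chi y != 0 -> U y /\ chart_dom c y]].
Proof.
move=> cx Ux.
have [m m0 hm] := gnorm_lower hg cx.
have [r r0 hr] := gnorm_ratio hg cx (ltr01 : (0 : R) < 1).
have [d d0 hd] := near_chart_inv cx Ux.
pose s := Num.min r d / 2.
have rd0 : 0 < Num.min r d by rewrite lt_min r0.
have s0 : 0 < s by exact: divr_gt0.
have s_rd : s < Num.min r d by rewrite /s ltr_pdivrMr // mulr_natr mulr2n ltrDl.
have [b [bC b0 bx bs [K K0 hK]]] := bump_exists (chart_map c x) s0.
pose chi y := if `[< chart_dom c y >] then b (chart_map c y) else 0.
have chiE y : chart_dom c y -> chi y = b (chart_map c y) by move=> cy; rewrite /chi asboolT.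
have chi0 y : chi y != 0 -> chart_dom c y /\ rn (chart_map c y - chart_map c x) < s.
  rewrite /chi; case: asboolP => [cy by0|]; last by rewrite eqxx.
  by split=> //; rewrite ltNge; apply: contra by0 => /bs ->.
(* Near [x] the norm is at least [m / 2] times [rn], and the bump is [K]-Lipschitz for [rn]; so [k]
   times the bump is 1-Lipschitz for the metric. *)
pose k := m / 2 / K; have k0 : 0 < k by rewrite !divr_gt0.
exists chi, b, k; split => //.
- apply: FF_of => y.
  pose A := [set z : Cspace R n | rn (z - chart_map c x) <= s].
  have [[cy hy]|ny] := pselect (chart_dom c y /\ rn (chart_map c y - chart_map c x) <= s).
    exists c => // e e0; apply: (near_chart cy).
    have hy' : rn (chart_map c y - chart_map c x) < r.
      by apply: le_lt_trans hy (lt_le_trans s_rd _); rewrite ge_min lexx.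
    have [q q0 hq] := chart_ball cy; exists q => // z zq.
    have [cz Kz] := chart_imageK (hq z zq).
    rewrite !chiE // Kz -mulrBr normrM gtr0_norm //.
    apply: le_trans (ler_wpM2l (ltW k0) (hK _ _)) _.
    have [_ _ /(_ (z - chart_map c y)) [_ h]] := hr _ hy'; rewrite chart_mapK // in h.
    have h2 := hm (z - chart_map c y).
    apply: (@le_trans _ _ (1 * (1 + 0) * N c y (z - chart_map c y))); last first.
      by rewrite ler_wpM2r ?gnorm_ge0 // !mul1r lerD2l ltW.
    rewrite addr0 !mul1r mulrA (_ : k * K = m / 2); last by rewrite /k divfK // gt_eqF.
    by move: h h2; move: (N c x _) (N c y _) => a b'; lra.
  have [c' cy'] := chart_cover y; exists c' => // e e0.
  (* The closed coordinate ball is compact, hence closed in the Hausdorff space [X]: off it the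
     extension by 0 vanishes on a whole neighborhood. *)
  have cl : \forall y' \near y, chi y' = 0.
    have cpt : compact (chart_inv c @` A).
      apply: continuous_compact; last exact: compact_rn_ball.
      apply: continuous_in_subspaceT => z; rewrite inE /A /= => hz.
      have zr : rn (z - chart_map c x) < r.
        by apply: le_lt_trans hz (lt_le_trans s_rd _); rewrite ge_min lexx.
      have [cz Kz _] := hr z zr; rewrite -{1}Kz; exact: (@chart_inv_continuous R n X c).
    have := compact_closed (@space_hausdorff R n X) cpt.
    rewrite -openC openE => /(_ y) H.
    have : nbhs y (~` [set chart_inv c x | x in A]).
      apply: H => -[z Az zy]; apply: ny.
      have zr : rn (z - chart_map c x) < r.
        by apply: le_lt_trans Az (lt_le_trans s_rd _); rewrite ge_min lexx.
      by have [cz Kz _] := hr z zr; rewrite -zy Kz.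
    apply: filterS => y' ny'; apply/eqP; apply: contra_notT ny' => /chi0 [cy2 hy2].
    by exists (chart_map c y'); [exact: ltW|rewrite chart_mapK].
  have y0 : chi y = 0 by exact: nbhs_singleton cl.
  apply: filterS cl => y' ->; rewrite y0 mulr0 subrr normr0.
  by rewrite !mulr_ge0 ?gnorm_ge0 // addr_ge0 // ltW.
- by rewrite chiE.
move=> y; split; [by rewrite /chi; case: asboolP|exact: chiE|].
move=> /chi0 [cy hy]; split=> //.
have yd : rn (chart_map c y - chart_map c x) < d.
  by apply: lt_trans hy (lt_le_trans s_rd _); rewrite ge_min lexx orbT.
by have [_ _] := hd _ yd; rewrite chart_mapK.
Qed.

(** The distance induces the topology: near [x] it is small by the chart estimate, and off [U] it is
    at least [k * chi x], because the bump vanishes there. *)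
Lemma nbhs_distP x (U : set X) : nbhs x U <-> exists2 r : R, 0 < r & forall y, dist x y < r -> U y.
Proof.
split=> [Ux|[r r0 hr]]; last by apply: filterS (near_dist x r0) => y; exact: hr.
have [c cx] := chart_cover x.
have [chi [b [k [_ k0 kF chix H]]]] := dist_bump cx Ux.
exists (k * chi x); first exact: mulr_gt0.
move=> y hy; have [_ _ Hy] := H y; have [chi0|/eqP] := boolP (chi y == 0); last by move/eqP/Hy => [].
exfalso; move: hy; rewrite ltNge; move/negP; apply.
by rewrite distC; apply: le_trans (le_dist y x kF); rewrite (eqP chi0) mulr0 subr0.
Qed.

Lemma dist_continuous x : continuous (dist x).
Proof.
move=> y; apply/cvgrPdist_lt => e e0.
apply: filterS (near_dist y e0) => z hz.
have h1 := dist_triangle y x z; have h2 := dist_triangle z x y.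
rewrite (distC z y) in h2; rewrite ltr_norml; apply/andP; split; lra.
Qed.

End Connected.
End Distance.

Lemma sub_split (V : zmodType) (a b c : V) : a - c = (a - b) + (b - c).
Proof. by rewrite addrA subrK. Qed.

Section Calculus.
Context {R : realType}.

Lemma diff_near_eq n m (f h : Cspace R n -> Cspace R m) (z : Cspace R n) (d : R) : 0 < d ->
  (forall z', rn (z' - z) < d -> f z' = h z') -> differentiable f z ->
  differentiable h z /\ forall v, 'd h z v = 'd f z v.
Proof.
move=> d0 fh df; have [C C0 hC] := diff_bound df.
apply: (@rn_diff R _ _ h z ('d f z) C hC) => e e0.
have [r r0 hr] := diff_rn df e0; exists (Num.min d r); first by rewrite lt_min d0.
move=> v; rewrite lt_min => /andP[vd vr].
rewrite -!fh; first exact: hr.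
- by rewrite subrr rn0.
- by rewrite [z + v]addrC addrK.
Qed.

Lemma diff_comp_rn n m p (f : Cspace R n -> Cspace R m) (h : Cspace R m -> Cspace R p) z :
  differentiable f z -> differentiable h (f z) ->
  differentiable (fun z => h (f z)) z /\ forall v, 'd (fun z => h (f z)) z v = 'd h (f z) ('d f z v).
Proof.
move=> df dh; have [C C0 hC] := diff_bound df; have [K K0 hK] := diff_bound dh.
have lin : linear (fun v => 'd h (f z) ('d f z v)).
  by move=> a u v; rewrite linearP (linearP ('d h (f z))).
apply: (@rn_diff_lin R _ _ (fun z => h (f z)) z _ (K * C) lin) => [v|e e0].
  by apply: le_trans (hK _) _; rewrite -mulrA ler_wpM2l // ltW.
pose e1 := e / (K + C + 1).
have S0 : 0 < K + C + 1 by rewrite !addr_gt0.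
have e10 : 0 < e1 by exact: divr_gt0.
have [r r0 hr] := diff_rn df (ltac:(by rewrite lt_min ltr01 e10) : 0 < Num.min 1 e1).
have [s s0 hs] := diff_rn dh e10.
have C1 : 0 < C + 1 by rewrite addr_gt0.
exists (Num.min r (s / (C + 1))); first by rewrite lt_min r0 divr_gt0.
move=> v; rewrite lt_min => /andP[vr vs].
have hv := hr v vr; set k := f (z + v) - f z in hv.
have m1 : Num.min 1 e1 <= 1 by rewrite ge_min lexx.
have m2 : Num.min 1 e1 <= e1 by rewrite ge_min lexx orbT.
have kv : rn k <= (C + 1) * rn v.
  rewrite -[k](subrK ('d f z v)); apply: le_trans (rnD _ _) _.
  rewrite mulrDl mul1r addrC; apply: lerD (hC v) _; apply: le_trans hv _.
  by rewrite ler_piMl // rn_ge0.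
have ks : rn k < s by apply: le_lt_trans kv _; rewrite mulrC -ltr_pdivlMr.
have := hs k ks; have -> : f z + k = f (z + v) by rewrite /k [f z + _]addrC subrK.
move=> h1; set A := h _ - h _ in h1 *.
have -> : A - 'd h (f z) ('d f z v) = (A - 'd h (f z) k) + 'd h (f z) (k - 'd f z v).
  have -> : 'd h (f z) (k - 'd f z v) = 'd h (f z) k - 'd h (f z) ('d f z v) by exact: linearB.
  exact: sub_split.
apply: le_trans (rnD _ _) _.
apply: le_trans (lerD h1 (hK _)) _.
have hv2 : rn (k - 'd f z v) <= e1 * rn v by apply: le_trans hv _; rewrite ler_wpM2r ?rn_ge0.
apply: (@le_trans _ _ (e1 * ((C + 1) * rn v) + K * (e1 * rn v))).
  by apply: lerD; rewrite ler_wpM2l // ltW.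
rewrite (_ : _ + _ = e1 * (K + C + 1) * rn v); last by ring.
by rewrite /e1 divfK // gt_eqF.
Qed.

Lemma tangent_comp n m p (X : complexManifold R n) (Y : complexManifold R m)
    (Z : complexManifold R p) (F : X -> Y) (G : Y -> Z) c c' c'' x :
  chart_dom c x -> chart_dom c' (F x) -> {for x, continuous F} ->
  differentiable (local_rep F c c') (chart_map c x) ->
  differentiable (local_rep G c' c'') (chart_map c' (F x)) ->
  differentiable (local_rep (G \o F) c c'') (chart_map c x) /\
  forall u, tangent_map (G \o F) c c'' x u = tangent_map G c' c'' (F x) (tangent_map F c c' x u).
Proof.
move=> cx cx' cF dF dG.
have E0 : local_rep F c c' (chart_map c x) = chart_map c' (F x).
  by rewrite /local_rep /= chart_mapK.
have N1 : \forall y \near x, chart_dom c' (F y).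
  by apply: cF; apply: open_nbhs_nbhs; split=> //; exact: chart_dom_open.
have [d d0 hd] := near_chart_inv cx N1.
rewrite -E0 in dG; have [D1 D2] := diff_comp_rn dF dG.
have E z : rn (z - chart_map c x) < d ->
    local_rep G c' c'' (local_rep F c c' z) = local_rep (G \o F) c c'' z.
  by move=> /hd [_ _ h]; rewrite /local_rep /= chart_mapK.
have [D3 D4] := diff_near_eq d0 E D1.
split; first exact: D3.
move=> u; apply: (etrans (D4 u)); apply: (etrans (D2 u)); by rewrite E0.
Qed.

Lemma holomorphic_comp n m p (X : complexManifold R n) (Y : complexManifold R m)
    (Z : complexManifold R p) (F : X -> Y) (G : Y -> Z) :
  holomorphic F -> holomorphic G -> holomorphic (G \o F).
Proof.
move=> [cF dF] [cG dG]; split; first by move=> x; apply: continuous_comp; [exact: cF|exact: cG].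
move=> c c'' x cx cx''; have [c' cx'] := chart_cover (F x).
by have [] := tangent_comp cx cx' (cF x) (dF c c' x cx cx') (dG c' c'' (F x) cx' cx'').
Qed.

Lemma holomorphic_id n (X : complexManifold R n) : holomorphic (@id X).
Proof.
split; first by move=> x; exact: cvg_id.
by move=> c c' x cx cx'; exact: (@transition_holomorphic R n X c c' x cx cx').
Qed.

Lemma biholomorphic_id n (X : complexManifold R n) : biholomorphic (@id X).
Proof. by split; [exact: holomorphic_id|exists id; split => //; exact: holomorphic_id]. Qed.

Lemma biholomorphic_comp n (X Y Z : complexManifold R n) (F : X -> Y) (G : Y -> Z) :
  biholomorphic F -> biholomorphic G -> biholomorphic (G \o F).
Proof.
move=> [hF [F' [hF' FK KF]]] [hG [G' [hG' GK KG]]].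
split; first exact: holomorphic_comp.
by exists (F' \o G'); split; [exact: holomorphic_comp|exact: can_comp|exact: can_comp].
Qed.

Lemma pullback_id n (X : complexManifold R n) (g : tensorField X) : hermitian_metric g ->
  pullback_scaled id g (cst 1) g.
Proof.
by move=> hg c c' x cx cx' u v; rewrite mul1r; exact: (hermitian_tensor hg cx cx' I).
Qed.

Lemma pullback_comp n (X Y Z : complexManifold R n) (F : X -> Y) (G : Y -> Z)
    (gX : tensorField X) (gY : tensorField Y) (gZ : tensorField Z) a b :
  holomorphic F -> holomorphic G -> pullback_scaled F gY a gX -> pullback_scaled G gZ b gY ->
  pullback_scaled (G \o F) gZ (fun x => a x * b (F x)) gX.
Proof.
move=> [cF dF] [cG dG] pF pG c c'' x cx cx'' u v; have [c' cx'] := chart_cover (F x).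
have [_ E] := tangent_comp cx cx' (cF x) (dF c c' x cx cx') (dG c' c'' (F x) cx' cx'').
rewrite !E [LHS](pG c' c'' (F x) cx' cx'') (pF c c' x cx cx').
by rewrite mulrCA mulrA.
Qed.

Lemma pullback_inv n (X : complexManifold R n) (F G : X -> X) (g : tensorField X) a :
  hermitian_metric g -> holomorphic F -> holomorphic G -> cancel G F ->
  (forall x, 0 < a x) -> pullback_scaled F g a g ->
  pullback_scaled G g (fun x => (a (G x))^-1) g.
Proof.
move=> hg hF hG GK a0 pF c c' x cx cx' u v.
have [cG dG] := hG; have [cF dF] := hF.
have cx2 : chart_dom c (F (G x)) by rewrite GK.
have [_ E] := tangent_comp cx cx' (cG x) (dG c c' x cx cx') (dF c' c (G x) cx' cx2).
have := pF c' c (G x) cx' cx2 (tangent_map G c c' x u) (tangent_map G c c' x v).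
rewrite -!E GK (_ : F \o G = id); last by apply/funext => y; exact: GK.
rewrite (hermitian_tensor hg cx cx I) => ->.
by rewrite mulKf // gt_eqF.
Qed.

End Calculus.

(** * Homotheties, compact balls and finite nets *)

Section Homotheties.
Context {R : realType} {n : nat} {X : complexManifold R n} {g : tensorField X}.
Hypothesis hg : hermitian_metric g.
Local Notation homothety := (@homothety R n X g).
Local Notation dist := (@dist R n X g).

Lemma homothety_id : homothety 1 id.
Proof.
by split=> //; [exact: holomorphic_id|rewrite expr1n; exact: pullback_id].
Qed.

Lemma homothety_comp l l' F G : homothety l F -> homothety l' G -> homothety (l * l') (G \o F).
Proof.
move=> [hF l0 pF] [hG l0' pG]; split; [exact: holomorphic_comp|exact: mulr_gt0|].
have := pullback_comp hF hG pF pG; congr (pullback_scaled _ _ _ _).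
by apply/funext => x; rewrite /cst exprMn.
Qed.

Lemma homothety_inv l F G : homothety l F -> holomorphic G -> cancel G F -> homothety l^-1 G.
Proof.
move=> [hF l0 pF] hG GK; split=> //; first by rewrite invr_gt0.
have := pullback_inv hg hF hG GK (fun _ => exprn_gt0 2 l0) pF.
by congr (pullback_scaled _ _ _ _); apply/funext => x; rewrite /cst exprVn.
Qed.

Hypothesis Xc : connected [set: X].

Lemma dist_homothety_eq l F G x y : homothety l F -> holomorphic G -> cancel F G -> cancel G F ->
  dist (F x) (F y) = l * dist x y.
Proof.
move=> hF hG FK GK; apply/eqP; rewrite eq_le (dist_homothety hg Xc) //=.
have := @dist_homothety R n X g hg Xc l^-1 G (F x) (F y) (homothety_inv hF hG GK).
by have [_ l0 _] := hF; rewrite !FK ler_pdivlMl.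
Qed.

Definition ball_cpt x (r : R) := compact [set y | dist x y <= r].

Lemma closed_dist_ball x (r : R) : closed [set y | dist x y <= r].
Proof.
apply: (@preimage_closed _ _ (dist x) [set t | t <= r]) => [y _|]; last exact: closed_le.
exact: dist_continuous.
Qed.

Lemma ball_cpt_le x y (r s : R) : dist y x + s <= r -> ball_cpt y r -> ball_cpt x s.
Proof.
move=> h cy; apply: subclosed_compact cy _; first exact: closed_dist_ball.
move=> z /= hz; apply: le_trans (dist_triangle hg Xc x y z) _.
by apply: le_trans h; rewrite lerD2l.
Qed.

Lemma ball_cpt_small x : exists2 r : R, 0 < r & ball_cpt x r.
Proof.
have [c cx] := chart_cover x; have [d d0 hd] := chart_ball cx.
pose A := [set z : Cspace R n | rn (z - chart_map c x) <= d / 2].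
have d2 : d / 2 < d by rewrite ltr_pdivrMr // mulr_natr mulr2n ltrDl.
have d20 : 0 < d / 2 by exact: divr_gt0.
have zd z : A z -> rn (z - chart_map c x) < d by move=> h; apply: le_lt_trans h d2.
have cA : compact (chart_inv c @` A).
  apply: continuous_compact; last exact: compact_rn_ball.
  apply: continuous_in_subspaceT => z; rewrite inE => /zd hz.
  by have [cz Kz] := chart_imageK (hd z hz); rewrite -{1}Kz; exact: (@chart_inv_continuous R n X c).
have nA : nbhs x (chart_inv c @` A).
  apply: (near_chart cx); exists (d / 2) => // z hz; exists z => //; exact: ltW.
have [r r0 hr] := (nbhs_distP hg Xc x _).1 nA.
exists (r / 2); first exact: divr_gt0.
apply: subclosed_compact cA _; first exact: closed_dist_ball.
by move=> y /= hy; apply: hr; apply: le_lt_trans hy _; rewrite ltr_pdivrMr // mulr_natr mulr2n ltrDl.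
Qed.

Lemma ball_cpt_homothety l F G x (r : R) : homothety l F -> holomorphic G -> cancel F G ->
  cancel G F -> ball_cpt x r -> ball_cpt (F x) (l * r).
Proof.
move=> hF hG FK GK cx; have [[cF _] l0 _] := hF.
have E : [set y | dist (F x) y <= l * r] = F @` [set y | dist x y <= r].
  apply/seteqP; split=> [y hy|_ [y hy <-]] /=.
    exists (G y); last exact: GK.
    by move: hy => /=; rewrite -{1}(GK y) (dist_homothety_eq _ _ hF hG FK GK) ler_pM2l.
  by rewrite (dist_homothety_eq _ _ hF hG FK GK) ler_pM2l.
rewrite /ball_cpt E; apply: continuous_compact => //.
exact: continuous_subspaceT.
Qed.

(** If no finite net existed, the sets of points at distance at least [e] from a finite set would
    generate a proper filter on [K], and a cluster point of it would be far from itself. *)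
Lemma compact_net (K : set X) (e : R) : 0 < e -> compact K ->
  exists2 s : seq X, (forall z, z \in s -> K z) &
    forall y, K y -> exists2 z, z \in s & dist z y < e.
Proof.
move=> e0 cK; apply: contrapT => nex.
pose D := [set s : seq X | forall z, z \in s -> K z].
pose far (s : seq X) := [set y | K y /\ forall z, z \in s -> e <= dist z y].
have far0 s : D s -> far s !=set0.
  move=> Ds; apply: contrapT => h; apply: nex; exists s => // y Ky; apply: contrapT => h'.
  apply: h; exists y; split=> // z zs; rewrite leNgt; apply/negP => h2; apply: h'; by exists z.
pose FF := filter_from D far.
have FP : ProperFilter FF.
  apply: filter_from_proper => //.
  apply: filter_from_filter; first by exists [::].
  move=> s t Ds Dt; exists (s ++ t).
    by move=> z; rewrite mem_cat => /orP[/Ds|/Dt].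
  move=> y [Ky h]; split; split => // z zs; by apply: h; rewrite mem_cat zs ?orbT.
have FK : FF K by exists [::] => // y [].
have [y [Ky hy]] := cK FF FP FK.
have Fy : FF (far [:: y]) by exists [:: y] => // z; rewrite inE => /eqP ->.
have [z [[Kz hz] zy]] := hy _ _ Fy (near_dist hg y e0).
by have := hz y (mem_head _ _); rewrite leNgt zy.
Qed.

End Homotheties.

(** * The group of homotheties when balls of large radius are not compact *)

(* [l] is the ratio of a homothety, [p], [p'] the radii at [x], [x'], [q], [q'] those at the base point and at the image of [x']; [d] and [s] are distances. *)
Lemma ratio_bound (R : realType) (l p p' q q' r t d s : R) :
  0 < l -> 8 * r <= q -> 100 * t <= p ->  0 < q -> d <= t -> s <= r -> p <= p' + d -> q' <= q + s -> q' = l * p' ->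
  l * p <= 2 * q.
Proof.
move=> l0 r8 t100 q0 h1 h2 h3 h4 h5.
have e1 : l * (p - t) <= l * p' by rewrite ler_pM2l //; lra.
have e2 : l * (100 * t) <= l * p by rewrite ler_pM2l.
nra.
Qed.

(** A half ball around [x] is mapped well inside the radius [q] at the base point, hence into a
    compact ball: [l * p] is at most [100 / 99] of [q + r], with [r <= q / 8]. *)
Lemma image_bound (R : realType) (l p p' q q' r t d s : R) (y z w : R) :
  0 < l -> 8 * r <= q -> 100 * t <= p ->  0 < q -> 0 < p -> d <= t -> s <= r -> p <= p' + d -> q' <= q + s ->
  q' = l * p' -> y <= p / 2 -> w <= d + y -> z <= s + l * w -> z <= 4 / 5 * q.
Proof.
move=> l0 r8 t100 q0 p0 h1 h2 h3 h4 h5 h6 h7 h8.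
have e1 : l * (p - t) <= l * p' by rewrite ler_pM2l //; lra.
have e2 : l * (100 * t) <= l * p by rewrite ler_pM2l.
have e3 : l * w <= l * (t + p / 2) by rewrite ler_pM2l //; lra.
nra.
Qed.

(** Here [q' >= 7 * r] while [l * w <= 3 * r], so [w] is at most [3 / 7] of [p'], and [p'] exceeds
    [p] by at most a hundredth. This leaves the preimage inside the half ball. *)
Lemma preimage_bound (R : realType) (l p p' q q' r t d s : R) (y w : R) :
  0 < l -> 8 * r <= q -> 100 * t <= p ->  0 < r -> 0 < p -> d <= t -> s <= r -> p' <= p + d -> q <= q' + s ->
  q' = l * p' -> l * w <= 2 * r + s -> y <= d + w -> y <= p / 2.
Proof.
move=> l0 r8 t100 r0 p0 h1 h2 h3 h4 h5 h6 h7.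
have e1 : l * p' <= l * (101 / 100 * p) by rewrite ler_pM2l //; lra.
have e2 : l * w <= l * (3 / 7 * (101 / 100 * p)) by nra.
rewrite ler_pM2l // in e2; lra.
Qed.

Section FiniteRadius.
Context {R : realType} {n : nat} {X : complexManifold R n} {g : tensorField X}.
Hypotheses (hg : hermitian_metric g) (Xc : connected [set: X]).
Variables (x1 : X) (r1 : R).
Hypothesis ncpt : ~ @ball_cpt R n X g x1 r1.
Local Notation homothety := (@homothety R n X g).
Local Notation dist := (@dist R n X g).
Local Notation ball_cpt := (@ball_cpt R n X g).
Let dT := dist_triangle hg Xc.
Let dC := distC hg Xc.

Definition rho x : R := sup [set r | ball_cpt x r].

(** A compact ball around [x] of radius at least [dist x1 x + r1] would contain the ball excluded by
    [ncpt], which is closed. *)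
Lemma has_sup_rho x : has_sup [set r | ball_cpt x r].
Proof.
split; first by have [r r0 hr] := ball_cpt_small hg Xc x; exists r.
exists (dist x1 x + r1) => r hr; rewrite leNgt; apply/negP => h; apply: ncpt.
by apply: (ball_cpt_le hg Xc) hr; rewrite dC ltW // dC.
Qed.

Lemma le_rho x (r : R) : ball_cpt x r -> r <= rho x.
Proof. by move=> hr; apply: sup_upper_bound => //; exact: has_sup_rho. Qed.

Lemma lt_rho x (r : R) : r < rho x -> ball_cpt x r.
Proof.
move=> h; have [h0 _] := has_sup_rho x; have [s hs rs] := sup_gt h0 h.
by apply: (ball_cpt_le hg Xc) hs; rewrite distxx // add0r ltW.
Qed.

Lemma rho_gt0 x : 0 < rho x.
Proof. by have [r r0 /le_rho] := ball_cpt_small hg Xc x; exact: lt_le_trans. Qed.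

Lemma rho_lip x y : rho x <= rho y + dist x y.
Proof.
have [h0 _] := has_sup_rho x; apply: ge_sup => // r hr; rewrite -lerBlDr; apply: le_rho.
by apply: (ball_cpt_le hg Xc) hr; rewrite addrC subrK.
Qed.

Lemma rho_homothety l F G x : homothety l F -> holomorphic G -> cancel F G -> cancel G F ->
  rho (F x) = l * rho x.
Proof.
move=> hF hG FK GK; have [hF' l0 _] := hF.
have hG' := homothety_inv hg hF hG GK.
have K l' F' G' y : homothety l' F' -> holomorphic G' -> cancel F' G' -> cancel G' F' ->
    l' * rho y <= rho (F' y).
  move=> h1 h2 h3 h4; have [_ l0' _] := h1; rewrite mulrC -ler_pdivlMr //.
  have [h0 _] := has_sup_rho y; apply: ge_sup => // r hr; rewrite ler_pdivlMr // mulrC.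
  by apply: le_rho; apply: (ball_cpt_homothety hg Xc h1 h2).
apply/eqP; rewrite eq_le (K _ _ G) // andbT.
by have := K _ _ _ (F x) hG' hF' GK FK; rewrite FK ler_pdivrMl.
Qed.

(** The ratio is hidden in an existential, so that equality in the group is equality of maps; [lam]
    recovers it. *)
Definition hom := {F : X -> X | biholomorphic F /\ exists l, homothety l F}.

Lemma hom_eq (a b : hom) : sval a = sval b -> a = b.
Proof.
by case: a b => [a pa] [b pb] /= E; subst b; congr exist; exact: Prop_irrelevance.
Qed.

Definition hone : hom := exist _ id (conj (biholomorphic_id X)
  (ex_intro _ 1 (homothety_id hg))).

Lemma hmul_proof (a b : hom) : biholomorphic (sval a \o sval b) /\
  exists l, homothety l (sval a \o sval b).
Proof.
case: a b => [a [ba [l ha]]] [b [bb [l' hb]]] /=; split; first exact: biholomorphic_comp.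
by exists (l' * l); exact: homothety_comp.
Qed.

Definition hmul (a b : hom) : hom := exist _ _ (hmul_proof a b).

Lemma hinv_ex (a : hom) : exists b : hom, cancel (sval a) (sval b) /\ cancel (sval b) (sval a).
Proof.
case: a => [F [[hF [G [hG FK GK]]] [l hl]]] /=.
have bG : biholomorphic G by split=> //; exists F.
have hl' := homothety_inv hg hl hG GK.
by exists (exist _ G (conj bG (ex_intro (fun l => homothety l G) _ hl'))).
Qed.

Definition hinv (a : hom) : hom := projT1 (cid (hinv_ex a)).
Lemma hinvK a : cancel (sval a) (sval (hinv a)).
Proof. by have [] := projT2 (cid (hinv_ex a)). Qed.
Lemma hinvKV a : cancel (sval (hinv a)) (sval a).
Proof. by have [] := projT2 (cid (hinv_ex a)). Qed.

Lemma hmulA a b c : hmul a (hmul b c) = hmul (hmul a b) c. Proof. exact: hom_eq. Qed.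
Lemma hmul1 a : hmul a hone = a. Proof. exact: hom_eq. Qed.
Lemma hmulV a : hmul a (hinv a) = hone.
Proof. by apply: hom_eq; apply/funext => x; exact: hinvKV. Qed.
Lemma hmulVl a : hmul (hinv a) a = hone.
Proof. by apply: hom_eq; apply/funext => x; exact: hinvK. Qed.

Lemma hom_holo (a : hom) : @holomorphic R n n X X (sval a). Proof. by case: a => F [[]]. Qed.

(** Read off from [rho], the ratio becomes a function of the map alone: by [rho_homothety] it equals
    every [l] for which the map is a homothety. *)
Definition lam (a : hom) : R := rho (sval a x1) / rho x1.

Lemma lam_homothety a : homothety (lam a) (sval a).
Proof.
have [l hl] : exists l, homothety l (sval a) by case: a => F [].
rewrite /lam (rho_homothety x1 hl (hom_holo (hinv a)) (hinvK a) (hinvKV a)).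
by rewrite mulfK // gt_eqF // rho_gt0.
Qed.

Lemma lam_gt0 a : 0 < lam a. Proof. by have [] := lam_homothety a. Qed.

Lemma lam_dist a x y : dist (sval a x) (sval a y) = lam a * dist x y.
Proof.
exact: (dist_homothety_eq hg Xc _ _ (lam_homothety a) (hom_holo (hinv a)) (hinvK a) (hinvKV a)).
Qed.

Lemma lam_rho a x : rho (sval a x) = lam a * rho x.
Proof. exact: (rho_homothety _ (lam_homothety a) (hom_holo (hinv a)) (hinvK a) (hinvKV a)). Qed.

Lemma lamM a b : lam (hmul a b) = lam a * lam b.
Proof. by rewrite {1}/lam /= !lam_rho mulrA mulfK // gt_eqF // rho_gt0. Qed.

Section BasePoint.
Variables (x0 : X) (r : R).
Hypotheses (r0 : 0 < r) (r8 : 8 * r <= rho x0).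

(** Basic neighborhoods of the identity: uniform closeness on one ball, for the map and its inverse.
    Uniform continuity of a bump supported near [x0] tests points of that ball only. *)
Definition nearid (e : R) (a : hom) := forall z, dist x0 z <= 2 * r ->
  dist (sval a z) z <= e /\ dist (sval (hinv a) z) z <= e.
Local Notation tb := (@tb R hom hmul nearid).

Lemma nearid1 (e : R) : 0 < e -> nearid e hone.
Proof.
move=> e0 z hz; rewrite /= distxx // ltW //; split=> //.
by have := hinvK hone z; rewrite /= => ->; rewrite distxx // ltW.
Qed.

Lemma nearid_mono (e e' : R) a : e <= e' -> nearid e a -> nearid e' a.
Proof. by move=> ee h z /h [h1 h2]; split; [exact: le_trans h1 _|exact: le_trans h2 _]. Qed.

(* Arzela-Ascoli *)
Lemma tb_equilipschitz (S : hom -> Prop) (K K0 : set X) (M : R) :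
  compact K -> compact K0 -> (forall a, S a -> lam a <= M) ->
  (forall a y, S a -> K y -> K0 (sval a y)) ->
  (forall a z, S a -> dist x0 z <= 2 * r -> K (sval (hinv a) z)) -> tb S.
Proof.
move=> cK cK0 hM hK hL e e0.
have M0 : 0 < `|M| + 1 by rewrite ltr_wpDl.
have e4 : 0 < e / 4 by exact: divr_gt0.
have [s sK hs] := compact_net hg (divr_gt0 e4 M0) cK.
have [t _ ht] := compact_net hg e4 cK0.
(* A pattern assigns to each net point of [K] a net point of [K0] close to its image. There are
   finitely many patterns, and two maps with the same pattern are within four times [e / 4] of each
   other on [K]. *)
pose T := {ffun seq_sub s -> seq_sub t}.
pose pat (a : hom) (sg : T) := forall i, dist (val (sg i)) (sval a (val i)) < e / 4.
have pat_ex a : S a -> exists sg, pat a sg.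
  move=> Sa; have /choice[f hf] : forall i : seq_sub s, exists j : seq_sub t,
      dist (val j) (sval a (val i)) < e / 4.
    move=> i; have [z zt hz] := ht _ (hK a _ Sa (sK _ (valP i))).
    by exists (SeqSub zt).
  by exists [ffun i => f i] => i; rewrite ffunE.
have /choice[rep hrep] : forall sg, exists b, (exists2 a, S a & pat a sg) -> S b /\ pat b sg.
  move=> sg; have [[a Sa pa]|no] := pselect (exists2 a, S a & pat a sg); first by exists a.
  by exists hone => h.
(* One representative for each pattern; [a] composed with the inverse of the representative of its
   own pattern is near the identity. *)
exists [seq hinv (rep sg) | sg <- enum T] => a Sa.
have [sg psg] := pat_ex a Sa; have [Sb pb] := hrep sg (ex_intro2 _ _ a Sa psg).
set b := rep sg in Sb pb.
have close y : K y -> dist (sval a y) (sval b y) <= e.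
  move=> Ky; have [z zs hz] := hs y Ky.
  have h0 c : S c -> dist (sval c y) (sval c z) <= e / 4.
    move=> Sc; rewrite lam_dist dC.
    apply: (@le_trans _ _ ((`|M| + 1) * (e / 4 / (`|M| + 1)))); last by rewrite mulrC divfK // gt_eqF.
    apply: ler_pM; rewrite ?dist_ge0 ?(ltW (lam_gt0 c)) ?(ltW hz) //.
    apply: le_trans (hM c Sc) (le_trans (ler_norm _) _); by rewrite lerDl.
  have h1 := dT (sval a z) (sval a y) (sval b y).
  have h2 := dT (val (sg (SeqSub zs))) (sval a z) (sval b y).
  have h3 := dT (sval b z) (val (sg (SeqSub zs))) (sval b y).
  have := psg (SeqSub zs); have := pb (SeqSub zs); have := h0 a Sa; have := h0 b Sb.
  move: h1 h2 h3; rewrite (dC (sval b y)) (dC (sval a z) (val _)) /=.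
  move: (dist _ _) (dist _ _) (dist _ _) (dist _ _) (dist _ _) (dist _ _) (dist _ _) => *.
  lra.
have Va : nearid e (hmul a (hinv b)).
  move=> z hz; split.
    by have := close _ (hL b z Sb hz); rewrite hinvKV.
  have -> : hinv (hmul a (hinv b)) = hmul b (hinv a).
    apply: hom_eq; apply/funext => y /=; apply: (can_inj (hinvK (hmul a (hinv b)))).
    by rewrite hinvKV /= hinvK hinvKV.
  by rewrite dC; have := close _ (hL a z Sa hz); rewrite hinvKV.
rewrite big_map big_enum (bigD1 sg) //= indT // lerDl.
by apply: sumr_ge0 => i _; exact: ind_ge0.
Qed.

Definition moved x (tau : R) (a : hom) := exists2 x', dist x x' <= tau & dist x0 (sval a x') <= r.

Lemma moved_lam x (tau : R) a : 100 * tau <= rho x -> moved x tau a ->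
  lam a * rho x <= 2 * rho x0.
Proof.
move=> t100 [x' h1 h2].
have k := rho_lip (sval a x') x0; rewrite (dC (sval a x')) in k.
exact: ratio_bound (lam_gt0 a) r8 t100 (rho_gt0 x0) h1 h2 (rho_lip x x') k (lam_rho a x').
Qed.

(** Since [rho (a x') = lam a * rho x'] with [a x'] near [x0], the ratio is bounded, so these maps
    are equi-Lipschitz. Balls of radius below [rho] are compact, and this supplies both compact sets
    that Arzela-Ascoli requires: the half ball around [x], and the ball around [x0] receiving its
    images. *)
Lemma tb_moved x (tau : R) : 100 * tau <= rho x -> tb (moved x tau).
Proof.
move=> t100; have rx := rho_gt0 x; have rx0 := rho_gt0 x0.
apply: (@tb_equilipschitz _ [set y | dist x y <= rho x / 2]
  [set y | dist x0 y <= 4 / 5 * rho x0] (2 * rho x0 / rho x)).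
- by apply: lt_rho; lra.
- by apply: lt_rho; lra.
- by move=> a /(moved_lam t100); rewrite ler_pdivlMr.
- move=> a y [x' h1 h2] /= hy.
  have k1 := rho_lip (sval a x') x0; rewrite (dC (sval a x')) in k1.
  have k2 := dT (sval a x') x0 (sval a y); rewrite lam_dist in k2.
  have k3 := dT x x' y; rewrite (dC x' x) in k3.
  exact: image_bound (lam_gt0 a) r8 t100 rx0 rx h1 h2 (rho_lip x x') k1 (lam_rho a x') hy k3 k2.
- move=> a z [x' h1 h2] hz /=; set y := sval (hinv a) z.
  have k1 := rho_lip x' x; rewrite (dC x') in k1.
  have k3 : lam a * dist x' y <= 2 * r + dist x0 (sval a x').
    rewrite -lam_dist hinvKV addrC; apply: le_trans (dT x0 (sval a x') z) _.
    by rewrite (dC (sval a x')) lerD2l.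
  exact: preimage_bound (lam_gt0 a) r8 t100 r0 rx h1 h2 k1 (rho_lip x0 (sval a x')) (lam_rho a x') k3 (dT x' x y).
Qed.

Lemma tb_nearid : tb (nearid r).
Proof.
have H := @tb_moved x0 (rho x0 / 100) (ltac:(by have := rho_gt0 x0; lra)).
move=> e e0; have [s hs] := H e e0; exists s => a Va; apply: hs; exists x0.
  by rewrite distxx //; have := rho_gt0 x0; lra.
have [h _] := Va x0 (ltac:(by rewrite distxx // mulr_ge0 // ltW)); by rewrite dC.
Qed.

End BasePoint.
End FiniteRadius.

Lemma Ck_local {R : realType} n k (U : set (Cspace R n)) f :
  (forall z, U z -> exists2 N : set (Cspace R n), N z & Ck k N f) -> Ck k U f.
Proof.
move=> H; apply: (@BC_Ck R n unit k U (fun _ => f) _ tt).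
by apply: BC_local => z /H [W Wz hW]; exists W; split=> //; exact: Ck_BC.
Qed.

Lemma smooth_local {R : realType} n (X : complexManifold R n) (f : X -> R) :
  (forall k c x, chart_dom c x -> exists2 d : R, 0 < d &
     Ck k [set z | rn (z - chart_map c x) < d] (f \o chart_inv c)) -> smooth_on [set: X] f.
Proof.
move=> H c k; apply: Ck_local => _ [x [cx _] <-]; have [d d0 hd] := H k c x cx.
by exists [set z | rn (z - chart_map c x) < d] => //=; rewrite subrr rn0.
Qed.

Lemma open_rn_ball {R : realType} n (w : Cspace R n) (d : R) : open [set z | rn (z - w) < d].
Proof.
rewrite open_rnP => z hz; exists (d - rn (z - w)); first by rewrite subr_gt0.
by move=> z' h; rewrite /=; have := rnBD z' z w; move: h hz => /=; lra.
Qed.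

(** * Smooth equivariant averages over the group of homotheties *)

Section Weight.
Context {R : realType} {n : nat} {X : complexManifold R n} {g : tensorField X}.
Hypotheses (hg : hermitian_metric g) (Xc : connected [set: X]).
Variables (x1 : X) (r1 : R).
Hypothesis ncpt : ~ @ball_cpt R n X g x1 r1.
Local Notation dist := (@dist R n X g).
Local Notation FF := (@FF R n X g).
Local Notation rho := (@rho R n X g).
Local Notation hom := (@hom R n X g).
Local Notation hmul := (@hmul R n X g).
Local Notation hone := (@hone R n X g hg).
Local Notation hinv := (@hinv R n X g hg).
Local Notation lam := (@lam R n X g x1).
Let dT := dist_triangle hg Xc.
Let dC := distC hg Xc.
Let lamgt0 := lam_gt0 hg Xc ncpt.

Section BasePoint.
Variables (x0 : X) (c0 : chart X) (r k : R) (chi : X -> R) (b : Cspace R n -> R).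
Hypotheses (c0x0 : chart_dom c0 x0) (r0 : 0 < r) (r8 : 8 * r <= rho x0)
  (rD : forall y, dist x0 y <= 2 * r -> chart_dom c0 y)
  (bC : Cinfty setT b) (k0 : 0 < k) (kF : FF (fun y => k * chi y))
  (chi_ge0 : forall y, 0 <= chi y) (chib : forall y, chart_dom c0 y -> chi y = b (chart_map c0 y))
  (chir : forall y, chi y != 0 -> dist x0 y < r) (chix0 : 0 < chi x0).
Local Notation nearid := (@nearid R n X g hg x0 r).
Local Notation moved := (@moved R n X g x0 r).

Definition wf (y : X) (a : hom) : R := lam a ^+ 2 * chi (sval a y).

Lemma chi_lip y y' : `|chi y - chi y'| <= dist y' y / k.
Proof.
have := le_dist_abs hg Xc y' y kF.
by rewrite -mulrBr normrM gtr0_norm // ler_pdivlMr // mulrC.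
Qed.

Lemma chi_le y : chi y <= chi x0 + r / k.
Proof.
have [->|ny] := eqVneq (chi y) 0; first by rewrite addr_ge0 // divr_ge0 // ltW.
rewrite -lerBlDl; apply: le_trans (ler_norm _) _; apply: le_trans (chi_lip _ _) _.
by rewrite ler_pM2r ?invr_gt0 // ltW // chir.
Qed.

Lemma moved_chi x (tau : R) y a : dist x y <= tau -> chi (sval a y) != 0 -> moved x tau a.
Proof. by move=> h /chir /ltW h'; exists y. Qed.

Lemma lam_le x (tau : R) a : 100 * tau <= rho x -> moved x tau a -> lam a <= 2 * rho x0 / rho x.
Proof.
move=> h m; rewrite ler_pdivlMr ?(rho_gt0 hg Xc ncpt) //.
exact: (moved_lam hg Xc ncpt r8 h m).
Qed.

(** On the ball of radius [2 * r] one has [rho z >= 6 * r], and moving [z] by at most [e] changes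
    [rho] by at most [e]. So the ratio is within [e / (6 * r)] of 1, and [lam a + 1 <= 3] gives the
    bound for the square. *)
Lemma lam_near e a : e <= r -> nearid e a -> dist x0 x0 <= 2 * r ->
  forall z, dist x0 z <= 2 * r -> `|lam a ^+ 2 - 1| <= e / (2 * r).
Proof.
move=> er Va _ z hz; have [h _] := Va z hz.
have e1 := rho_lip hg Xc ncpt (sval a z) z; have e2 := rho_lip hg Xc ncpt z (sval a z).
have e3 := rho_lip hg Xc ncpt x0 z.
rewrite (lam_rho hg Xc ncpt) in e1 e2; rewrite (dC z) in e2.
have rr := r0; have rr8 := r8; have l0 := lamgt0 a.
have pz : 6 * r <= rho z by lra.
have dz : 0 <= dist (sval a z) z by exact: dist_ge0.
have d1 : `|lam a - 1| <= e / (6 * r).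
  rewrite ler_pdivlMr ?mulr_gt0 //; apply: (@le_trans _ _ (`|lam a - 1| * rho z)).
    by rewrite ler_wpM2l.
  have pz0 : 0 < rho z by apply: lt_le_trans pz; rewrite mulr_gt0.
  rewrite -[rho z]gtr0_norm // -normrM mulrBl mul1r ler_norml; apply/andP; split; lra.
have d2 : e / (6 * r) <= 1 by rewrite ler_pdivrMr ?mulr_gt0 // mul1r; lra.
have -> : lam a ^+ 2 - 1 = (lam a - 1) * (lam a + 1) by ring.
rewrite normrM (_ : e / (2 * r) = e / (6 * r) * 3); last by field; rewrite gt_eqF.
apply: ler_pM => //; rewrite ger0_norm; last by rewrite addr_ge0 // ltW.
by move: (le_trans d1 d2); rewrite ler_norml => /andP[_]; lra.
Qed.

(** Only maps that bring some point near [x] close to [x0] contribute, and these form a totally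
    bounded set on which the ratio is bounded; uniform continuity combines [lam_near] with the
    Lipschitz bound on [chi]. *)
Lemma Lsp_wf x (tau : R) y : 100 * tau <= rho x -> dist x y <= tau ->
  Lsp hmul nearid (moved x tau) (wf y).
Proof.
move=> t100 xy; set La := 2 * rho x0 / rho x; set M := chi x0 + r / k.
have La0 : 0 < La by rewrite divr_gt0 ?mulr_gt0 ?(rho_gt0 hg Xc ncpt).
have M0 : 0 <= M by apply: le_trans (chi_le x0); exact: chi_ge0.
have lamS a : moved x tau a -> lam a ^+ 2 <= La ^+ 2.
  move=> /(lam_le t100) h; rewrite ler_sqr ?nnegrE ?(ltW La0) //; exact: ltW.
split.
(* The variation of [wf] is [lam a ^+ 2] times the sum of a change of ratio and a change of [chi];
   the two brackets in [Q] are their rates, and the 1 keeps [Q] positive. *)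
- move=> eta eta0; pose Q := La ^+ 2 * (M / (2 * r) + k^-1) + 1.
  have P0 : 0 <= M / (2 * r) + k^-1.
    by rewrite addr_ge0 ?divr_ge0 ?invr_ge0 ?mulr_ge0 // ltW.
  have Q0 : 0 < Q by rewrite ltr_wpDl // mulr_ge0 ?sqr_ge0.
  exists (Num.min r (eta / Q)); first by rewrite lt_min r0 divr_gt0.
  move=> ga; set e := Num.min _ _ => Vg a.
  have er : e <= r by rewrite ge_min lexx.
  have e0 : 0 < e by rewrite lt_min r0 divr_gt0.
  have eQ : La ^+ 2 * (M * (e / (2 * r)) + e / k) <= eta.
    apply: (@le_trans _ _ (e * Q)); last by rewrite -ler_pdivlMr // ge_min lexx orbT.
    rewrite /Q (_ : La ^+ 2 * _ = e * (La ^+ 2 * (M / (2 * r) + k^-1))); last by ring.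
    by rewrite ler_pM2l // lerDl.
  have L2 : 0 <= La ^+ 2 by exact: sqr_ge0.
  have Mr0 : 0 <= M * (e / (2 * r)).
    by rewrite mulr_ge0 // divr_ge0 ?mulr_ge0 // ltW.
  rewrite /wf (lamM hg Xc ncpt) /=; set z := sval a y.
  (* When [chi] vanishes at [z], nothing says that [a] lies in [moved]; the bound on the ratio then
     comes from the product [ga a]. *)
  have [z0|nz] := eqVneq (chi z) 0.
    rewrite z0 mulr0 subr0; have [->|nw] := eqVneq (chi (sval ga z)) 0.
      by rewrite mulr0 normr0 ltW.
    have hw := chir nw.
    have [_ h2] := Vg (sval ga z) (ltac:(by have rr := r0; lra)).
    rewrite hinvK in h2.
    have mga : moved x tau (hmul ga a) by apply: (moved_chi xy).
    have := lamS _ mga; rewrite (lamM hg Xc ncpt) => hl.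
    rewrite normrM ger0_norm ?sqr_ge0 //; apply: le_trans eQ.
    apply: ler_pM; rewrite ?sqr_ge0 //.
    apply: (@le_trans _ _ (e / k)); last by rewrite lerDr.
    rewrite -[chi _]subr0 -z0; apply: le_trans (chi_lip _ _) _.
    by rewrite ler_pM2r ?invr_gt0.
  have hz := chir nz.
  have hz2 : dist x0 z <= 2 * r by have rr := r0; lra.
  have [h1 _] := Vg z hz2.
  have xx : dist x0 x0 <= 2 * r by rewrite distxx // mulr_ge0 // ltW.
  have hl := lam_near er Vg xx hz2.
  have ma : moved x tau a by apply: (moved_chi xy).
  rewrite exprMn (_ : _ - _ = lam a ^+ 2 * ((lam ga ^+ 2 - 1) * chi (sval ga z) +
    (chi (sval ga z) - chi z))); last by ring.
  rewrite normrM ger0_norm ?sqr_ge0 //; apply: le_trans eQ.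
  apply: ler_pM; rewrite ?sqr_ge0 //; first exact: lamS.
  apply: le_trans (ler_normD _ _) _; apply: lerD.
    rewrite normrM mulrC; apply: ler_pM => //.
    by rewrite ger0_norm //; exact: chi_le.
  by apply: le_trans (chi_lip _ _) _; rewrite ler_pM2r ?invr_gt0 // dC.
- move=> a na; rewrite /wf; have [->|h] := eqVneq (chi (sval a y)) 0; first by rewrite mulr0.
  by exfalso; apply: na; exact: (moved_chi xy).
- exists (La ^+ 2 * M) => a; rewrite /wf; have [->|h] := eqVneq (chi (sval a y)) 0.
    by rewrite mulr0 normr0 mulr_ge0 // sqr_ge0.
  rewrite normrM !ger0_norm ?sqr_ge0 //; apply: ler_pM; rewrite ?sqr_ge0 //; last exact: chi_le.
  by apply: lamS; exact: (moved_chi xy).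
Qed.

(* The average over the group of homotheties of a bump, twisted by the squared ratio: by invariance [weight * g] is preserved by all homotheties. *)
Definition weight (y : X) : R := haar hmul nearid r (wf y).

Let HA := @hmulA R n X g.
Let H1 := @hmul1 R n X g hg.
Let HV := @hmulV R n X g hg.
Let HVl := @hmulVl R n X g hg.
Let N1 := @nearid1 R n X g hg Xc x0 r.
Let Nm := @nearid_mono R n X g hg x0 r.
Let TN := tb_nearid hg Xc ncpt r0 r8.

Lemma wf_ge0 y a : 0 <= wf y a. Proof. by rewrite mulr_ge0 ?sqr_ge0. Qed.

Lemma small_wf y : small hmul nearid (wf y).
Proof.
have h : 100 * (rho y / 100) <= rho y by rewrite mulrC divfK.
apply: (Lsp_small (tb_moved hg Xc ncpt r0 r8 h) (Lsp_wf h _)).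
by rewrite distxx // divr_ge0 // ltW // (rho_gt0 hg Xc ncpt).
Qed.

Lemma weight_ge0 y : 0 <= weight y.
Proof. exact: (haar_ge0 HA N1 r0 TN (small_wf y)). Qed.

(** The value of [wf y] at the product [h a] is [lam a ^+ 2] times that of [wf (a y)] at [h], by
    multiplicativity of the ratio; right invariance of the functional concludes. *)
Lemma weight_equiv (a : hom) y : lam a ^+ 2 * weight (sval a y) = weight y.
Proof.
rewrite /weight -(haarZ HA N1 r0 TN (sqr_ge0 (lam a)) (small_wf (sval a y))).
rewrite -[RHS](haar_translate HA H1 HVl N1 r0 TN a (small_wf y)); congr (haar _ _ _ _).
apply/funext => h; rewrite /wf (lamM hg Xc ncpt) [(lam h * lam a) ^+ 2]exprMn /=.
by rewrite mulrA [lam h ^+ 2 * lam a ^+ 2]mulrC.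
Qed.

(** For [a] close to the identity the squared ratio is at least [1 / 2] and [chi (a x0)] at least
    half of [chi x0], so the averaged function is bounded below on a neighborhood of the
    identity. *)
Lemma weight_gt0 : 0 < weight x0.
Proof.
pose e := Num.min r (k * chi x0 / 2).
have e0 : 0 < e by rewrite lt_min r0 divr_gt0 // mulr_gt0.
have c0' : 0 < chi x0 / 4 by exact: divr_gt0.
apply: (haar_gt0 HA H1 HVl N1 r0 TN (small_wf x0) c0' e0 (b := hone)) => a.
rewrite hmul1; have [Va|nVa] := pselect (nearid e a); last by rewrite indF // mulr0 wf_ge0.
rewrite indT // mulr1 /wf.
have xx : dist x0 x0 <= 2 * r by rewrite distxx // mulr_ge0 // ltW.
have er : e <= r by rewrite ge_min lexx.
have [h _] := Va x0 xx.
have h1 : 1 / 2 <= lam a ^+ 2.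
  have := lam_near er Va xx xx.
  have : e / (2 * r) <= 1 / 2 by rewrite ler_pdivrMr ?mulr_gt0 // mulrA divfK // mul1r.
  by rewrite ler_norml => h1 /andP[h2 _]; lra.
have h2 : chi x0 / 2 <= chi (sval a x0).
  have := chi_lip x0 (sval a x0); rewrite ler_norml => /andP[_ h2].
  have : dist (sval a x0) x0 / k <= chi x0 / 2.
    rewrite ler_pdivrMr // mulrAC; apply: le_trans h _.
    by rewrite [chi x0 * k]mulrC ge_min lexx orbT.
  by lra.
have -> : chi x0 / 4 = 1 / 2 * (chi x0 / 2) by field.
by apply: ler_pM => //; rewrite divr_ge0.
Qed.

(** For points near [x] the averaged family is a fixed smooth function composed with uniformly
    bounded holomorphic maps, hence of class C^k with uniform bounds; the functional is then applied
    under all derivatives. *)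
Lemma weight_smooth : smooth_on [set: X] weight.
Proof.
apply: smooth_local => kk c x cx.
have px := rho_gt0 hg Xc ncpt x; have px0 := rho_gt0 hg Xc ncpt x0.
set La := 2 * rho x0 / rho x.
have La0 : 0 < La by rewrite divr_gt0 // mulr_gt0.
(* The first bound is the margin required by [tb_moved]. The second keeps, for every moved [a], the
   image of the [tau]-ball around [x] within [2 * r] of [x0], inside the domain of [c0]. *)
pose tau := Num.min (rho x / 100) (r / (2 * La)).
have t0 : 0 < tau by rewrite lt_min !divr_gt0 // mulr_gt0.
have t100 : 100 * tau <= rho x by rewrite mulrC -ler_pdivlMr // ge_min lexx.
have La2 : 0 < 2 * La by exact: mulr_gt0.
have tr : 2 * La * tau <= r.
  have : tau <= r / (2 * La) by rewrite ge_min lexx orbT.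
  by rewrite ler_pdivlMr // mulrC.
have [d d0 hd] := near_chart_inv cx (near_dist hg x t0).
exists d => //; set U := [set z | _].
have oU : open U by exact: open_rn_ball.
have stay a z : moved x tau a -> U z -> dist x0 (sval a (chart_inv c z)) <= 2 * r.
  move=> ma /hd [_ _ h]; have [x' h1 h2] := ma.
  have k1 := dT (sval a x') x0 (sval a (chart_inv c z)).
  rewrite (lam_dist hg Xc ncpt) in k1; have k2 := dT x x' (chart_inv c z).
  rewrite (dC x' x) in k2.
  have k3 : lam a * dist x' (chart_inv c z) <= La * (2 * tau).
    apply: ler_pM; [exact: ltW|exact: dist_ge0|exact: (lam_le t100 ma)|by lra].
  by lra.
have [B B0 hB] : exists2 B : R, 0 <= B & forall y, dist x0 y <= 2 * r -> rn (chart_map c0 y) <= B.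
  have cL : compact [set y | dist x0 y <= 2 * r].
    by apply: (lt_rho hg Xc ncpt); have rr := r0; have rr8 := r8; lra.
  have [||y _ hy] := @compact_EVT_max X R (fun y => rn (chart_map c0 y - 0)) _ _ cL.
  - by exists x0; rewrite /= distxx // mulr_ge0 // ltW.
  - apply: continuous_in_subspaceT => y; rewrite inE => /rD hy.
    apply: (@continuous_comp X (Cspace R n) R (chart_map c0) (fun w => rn (w - 0))).
      exact: chart_map_continuous.
    exact: rn_triangle_cont.
  - exists (rn (chart_map c0 y - 0)); first exact: rn_ge0.
    by move=> y' h; have := hy y'; rewrite inE => /(_ h); rewrite subr0.
(* For [a] outside [moved] both factors are set to 0. The product is unchanged, because [chi]
   vanishes at the image point, and the family becomes bounded uniformly in all [a]. *)
pose A (a : hom) z := if `[< moved x tau a >] then chart_map c0 (sval a (chart_inv c z)) else 0.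
pose C (a : hom) := if `[< moved x tau a >] then lam a ^+ 2 else 0.
have E a z : U z -> C a * b (A a z) = wf (chart_inv c z) a.
  move=> Uz; rewrite /C /A; case: asboolP => [ma|na].
    by rewrite /wf chib //; apply: rD; exact: stay.
  rewrite mul0r; have [h|h] := eqVneq (chi (sval a (chart_inv c z))) 0; first by rewrite /wf h mulr0.
  exfalso; apply: na; apply: (moved_chi _ h); by have [_ _ /ltW] := hd z Uz.
have hA : holo_family U A.
  split=> [a z Uz|z Uz].
    rewrite /A; case: asboolP => ma; last exact: differentiable_cst.
    have [cz Kz _] := hd z Uz; rewrite -Kz.
    have [_ H] := hom_holo a; apply: (H c c0) => //.
    by apply: rD; exact: stay.
  have [e e0 he] := (open_rnP _).1 oU z Uz; exists B, e; split=> // a z' /he Uz'.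
  by rewrite /A; case: asboolP => ma; [apply: hB; exact: stay|rewrite rn0].
have FB j : BC j U (fun a z => wf (chart_inv c z) a).
  apply: (@BC_ext R n hom j U (fun a z => C a * b (A a z))) => //.
  apply: (@BCM R n hom j U (fun a _ => C a) (fun a z => b (A a z))) => //.
    apply: (@BC_cst R n hom j U C (La ^+ 2)) => a; rewrite /C; case: asboolP => [ma|_].
      rewrite ger0_norm ?sqr_ge0 // ler_sqr ?nnegrE ?(ltW La0) ?(ltW (lamgt0 a)) //.
      exact: (lam_le t100 ma).
    by rewrite normr0 sqr_ge0.
  apply: (@BC_comp R n n hom j U setT (fun _ => b) A) => //; first exact: openT.
  apply: Ck_PC_compact; last exact: bC.
  move=> z Uz; have [_ H] := hA; have [M [e [e0 he]]] := H z Uz.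
  exists e => //; exists [set w | rn (w - 0) <= M]; split => //; first exact: compact_rn_ball.
  by move=> a z' hz'; rewrite /= subr0; exact: he.
have TM := tb_moved hg Xc ncpt r0 r8 t100.
have LF z : U z -> Lsp hmul nearid (moved x tau) (fun a => wf (chart_inv c z) a).
  by move=> Uz; apply: Lsp_wf => //; have [_ _ /ltW] := hd z Uz.
have C0 : 0 <= 2 * haar hmul nearid r (fun a => ind (moved x tau a)).
  rewrite mulr_ge0 //; apply: (haar_ge0 HA N1 r0 TN); exact: small_ind.
have := @functional_Ck R n hom (Lsp hmul nearid (moved x tau)) (haarJ hmul nearid r) _ C0
  (fun f h lf lh => haarJB HA H1 HV N1 Nm r0 TN TM lf lh)
  (fun t f lf => haarJZ HA N1 r0 TN t TM lf)
  (fun f M M0 lf fM => haarJ_bound HA N1 r0 TN TM M0 lf fM)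
  (fun f => @Lsp_closed R hom hmul nearid (moved x tau) f) kk U
  (fun a z => wf (chart_inv c z) a) oU (FB kk.+1) LF.
congr Ck; apply/funext => z /=; rewrite /weight.
by apply: (haarJ_ge0 HA N1 r0 TN) => a; exact: wf_ge0.
Qed.

End BasePoint.

Lemma weight_exists x0 : exists v : X -> R, [/\ smooth_on [set: X] v, forall y, 0 <= v y, 0 < v x0 &
  forall (a : hom) y, lam a ^+ 2 * v (sval a y) = v y].
Proof.
have [c0 cx0] := chart_cover x0.
have px0 := rho_gt0 hg Xc ncpt x0.
have nD : nbhs x0 (chart_dom c0) by apply: open_nbhs_nbhs; split=> //; exact: chart_dom_open.
have [s s0 hs] := (nbhs_distP hg Xc x0 _).1 nD.
(* An eighth of [rho x0] serves the compactness estimates; a third of [s] keeps the ball of radius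
   [2 * r] inside one chart. *)
pose r := Num.min (rho x0 / 8) (s / 3).
have r0 : 0 < r by rewrite lt_min !divr_gt0.
have r8 : 8 * r <= rho x0 by rewrite mulrC -ler_pdivlMr // ge_min lexx.
have r3 : r * 3 <= s by rewrite -ler_pdivlMr // ge_min lexx orbT.
have rD y : dist x0 y <= 2 * r -> chart_dom c0 y by move=> h; apply: hs; lra.
have nU := near_dist hg x0 r0.
have [chi [b [k [bC k0 kF chix H]]]] := dist_bump hg cx0 nU.
have c_ge0 y : 0 <= chi y by have [] := H y.
have cb y : chart_dom c0 y -> chi y = b (chart_map c0 y) by have [] := H y.
have cr y : chi y != 0 -> dist x0 y < r by have [_ _ h] := H y; move=> /h [].
exists (weight x0 r chi); split.
- exact: (@weight_smooth x0 c0 r k chi b).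
- by move=> y; apply: (@weight_ge0 x0 r k chi).
- exact: (@weight_gt0 x0 r k chi).
- by move=> a y; apply: (@weight_equiv x0 r k chi).
Qed.

End Weight.

(** * Countable sums of smooth functions *)

Section WordBounds.
Context {R : realType} {n : nat}.
Local Notation V := (Cspace R n).

(** Linearity in the direction, obtained from the chain rule for the identity map. *)
Lemma dirD_basis (f : V -> R) U z v : open U -> Ck 1 U f -> U z ->
  dirD v f z = \sum_p rc p v * dirD (eb p) f z.
Proof.
move=> oU [_ Cf] Uz; have [d d0 hd] := (open_rnP _).1 oU z Uz.
have did := @ex_diff _ _ _ _ _ _ _ (is_diff_id z).
have hA p w : rn (w - z) < d -> derivable (along f w (eb p)) 0 1.
  by move=> hw; have [h _] := Cf (eb p); apply: h; exact: hd.
have hB p : {for z, continuous (dirD (eb p) f)} by have [_ [h _]] := Cf (eb p); exact: h.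
have [_ E] := @chain_rule R n n f id z v d d0 hA hB did.
rewrite /dirD E; apply: eq_bigr => p _; congr (rc p _ * _).
by have -> := @diff_val _ _ _ _ _ _ _ (is_diff_id z).
Qed.

(** At each order only finitely many derivatives, along words in the basis vectors, have to be
    bounded; [dirD_basis] recovers the other directions. *)
Fixpoint basis_lb {S : Type} (k : nat) (U : set V) (F : S -> V -> R) : Prop :=
  loc_bounded U F /\ if k is k'.+1 then
    forall p, basis_lb k' U (fun s => dirD (eb p) (F s)) else True.

Lemma basis_BC {S : Type} k (U : set V) (F : S -> V -> R) : open U ->
  (forall s, Ck k U (F s)) -> basis_lb k U F -> BC k U F.
Proof.
move=> oU; elim: k F => [|k IH] F CF [lb H]; first by split => // s; have [] := CF s.
split => //; first by move=> s; have [] := CF s.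
move=> v; split; first by move=> s z Uz; have [_ /(_ v) [h _]] := CF s; exact: h.
apply: (@BC_ext R n S k U (fun s z => \sum_p rc p v * dirD (eb p) (F s) z)) => //.
  move=> s z Uz; apply/esym; apply: (dirD_basis v oU _ Uz).
  have [c CF'] := CF s; split=> // w; have [h1 h2] := CF' w; split=> //.
  by split; first by case: (k) h2 => [|k'] [].
apply: (@BC_sum R n S k U _ (fun p s z => rc p v * dirD (eb p) (F s) z)) => // p.
apply: (@BCM R n S k U (fun _ _ => rc p v) (fun s => dirD (eb p) (F s))) => //.
  by apply: (@BC_cst R n S k U (fun=> rc p v) `|rc p v|).
by apply: IH => [s|]; [have [_ /(_ (eb p)) []] := CF s|exact: H].
Qed.

(** A ball for the C^k seminorm on [K], expressed by the inequalities that define it. *)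
Fixpoint Bw (k : nat) (M : R) (K : set V) (f : V -> R) : Prop :=
  (forall z, K z -> `|f z| <= M) /\ if k is k'.+1 then
    forall p, Bw k' M K (dirD (eb p) f) else True.

Lemma Bw_le k (M M' : R) K f : M <= M' -> Bw k M K f -> Bw k M' K f.
Proof.
move=> h; elim: k f => [|k IH] f [h1 h2].
  by split=> // z Kz; apply: le_trans h; exact: h1.
split; first by move=> z Kz; apply: le_trans h; exact: h1.
by move=> p; apply: IH; exact: h2.
Qed.

Lemma compact_bound (U K : set V) (f : V -> R) : compact K -> K `<=` U ->
  (forall z, U z -> {for z, continuous f}) ->
  exists2 M : R, 0 <= M & forall z, K z -> `|f z| <= M.
Proof.
move=> cK KU cf; have [K0|/nonemptyPn K0] := pselect (K !=set0); last first.
  by exists 0 => // z; rewrite K0.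
have [|z _ hz] := @compact_EVT_max V R (fun z => `|f z|) K K0 cK.
  apply: continuous_in_subspaceT => z; rewrite inE => /KU /cf h.
  by apply: (@continuous_comp V R R f Num.norm z h); exact: norm_continuous.
by exists `|f z| => // z' Kz'; apply: hz; rewrite inE.
Qed.

Lemma Bw_ex k (U K : set V) f : compact K -> K `<=` U -> Ck k U f ->
  exists2 M : R, 0 <= M & Bw k M K f.
Proof.
move=> cK KU; elim: k f => [|k IH] f [cf Cf].
  by have [M M0 hM] := compact_bound cK KU cf; exists M.
have [M M0 hM] := compact_bound cK KU cf.
have /choice[m hm] : forall p : 'I_n * bool, exists m, 0 <= m /\ Bw k m K (dirD (eb p) f).
  by move=> p; have [_ C] := Cf (eb p); have [m m0 h] := IH _ C; exists m.
have m0 p : 0 <= m p by have [] := hm p.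
have S0 : 0 <= \sum_p m p by apply: sumr_ge0.
exists (M + \sum_p m p); first by rewrite addr_ge0.
split; first by move=> z /hM h; apply: le_trans h _; rewrite lerDl.
move=> p; have [_ h] := hm p; apply: Bw_le h.
rewrite (bigD1 p) //= addrCA lerDl addr_ge0 //; exact: sumr_ge0.
Qed.

Lemma Bw_ext k (M : R) (U K : set V) f h : open U -> K `<=` U -> Ck k U f ->
  (forall z, U z -> f z = h z) -> Bw k M K f -> Bw k M K h.
Proof.
move=> oU KU; elim: k f h => [|k IH] f h [_ Cf] fh [b1 b2].
  by split=> // z Kz; rewrite -fh; [exact: b1|exact: KU].
split; first by move=> z Kz; rewrite -fh; [exact: b1|exact: KU].
move=> p; have [d C] := Cf (eb p).
apply: (IH (dirD (eb p) f) _ C _ (b2 p)) => z Uz.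
have [e e0 he] := (open_rnP _).1 oU z Uz.
have [_ H] := @dirD_ext R n f h z (eb p) e e0 (fun z' hz' => fh z' (he z' hz')).
exact: H (d z Uz).
Qed.

Lemma Ck_scale k (U : set V) f (a : R) : open U -> Ck k U f -> Ck k U (fun z => a * f z).
Proof.
move=> oU Cf; apply: (@BC_Ck R n unit k U (fun _ z => a * f z) _ tt).
apply: (@BCM R n unit k U (fun _ _ => a) (fun _ => f)) => //; last exact: Ck_BC.
by apply: (@BC_cst R n unit k U (fun=> a) `|a|).
Qed.

Lemma Bw_scale k (M a : R) (U K : set V) f : open U -> K `<=` U -> 0 <= a -> Ck k U f ->
  Bw k M K f -> Bw k (a * M) K (fun z => a * f z).
Proof.
move=> oU KU a0; elim: k f => [|k IH] f [_ Cf] [b1 b2].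
  by split=> // z Kz; rewrite normrM ger0_norm // ler_wpM2l // b1.
split; first by move=> z Kz; rewrite normrM ger0_norm // ler_wpM2l // b1.
move=> p; have [d C] := Cf (eb p).
apply: (@Bw_ext k _ U K (fun z => a * dirD (eb p) f z)) => //.
- exact: Ck_scale.
- move=> z Uz; have [dc ec] := dirD_cst a z (eb p).
  by have [_ ->] := dirDM dc (d z Uz); rewrite ec mul0r add0r.
- by apply: IH => //; exact: b2.
Qed.

Lemma Bw_basis_lb {S : Type} k (M : R) (U K : set V) (F : S -> V -> R) : open U -> U `<=` K ->
  (forall s, Bw k M K (F s)) -> basis_lb k U F.
Proof.
move=> oU UK; elim: k F => [|k IH] F b.
  split=> // z Uz; have [d d0 hd] := (open_rnP _).1 oU z Uz; exists M, d; split=> // s z' /hd /UK.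
  by have [h _] := b s; exact: h.
split.
  move=> z Uz; have [d d0 hd] := (open_rnP _).1 oU z Uz; exists M, d; split=> // s z' /hd /UK.
  by have [h _] := b s; exact: h.
by move=> p; apply: IH => s; have [_ h] := b s; exact: h.
Qed.
End WordBounds.

Section GeometricFunctional.
Context {R : realType}.

Definition gw (i : nat) : R := 2^-1 ^+ i.+1.
Lemma gw_gt0 i : 0 < gw i. Proof. by rewrite exprn_gt0 // invr_gt0. Qed.
Lemma gw_sum k : \sum_(i < k) gw i = 1 - 2^-1 ^+ k.
Proof.
elim: k => [|k IH]; first by rewrite big_ord0 expr0 subrr.
by rewrite big_ord_recr /= IH /gw exprS; lra.
Qed.

Definition gpart (f : nat -> R) k := \sum_(i < k) gw i * f i.
(** The series with weights [2^-(i+1)], taken as an ultralimit of partial sums so that linearity and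
    the supremum bound follow from those of [ulim]. It is a second instance of the functionals under
    which derivatives may be taken. *)
Definition gsum (f : nat -> R) : R := ulim (gpart f).

Lemma gpart_le f (M : R) k : 0 <= M -> (forall i, `|f i| <= M) -> `|gpart f k| <= M.
Proof.
move=> M0 hf; apply: le_trans (ler_norm_sum _ _ _) _.
apply: (@le_trans _ _ (\sum_(i < k) gw i * M)).
  by apply: ler_sum => i _; rewrite normrM gtr0_norm ?gw_gt0 // ler_wpM2l // ltW // gw_gt0.
by rewrite -mulr_suml gw_sum ler_piMl // gerBl exprn_ge0 // invr_ge0.
Qed.

Lemma gpart_bdd f : bdd f -> bdd (gpart f).
Proof.
move=> [M hM]; exists `|M| => k; apply: gpart_le => // i; exact: le_trans (hM i) (ler_norm _).
Qed.

Lemma gsumB f h : bdd f -> bdd h -> bdd (fun i => f i - h i) /\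
  gsum (fun i => f i - h i) = gsum f - gsum h.
Proof.
move=> bf bh; split.
  have [M hM] := bf; have [M' hM'] := bh; exists (M + M') => i.
  by apply: le_trans (ler_normB _ _) _; exact: lerD.
have E : gpart (fun i => f i - h i) = (fun k => gpart f k + (-1) * gpart h k).
  apply/funext => k; rewrite /gpart mulN1r -sumrN -big_split /=.
  by apply: eq_bigr => i _; rewrite mulrBr.
have bh' : bdd (fun k => (-1) * gpart h k).
  have [M hM] := gpart_bdd bh; exists M => k; by rewrite mulN1r normrN.
rewrite /gsum E (ulimD (gpart_bdd bf) bh') (ulimZ _ (gpart_bdd bh)) mulN1r //.
Qed.

Lemma gsumZ (t : R) f : bdd f -> bdd (fun i => t * f i) /\ gsum (fun i => t * f i) = t * gsum f.
Proof.
move=> bf; split.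
  by have [M hM] := bf; exists (`|t| * M) => i; rewrite normrM ler_wpM2l.
rewrite /gsum -(ulimZ _ (gpart_bdd bf)); congr ulim; apply/funext => k.
by rewrite /gpart mulr_sumr; apply: eq_bigr => i _; rewrite mulrCA.
Qed.

Lemma bdd_cst (c : R) : bdd (fun=> c). Proof. by exists `|c|. Qed.

Lemma gsum_bound f (M : R) : 0 <= M -> bdd f -> (forall i, `|f i| <= M) -> `|gsum f| <= 1 * M.
Proof.
move=> M0 bf hf; rewrite mul1r ler_norml -(ulim_cst M) -(ulim_cst (- ulim (fun=> M))).
have h k : - M <= gpart f k <= M by rewrite -ler_norml; exact: gpart_le.
apply/andP; split; apply: (@ulim_le _ _ _ 0%N); do ?[exact: bdd_cst|exact: gpart_bdd].
  by move=> k _; rewrite ulim_cst; case/andP: (h k).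
by move=> k _; case/andP: (h k).
Qed.

Lemma gsum_gt0 f j : bdd f -> (forall i, 0 <= f i) -> 0 < f j -> 0 < gsum f.
Proof.
move=> bf f0 fj; apply: (@lt_le_trans _ _ (gw j * f j)); first by rewrite mulr_gt0 // gw_gt0.
rewrite -(ulim_cst (gw j * f j)); apply: (@ulim_le _ _ _ j.+1).
- exact: bdd_cst.
- exact: gpart_bdd.
move=> k jk; rewrite /gpart (bigD1 (Ordinal jk)) //= lerDl.
by apply: sumr_ge0 => i _; rewrite mulr_ge0 // ltW // gw_gt0.
Qed.
End GeometricFunctional.

(** Each member of the countable base contained in some [W x] selects such an [x]; indices without
    such a member receive the default [x0]. *)
Lemma lindelof (T : topologicalType) (W : T -> set T) (x0 : T) : @second_countable T ->
  (forall x, open (W x) /\ W x x) -> exists e : nat -> T, forall y, exists i, W (e i) y.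
Proof.
move=> [B /countable_injP[f fi] [Bo Bb]] hW.
have /choice[e he] : forall i : nat, exists x, (exists2 U, B U /\ f U = i & exists x, U `<=` W x) ->
    forall U, B U -> f U = i -> U `<=` W x.
  move=> i; have [[U [BU fU] [x hx]]|no] := pselect (exists2 U, B U /\ f U = i & exists x, U `<=` W x).
    exists x => _ U' BU' fU'; have -> // : U' = U by apply: fi; rewrite ?inE // fU fU'.
  by exists x0.
exists e => y; have [oW Wy] := hW y.
have [U [BU Uy] UW] := Bb y (W y) (open_nbhs_nbhs (conj oW Wy)).
exists (f U); apply: (he (f U) _ U) => //; by exists U => //; exists y.
Qed.

Section Pullback.
Context {R : realType} {n : nat} {X : complexManifold R n}.

Lemma Ck_pullback k c c' x (F : X -> X) O f : chart_dom c x -> chart_dom c' (F x) ->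
  holomorphic F -> open O -> O (chart_map c' (F x)) -> Ck k O (f \o chart_inv c') ->
  exists2 d : R, 0 < d & Ck k [set z | rn (z - chart_map c x) < d] (f \o F \o chart_inv c).
Proof.
move=> cx cx' [cF dF] oO Ox Cf.
have H1 : \forall y \near x, chart_dom c' (F y) /\ O (chart_map c' (F y)).
  have h1 : nbhs (F x) (chart_dom c') by apply: open_nbhs_nbhs; split=> //; exact: chart_dom_open.
  have h2 : nbhs (F x) (chart_map c' @^-1` O).
    by apply: (@chart_map_continuous R n X c' (F x) cx'); apply: open_nbhs_nbhs.
  exact: cF (filterI h1 h2).
have [d d0 hd] := near_chart_inv cx H1; exists d => //.
set U := [set z | _]; have oU : open U by exact: open_rn_ball.
pose a := local_rep F c c'.
have da z : U z -> differentiable a z.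
  by move=> /hd [cz Kz [h1 h2]]; rewrite -Kz; exact: (dF c c').
apply: (@BC_Ck R n unit k U (fun _ => f \o F \o chart_inv c) _ tt).
apply: (@BC_ext R n unit k U (fun _ z => (f \o chart_inv c') (a z))) => //.
  by move=> _ z /hd [cz Kz [h1 h2]]; rewrite /a /local_rep /= chart_mapK.
apply: (@BC_comp R n n unit k U O (fun _ => f \o chart_inv c') (fun _ => a)) => //.
- by move=> _ z /hd [cz Kz [h1 h2]].
- split=> [_ z|z Uz]; first exact: da.
  by have [e e0 he] := diff_locally_bounded (da z Uz); exists (1 + rn (a z)), e.
apply: (@BC_PC R n n unit k U O (fun _ => f \o chart_inv c') a).
  move=> z Uz; split; first by have [cz Kz [h1 h2]] := hd z Uz.
  by apply: differentiable_continuous; exact: da.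
exact: Ck_BC.
Qed.

Lemma smooth_pullback (F : X -> X) (f : X -> R) : holomorphic F -> smooth_on [set: X] f ->
  smooth_on [set: X] (f \o F).
Proof.
move=> hF sf; apply: smooth_local => k c x cx; have [c' cx'] := chart_cover (F x).
apply: (Ck_pullback cx cx' hF (@chart_image_open R n X c')); first exact: chart_image.
by have := sf c' k; rewrite setIT.
Qed.

Lemma smooth_near (f : X -> R) x (e : R) : smooth_on [set: X] f -> 0 < e ->
  \forall y \near x, `|f y - f x| < e.
Proof.
move=> sf e0; have [c cx] := chart_cover x; apply: (near_chart cx).
have [cf _] := sf c 0%N; rewrite setIT in cf.
have [d d0 hd] := (cont_rnP _ _).1 (cf _ (chart_image cx)) e e0; exists d => // z /hd.
by rewrite /= chart_mapK.
Qed.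

(** Dividing the terms by fast growing constants bounds, in each chart of a countable family, every
    derivative uniformly in the index. Relations of the form [t * w y' = w y] shared by all
    functions in [P] are linear in [w] and pass to the sum. *)
Lemma positive_combination (P : (X -> R) -> Prop) :
  (forall x, exists v, [/\ P v, smooth_on [set: X] v, forall y, 0 <= v y & 0 < v x]) ->
  exists v : X -> R, [/\ smooth_on [set: X] v, forall x, 0 < v x &
    forall (t : R) y y', (forall w, P w -> t * w y' = w y) -> t * v y' = v y].
Proof.
move=> H; have [[x0 _]|/nonemptyPn X0] := pselect ([set: X] !=set0); last first.
  have no (x : X) : False by have : [set: X] x by []; rewrite X0.
  exists (fun _ => 1); split => [|x|t y]; [|by case: (no x)|by case: (no y)].
  by apply: smooth_local => k c x; case: (no x).
have /choice[w hw] := H.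
have [e he] : exists e : nat -> X, forall y, exists i, 0 < w (e i) y.
  apply: (@lindelof X (fun x => [set y | 0 < w x y]) x0); first exact: space_second_countable.
  move=> x; have [_ sw _ wx] := hw x; split=> //; rewrite openE => y /= wy.
  apply: filterS (smooth_near y sw wy) => y' /=; rewrite ltr_norml => /andP[]; lra.
pose u i := w (e i).
have us i : smooth_on [set: X] (u i) by have [] := hw (e i).
have u0 i y : 0 <= u i y by have [_ _ h _] := hw (e i); exact: h.
have Pu i : P (u i) by have [] := hw (e i).
(* Closed coordinate balls: compact sets on which derivatives have bounds, while countably many of
   their interiors cover [X]. *)
have /choice[cr hcr] : forall x, exists cr : chart X * R, [/\ chart_dom cr.1 x, 0 < cr.2 &
    forall z, rn (z - chart_map cr.1 x) <= cr.2 -> (chart_map cr.1 @` chart_dom cr.1) z].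
  move=> x; have [c cx] := chart_cover x; have [d d0 hd] := chart_ball cx.
  exists (c, d / 2); split=> //=; first exact: divr_gt0.
  by move=> z hz; apply: hd; apply: le_lt_trans hz _; rewrite ltr_pdivrMr // mulr_natr mulr2n ltrDl.
pose cc x := (cr x).1; pose cp x := chart_map (cc x) x; pose cd x := (cr x).2.
have [e' he'] : exists e' : nat -> X, forall y, exists j, chart_dom (cc (e' j)) y /\
    rn (chart_map (cc (e' j)) y - cp (e' j)) < cd (e' j).
  apply: (@lindelof X (fun x => [set y | chart_dom (cc x) y /\
    rn (chart_map (cc x) y - cp x) < cd x]) x0); first exact: space_second_countable.
  move=> x; have [cx d0 _] := hcr x; split; last by split=> //; rewrite subrr rn0.
  rewrite openE => y [cy hy].
  have h1 : nbhs y (chart_dom (cc x)) by apply: open_nbhs_nbhs; split=> //; exact: chart_dom_open.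
  have h2 : nbhs y (chart_map (cc x) @^-1` [set z | rn (z - cp x) < cd x]).
    apply: (@chart_map_continuous R n X (cc x) y cy); apply: open_nbhs_nbhs; split=> //.
    exact: open_rn_ball.
  exact: filterI h1 h2.
pose c j := cc (e' j); pose I j := chart_map (c j) @` chart_dom (c j).
pose K j := [set z : Cspace R n | rn (z - cp (e' j)) <= cd (e' j)].
pose O j := [set z : Cspace R n | rn (z - cp (e' j)) < cd (e' j)].
have KI j : K j `<=` I j by have [_ _ h] := hcr (e' j).
have OK j : O j `<=` K j by move=> z; exact: ltW.
have oI j : open (I j) by exact: chart_image_open.
have CI k i j : Ck k (I j) (u i \o chart_inv (c j)).
  by have := us i (c j) k; rewrite setIT.
have /choice[M hM] : forall ijk : nat * nat * nat, exists M : R, 0 <= M /\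
    Bw ijk.2 M (K ijk.1.2) (u ijk.1.1 \o chart_inv (c ijk.1.2)).
  move=> [[i j] k]; have [M M0 h] := Bw_ex (@compact_rn_ball R n _ _) (@KI j) (CI k i j).
  by exists M.
have M0 ijk : 0 <= M ijk by have [] := hM ijk.
(* Diagonal choice: [D i] dominates the derivatives of [u i] of order [k < i] on the balls with
   index [j < i], so each pair [(j, k)] is missed by finitely many [i] only. *)
pose D i := 1 + \sum_(j < i) \sum_(k < i) M (i, val j, val k).
have D1 i : 1 <= D i by rewrite lerDl; apply: sumr_ge0 => j _; apply: sumr_ge0.
have D0 i : 0 < D i by exact: lt_le_trans ltr01 (D1 i).
have Mle i j k : (j < i)%N -> (k < i)%N -> M (i, j, k) <= D i.
  move=> ji ki; rewrite /D (bigD1 (Ordinal ji)) //= (bigD1 (Ordinal ki)) //=.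
  have s1 : 0 <= \sum_(i0 < i | i0 != Ordinal ki) M (i, j, val i0) by apply: sumr_ge0.
  have s2 : 0 <= \sum_(i0 < i | i0 != Ordinal ji) \sum_(k0 < i) M (i, val i0, val k0).
    by apply: sumr_ge0 => j' _; apply: sumr_ge0.
  by lra.
pose F j i z := (D i)^-1 * u i (chart_inv (c j) z).
have BF j k : BC k (O j) (F j).
  have oO : open (O j) by exact: open_rn_ball.
  apply: basis_BC => //.
    move=> i; apply: (@Ck_scale R n k (O j) (u i \o chart_inv (c j))) => //.
    apply: (@BC_Ck R n unit k (O j) (fun _ => u i \o chart_inv (c j)) _ tt).
    apply: (@BC_subset R n unit k (I j)); last exact: Ck_BC.
    by move=> z /OK /KI.
  (* The finitely many terms with [i <= maxn j k], which [D i] does not dominate, are bounded by an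
     explicit sum; the others are at most 1. *)
  pose Q := 1 + \sum_(i < (maxn j k).+1) M (val i, j, k).
  apply: (@Bw_basis_lb R n nat k Q (O j) (K j)) => // i.
  have [_ /= b] := hM (i, j, k).
  have Di : 0 <= (D i)^-1 by rewrite invr_ge0 ltW.
  have := Bw_scale (oI j) (@KI j) Di (CI k i j) b; apply: Bw_le.
  have [ik|ik] := ltnP (maxn j k) i.
    rewrite mulrC ler_pdivrMr //; apply: (@le_trans _ _ (D i)).
      by apply: Mle; apply: leq_ltn_trans ik; rewrite ?leq_maxl ?leq_maxr.
    by rewrite ler_peMl ?(ltW (D0 i)) // lerDl; apply: sumr_ge0.
  rewrite mulrC ler_pdivrMr //; apply: (@le_trans _ _ Q); last first.
    by rewrite ler_peMr // addr_ge0 // sumr_ge0.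
  have ik' : (i < (maxn j k).+1)%N by [].
  rewrite /Q (bigD1 (Ordinal ik')) //=.
  have : 0 <= \sum_(i0 < (maxn j k).+1 | i0 != Ordinal ik') M (val i0, j, k) by apply: sumr_ge0.
  by lra.
have bddF j z : O j z -> bdd (F j ^~ z).
  move=> Oz; have /BC_lb := BF j 0%N => /(_ z Oz) [B [d [d0 hB]]]; exists B => i.
  by apply: hB; rewrite subrr rn0.
have bddu y : bdd (fun i => (D i)^-1 * u i y).
  have [j [cy hy]] := he' y; have := bddF j (chart_map (c j) y) hy.
  by rewrite /F chart_mapK.
pose v y := gsum (fun i => (D i)^-1 * u i y).
exists v; split.
- apply: smooth_local => k c' x cx; have [j [cy hy]] := he' x.
  have oO : open (O j) by exact: open_rn_ball.
  apply: (@Ck_pullback k c' (c j) x id (O j) v) => //; first exact: holomorphic_id.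
  exact: (@functional_Ck R n nat bdd gsum 1 ler01 gsumB gsumZ gsum_bound
    (fun f H => ltac:(have [h [M' hM'] fh] := H 1 ltr01; exists (1 + M') => i;
       rewrite -[f i](subrK (h i)); apply: le_trans (ler_normD _ _) _; exact: lerD))
    k (O j) (F j) oO (BF j k.+1) (bddF j)).
- move=> x; have [i hi] := he x; apply: (@gsum_gt0 _ _ i) => //.
    by move=> i'; rewrite mulr_ge0 // invr_ge0 ltW.
  by rewrite mulr_gt0 // invr_gt0.
- move=> t y y' ht; rewrite /v; have [_ <-] := gsumZ t (bddu y').
  by congr gsum; apply/funext => i; rewrite mulrCA ht.
Qed.
End Pullback.

(** * Conformal factors of Kahler metrics *)

Section DerivativeRules.
Context {R : realType}.

Lemma is_derive_bigsum (I : Type) (s : seq I) (h : I -> R -> R) (dh : I -> R) (t : R) :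
  (forall i, is_derive t 1 (h i) (dh i)) ->
  is_derive t 1 (fun x => \sum_(i <- s) h i x) (\sum_(i <- s) dh i).
Proof.
move=> H; elim: s => [|i s IH].
  rewrite big_nil; have -> : (fun x : R => \sum_(i <- [::]) h i x) = cst 0.
    by apply/funext => x; rewrite big_nil.
  exact: is_derive_cst.
rewrite big_cons; have -> : (fun x => \sum_(j <- i :: s) h j x) = h i + (fun x => \sum_(j <- s) h j x).
  by apply/funext => x; rewrite big_cons.
exact: is_deriveD.
Qed.

Lemma is_derive_mul3 (P Q W : R -> R) (t dp dq dw : R) :
  is_derive t 1 P dp -> is_derive t 1 Q dq -> is_derive t 1 W dw ->
  is_derive t 1 (fun x => P x * Q x * W x) (dp * Q t * W t + P t * dq * W t + P t * Q t * dw).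
Proof.
move=> hP hQ hW; apply: (is_derive_eq (is_deriveM (is_deriveM hP hQ) hW)).
rewrite /GRing.scale /= -[(P * Q) t]/(P t * Q t); ring.
Qed.
End DerivativeRules.

(** In its use, [x1] to [x4] contain second derivatives of the map: [x1] and [x3] occur twice by
    their symmetry, [x2 = - x4] holds by symmetry and antisymmetry of the form, and the [d] terms
    cancel because the form is closed. *)
Lemma cancel_terms {R : realType} (x1 x2 x3 x4 d1 d2 d3 : R) : d1 - d2 + d3 = 0 -> x2 = - x4 ->
  x1 + x2 + d1 - (x1 + x3 + d2) + (x4 + x3 + d3) = 0.
Proof. by move=> h1 h2; lra. Qed.

Lemma contraction_terms {R : realType} (d0 d1 d2 a k1 k2 k3 f : R) : k1 - k2 + k3 = 0 ->
  d0 * a + f * k1 - (d1 * 0 + f * k2) + (d2 * 0 + f * k3) = 0 -> d0 * a = 0.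
Proof.
move=> h; rewrite (_ : d0 * a + _ - _ + _ = d0 * a + f * (k1 - k2 + k3)); last by ring.
by rewrite h mulr0 addr0.
Qed.

Lemma coefficients_zero {R : realType} (s t : R[i]) (a b : R) :
  s * 0 + t * ('i * 0) + ((- a)%:C * 1 + b%:C * ('i * 1)) = 0 -> a = 0 /\ b = 0.
Proof.
rewrite !mulr0 !mulr1 !add0r => /eqP; rewrite eq_complex /= => /andP[/eqP h1 /eqP h2].
by split; lra.
Qed.

Lemma rotate_combination {R : realType} (a a' b b' : R) (p q : R[i]) :
  'i * (a%:C * p + (- b)%:C * ('i * p) + ((- a')%:C * q + b'%:C * ('i * q))) =
  a%:C * ('i * p) + b%:C * p + ((- a')%:C * ('i * q) + (- b')%:C * q).
Proof.
have ii : 'i * 'i = -1 :> R[i] by rewrite -expr2 sqr_i.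
have -> : 'i * (a%:C * p + (- b)%:C * ('i * p) + ((- a')%:C * q + b'%:C * ('i * q))) =
  a%:C * ('i * p) + ('i * 'i) * ((- b)%:C * p) + ((- a')%:C * ('i * q) + ('i * 'i) * (b'%:C * q)).
  by ring.
by rewrite ii !rmorphN; ring.
Qed.

Lemma row_combination {R : realType} n (e0 e1 : 'rV[R[i]]_n) (s t u w : R[i]) j :
  (s *: e0 + t *: ('i *: e0) + (u *: e1 + w *: ('i *: e1))) ord0 j =
  s * e0 ord0 j + t * ('i * e0 ord0 j) + (u * e1 ord0 j + w * ('i * e1 ord0 j)).
Proof. by rewrite !mxE. Qed.

Lemma rotate_row {R : realType} n (e0 e1 : 'rV[R[i]]_n) (a a' b b' : R) :
  'i *: (a%:C *: e0 + (- b)%:C *: ('i *: e0) + ((- a')%:C *: e1 + b'%:C *: ('i *: e1))) =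
  a%:C *: ('i *: e0) + b%:C *: e0 + ((- a')%:C *: ('i *: e1) + (- b')%:C *: e1).
Proof.
apply/rowP => j; rewrite [LHS]mxE row_combination !mxE.
exact: rotate_combination.
Qed.

Section FactorConstant.
Context {R : realType} {n : nat} {X : complexManifold R n} {g : tensorField X}.
Hypothesis gK : kahler_metric g.
Let hg : hermitian_metric g := proj1 gK.
Local Notation V := (Cspace R n).
Implicit Types (c : chart X) (x : X).

Definition om c (w A B : V) : R := g c (chart_inv c w) ('i *: A) B.

Lemma scale_ii (A : V) : 'i *: ('i *: A) = - A :> V.
Proof.
by apply/rowP => j; rewrite !mxE mulrA -expr2 sqr_i mulN1r.
Qed.

Section At.
Context {c : chart X} {w : V}.
Hypothesis cw : chart_dom c (chart_inv c w).

Lemma om_anti A B : om c w A B = - om c w B A.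
Proof.
rewrite /om -(gJ hg cw ('i *: A)) scale_ii (gNl hg cw); congr (- _).
exact: (gC hg cw).
Qed.

Lemma omDl A A' B : om c w (A + A') B = om c w A B + om c w A' B.
Proof.
rewrite /om -(gDl hg cw); congr (g _ _ _ _).
by apply/rowP => j; rewrite !mxE mulrDr.
Qed.

Lemma omZl (t : R) A B : om c w (t%:C *: A) B = t * om c w A B.
Proof.
have E : 'i *: (t%:C *: A) = t%:C *: ('i *: A) :> V.
  by rewrite [LHS](@scalerA R[i] V) [RHS](@scalerA R[i] V) mulrC.
exact: etrans (congr1 (fun u => g c (chart_inv c w) u B) E) (gZl hg cw t ('i *: A) B).
Qed.

Lemma omDr A B B' : om c w A (B + B') = om c w A B + om c w A B'.
Proof. exact: (gDr hg cw). Qed.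
Lemma omZr (t : R) A B : om c w A (t%:C *: B) = t * om c w A B.
Proof. exact: (gZr hg cw). Qed.

Lemma om_expand A B : om c w A B = \sum_p \sum_q rc p A * rc q B * om c w (eb p) (eb q).
Proof.
have H1 (s : seq ('I_n * bool)) : om c w (\sum_(p <- s) (rc p A)%:C *: eb p) B =
    \sum_(p <- s) rc p A * om c w (eb p) B.
  elim: s => [|p s IH]; last by rewrite !big_cons omDl omZl IH.
  rewrite !big_nil; have := omZl 0 0 B; rewrite mul0r => <-; congr (om _ _ _ _).
  by apply/rowP => j; rewrite !mxE mulr0.
rewrite {1}[A]real_basis H1; apply: eq_bigr => p _.
have H2 (s : seq ('I_n * bool)) : om c w (eb p) (\sum_(q <- s) (rc q B)%:C *: eb q) =
    \sum_(q <- s) rc q B * om c w (eb p) (eb q).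
  elim: s => [|q s IH]; last by rewrite !big_cons omDr omZr IH.
  rewrite !big_nil; have := omZr 0 (eb p) 0; rewrite mul0r => <-; congr (om _ _ _ _).
  by apply/rowP => j; rewrite !mxE mulr0.
by rewrite {1}[B]real_basis H2 mulr_sumr; apply: eq_bigr => q _; rewrite mulrA.
Qed.
End At.

Lemma om_smooth c A B k : Ck k (chart_map c @` chart_dom c) (fun w => om c w A B).
Proof. by have := hermitian_smooth hg c ('i *: A) B k; rewrite setIT. Qed.

Lemma dirD_om c (U A B w : V) : (chart_map c @` chart_dom c) w ->
  dirD U (fun z => om c z A B) w =
  \sum_p \sum_q rc p A * rc q B * dirD U (fun z => om c z (eb p) (eb q)) w.
Proof.
move=> Iw; have [d d0 hd] := (open_rnP _).1 (@chart_image_open R n X c) w Iw.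
have E z' : rn (z' - w) < d -> (fun z => \sum_p \sum_q rc p A * rc q B * om c z (eb p) (eb q)) z' = om c z' A B.
  by move=> /hd /chart_imageK [cz _]; rewrite (om_expand cz A B).
have D p q : is_derive (0 : R) 1 (along (fun z => rc p A * rc q B * om c z (eb p) (eb q)) w U)
    (rc p A * rc q B * dirD U (fun z => om c z (eb p) (eb q)) w).
  have [_ H] := om_smooth c (eb p) (eb q) 1; have [h _] := H U.
  have [dc ec] := dirD_cst (rc p A * rc q B) w U.
  have [h1 h2] := dirDM dc (h w Iw); rewrite ec mul0r add0r in h2.
  by rewrite -h2; exact: DeriveDef.
have DS := is_derive_bigsum (index_enum _) (fun p => is_derive_bigsum (index_enum _) (D p)).
have [h1 h2] := @dirD_ext R n _ _ w U d d0 E.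
have [e1 e2] := DS.
by rewrite -h2 //; exact: e2.
Qed.

Section Pullback.
Context {c c' : chart X} {x : X} {F : X -> X}.
Hypotheses (cx : chart_dom c x) (cx' : chart_dom c' (F x)) (hF : holomorphic F).
Let a := local_rep F c c'.
Let z0 := chart_map c x.

Lemma pull_near : exists2 d : R, 0 < d & forall z, rn (z - z0) < d ->
  [/\ chart_dom c (chart_inv c z), chart_map c (chart_inv c z) = z,
    chart_dom c' (F (chart_inv c z)) & differentiable a z].
Proof.
have [cF dF] := hF.
have H1 : \forall y \near x, chart_dom c' (F y).
  by apply: cF; apply: open_nbhs_nbhs; split=> //; exact: chart_dom_open.
have [d d0 hd] := near_chart_inv cx H1; exists d => // z /hd [cz Kz Fz]; split => //.
by rewrite -Kz; exact: (dF c c').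
Qed.

Definition d2 (A B : V) : V := 'd (fun z => 'd a z A) z0 B.

Lemma d2C A B : d2 A B = d2 B A.
Proof.
have [d d0 hd] := pull_near.
by apply: (@holo_deriv_sym R n n a z0 A B d d0) => z /hd [].
Qed.

Lemma a_z0 : a z0 = chart_map c' (F x).
Proof. by rewrite /a /local_rep /= /z0 chart_mapK. Qed.

(** Both the base point and the two arguments vary. Expansion in the real basis turns the pulled
    back form into a sum of products of three scalar functions, to which the product rule
    applies. *)
Lemma dirD_pullback (U A B : V) :
  is_derive (0 : R) 1 (along (fun z => om c' (a z) ('d a z A) ('d a z B)) z0 U)
    (om c' (a z0) (d2 A U) ('d a z0 B) + om c' (a z0) ('d a z0 A) (d2 B U) +
     dirD ('d a z0 U) (fun w => om c' w ('d a z0 A) ('d a z0 B)) (a z0)).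
Proof.
have [d d0 hd] := pull_near.
have daz z : rn (z - z0) < d -> differentiable a z by move=> /hd [].
have da0 : differentiable a z0 by apply: daz; rewrite subrr rn0.
have Iz z : rn (z - z0) < d -> chart_dom c' (chart_inv c' (a z)).
  by move=> /hd [_ _ h _]; rewrite /a /local_rep /= chart_mapK.
have Ia : (chart_map c' @` chart_dom c') (a z0) by rewrite a_z0; exact: chart_image.
have cz0 : chart_dom c' (chart_inv c' (a z0)) by rewrite a_z0 chart_mapK.
have [r r0 hr] := (open_rnP _).1 (@chart_image_open R n X c') _ Ia.
have dda A' : differentiable (fun z => 'd a z A') z0 by have [] := @holo_deriv R n n a z0 A' d d0 daz.
have DW p q : is_derive (0 : R) 1 (along (fun z => om c' (a z) (eb p) (eb q)) z0 U)
    (dirD ('d a z0 U) (fun w => om c' w (eb p) (eb q)) (a z0)).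
  have C1 := om_smooth c' (eb p) (eb q) 1; have [_ H] := C1.
  rewrite (dirD_basis ('d a z0 U) (@chart_image_open R n X c') C1 Ia).
  apply: (@chain_rule R n n (fun w => om c' w (eb p) (eb q)) a z0 U r r0) => //.
    by move=> s w /hr Iw; have [h _] := H (eb s); exact: h.
  by move=> s; have [_ [h _]] := H (eb s); exact: h.
have D p q := is_derive_mul3 (@dirD_rc R n n (fun z => 'd a z A) z0 U p (dda A))
  (@dirD_rc R n n (fun z => 'd a z B) z0 U q (dda B)) (DW p q).
have [s1 s2] := is_derive_bigsum (index_enum _) (fun p => is_derive_bigsum (index_enum _) (D p)).
pose f z := \sum_p \sum_q rc p ('d a z A) * rc q ('d a z B) * om c' (a z) (eb p) (eb q).
have E z : rn (z - z0) < d -> f z = om c' (a z) ('d a z A) ('d a z B).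
  by move=> /Iz h; rewrite (om_expand h).
have [h1 h2] := @dirD_ext R n f _ z0 U d d0 E.
apply: DeriveDef; first exact: h1.
apply: etrans (esym (h2 s1)) _; apply: (etrans s2).
rewrite !(om_expand cz0) (dirD_om _ _ _ Ia) -!big_split /=; apply: eq_bigr => p _.
by rewrite -!big_split /=; apply: eq_bigr => q _; rewrite !along0.
Qed.
End Pullback.

Lemma kahler_om c w u v t : (chart_map c @` chart_dom c) w ->
  dirD u (fun z => om c z v t) w - dirD v (fun z => om c z u t) w
  + dirD t (fun z => om c z u v) w = 0.
Proof.
move=> /chart_imageK [cw Kw]; have [_ H] := gK.
by have := H c (chart_inv c w) cw I u v t; rewrite /ext_deriv Kw.
Qed.

(* The second derivatives of [F] cancel by symmetry. *)
Lemma pullback_closed c c' x (F : X -> X) u v t : chart_dom c x -> chart_dom c' (F x) ->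
  holomorphic F ->
  let H A B := fun z => om c' (local_rep F c c' z) ('d (local_rep F c c') z A)
    ('d (local_rep F c c') z B) in
  dirD u (H v t) (chart_map c x) - dirD v (H u t) (chart_map c x)
  + dirD t (H u v) (chart_map c x) = 0.
Proof.
move=> cx cx' hF H.
pose w0 := local_rep F c c' (chart_map c x).
have [L [Q [QC E]]] : exists (L : V -> V) (Q : V -> V -> V), (forall A B, Q A B = Q B A) /\
    forall U A B, dirD U (H A B) (chart_map c x) = om c' w0 (Q A U) (L B) + om c' w0 (L A) (Q B U) +
      dirD (L U) (fun w => om c' w (L A) (L B)) w0.
  exists ('d (local_rep F c c') (chart_map c x)), (@d2 c c' x F).
  split=> [A B|U A B]; first exact: (d2C cx cx' hF).
  exact: (@derive_val _ _ _ _ _ _ _ (dirD_pullback cx cx' hF U A B)).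
have Ia := chart_image cx'; rewrite -(@a_z0 c c' x F cx) -/w0 in Ia.
have [cz0 _] := chart_imageK Ia.
have k := kahler_om (L u) (L v) (L t) Ia.
have a1 := om_anti cz0 (L v) (Q u t).
rewrite (E u v t) (E v u t) (E t u v) (QC v u) (QC t u) (QC v t).
exact: cancel_terms k a1.
Qed.

Lemma g_combination c x (cx : chart_dom c x) (a b d e : R) (p q r s u : V) :
  g c x (a%:C *: p + b%:C *: q + (d%:C *: r + e%:C *: s)) u =
  a * g c x p u + b * g c x q u + (d * g c x r u + e * g c x s u).
Proof.
rewrite (gDl hg cx (a%:C *: p + b%:C *: q)) (gDl hg cx (a%:C *: p)) (gDl hg cx (d%:C *: r)).
by rewrite (gZl hg cx a) (gZl hg cx b) (gZl hg cx d) (gZl hg cx e).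
Qed.

(** The two conditions say that the Hermitian product of [v] with [u] vanishes. This is one complex
    equation, with a nonzero solution in the plane spanned by two coordinate vectors; here the
    dimension enters. *)
Lemma orthogonal_vector c x u : (2 <= n)%N -> chart_dom c x ->
  exists2 v : V, v != 0 & g c x v u = 0 /\ g c x ('i *: v) u = 0.
Proof.
move=> n2 cx; have n1 : (1 < n)%N by []; have n0 : (0 < n)%N by apply: ltn_trans n1.
pose j0 := Ordinal n0; pose j1 := Ordinal n1.
pose e0 : V := delta_mx ord0 j0; pose e1 : V := delta_mx ord0 j1.
pose A0 := g c x e0 u; pose A1 := g c x e1 u.
pose B0 := g c x ('i *: e0) u; pose B1 := g c x ('i *: e1) u.
have e00 : e0 != 0.
  apply/eqP => /rowP /(_ j0); rewrite !mxE !eqxx /= => /eqP; by rewrite oner_eq0.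
have [|nz] := pselect (A0 = 0 /\ B0 = 0); first by exists e0.
(* The combination [(A1 - i B1) e0 - (A0 - i B0) e1], the evident solution of one equation in two
   unknowns; it is nonzero as [A0] and [B0] do not both vanish. *)
pose v : V := A1%:C *: e0 + (- B1)%:C *: ('i *: e0) + ((- A0)%:C *: e1 + B0%:C *: ('i *: e1)).
exists v.
  apply/eqP => v0; apply: nz.
  have E0 : (e0 : 'rV[R[i]]_n) ord0 j1 = 0 by rewrite !mxE eqxx.
  have E1 : (e1 : 'rV[R[i]]_n) ord0 j1 = 1 by rewrite !mxE !eqxx.
  have : (v : 'rV[R[i]]_n) ord0 j1 = 0 by rewrite v0 mxE.
  have -> := row_combination e0 e1 A1%:C (- B1)%:C (- A0)%:C B0%:C j1.
  by rewrite E0 E1; exact: coefficients_zero.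
have iv := rotate_row e0 e1 A1 A0 B1 B0 : 'i *: v = _.
split.
  apply: (etrans (g_combination cx A1 (- B1) (- A0) B0 e0 ('i *: e0) e1 ('i *: e1) u)).
  by rewrite -/A0 -/A1 -/B0 -/B1; ring.
apply: (etrans (congr1 (fun z => g c x z u) iv)).
apply: (etrans (g_combination cx A1 B1 (- A0) (- B0) ('i *: e0) e0 ('i *: e1) e1 u)).
by rewrite -/A0 -/A1 -/B0 -/B1; ring.
Qed.

Variables (F : X -> X) (f : X -> R).
Hypotheses (n2 : (2 <= n)%N) (hF : holomorphic F) (sf : smooth_on [set: X] f)
  (pF : pullback_scaled F g f g).

(** The closed form [f * omega] is evaluated on [u], [v], [J v] with [v] complex orthogonal to [u]:
    of the terms with a derivative of [f] only [df (u) * g (v, v)] survives, and the rest vanishes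
    because [omega] is closed. *)
Lemma factor_dirD c x u : chart_dom c x -> dirD u (f \o chart_inv c) (chart_map c x) = 0.
Proof.
move=> cx; have [c' cx'] := chart_cover (F x).
have [d d0 hd] := pull_near cx cx' hF.
set z0 := chart_map c x.
have [v v0 [v1 v2]] := orthogonal_vector u n2 cx.
have E A B z : rn (z - z0) < d ->
    f (chart_inv c z) * om c z A B = om c' (local_rep F c c' z) ('d (local_rep F c c') z A)
      ('d (local_rep F c c') z B).
  move=> /hd [cz Kz Fz daz].
  rewrite /om /local_rep /= chart_mapK // -[chart_map c' \o F \o chart_inv c]/(local_rep F c c').
  rewrite -(pF cz Fz) /tangent_map Kz; congr (g _ _ _ _).
  exact: diff_scale.
have Iz : (chart_map c @` chart_dom c) z0 by exact: chart_image.
have df U : derivable (along (f \o chart_inv c) z0 U) 0 1.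
  by have [_ /(_ U) [h _]] := sf c 1; apply: h; rewrite setIT.
have dom A B U : derivable (along (fun z => om c z A B) z0 U) 0 1.
  by have [_ /(_ U) [h _]] := om_smooth c A B 1; exact: h.
have P U A B : dirD U (fun z => om c' (local_rep F c c' z) ('d (local_rep F c c') z A)
      ('d (local_rep F c c') z B)) z0 =
    dirD U (f \o chart_inv c) z0 * om c z0 A B + f x * dirD U (fun z => om c z A B) z0.
  have [h1 h2] := dirDM (df U) (dom A B U).
  have [_ <-] := @dirD_ext R n (fun z => (f \o chart_inv c) z * om c z A B) _ z0 U d d0 (E A B) => //.
  by rewrite h2 /= /z0 chart_mapK.
have := pullback_closed u v ('i *: v) cx cx' hF; rewrite /= -/z0 !P.
have := kahler_om u v ('i *: v) Iz.
have o1 : om c z0 v ('i *: v) = g c x v v by rewrite /om /z0 chart_mapK // (gJ hg cx).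
have o2 : om c z0 u ('i *: v) = 0 by rewrite /om /z0 chart_mapK // (gJ hg cx) (gC hg cx).
have o3 : om c z0 u v = 0.
  have cz : chart_dom c (chart_inv c z0) by rewrite /z0 chart_mapK.
  by rewrite (om_anti cz) /om /z0 chart_mapK // v2 oppr0.
rewrite o1 o2 o3 => k1 k2.
have := contraction_terms k1 k2.
by move=> /eqP; rewrite mulf_eq0 (gt_eqF (g_gt0 hg cx v0)) orbF => /eqP.
Qed.

Lemma factor_constant (Xc : connected [set: X]) x y : f x = f y.
Proof.
move: x y; apply: (connected_class Xc) => [x|x y z -> //].
have [c cx] := chart_cover x; have [d d0 hd] := chart_ball cx.
apply: (near_chart cx); exists d => // z hz.
suff -> : f (chart_inv c z) = f x by [].
set h := z - chart_map c x.
have [] := @dir_MVT R n (f \o chart_inv c) (chart_map c x) h 1.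
  move=> t; rewrite normr1 => t1.
  have It : (chart_map c @` (chart_dom c `&` setT)) (chart_map c x + t%:C *: h).
    rewrite setIT; apply: hd; rewrite addrC addKr rnZ rn_real.
    by apply: le_lt_trans hz; rewrite ler_piMl // rn_ge0.
  by have [_ /(_ h) [k _]] := sf c 1; exact: k.
move=> t; rewrite normr1 => t1.
have It : rn (chart_map c x + t%:C *: h - chart_map c x) < d.
  rewrite addrC addKr rnZ rn_real.
  by apply: le_lt_trans hz; rewrite ler_piMl // rn_ge0.
have [ct Kt] := chart_imageK (hd _ It).
have FD := factor_dirD h ct; rewrite Kt in FD; rewrite FD mulr0 /= chart_mapK //.
have -> : chart_map c x + (1 : R)%:C *: h = z.
  apply: etrans (_ : chart_map c x + h = _); last by rewrite /h addrC subrK.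
  by apply/rowP => j; rewrite !mxE rmorph1 mul1r.
by move=> /eqP; rewrite subr_eq0 => /eqP.
Qed.
End FactorConstant.

(** * Linearization of contracting homotheties *)

Section Geometric.
Context {R : realType}.

Lemma geometric_small (q e : R) : 0 <= q < 1 -> 0 < e ->
  exists k0, forall k, (k0 <= k)%N -> q ^+ k <= e.
Proof.
move=> /andP[q0 q1] e0; have q1' : `|q| < 1 by rewrite ger0_norm.
have /cvgrPdist_le /(_ e e0) [k0 _ h] := @cvg_expr R q q1'.
by exists k0 => k /h; rewrite /= sub0r normrN ger0_norm // exprn_ge0.
Qed.

(** The rate [mu] lies strictly between [l] and its square root: above [l] to absorb the quadratic
    error in the contraction, below the root so that quadratic errors amplified by [l^-1] at each
    step remain summable. *)
Lemma intermediate_rate (l : R) : 0 < l < 1 -> exists mu, [/\ l < mu, mu < 1 & mu ^+ 2 < l].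
Proof.
move=> /andP[l0 l1]; pose s := Num.sqrt l.
have s2 : s ^+ 2 = l by rewrite sqr_sqrtr // ltW.
have s0 : 0 < s by rewrite sqrtr_gt0.
have s1 : s < 1.
  by rewrite -(ltr_pXn2r (n := 2)) ?nnegrE ?(ltW s0) // s2 expr1n.
have ls : l < s by rewrite -s2 expr2 -[ltRHS]mulr1 ltr_pM2l.
exists ((l + s) / 2); split; [lra|lra|].
by rewrite -s2 ltr_pXn2r ?nnegrE ?(ltW s0) //; lra.
Qed.
End Geometric.

Lemma add_sub_sub (V : zmodType) (a b : V) : a + b - a - b = 0.
Proof. by rewrite [a + b]addrC addrK subrr. Qed.

Lemma linear_bounded_diff {R : realType} n m (L : Cspace R n -> Cspace R m) (C : R) z :
  linear L -> (forall u v, L (u + v) = L u + L v) -> (forall u, rn (L u) <= C * rn u) ->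
  differentiable L z /\ forall v, 'd L z v = L v.
Proof.
move=> lin LD hC; apply: (@rn_diff_lin R _ _ L z L C lin hC) => e e0; exists 1 => // h _.
have -> : L (z + h) - L z - L h = 0 by rewrite LD; exact: add_sub_sub.
by rewrite rn0 mulr_ge0 ?rn_ge0 // ltW.
Qed.

Lemma rate_identity {R : realType} (l mu K t : R) k :
  l^-1 ^+ k.+1 * (K * (mu ^+ k * t) ^+ 2) = K / l * (mu ^+ 2 / l) ^+ k * t ^+ 2.
Proof.
rewrite exprS exprMn [(mu ^+ 2 / l) ^+ k]exprMn exprAC.
by move: (mu ^+ 2 ^+ k) (l^-1 ^+ k) (t ^+ 2) => x y z; ring.
Qed.

(** * Koenigs linearization near a fixed point *)

Section Koenigs.
Context {R : realType} {n : nat}.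
Local Notation V := (Cspace R n).
Variables (N : V -> R) (m C l : R) (a : V -> V) (A B : {linear V -> V}) (z0 : V) (d : R).
Hypotheses (m0 : 0 < m) (C0 : 0 < C) (Nlo : forall u, m * rn u <= N u)
  (Nup : forall u, N u <= C * rn u) (ND : forall u v, N (u + v) <= N u + N v)
  (NN : forall u, N (- u) = N u) (l01 : 0 < l < 1) (NA : forall u, N (A u) = l * N u)
  (NB : forall u, N (B u) = l^-1 * N u) (AB : forall u, A (B u) = u) (BA : forall u, B (A u) = u)
  (d0 : 0 < d) (da : forall z, rn (z - z0) < d -> differentiable a z) (az0 : a z0 = z0)
  (dA : forall u, 'd a z0 u = A u).

Lemma N_nonneg u : 0 <= N u.
Proof. by apply: le_trans (Nlo u); rewrite mulr_ge0 ?rn_ge0 // ltW. Qed.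

Lemma N_diff u v w : N (u - w) <= N (u - v) + N (v - w).
Proof. by rewrite (sub_split u v w); exact: ND. Qed.

Lemma quadratic_remainder : exists r K : R, [/\ 0 < r, 0 <= K &
  forall h, N h <= r -> rn h < d /\ N (a (z0 + h) - z0 - A h) <= K * N h ^+ 2].
Proof.
have da0 : differentiable a z0 by apply: da; rewrite subrr rn0.
have [d1 d10 hd1] := diff_locally_bounded da0.
pose r := Num.min d d1 / 2; have rr0 : 0 < Num.min d d1 by rewrite lt_min d0.
have r0 : 0 < r by exact: divr_gt0.
have rlt : r < Num.min d d1 by rewrite ltr_pdivrMr // mulr_natr mulr2n ltrDl.
have [rd rd1] : r < d /\ r < d1 by move: rlt; rewrite lt_min => /andP[].
set M := 1 + rn (a z0).
have T := @taylor_estimate R n n a z0 r M r0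
  (fun z h => da (le_lt_trans h rd)) (fun z h => hd1 z (le_lt_trans h rd1)).
have K0 : 0 <= 8 * M / r ^+ 2.
  by rewrite divr_ge0 ?sqr_ge0 // mulr_ge0 // addr_ge0 // rn_ge0.
exists (m * (r / 2)), (C * (8 * M / r ^+ 2) / m ^+ 2); split.
- by rewrite !mulr_gt0 // invr_gt0.
- by rewrite divr_ge0 ?sqr_ge0 // mulr_ge0 // ltW.
move=> h hr; have h1 : rn h <= r / 2.
  by rewrite -(ler_pM2l m0); exact: le_trans (Nlo h) hr.
split; first by apply: le_lt_trans h1 _; apply: lt_trans rd; rewrite ltr_pdivrMr // mulr_natr mulr2n ltrDl.
have := T h h1; rewrite az0 dA => T1.
apply: le_trans (Nup _) _; apply: le_trans (ler_wpM2l (ltW C0) T1) _.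
set Q := 8 * M / r ^+ 2 in K0 *.
have -> : C * Q / m ^+ 2 * N h ^+ 2 = C * (Q * (N h ^+ 2 / m ^+ 2)) by ring.
rewrite ler_wpM2l ?(ltW C0) // ler_wpM2l //.
rewrite ler_pdivlMr ?exprn_gt0 // mulrC -exprMn ler_sqr ?nnegrE ?N_nonneg //.
by rewrite mulr_ge0 ?rn_ge0 // ltW.
Qed.

Lemma iterB_sub k u v : iter k B (u - v) = iter k B u - iter k B v.
Proof. by elim: k => // k IH; rewrite !iterS IH linearB. Qed.

Lemma iterB_add k u v : iter k B (u + v) = iter k B u + iter k B v.
Proof. by elim: k => // k IH; rewrite !iterS IH linearD. Qed.

Lemma N_iterB k u : N (iter k B u) = l^-1 ^+ k * N u.
Proof. by elim: k => [|k IH]; rewrite ?expr0 ?mul1r // iterS NB IH exprS mulrA. Qed.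

Lemma iterB_diff k z : differentiable (fun w : V => iter k B (w - z0)) z.
Proof.
have lin : linear (fun u : V => iter k B u).
  by elim: k => [|k IH] // t u v; rewrite !iterS IH linearP.
have hb (u : V) : rn (iter k B u) <= (l^-1 ^+ k * C / m) * rn u.
  rewrite mulrAC ler_pdivlMr // mulrC; apply: le_trans (Nlo _) _.
  rewrite N_iterB -mulrA ler_wpM2l // exprn_ge0 // invr_ge0.
  by case/andP: l01 => /ltW.
have [dB _] := @linear_bounded_diff R n n (fun u : V => iter k B u) _ (z - z0) lin (iterB_add k) hb.
have [ds _] := @diff_shift R n z0 z.
by have [] := @diff_comp_rn R n n n (fun w : V => w - z0) (fun u : V => iter k B u) z ds dB.
Qed.

(* Koenigs linearization: [E] is the limit of [B^k (a^k z - z0)]; it converges as soon as [a] contracts by [mu] with [mu ^+ 2 < l]. *)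
Lemma koenigs : exists (E : V -> V) (mu r K : R), [/\ l < mu < 1, mu ^+ 2 < l, 0 < r, 0 <= K &
  forall z, N (z - z0) < r -> [/\ rn (z - z0) < d, N (a z - z0) <= mu * N (z - z0),
    differentiable E z, E (a z) = A (E z) & N (E z - (z - z0)) <= K * N (z - z0) ^+ 2]].
Proof.
have [mu [lmu mu1 mu2]] := intermediate_rate l01.
have /andP[l0 l1] := l01.
have [r1 [K [r10 K0 HK]]] := quadratic_remainder.
have mu0 : 0 < mu by exact: lt_trans lmu.
(* Within this radius the quadratic remainder is at most [mu - l] times the distance to the fixed
   point, so [a] contracts by [mu]. *)
pose r := Num.min r1 ((mu - l) / (K + 1)).
have K1 : 0 < K + 1 by rewrite ltr_wpDl.
have r0 : 0 < r by rewrite lt_min r10 divr_gt0 // subr_gt0.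
have rr1 : r <= r1 by rewrite ge_min lexx.
have rK : K * r <= mu - l.
  have : r <= (mu - l) / (K + 1) by rewrite ge_min lexx orbT.
  by rewrite ler_pdivlMr // mulrDr mulr1 mulrC; have := ltW r0; lra.
pose W z := N (z - z0) < r.
have Wrem z : W z -> rn (z - z0) < d /\ N (a z - z0 - A (z - z0)) <= K * N (z - z0) ^+ 2.
  move=> Wz; have := HK (z - z0) (ltW (lt_le_trans Wz rr1)).
  by have -> : z0 + (z - z0) = z by rewrite addrC subrK.
have contr z : W z -> N (a z - z0) <= mu * N (z - z0).
  move=> Wz; have [_ h] := Wrem z Wz.
  have := ND (a z - z0 - A (z - z0)) (A (z - z0)); rewrite subrK NA => h2.
  have h3 : K * N (z - z0) ^+ 2 <= (mu - l) * N (z - z0).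
    rewrite expr2 mulrA ler_wpM2r ?N_nonneg //; apply: le_trans rK.
    by rewrite ler_wpM2l // ltW.
  by move: h h2 h3; rewrite mulrBl; lra.
pose it k z := iter k a z.
have itW k z : W z -> W (it k z) /\ N (it k z - z0) <= mu ^+ k * N (z - z0).
  move=> Wz; elim: k => [|k [Wk hk]]; first by rewrite expr0 mul1r.
  have h := contr _ Wk; rewrite /it iterS -/(it k z); split.
    by apply: le_lt_trans h (le_lt_trans _ Wk); rewrite ler_piMl ?N_nonneg // ltW.
  by apply: le_trans h _; rewrite exprS -mulrA ler_pM2l.
have itd k z : W z -> differentiable (it k) z.
  move=> Wz; elim: k => [|k IH]; first exact: (@ex_diff _ _ _ _ _ _ _ (is_diff_id z)).
  have [h _] := itW k z Wz; have [hd _] := Wrem _ h.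
  by have [] := diff_comp_rn IH (da hd).
pose E k z := iter k B (it k z - z0).
pose q := mu ^+ 2 / l.
have q0 : 0 <= q by rewrite divr_ge0 ?sqr_ge0 // ltW.
have q1 : q < 1 by rewrite ltr_pdivrMr // mul1r.
(* The [k]-th increment of [E] is at most [K / l * q ^+ k] times the squared distance. Written as
   [K' * (q ^+ k - q ^+ k.+1)] the bound telescopes. *)
pose K' := K / (l * (1 - q)).
have q1' : 0 < 1 - q by rewrite subr_gt0.
have K'0 : 0 <= K' by rewrite divr_ge0 // mulr_ge0 // ltW.
have stepE k z : W z -> N (E k.+1 z - E k z) <= K' * (q ^+ k - q ^+ k.+1) * N (z - z0) ^+ 2.
  move=> Wz; have [Wk hk] := itW k z Wz; have [_ rk] := Wrem _ Wk.
  have -> : E k.+1 z - E k z = iter k.+1 B (a (it k z) - z0 - A (it k z - z0)).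
    by rewrite iterB_sub /E /it iterS; congr (_ - _); rewrite iterSr BA.
  rewrite N_iterB; apply: (@le_trans _ _ (l^-1 ^+ k.+1 * (K * (mu ^+ k * N (z - z0)) ^+ 2))).
    rewrite ler_wpM2l ?exprn_ge0 ?invr_ge0 ?(ltW l0) //; apply: le_trans rk _.
    have t0 : 0 <= mu ^+ k * N (z - z0) by rewrite mulr_ge0 ?N_nonneg // exprn_ge0 // ltW.
    by rewrite ler_wpM2l // ler_sqr ?nnegrE ?N_nonneg.
  have -> : l^-1 ^+ k.+1 * (K * (mu ^+ k * N (z - z0)) ^+ 2) = K / l * q ^+ k * N (z - z0) ^+ 2.
    exact: rate_identity.
  have -> // : K' * (q ^+ k - q ^+ k.+1) * N (z - z0) ^+ 2 = K / l * q ^+ k * N (z - z0) ^+ 2.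
  by rewrite /K' exprS; field; rewrite !gt_eqF.
have sumE k j z : W z -> N (E (k + j)%N z - E k z) <= K' * (q ^+ k - q ^+ (k + j)) * N (z - z0) ^+ 2.
  move=> Wz; elim: j => [|j IH].
    rewrite addn0 !subrr mulr0 mul0r; apply: le_trans (Nup 0) _; by rewrite rn0 mulr0.
  rewrite addnS; apply: le_trans (N_diff _ (E (k + j)%N z) _) _.
  have -> : K' * (q ^+ k - q ^+ (k + j).+1) * N (z - z0) ^+ 2 =
      K' * (q ^+ (k + j) - q ^+ (k + j).+1) * N (z - z0) ^+ 2 +
      K' * (q ^+ k - q ^+ (k + j)) * N (z - z0) ^+ 2.
    by move: (q ^+ k) (q ^+ (k + j)) (q ^+ (k + j).+1) => x y w; ring.
  exact: lerD (stepE _ _ Wz) IH.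
have tail k j z : W z -> N (E (k + j)%N z - E k z) <= K' * q ^+ k * N (z - z0) ^+ 2.
  move=> Wz; apply: le_trans (sumE k j z Wz) _.
  by rewrite ler_wpM2r ?sqr_ge0 // ler_wpM2l // gerBl exprn_ge0.
have qsmall (e t : R) : 0 < e -> 0 <= t -> exists k0, forall k, (k0 <= k)%N -> K' * q ^+ k * t <= e.
  move=> e0 t0; have e1 : 0 < e / (K' * t + 1) by rewrite divr_gt0 // ltr_wpDl // mulr_ge0.
  have [k0 hk0] := geometric_small (ltac:(by rewrite q0 q1) : 0 <= q < 1) e1.
  have p0 : 0 < K' * t + 1 by rewrite ltr_wpDl // mulr_ge0.
  exists k0 => k /hk0; rewrite ler_pdivlMr //; apply: le_trans.
  rewrite mulrAC mulrDr mulr1 [_ ^+ k * _]mulrC lerDl; exact: exprn_ge0.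
have lim z : exists y, W z -> forall e : R, 0 < e -> exists k0, forall k, (k0 <= k)%N -> rn (E k z - y) <= e.
  have [Wz|nW] := pselect (W z); last by exists 0.
  have [y hy] : exists y, forall e : R, 0 < e -> exists k0, forall k, (k0 <= k)%N -> rn (E k z - y) <= e.
    apply: (@Cspace_cauchy R n (fun k => E k z)) => x x0.
    have [k0 hk0] := qsmall (m * x) (N (z - z0) ^+ 2) (mulr_gt0 m0 x0) (sqr_ge0 _).
    exists k0 => k kk; rewrite -(ler_pM2l m0); apply: le_trans (Nlo _) _.
    by apply: le_trans (hk0 k0 (leqnn _)); rewrite -(subnKC kk); exact: tail.
  by exists y.
have /choice[F hF] := lim.
have FE k z : W z -> N (F z - E k z) <= K' * q ^+ k * N (z - z0) ^+ 2.
  move=> Wz; apply/ler_addgt0Pr => e e0.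
  have [k0 hk0] := hF z Wz (e / C) (divr_gt0 e0 C0).
  apply: le_trans (N_diff _ (E (k + k0)%N z) _) _; rewrite addrC; apply: lerD; first exact: tail.
  rewrite -NN opprB; apply: le_trans (Nup _) _; rewrite mulrC -ler_pdivlMr //.
  by apply: hk0; rewrite leq_addl.
exists F, mu, r, K'; split=> //; first by rewrite lmu.
move=> z Wz; have [zd _] := Wrem z Wz; split=> //; first exact: contr.
(* Half of the slack to the boundary of [W], converted to [rn]: the closed ball around [z] lies in
   [W], where the convergence is uniform and Weierstrass applies. *)
- pose e := (r - N (z - z0)) / (2 * C).
  have e0 : 0 < e by rewrite divr_gt0 ?mulr_gt0 // subr_gt0.
  have We z' : rn (z' - z) <= e -> W z'.
    move=> h; apply: le_lt_trans (N_diff z' z z0) _; rewrite -ltrBrDr.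
    apply: le_lt_trans (Nup _) _; rewrite mulrC -ltr_pdivlMr //; apply: le_lt_trans h _.
    rewrite /e ltr_pM2l ?subr_gt0 // ltf_pV2 ?posrE ?mulr_gt0 //.
    by rewrite ltr_pMl // ltr1n.
  have unif (x : R) : 0 < x -> exists k0, forall k, (k0 <= k)%N -> forall z', rn (z' - z) <= e ->
      rn (E k z' - F z') <= x.
    move=> x0; have [k0 hk0] := qsmall (m * x) (r ^+ 2) (mulr_gt0 m0 x0) (sqr_ge0 _).
    exists k0 => k kk z' /We Wz'; rewrite -(ler_pM2l m0); apply: le_trans (Nlo _) _.
    rewrite -NN opprB; apply: le_trans (FE k z' Wz') _; apply: le_trans (hk0 k kk).
    apply: ler_wpM2l; first exact: mulr_ge0 K'0 (exprn_ge0 k q0).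
    by rewrite ler_sqr ?nnegrE ?N_nonneg ?(ltW r0) //; exact: ltW.
  have bnd z' : rn (z' - z) <= e -> rn (F z') <= (K' * r ^+ 2 + r) / m.
    move=> /We Wz'; rewrite ler_pdivlMr // mulrC; apply: le_trans (Nlo _) _.
    rewrite -[F z'](subrK (E 0%N z')); apply: le_trans (ND _ _) _; apply: lerD; last exact: ltW.
    apply: le_trans (FE 0%N z' Wz') _; rewrite expr0 mulr1 ler_wpM2l //.
    by rewrite ler_sqr ?nnegrE ?N_nonneg ?(ltW r0) //; exact: ltW.
  have dE k z' : rn (z' - z) <= e -> differentiable (E k) z'.
    move=> /We Wz'; have [] := @diff_comp_rn R n n n (it k) (fun w => iter k B (w - z0)) z' (itd k z' Wz').
      exact: iterB_diff.
    by [].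
  by have [] := @weierstrass R n n E F z e _ e0 dE unif bnd.
- have [Wa _] := itW 1%N z Wz; rewrite /it /= in Wa.
  apply: (@lim_rn_unique R V (fun k => E k (a z))); first exact: hF.
  move=> e e0; have [k0 hk0] := hF z Wz (m * e / (C * l)) (divr_gt0 (mulr_gt0 m0 e0) (mulr_gt0 C0 l0)).
  exists k0 => k kk; have -> : E k (a z) = A (E k.+1 z).
    by rewrite /E /it -iterSr iterS AB.
  rewrite -(ler_pM2l m0); apply: le_trans (Nlo _) _; rewrite -linearB NA.
  have h := hk0 k.+1 (leq_trans kk (leqnSn k)).
  apply: (@le_trans _ _ (l * (C * rn (E k.+1 z - F z)))); first by rewrite ler_pM2l.
  rewrite mulrA -ler_pdivlMl ?mulr_gt0 // mulrC [l * C]mulrC; exact: h.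
- by have := FE 0%N z Wz; rewrite expr0 mulr1.
Qed.
End Koenigs.

Section LinearAlgebra.
Context {R : realType} {n : nat}.
Local Notation V := (Cspace R n).

Lemma mulmx_linear (M : 'M[R[i]]_n) : linear (fun u : V => ((u : 'rV_n) *m M : V)).
Proof. by move=> a u v; rewrite mulmxDl scalemxAl. Qed.

Lemma mulmx_bounded (M : 'M[R[i]]_n) : exists2 C : R, 0 < C &
  forall u : V, rn ((u : 'rV_n) *m M : V) <= C * rn u.
Proof.
exists (1 + \sum_i \sum_j rn (M i j)).
  by rewrite ltr_wpDr //; apply: sumr_ge0 => i _; apply: sumr_ge0 => j _; exact: rn_ge0.
move=> u; have S0 : 0 <= \sum_i \sum_j rn (M i j).
  by apply: sumr_ge0 => i _; apply: sumr_ge0 => j _; exact: rn_ge0.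
apply: rn_le_co => [|j]; first by rewrite mulr_ge0 ?rn_ge0 // addr_ge0.
have sumrn (s : seq 'I_n) (F : 'I_n -> R[i]) : rn (\sum_(i <- s) F i) <= \sum_(i <- s) rn (F i).
  elim: s => [|i s IH]; first by rewrite !big_nil rn0.
  by rewrite !big_cons; apply: le_trans (rnD _ _) _; rewrite lerD2l.
rewrite /co mxE; apply: le_trans (sumrn _ _) _.
rewrite mulrDl mul1r; apply: (@le_trans _ _ (0 + (\sum_i \sum_j rn (M i j)) * rn u)); last first.
  by rewrite lerD2r rn_ge0.
rewrite add0r mulr_suml; apply: ler_sum => i _; rewrite rnM mulrC.
apply: ler_pM; rewrite ?rn_ge0 //; last exact: (rn_co u i).
by rewrite (bigD1 j) //= lerDl; apply: sumr_ge0 => k _; exact: rn_ge0.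
Qed.

Lemma mulmx_diff (M : 'M[R[i]]_n) (z : V) :
  differentiable (fun u : V => ((u : 'rV_n) *m M : V)) z /\
  forall v, 'd (fun u : V => ((u : 'rV_n) *m M : V)) z v = (v : 'rV_n) *m M.
Proof.
have [C C0 hC] := mulmx_bounded M.
apply: (@linear_bounded_diff R n n (fun u : V => ((u : 'rV_n) *m M : V)) C z (mulmx_linear M)) => //.
by move=> u v; exact: mulmxDl.
Qed.

Lemma injective_unitmx (L : {linear V -> V}) : (forall u, L u = 0 -> u = 0) ->
  exists2 M : 'M[R[i]]_n, M \in unitmx & forall u, L u = (u : 'rV_n) *m M.
Proof.
move=> inj; exists (lin1_mx (L : 'rV[R[i]]_n -> 'rV[R[i]]_n)).
  rewrite -row_free_unit; apply: inj_row_free => v hv; apply: inj.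
  by rewrite -[L v](@mul_rV_lin1 _ _ _ (L : {linear 'rV[R[i]]_n -> 'rV[R[i]]_n}) v).
by move=> u; rewrite -[LHS](@mul_rV_lin1 _ _ _ (L : {linear 'rV[R[i]]_n -> 'rV[R[i]]_n}) u).
Qed.

(** A continuous right inverse of a map with injective differential: the little-o estimate at [w0]
    and the lower bound [c] give [rn v <= 2 / c * rn h], which turns an error small in [v] into one
    small in [h]. The inverse matrix is then the differential. *)
Lemma diff_inverse (f k : V -> V) (w0 z0 : V) (c d : R) : differentiable f w0 -> f w0 = z0 ->
  k z0 = w0 -> 0 < d -> (forall z, rn (z - z0) < d -> f (k z) = z) -> {for z0, continuous k} ->
  0 < c -> (forall u, c * rn u <= rn ('d f w0 u)) -> differentiable k z0.
Proof.
move=> df fw kz d0 fk ck c0 hc.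
have [M uM hM] : exists2 M : 'M[R[i]]_n, M \in unitmx & forall u, 'd f w0 u = (u : 'rV_n) *m M.
  apply: injective_unitmx => u u0; have := hc u; rewrite u0 rn0 pmulr_rle0 // => h.
  by apply/eqP; rewrite -rn_eq0 eq_le h rn_ge0.
pose S (u : V) : V := (u : 'rV_n) *m invmx M.
have [C C0 hC] := mulmx_bounded (invmx M).
have S1 (u : V) : S ('d f w0 u) = u by rewrite hM /S mulmxK.
have SB (u v : V) : S (u - v) = S u - S v by exact: mulmxBl.
have small (e : R) : 0 < e -> exists2 r : R, 0 < r & forall h, rn h < r ->
    rn (k (z0 + h) - k z0 - S h) <= e * rn h.
  (* The bound [c / 2] yields the Lipschitz estimate on [v]; the other one makes the final error
     [C * e1 * 2 / c] at most [e]. *)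
  move=> e0; pose e1 := Num.min (c / 2) (e * c / (2 * C)).
  have e10 : 0 < e1 by rewrite lt_min !divr_gt0 ?mulr_gt0.
  have e1c : e1 <= c / 2 by rewrite ge_min lexx.
  have e1e : C * e1 * 2 <= e * c.
    have : e1 <= e * c / (2 * C) by rewrite ge_min lexx orbT.
    by rewrite ler_pdivlMr ?mulr_gt0 //; lra.
  have [s s0 hs] := diff_rn df e10.
  have [r r0 hr] := (contv_rnP _ _).1 ck s s0.
  exists (Num.min d r); first by rewrite lt_min d0.
  move=> h; rewrite lt_min => /andP[hd1 hr1].
  have hz : z0 + h - z0 = h by rewrite [z0 + h]addrC addrK.
  set v := k (z0 + h) - k z0.
  have vs : rn v < s by apply: hr; rewrite hz.
  have fv : f (w0 + v) = z0 + h.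
    by rewrite /v kz [w0 + _]addrC subrK fk // hz.
  have := hs v vs; rewrite fv fw hz => h1.
  have h2 : rn v <= 2 / c * rn h.
    have h3 := rnD (- (h - 'd f w0 v)) h; rewrite rnN (_ : - (h - 'd f w0 v) + h = 'd f w0 v) in h3; last first.
      by rewrite opprB subrK.
    have h4 := hc v; rewrite mulrAC ler_pdivlMr //.
    have h5 : e1 * rn v <= c / 2 * rn v by rewrite ler_wpM2r ?rn_ge0.
    by lra.
  have -> : v - S h = S ('d f w0 v - h) by rewrite SB S1.
  apply: le_trans (hC _) _; rewrite rn_dist.
  apply: (@le_trans _ _ (C * (e1 * (2 / c * rn h)))).
    rewrite ler_wpM2l ?(ltW C0) //; apply: le_trans h1 _.
    by apply: ler_wpM2l h2; exact: ltW.
  rewrite (_ : C * (e1 * (2 / c * rn h)) = (C * e1 * 2) / c * rn h); last by ring.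
  by rewrite ler_wpM2r ?rn_ge0 // ler_pdivrMr.
by have [H _] := @rn_diff_lin R V V k z0 S C (mulmx_linear (invmx M)) hC small.
Qed.
End LinearAlgebra.

(** * A linear change of coordinates taking the metric at a point to the flat one *)

Section HermitianRoot.
Context {R : realType} {n : nat} {X : complexManifold R n} {g : tensorField X}.
Hypothesis hg : hermitian_metric g.
Local Notation V := (Cspace R n).
Local Notation K := R[i].
Local Open Scope sesquilinear_scope.
Variables (c : chart X) (p : X).
Hypothesis cp : chart_dom c p.

(** The Hermitian form, complex linear in its first argument, whose real part is [g]. *)
Definition Hf (u v : V) : K := (g c p u v +i* g c p u ('i *: v))%C.

Lemma g_iL u v : g c p ('i *: u) v = - g c p u ('i *: v).
Proof.
rewrite -(gJ hg cp ('i *: u) v) scale_ii; exact: (gNl hg cp).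
Qed.

Lemma complex_scale (a : K) (u : V) : a *: u = (complex.Re a)%:C *: u + (complex.Im a)%:C *: ('i *: u) :> V.
Proof.
by apply/rowP => j; rewrite !mxE {1}[a]complexE; move: (_ ord0 j) => t; rewrite mulrDl -mulrA mulrCA.
Qed.

Lemma Hf_lin (a : K) u u' v : Hf (a *: u + u') v = a * Hf u v + Hf u' v.
Proof.
have E w : g c p (a *: u + u') w = complex.Re a * g c p u w - complex.Im a * g c p u ('i *: w) + g c p u' w.
  rewrite (complex_scale a u) (gDl hg cp) (gDl hg cp (_ *: u)) (gZl hg cp) (gZl hg cp (complex.Im a)).
  by rewrite g_iL mulrN.
rewrite /Hf E E; have -> : g c p u ('i *: ('i *: v)) = - g c p u v.
  by rewrite scale_ii; exact: (gNr hg cp).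
case: a {E} => x y; apply/eqP; rewrite eq_complex /=; apply/andP; split; apply/eqP; ring.
Qed.

Lemma Hf_conj u v : Hf v u = (Hf u v)^*.
Proof.
have -> : (Hf u v)^* = (g c p u v -i* g c p u ('i *: v))%C by [].
rewrite /Hf (gC hg cp v u); congr (_ +i* _)%C.
by rewrite (gC hg cp v) g_iL.
Qed.

Definition Hmx : 'M[K]_n := \matrix_(i, j) Hf (delta_mx ord0 i) (delta_mx ord0 j).

Lemma Hf_sum (s : seq 'I_n) (a : 'I_n -> K) (e : 'I_n -> V) v :
  Hf (\sum_(i <- s) a i *: e i) v = \sum_(i <- s) a i * Hf (e i) v.
Proof.
elim: s => [|i s IH]; last by rewrite !big_cons Hf_lin IH.
by rewrite !big_nil /Hf !(g0l hg cp).
Qed.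

Lemma HfE u v : Hf u v = ((u : 'rV_n) *m Hmx *m (v : 'rV_n)^t*) ord0 ord0.
Proof.
have row_sum (w : V) : w = \sum_i (w : 'rV_n) ord0 i *: (delta_mx ord0 i : V).
  exact: (@row_sum_delta K n (w : 'rV_n)).
rewrite [in LHS](row_sum u) Hf_sum -mulmxA mxE; apply: eq_bigr => i _; congr (_ * _).
rewrite Hf_conj [in LHS](row_sum v) Hf_sum rmorph_sum mxE; apply: eq_bigr => j _.
rewrite rmorphM !mxE mulrC; congr (_ * _); exact: esym (Hf_conj _ _).
Qed.

Lemma Hmx_hermitian : Hmx \is hermsymmx.
Proof.
apply/is_hermitianmxP; rewrite expr0 scale1r; apply/matrixP => i j.
by rewrite !mxE; exact: Hf_conj.
Qed.

(** The Gram matrix is diagonalized by a unitary [P]. Its eigenvalues are the squared lengths of the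
    rows of [P], so they have square roots, and [M] is the adjoint of [P] followed by those
    roots. *)
Lemma hermitian_root : exists2 M : 'M[K]_n, M \in unitmx &
  forall u v : V, @flat_metric R n tt (0 : V) ((u : 'rV_n) *m M) ((v : 'rV_n) *m M) = g c p u v.
Proof.
have [P [sd [uP HP]]] : exists (P : 'M[K]_n) sd, P \is unitarymx /\
    Hmx = invmx P *m diag_mx sd *m P.
  exists (spectralmx Hmx), (spectral_diag Hmx); split; first exact: spectral_unitarymx.
  exact/orthomx_spectralP/hermitian_normalmx/Hmx_hermitian.
have PPt : P *m P ^t* = 1%:M by exact/unitarymxP.
have uPt : P ^t* *m P = 1%:M by rewrite -invmx_unitary // mulVmx // unitarymx_unit.
have DE i : sd ord0 i = Hf (row i P) (row i P).
  rewrite HfE; have -> : (row i P *m Hmx *m (row i P)^t*) ord0 ord0 = (P *m Hmx *m P^t*) i i.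
    by rewrite !mxE; apply: eq_bigr => j _; rewrite !mxE; congr (_ * _); apply: eq_bigr => k _; rewrite !mxE.
  rewrite HP -!mulmxA PPt mulmx1 mulKVmx ?unitarymx_unit //.
  by rewrite mxE eqxx mulr1n.
pose s i := g c p (row i P) (row i P).
have sE i : sd ord0 i = (s i)%:C.
  rewrite DE /Hf; congr (_ +i* _)%C; have := g_iL (row i P) (row i P).
  by rewrite (gC hg cp) => h; have h2 := h; lra.
pose D := diag_mx (\row_i (Num.sqrt (s i))%:C).
have DD : D *m D ^t* = diag_mx (sd).
  rewrite /D; apply/matrixP => i j; rewrite mul_diag_mx !mxE.
  rewrite eq_sym; case: eqVneq => [->|_]; last by rewrite !mulr0n rmorph0 mulr0.
  rewrite !mulr1n sE.
  have -> : Num.conj ((Num.sqrt (s j))%:C : K) = (Num.sqrt (s j))%:C.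
    by rewrite -[LHS]/((Num.sqrt (s j)) +i* (- 0))%C oppr0.
  by rewrite -rmorphM -expr2 sqr_sqrtr // g_ge0.
pose M := P ^t* *m D.
have flatE (u v : 'rV[K]_n) : @flat_metric R n tt (0 : V) u v = complex.Re ((u *m v ^t*) ord0 ord0).
  by rewrite /flat_metric mxE; congr complex.Re; apply: eq_bigr => j _; rewrite !mxE.
have gE u v : @flat_metric R n tt (0 : V) ((u : 'rV_n) *m M) ((v : 'rV_n) *m M) = g c p u v.
  rewrite flatE (_ : _ *m _ = (u : 'rV_n) *m Hmx *m (v : 'rV_n)^t*); first by rewrite -HfE.
  rewrite HP invmx_unitary // /M !trmx_mul !map_mxM /= !mulmxA; congr (_ *m _).
  by rewrite -[in RHS]DD trmxCK !mulmxA.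
exists M => //.
rewrite -row_free_unit; apply: inj_row_free => v hv; apply/eqP/negPn/negP => v0.
have := g_gt0 hg cp v0; rewrite -gE hv flatE mul0mx mxE /=.
by rewrite ltxx.
Qed.
End HermitianRoot.

Lemma squeeze_one {R : realType} (x y : R) : 0 <= x -> 0 <= y ->
  (forall e : R, 0 < e -> e < 1 -> x <= (1 + e) ^+ 2 * y /\ (1 - e) * y <= (1 + e) * x) -> x = y.
Proof.
move=> x0 y0 H; apply/eqP; rewrite eq_le; apply/andP; split; apply/ler_addgt0Pr => h h0.
  pose e := Num.min (1 / 2) (h / (3 * y + 1)).
  have y1 : 0 < 3 * y + 1 by rewrite ltr_wpDl // mulr_ge0.
  have e0 : 0 < e by rewrite lt_min !divr_gt0.
  have e1 : e <= 1 / 2 by rewrite ge_min lexx.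
  have e2 : e * (3 * y + 1) <= h by rewrite -ler_pdivlMr // ge_min lexx orbT.
  have [h1 _] := H e e0 (ltac:(lra)); apply: le_trans h1 _.
  have : e * e <= e by rewrite ler_piMl ?(ltW e0) //; lra.
  by nra.
pose e := Num.min (1 / 2) (h / (x + y + 1)).
have y1 : 0 < x + y + 1 by rewrite ltr_wpDl // addr_ge0.
have e0 : 0 < e by rewrite lt_min !divr_gt0.
have e1 : e <= 1 / 2 by rewrite ge_min lexx.
have e2 : e * (x + y + 1) <= h by rewrite -ler_pdivlMr // ge_min lexx orbT.
have [_ h1] := H e e0 (ltac:(lra)).
by nra.
Qed.

Lemma split_difference (V : zmodType) (a b e f z : V) :
  b - a = - ((e - (b - z)) - (f - (a - z))) + (e - f).
Proof.
have -> : (e - (b - z)) - (f - (a - z)) = (e - f) - ((b - z) - (a - z)).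
  by rewrite !opprD !opprK addrACA.
by rewrite opprB subrK opprB addrA subrK.
Qed.

Lemma eq_ler {R : realType} (x y : R) : x = y -> x <= y. Proof. by move=> ->. Qed.

Lemma rate_balance {R : realType} (l mu K r : R) (j k : nat) : l != 0 ->
  2 * (K * (mu ^+ j * r) ^+ 2) = l ^+ (j + k) * (2 * K * r ^+ 2 * l^-1 ^+ k * (mu ^+ 2 / l) ^+ j).
Proof.
move=> l0; rewrite exprMn [(mu ^+ 2 / l) ^+ j]exprMn exprAC exprD !exprVn.
by field; rewrite !expf_neq0.
Qed.

Section Iterates.
Context {R : realType} {n : nat} {X : complexManifold R n} {g : tensorField X}.
Hypothesis hg : hermitian_metric g.

Lemma tangent_id (c : chart X) x u : chart_dom c x -> tangent_map id c c x u = u.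
Proof.
move=> cx; have [d d0 hd] := chart_ball cx.
have did := @ex_diff _ _ _ _ _ _ _ (is_diff_id (chart_map c x)).
have E z : rn (z - chart_map c x) < d -> id z = local_rep id c c z.
  by move=> /hd /chart_imageK [_ h]; rewrite /local_rep /= h.
have [_ h] := diff_near_eq d0 E did.
apply: (etrans (h u)).
by have -> := @diff_val _ _ _ _ _ _ _ (is_diff_id (chart_map c x)).
Qed.

Lemma homothety_iter (l : R) (F : X -> X) k : homothety (g := g) l F ->
  homothety (g := g) (l ^+ k) (iter k F).
Proof.
move=> hF; elim: k => [|k IH]; first by rewrite expr0; exact: homothety_id.
by rewrite exprS mulrC; exact: (homothety_comp IH hF).
Qed.

Lemma iter_can (F G : X -> X) k : cancel F G -> cancel (iter k F) (iter k G).
Proof. by move=> FK; elim: k => // k IH x; rewrite iterSr iterS FK IH. Qed.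
End Iterates.

Section FixedPoint.
Context {R : realType} {n : nat} {X : complexManifold R n} {g : tensorField X}.
Hypotheses (hg : hermitian_metric g) (Xc : connected [set: X])
  (cpl : forall x r, @ball_cpt R n X g x r).
Local Notation dist := (@dist R n X g).

Lemma dist_eq0 x y : dist x y = 0 -> x = y.
Proof.
move=> d0; apply: contrapT => xy.
have : closed [set y] by apply: compact_closed; [exact: space_hausdorff|exact: compact_set1].
rewrite -openC openE => /(_ x) H; have /(nbhs_distP hg Xc) [r r0 /(_ y)] : nbhs x (~` [set y]) by exact: H.
by rewrite d0 => /(_ r0); apply.
Qed.

(** The displacement [dist x (F x)] attains its minimum on a compact ball preserved by [F]; at [F x]
    it is at most [l] times as large, so the minimum is 0. *)
Lemma contraction_fixed_point (l : R) (F : X -> X) (x0 : X) : homothety (g := g) l F -> l < 1 ->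
  exists p, F p = p.
Proof.
move=> hF l1; have [_ l0 _] := hF.
have dF := dist_homothety hg Xc _ _ hF.
(* [Rb] solves [q + l * Rb = Rb], which makes the ball of radius [Rb] stable under [F]. *)
pose q := dist x0 (F x0); pose Rb := q / (1 - l).
have l1' : 0 < 1 - l by rewrite subr_gt0.
have q0 : 0 <= q by exact: dist_ge0.
have Rb0 : 0 <= Rb by rewrite divr_ge0 // ltW.
have RbE : q + l * Rb = Rb by rewrite /Rb; field; rewrite gt_eqF.
have fc : continuous (fun x => dist x (F x)).
  move=> x; apply/cvgrPdist_lt => e e0; have e2 : 0 < e / 2 by exact: divr_gt0.
  apply: filterS (near_dist hg x e2) => y hy.
  have h1 := dist_triangle hg Xc y x (F x); have h2 := dist_triangle hg Xc (F y) y (F x).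
  have h3 := dist_triangle hg Xc x y (F y); have h4 := dist_triangle hg Xc (F x) x (F y).
  have h5 := dF x y; have h6 : l * dist x y <= dist x y by rewrite ler_piMl ?dist_ge0 // ltW.
  rewrite (distC hg Xc (F y) (F x)) in h2; rewrite (distC hg Xc y x) in h3.
  by rewrite ltr_norml; apply/andP; split; lra.
have [||x xB hx] := @compact_EVT_min X R (fun x => dist x (F x)) _ _ (cpl (x := x0) (r := Rb)).
- by exists x0; rewrite /= distxx.
- exact: continuous_subspaceT.
rewrite inE /= in xB.
have FxB : dist x0 (F x) <= Rb.
  apply: le_trans (dist_triangle hg Xc (F x0) x0 (F x)) _; rewrite -RbE -/q lerD2l.
  by apply: le_trans (dF x0 x) _; rewrite ler_pM2l.
have h1 := hx (F x) (ltac:(by rewrite inE)).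
have h2 := dF x (F x); have h3 : 0 <= dist x (F x) by exact: dist_ge0.
exists x; apply/esym; apply: dist_eq0; apply/eqP; rewrite eq_le h3 andbT.
have : (1 - l) * dist x (F x) <= 0 by rewrite mulrBl mul1r; lra.
by rewrite pmulr_rle0.
Qed.
End FixedPoint.

(** * Global linearization of a contracting homothety *)

Section Linearization.
Context {R : realType} {n : nat} {X : complexManifold R n} {g : tensorField X}.
Hypotheses (hg : hermitian_metric g) (Xc : connected [set: X])
  (cpl : forall x r, @ball_cpt R n X g x r).
Local Notation dist := (@dist R n X g).
Local Notation V := (Cspace R n).
Local Notation Y := (flat_space R n).
Variables (l : R) (al be : X -> X) (p : X) (c : chart X).
Hypotheses (hal : homothety (g := g) l al) (hbe : holomorphic be) (alK : cancel al be)
  (beK : cancel be al) (l1 : l < 1) (alp : al p = p) (cp : chart_dom c p).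
Let z0 := chart_map c p.
Let Np := gnorm (g := g) c p.
Let A := 'd (local_rep al c c) z0.
Let B := 'd (local_rep be c c) z0.
Let l0 : 0 < l. Proof. by have [_ h _] := hal. Qed.
Let halh : holomorphic al. Proof. by have [h _ _] := hal. Qed.

Lemma bep : be p = p. Proof. by rewrite -{1}alp alK. Qed.

Lemma NpA u : Np (A u) = l * Np u.
Proof.
have cp' : chart_dom c (al p) by rewrite alp.
by have := homothety_N u hal cp cp'; rewrite alp.
Qed.

Lemma AB u : A (B u) = u.
Proof.
have cp' : chart_dom c (be p) by rewrite bep.
have [cb db] := hbe; have [ca da] := halh.
have cp2 : chart_dom c (al (be p)) by rewrite beK.
have [_ h] := tangent_comp cp cp' (cb p) (db c c p cp cp') (da c c (be p) cp' cp2).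
have id_ab : al \o be = id by apply/funext => x; exact: beK.
have E1 : tangent_map (al \o be) c c p u = u by rewrite id_ab; exact: tangent_id.
exact: etrans (esym (congr1 (fun q => tangent_map al c c q (B u)) bep)) (etrans (esym (h u)) E1).
Qed.

Lemma BA u : B (A u) = u.
Proof.
have cp' : chart_dom c (al p) by rewrite alp.
have [cb db] := hbe; have [ca da] := halh.
have cp2 : chart_dom c (be (al p)) by rewrite alK.
have [_ h] := tangent_comp cp cp' (ca p) (da c c p cp cp') (db c c (al p) cp' cp2).
have id_ba : be \o al = id by apply/funext => x; exact: alK.
have E1 : tangent_map (be \o al) c c p u = u by rewrite id_ba; exact: tangent_id.
exact: etrans (esym (congr1 (fun q => tangent_map be c c q (A u)) alp)) (etrans (esym (h u)) E1).
Qed.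

Lemma NpB u : Np (B u) = l^-1 * Np u.
Proof. by rewrite -{2}(AB u) NpA mulKf // gt_eqF. Qed.

Lemma NpiterB k u : Np (iter k B u) = l^-1 ^+ k * Np u.
Proof. by elim: k => [|k IH]; rewrite ?expr0 ?mul1r // iterS NpB IH exprS mulrA. Qed.

Lemma koenigs_chart : exists (E : V -> V) (mu r K : R), [/\ l < mu < 1, mu ^+ 2 < l, 0 < r, 0 <= K &
  forall z, Np (z - z0) < r -> [/\ chart_dom c (chart_inv c z), chart_map c (chart_inv c z) = z,
    chart_dom c (al (chart_inv c z)) &
    [/\ Np (local_rep al c c z - z0) <= mu * Np (z - z0),
    differentiable E z, E (local_rep al c c z) = A (E z) & Np (E z - (z - z0)) <= K * Np (z - z0) ^+ 2]]].
Proof.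
have [m m0 hm] := gnorm_lower hg cp; have [C C0 hC] := gnorm_upper hg cp.
have cp' : chart_dom c (al p) by rewrite alp.
have [d d0 hd] := pull_near cp cp' halh.
have az0 : local_rep al c c z0 = z0 by rewrite /local_rep /= /z0 chart_mapK // alp.
have l01 : 0 < l < 1 by rewrite l0.
have da z : rn (z - z0) < d -> differentiable (local_rep al c c) z by move=> /hd [].
have [E [mu [r [K [h1 h2 h3 h4 H]]]]] := @koenigs R n Np m C l (local_rep al c c) A B z0 d m0 C0 hm hC
  (fun u v => gnormD hg u v cp) (fun u => gnormN hg u cp) l01 NpA NpB AB BA d0 da az0 (fun u => erefl).
exists E, mu, r, K; split=> // z hz; have [k1 k2 k3 k4 k5] := H z hz.
by have [j1 j2 j3 j4] := hd z k1.
Qed.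

Section Global.
Variables (E : V -> V) (mu r K : R).
Hypotheses (hmu : l < mu < 1) (mu2 : mu ^+ 2 < l) (r0 : 0 < r) (K0 : 0 <= K).
Hypothesis HE : forall z, Np (z - z0) < r -> [/\ chart_dom c (chart_inv c z),
    chart_map c (chart_inv c z) = z, chart_dom c (al (chart_inv c z)) &
    [/\ Np (local_rep al c c z - z0) <= mu * Np (z - z0),
    differentiable E z, E (local_rep al c c z) = A (E z) & Np (E z - (z - z0)) <= K * Np (z - z0) ^+ 2]].

Definition good y := chart_dom c y /\ Np (chart_map c y - z0) < r.

Lemma Np_ge0 u : 0 <= Np u. Proof. exact: gnorm_ge0. Qed.

Lemma good_step y : good y -> [/\ good (al y),
  Np (chart_map c (al y) - z0) <= mu * Np (chart_map c y - z0) &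
  E (chart_map c (al y)) = A (E (chart_map c y))].
Proof.
move=> [cy hy]; have [_ _] := HE hy; rewrite /local_rep /= chart_mapK // => h1 [h2 _ h3 _].
have /andP[_ m1] := hmu.
split=> //; split=> //; apply: le_lt_trans h2 (le_lt_trans _ hy).
by rewrite ler_piMl ?Np_ge0 // ltW.
Qed.

Lemma good_iter k y : good y -> [/\ good (iter k al y),
  Np (chart_map c (iter k al y) - z0) <= mu ^+ k * Np (chart_map c y - z0) &
  E (chart_map c (iter k al y)) = iter k A (E (chart_map c y))].
Proof.
move=> gy; elim: k => [|k [g1 g2 g3]]; first by rewrite expr0 mul1r.
have [h1 h2 h3] := good_step g1; have /andP[lm _] := hmu.
split=> //; last by rewrite !iterS h3 g3.
rewrite iterS; apply: le_trans h2 _; rewrite exprS -mulrA ler_pM2l //.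
exact: lt_trans l0 lm.
Qed.

Lemma good_near y : good y -> \forall y' \near y, good y'.
Proof.
move=> [cy hy]; have [C C0 hC] := gnorm_upper hg cp.
have e0 : 0 < (r - Np (chart_map c y - z0)) / C by rewrite divr_gt0 // subr_gt0.
have h1 : nbhs y (chart_dom c) by apply: open_nbhs_nbhs; split=> //; exact: chart_dom_open.
have h2 : nbhs y (chart_map c @^-1` [set z | rn (z - chart_map c y) < (r - Np (chart_map c y - z0)) / C]).
  apply: (@chart_map_continuous R n X c y cy); apply/nbhs_rnP; by exists ((r - Np (chart_map c y - z0)) / C).
apply: filterS (filterI h1 h2) => y' [cy' hy']; split=> //.
rewrite (sub_split (chart_map c y') (chart_map c y) z0).
apply: le_lt_trans (gnormD hg _ _ cp) _; rewrite -ltrBrDr; apply: le_lt_trans (hC _) _.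
by rewrite mulrC -ltr_pdivlMr.
Qed.

Lemma good_p : good p.
Proof. by split=> //; rewrite /z0 subrr /Np gnorm0. Qed.

Lemma iter_alp k : iter k al p = p.
Proof. by elim: k => // k IH; rewrite iterS IH alp. Qed.

Lemma dist_iter k x : dist p (iter k al x) <= l ^+ k * dist p x.
Proof.
by have := dist_homothety hg Xc p x (homothety_iter hg k hal); rewrite iter_alp.
Qed.

Lemma reach_ball (d : R) x : 0 < d -> exists k0, forall k, (k0 <= k)%N -> dist p (iter k al x) < d.
Proof.
move=> d0; have p1 : 0 < dist p x + 1 by rewrite ltr_wpDl // dist_ge0.
have e0 : 0 < d / 2 / (dist p x + 1) by rewrite !divr_gt0.
have l01 : 0 <= l < 1 by rewrite (ltW l0).
have [k0 hk] := geometric_small l01 e0; exists k0 => k /hk h.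
apply: le_lt_trans (dist_iter k x) _; apply: le_lt_trans (_ : _ <= d / 2) _; last first.
  by rewrite ltr_pdivrMr // mulr_natr mulr2n ltrDl.
move: h; rewrite ler_pdivlMr //; apply: le_trans; rewrite ler_wpM2l ?lerDl //.
by rewrite exprn_ge0 // ltW.
Qed.

Lemma reach x : exists k0, forall k, (k0 <= k)%N -> good (iter k al x).
Proof.
have [d d0 hd] := (nbhs_distP hg Xc p _).1 (good_near good_p).
by have [k0 hk] := reach_ball x d0; exists k0 => k /hk /hd.
Qed.

Lemma reach1 x : exists k, good (iter k al x).
Proof. by have [k0 h] := reach x; exists k0; exact: h. Qed.

(** The extension of [E] forced by [E \o al = A \o E]: iterate [al] until the point enters the
    domain of [E], then undo the iterations by [B]. The value does not depend on the number of
    iterations, as [lin_mapE] records. *)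
Definition lin_map (x : X) : V :=
  let k := projT1 (cid (reach1 x)) in iter k B (E (chart_map c (iter k al x))).

Lemma iterBA k u : iter k B (iter k A u) = u.
Proof. by elim: k u => // k IH u; rewrite iterSr iterS BA IH. Qed.

Lemma iterAB k u : iter k A (iter k B u) = u.
Proof. by elim: k u => // k IH u; rewrite iterSr iterS AB IH. Qed.

Lemma lin_map_shift j k x : good (iter k al x) ->
  iter (j + k) B (E (chart_map c (iter (j + k) al x))) = iter k B (E (chart_map c (iter k al x))).
Proof.
move=> gk; rewrite (iterD j k al x); have [_ _ ->] := good_iter j gk.
by rewrite addnC (iterD k j B) iterBA.
Qed.

Lemma lin_mapE k x : good (iter k al x) -> lin_map x = iter k B (E (chart_map c (iter k al x))).
Proof.
move=> gk; rewrite /lin_map; have gk' := projT2 (cid (reach1 x)).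
set k' := projT1 _ in gk' *.
by rewrite -(lin_map_shift k gk') -(lin_map_shift k' gk) addnC.
Qed.

Lemma lin_map_good y : good y -> lin_map y = E (chart_map c y).
Proof. exact: (@lin_mapE 0%N y). Qed.

Lemma lin_map_iter k x : lin_map (iter k al x) = iter k A (lin_map x).
Proof.
have [k0 h] := reach x.
have g1 : good (iter (k0 + k) al x) by apply: h; rewrite leq_addr.
have g2 : good (iter k0 al (iter k al x)) by rewrite -iterD.
by rewrite (lin_mapE g1) (lin_mapE g2) (iterD k0 k al x) addnC (iterD k k0 B) iterAB.
Qed.

Lemma iterB_lin_diff k w : differentiable (fun u : V => iter k B u) w /\
  forall v, 'd (fun u : V => iter k B u) w v = iter k B v.
Proof.
have [m m0 hm] := gnorm_lower hg cp; have [C C0 hC] := gnorm_upper hg cp.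
have lin : linear (fun u : V => iter k B u).
  by elim: k => [|k IH] // t u v; rewrite !iterS IH linearP.
have add u v : iter k B (u + v) = iter k B u + iter k B v.
  by elim: k {lin} => // k IH; rewrite !iterS IH linearD.
have hb (u : V) : rn (iter k B u) <= (l^-1 ^+ k * C / m) * rn u.
  rewrite mulrAC ler_pdivlMr // mulrC; apply: le_trans (hm _) _.
  by rewrite -/Np NpiterB -mulrA ler_wpM2l // exprn_ge0 // invr_ge0 ltW.
exact: (@linear_bounded_diff R n n (fun u : V => iter k B u) _ w lin add hb).
Qed.

Lemma E_diff y : good y -> differentiable E (chart_map c y).
Proof. by move=> [cy hy]; have [_ _ _ [_ h _ _]] := HE hy. Qed.

Lemma lin_map_diff c1 x k : chart_dom c1 x -> good (iter k al x) ->
  differentiable (lin_map \o chart_inv c1) (chart_map c1 x) /\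
  forall u, 'd (lin_map \o chart_inv c1) (chart_map c1 x) u =
    iter k B ('d E (chart_map c (iter k al x)) (tangent_map (iter k al) c1 c x u)).
Proof.
move=> cx gk; have [[ci di] _ _] := homothety_iter hg k hal.
have [ck _] := gk; have da := di c1 c x cx ck.
have nG : \forall y \near x, good (iter k al y) by apply: ci; exact: good_near.
have [d d0 hd] := near_chart_inv cx nG.
have E0 : local_rep (iter k al) c1 c (chart_map c1 x) = chart_map c (iter k al x).
  by rewrite /local_rep /= chart_mapK.
have dE : differentiable E (local_rep (iter k al) c1 c (chart_map c1 x)) by rewrite E0; exact: E_diff.
have [D1 D1'] := diff_comp_rn da dE.
have [D2 D2'] := iterB_lin_diff k (E (local_rep (iter k al) c1 c (chart_map c1 x))).
have [D3 D3'] := @diff_comp_rn R n n n (fun z => E (local_rep (iter k al) c1 c z)) (fun u => iter k B u) _ D1 D2.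
have EQ z : rn (z - chart_map c1 x) < d ->
    iter k B (E (local_rep (iter k al) c1 c z)) = (lin_map \o chart_inv c1) z.
  by move=> /hd [_ _ gz]; rewrite /= (lin_mapE gz).
have [D4 D4'] := diff_near_eq d0 EQ D3.
split; first exact: D4.
move=> u; apply: (etrans (D4' u)); apply: (etrans (D3' u)); apply: (etrans (D2' _)).
apply: (etrans (congr1 (fun w : V => iter k B w) (D1' u))).
exact: (congr1 (fun w : V => iter k B ('d E w (tangent_map (iter k al) c1 c x u))) E0).
Qed.

(* By the Cauchy estimate applied to [E z - (z - z0)], which is quadratic at [z0]. *)
Lemma dE_near (e : R) : 0 < e -> e < 1 -> exists2 d : R, 0 < d & forall y, dist p y < d ->
  good y /\ forall v, Np ('d E (chart_map c y) v) <= (1 + e) ^+ 2 * gnorm (g := g) c y v /\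
    (1 - e) * gnorm (g := g) c y v <= (1 + e) * Np ('d E (chart_map c y) v).
Proof.
move=> e0 e1; have [m m0 hm] := gnorm_lower hg cp; have [C C0 hC] := gnorm_upper hg cp.
(* On the ball of radius [s] the remainder [E z' - (z' - z0)] is of order [s ^+ 2]. Cauchy's
   estimate divides by [s], and [s * (Q - 1)] is the resulting bound on the deviation of the
   differential from the identity, relative to [Np]. *)
pose Q := C * (2 * (K * (C * 2) ^+ 2 / m)) / m + 1.
have Q0 : 0 < Q.
  by rewrite ltr_wpDl // !(divr_ge0, mulr_ge0, sqr_ge0) // ltW.
pose s := Num.min (e / Q) (r / (4 * C)).
have s0 : 0 < s by rewrite lt_min !divr_gt0 ?mulr_gt0.
have sQ : s * Q <= e by rewrite -ler_pdivlMr // ge_min lexx.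
have sr : s * (4 * C) <= r by rewrite -ler_pdivlMr ?mulr_gt0 // ge_min lexx orbT.
have [d1 d10 hd1] := gnorm_ratio hg cp e0.
have n1 : nbhs p (chart_map c @^-1` [set w | rn (w - z0) < Num.min s d1]).
  have sd : 0 < Num.min s d1 by rewrite lt_min s0.
  apply: (@chart_map_continuous R n X c p cp); apply/nbhs_rnP; by exists (Num.min s d1).
have [d d0 hd] := (nbhs_distP hg Xc p _).1 (filterI (good_near good_p) n1).
exists d => // y /hd [gy] /=; rewrite lt_min => /andP[ys yd]; split=> // v.
have [cy hy] := gy.
set z := chart_map c y in ys yd hy *.
have [_ _ hN] := hd1 z yd; have [hN1 hN2] := hN v; rewrite /z chart_mapK // in hN1 hN2.
have rz z' : rn (z' - z) <= s -> Np (z' - z0) <= C * (2 * s) /\ Np (z' - z0) < r.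
  move=> h; have h2 : rn (z' - z0) <= 2 * s.
    by have := rnBD z' z z0; have := ltW ys; lra.
  have h3 : Np (z' - z0) <= C * (2 * s) by apply: le_trans (hC _) _; rewrite ler_pM2l.
  split=> //; apply: le_lt_trans h3 _; apply: lt_le_trans sr.
  by have := mulr_gt0 s0 C0; nra.
have dEz z' : rn (z' - z) <= s -> differentiable E z'.
  by move=> /rz [_ h]; have [_ _ _ [_ k _ _]] := HE h.
have dS z' : rn (z' - z) <= s -> differentiable (fun w : V => w - z0) z'.
  by move=> _; have [] := @diff_shift R n z0 z'.
have bnd z' : rn (z' - z) <= s -> rn (E z' - (z' - z0)) <= (K * (C * 2) ^+ 2 / m) * s ^+ 2.
  move=> /rz [h1 h2]; have [_ _ _ [_ _ _ k]] := HE h2.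
  rewrite mulrAC ler_pdivlMr // mulrC; apply: le_trans (hm _) _; apply: le_trans k _.
  rewrite -mulrA ler_wpM2l // -exprMn -mulrA ler_sqr ?nnegrE ?Np_ge0 //.
  by rewrite !mulr_ge0 // ltW.
have ce := @cauchy_sub R n n E (fun w : V => w - z0) z s _ s0 dEz dS bnd v.
have [_ ds] := @diff_shift R n z0 z.
have ce' : rn ('d E z v - v) <= 2 * (K * (C * 2) ^+ 2 / m * s ^+ 2) / s * rn v.
  exact: (eq_ind _ (fun w : V => rn ('d E z v - w) <= _) ce _ (ds v)).
have close : Np ('d E z v - v) <= e * Np v.
  apply: le_trans (hC _) _; apply: le_trans (ler_wpM2l (ltW C0) ce') _.
  rewrite [leLHS](_ : _ = (s * (Q - 1)) * (m * rn v)); last first.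
    by rewrite /Q; field; rewrite !gt_eqF.
  apply: ler_pM; [|by rewrite mulr_ge0 ?rn_ge0 // ltW| |exact: hm].
    by rewrite mulr_ge0 ?(ltW s0) // addrK !(divr_ge0, mulr_ge0, sqr_ge0) // ltW.
  by apply: le_trans sQ; rewrite ler_wpM2l ?(ltW s0) // gerBl.
have t1 := gnormD hg ('d E z v - v) v cp; rewrite subrK in t1.
have t2 := gnormD hg (- ('d E z v - v)) ('d E z v) cp; rewrite (gnormN hg _ cp) opprB subrK in t2.
rewrite -/Np in t1 t2 hN1 hN2 *; rewrite -/z.
have p1 := Np_ge0 v; have p2 : 0 <= gnorm (g := g) c y v by exact: gnorm_ge0.
move: (Np v) (Np _) (Np _) (gnorm c y v) p1 p2 t1 t2 hN1 hN2 close => a1 a2 a3 a4 *.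
split; nra.
Qed.

(** The iterate of [al] multiplies norms by [l ^+ k] and the iterate of [B] by its inverse, both
    exactly; in between, the differential of [E] is as close to an isometry as desired, because the
    iterates of [x] tend to [p]. No error survives. *)
Lemma lin_map_isometry c1 x u : chart_dom c1 x ->
  Np ('d (lin_map \o chart_inv c1) (chart_map c1 x) u) = gnorm (g := g) c1 x u.
Proof.
move=> cx; apply: squeeze_one; [exact: gnorm_ge0|exact: gnorm_ge0|].
move=> e e0 e1; have [d d0 hd] := dE_near e0 e1.
have [k0 hk] := reach_ball x d0; have hk0 := hk k0 (leqnn _).
have [gk H] := hd _ hk0; have [_ ->] := lin_map_diff cx gk.
have [ck _] := gk; have hi := homothety_iter hg k0 hal.
have [h1 h2] := H (tangent_map (iter k0 al) c1 c x u).
have hN := homothety_N u hi cx ck; rewrite hN in h1 h2.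
have lk : 0 < l ^+ k0 by rewrite exprn_gt0.
rewrite NpiterB exprVn; split.
  by rewrite ler_pdivrMl //; apply: le_trans h1 _; rewrite mulrCA.
by rewrite mulrCA ler_pdivlMl // mulrCA.
Qed.

Lemma lin_map_cont x : {for x, continuous lin_map}.
Proof.
have [c1 cx] := chart_cover x; have [k gk] := reach1 x.
have [D _] := lin_map_diff cx gk; have cD := differentiable_continuous D.
move=> U /= nU; have nU' : nbhs (chart_map c1 x) ((lin_map \o chart_inv c1) @^-1` U).
  by apply: cD; rewrite /= chart_mapK.
have [d d0 hd] := (nbhs_rnP _ _).1 nU'.
by apply: (near_chart cx); exists d.
Qed.

Lemma NpiterA k u : Np (iter k A u) = l ^+ k * Np u.
Proof. by elim: k => [|k IH]; rewrite ?expr0 ?mul1r // iterS NpA IH exprS mulrA. Qed.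

Lemma iterA_sub k u v : iter k A (u - v) = iter k A u - iter k A v.
Proof. by elim: k => // k IH; rewrite !iterS IH linearB. Qed.

Lemma iterB_sub' k u v : iter k B (u - v) = iter k B u - iter k B v.
Proof. by elim: k => // k IH; rewrite !iterS IH linearB. Qed.

Lemma be_iter k : homothety (g := g) (l^-1 ^+ k) (iter k be).
Proof.
have h := homothety_inv hg hal hbe beK.
exact: (homothety_iter hg k h).
Qed.

Lemma dist_iter_eq k x y : dist (iter k al x) (iter k al y) = l ^+ k * dist x y.
Proof.
have [hb _ _] := be_iter k.
exact: (dist_homothety_eq hg Xc x y (homothety_iter hg k hal) hb (iter_can k alK) (iter_can k beK)).
Qed.

Lemma chart_at_p : exists C d : R, [/\ 0 < C, 0 < d &
  forall z z', rn (z - z0) < d -> rn (z' - z0) < d ->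
    chart_dom c (chart_inv c z) /\ dist (chart_inv c z) (chart_inv c z') <= C * Np (z' - z)].
Proof.
have [C [d [C0 d0 H]]] := dist_chart hg cp; have [m m0 hm] := gnorm_lower hg cp.
exists (C / m), d; split=> //; first exact: divr_gt0.
move=> z z' hz hz'; have [cz _ _ k] := H z hz; split=> //.
apply: le_trans (k z' hz') _; rewrite mulrAC -mulrA ler_pM2l // ler_pdivlMr // mulrC; exact: hm.
Qed.

(* Comparing [alpha^k x] and [alpha^k y] in the chart and letting [k] tend to infinity. *)
Lemma lin_map_lower : exists2 C : R, 0 < C & forall x y, dist x y <= C * Np (lin_map x - lin_map y).
Proof.
have [C [d [C0 d0 H]]] := chart_at_p; exists C => // x y.
have n1 : nbhs p (chart_map c @^-1` [set w | rn (w - z0) < d]).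
  by apply: (@chart_map_continuous R n X c p cp); apply/nbhs_rnP; exists d.
have [s s0 hs] := (nbhs_distP hg Xc p _).1 (filterI (good_near good_p) n1).
have [kx hx] := reach_ball x s0; have [ky hy] := reach_ball y s0.
pose k := maxn kx ky.
have [gx xd] := hs _ (hx k (leq_maxl _ _)); have [gy yd] := hs _ (hy k (leq_maxr _ _)).
have /andP[lm m1] := hmu; have mu0 : 0 < mu by exact: lt_trans l0 lm.
pose q := mu ^+ 2 / l; have q01 : 0 <= q < 1.
  by rewrite divr_ge0 ?sqr_ge0 ?(ltW l0) //= ltr_pdivrMr // mul1r.
(* After [j + k] iterations both points lie in the chart at [p], where [E] differs from the
   coordinate by at most [K * (mu ^+ j * r) ^+ 2]. Rescaling by [l ^- (j + k)] leaves an error of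
   order [(mu ^+ 2 / l) ^+ j]. *)
have main j : dist x y <= C * (Np (lin_map x - lin_map y) + 2 * K * r ^+ 2 * l^-1 ^+ k * q ^+ j).
  have lk : 0 < l ^+ (j + k) by rewrite exprn_gt0.
  have sj w : dist p (iter (j + k) al w) < s -> good (iter (j + k) al w) /\
      rn (chart_map c (iter (j + k) al w) - z0) < d by move=> /hs [].
  have [gxj xjd] := sj x (hx (j + k)%N (leq_trans (leq_maxl _ _) (leq_addl _ _))).
  have [gyj yjd] := sj y (hy (j + k)%N (leq_trans (leq_maxr _ _) (leq_addl _ _))).
  have Fx := lin_map_iter (j + k) x; rewrite (lin_map_good gxj) in Fx.
  have Fy := lin_map_iter (j + k) y; rewrite (lin_map_good gyj) in Fy.
  have [_ nx _] := good_iter j gx; rewrite -iterD in nx.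
  have [_ ny _] := good_iter j gy; rewrite -iterD in ny.
  have [cxj rxj] := gxj; have [cyj ryj] := gyj.
  have [_ _ _ [_ _ _ ex]] := HE rxj; have [_ _ _ [_ _ _ ey]] := HE ryj.
  have [_] := H _ _ xjd yjd; rewrite !chart_mapK // dist_iter_eq => h.
  set a1 := chart_map c _ in nx ex rxj h xjd Fx; set a2 := chart_map c _ in ny ey ryj h yjd Fy.
  have D : Np (a2 - a1) <= l ^+ (j + k) * Np (lin_map x - lin_map y) + 2 * (K * (mu ^+ j * r) ^+ 2).
    have -> : a2 - a1 = - ((E a2 - (a2 - z0)) - (E a1 - (a1 - z0))) + (E a2 - E a1).
      exact: split_difference.
    apply: le_trans (gnormD hg _ _ cp) _; rewrite (gnormN hg _ cp) addrC -/Np; apply: lerD.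
      rewrite Fx Fy -iterA_sub NpiterA ler_pM2l //.
      by have E1 := gnormN hg (lin_map x - lin_map y) cp; rewrite opprB in E1; rewrite /Np E1.
    apply: le_trans (gnormD hg _ _ cp) _; rewrite (gnormN hg _ cp) -/Np.
    have bq w : 0 <= w -> w <= mu ^+ j * r -> K * w ^+ 2 <= K * (mu ^+ j * r) ^+ 2.
      by move=> w0 hw; rewrite ler_wpM2l // ler_sqr ?nnegrE // (le_trans w0).
    have mj : 0 <= mu ^+ j by rewrite exprn_ge0 // ltW.
    have b1 := bq _ (Np_ge0 _) (le_trans nx (ler_wpM2l mj (ltW (proj2 gx)))).
    have b2 := bq _ (Np_ge0 _) (le_trans ny (ler_wpM2l mj (ltW (proj2 gy)))).
    by have := le_trans ex b1; have := le_trans ey b2; rewrite -/a1 -/a2; lra.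
  rewrite -(ler_pM2l lk); apply: le_trans h _; rewrite mulrCA ler_pM2l //.
  apply: le_trans D _; rewrite [in leRHS]mulrDr lerD2l; apply: eq_ler.
  by apply: rate_balance; rewrite gt_eqF.
apply/ler_addgt0Pr => e e0.
pose W := C * (2 * K * r ^+ 2 * l^-1 ^+ k).
have W0 : 0 <= W.
  by rewrite !mulr_ge0 ?sqr_ge0 ?exprn_ge0 ?invr_ge0 // ltW.
have e1 : 0 < e / (W + 1) by rewrite divr_gt0 // ltr_wpDl.
have [j0 hj] := geometric_small q01 e1; apply: le_trans (main j0) _.
rewrite mulrDr lerD2l mulrA -/W; have := hj j0 (leqnn _).
rewrite ler_pdivlMr ?ltr_wpDl // mulrC; apply: le_trans; rewrite ler_wpM2r ?lerDl //.
by rewrite exprn_ge0 //; case/andP: q01.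
Qed.

Lemma iter_bep k : iter k be p = p.
Proof. by elim: k => // k IH; rewrite iterS IH bep. Qed.

(** The distance from [lin_map x] to [zeta] is minimized over a compact ball. Taking the chart point
    [z0 + A^k zeta] back by [be^k] gives points of that ball whose images miss [zeta] by [l^-k]
    times an error quadratic in [l^k], so the minimum is 0. *)
Lemma lin_map_surj zeta : exists x, lin_map x = zeta.
Proof.
have [C [d [C0 d0 H]]] := chart_at_p; have [m m0 hm] := gnorm_lower hg cp.
have [Cu Cu0 hCu] := gnorm_upper hg cp.
pose Z := Np zeta; have Z0 : 0 <= Z by exact: Np_ge0.
pose f x := Np (lin_map x - zeta).
have fc : continuous f.
  move=> x; apply/cvgrPdist_lt => e e0.
  have n1 : nbhs x (lin_map @^-1` [set w | rn (w - lin_map x) < e / Cu]).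
    have := @lin_map_cont x [set w | rn (w - lin_map x) < e / Cu]; apply.
    by apply/nbhs_rnP; exists (e / Cu) => //; exact: divr_gt0.
  apply: filterS n1 => y /= hy.
  have h1 : Np (lin_map y - lin_map x) < e.
    by apply: le_lt_trans (hCu _) _; rewrite mulrC -ltr_pdivlMr.
  have h2 := gnormD hg (lin_map y - lin_map x) (lin_map x - zeta) cp; rewrite -sub_split in h2.
  have h3 := gnormD hg (lin_map x - lin_map y) (lin_map y - zeta) cp; rewrite -sub_split in h3.
  rewrite -(gnormN hg (lin_map x - lin_map y) cp) opprB in h3.
  by rewrite /f ltr_norml; apply/andP; rewrite -/Np in h2 h3; split; lra.
have [||x _ hx] := @compact_EVT_min X R f _ _ (cpl (x := p) (r := C * Z)).
- by exists p; rewrite /= distxx // mulr_ge0 // ltW.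
- exact: continuous_subspaceT.
have f0 : f x <= 0.
  apply/ler_addgt0Pr => e e0; rewrite add0r.
  (* [t] will bound the norm of [A^k zeta]: the three terms keep the point in the domain of [E], in
     the chart ball of the distance estimate, and make the final error [K * Z * t] at most [e]. *)
  pose t := Num.min (Num.min (r / 2) (m * d / 2)) (e / (K * Z + 1)).
  have KZ : 0 < K * Z + 1 by rewrite ltr_wpDl // mulr_ge0.
  have t0 : 0 < t by rewrite !lt_min !divr_gt0 // mulr_gt0.
  have l01 : 0 <= l < 1 by rewrite (ltW l0).
  have tZ : 0 < t / (Z + 1) by rewrite divr_gt0 // ltr_wpDl.
  have [k hk] := geometric_small l01 tZ; have lk := hk k (leqnn _).
  have lk0 : 0 < l ^+ k by rewrite exprn_gt0.
  have lZ : l ^+ k * Z <= t.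
    move: lk; rewrite ler_pdivlMr ?ltr_wpDl //; apply: le_trans.
    by rewrite ler_pM2l // lerDl.
  pose u := iter k A zeta; have uN : Np u = l ^+ k * Z by exact: NpiterA.
  have t1 : t <= r / 2 by rewrite !ge_min lexx.
  have t2 : t <= m * d / 2 by rewrite !ge_min lexx orbT.
  have t3 : t <= e / (K * Z + 1) by rewrite ge_min lexx orbT.
  pose z := z0 + u; have zu : z - z0 = u by rewrite /z [z0 + u]addrC addrK.
  have zr : Np (z - z0) < r by rewrite zu uN; have := r0; lra.
  have zd : rn (z - z0) < d.
    rewrite -(ltr_pM2l m0); apply: le_lt_trans (hm _) _; rewrite -/Np zu uN.
    by have := mulr_gt0 m0 d0; lra.
  have [cz Kz _ [_ _ _ ez]] := HE zr.
  pose y := chart_inv c z; pose xk := iter k be y.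
  have gy : good (iter k al xk).
    by rewrite /xk (iter_can k beK); split=> //; rewrite /y Kz.
  have ak : iter k al xk = y := iter_can k beK y.
  have Fk : lin_map xk = iter k B (E z) := etrans (lin_mapE gy)
    (congr1 (fun w => iter k B (E w)) (etrans (congr1 (chart_map c) ak) Kz)).
  have xkB : dist p xk <= C * Z.
    have z00 : rn (z0 - z0) < d by rewrite subrr rn0.
    have := dist_homothety hg Xc p y (be_iter k); rewrite iter_bep => h; apply: le_trans h _.
    have [_] := H _ _ z00 zd; rewrite {1}/z0 chart_mapK // zu uN -/y => h.
    rewrite exprVn ler_pdivrMl //; apply: le_trans h _; by rewrite mulrCA.
  have := hx xk (ltac:(by rewrite inE)) => h; apply: le_trans h _.
  rewrite /f Fk -{1}(iterBA k zeta) -iterB_sub' NpiterB -/u.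
  rewrite zu uN in ez; rewrite exprVn ler_pdivrMl //; apply: le_trans ez _.
  rewrite exprMn expr2 -mulrA mulrCA ler_pM2l // mulrCA.
  have h2 : l ^+ k * Z * (K * Z) <= e.
    apply: (@le_trans _ _ (e / (K * Z + 1) * (K * Z))).
      by rewrite ler_wpM2r ?mulr_ge0 // (le_trans lZ).
    by rewrite mulrAC ler_pdivrMr // ler_wpM2l ?(ltW e0) // lerDl.
  by apply: le_trans h2; rewrite expr2; apply: eq_ler; ring.
exists x; have : rn (lin_map x - zeta) = 0.
  apply/eqP; rewrite eq_le rn_ge0 andbT -(pmulr_rle0 _ m0); exact: le_trans (hm _) f0.
by move=> /eqP; rewrite rn_eq0 subr_eq0 => /eqP.
Qed.
End Global.

Lemma linearization_exists : exists F : X -> V, [/\ forall x, {for x, continuous F},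
  forall c1 x, chart_dom c1 x -> differentiable (F \o chart_inv c1) (chart_map c1 x) /\
    forall u, Np ('d (F \o chart_inv c1) (chart_map c1 x) u) = gnorm (g := g) c1 x u,
  exists2 C : R, 0 < C & forall x y, dist x y <= C * Np (F x - F y) &
  forall zeta, exists x, F x = zeta].
Proof.
have [E [mu [r [K [h1 h2 h3 h4 H]]]]] := koenigs_chart.
exists (lin_map E h3); split.
- by move=> x; apply: lin_map_cont; eassumption.
- move=> c1 x cx; split; last by move=> u; apply: lin_map_isometry; eassumption.
  have [k gk] : exists k, good r (iter k al x) by apply: reach1; eassumption.
  by have [D _] := lin_map_diff h1 h3 H cx gk.
- by apply: lin_map_lower; eassumption.
- by apply: lin_map_surj; eassumption.
Qed.
End Linearization.

(** * The theorem *)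

Section Conformal.
Context {R : realType} {n : nat} {X : complexManifold R n}.

Lemma smooth_cst (a : R) : smooth_on [set: X] (fun _ => a).
Proof.
move=> c k; apply: (@BC_Ck R n unit k _ (fun _ => (fun _ => a) \o chart_inv c) _ tt).
by apply: (@BC_cst R n unit k _ (fun=> a) `|a|).
Qed.

Lemma image_setT c : open (chart_map c @` (@chart_dom R n X c `&` setT)).
Proof. by rewrite setIT; exact: chart_image_open. Qed.

Lemma Ck_mul k (U : set (Cspace R n)) f h : open U -> Ck k U f -> Ck k U h ->
  Ck k U (fun z => f z * h z).
Proof.
move=> oU Cf Ch; apply: (@BC_Ck R n unit k U (fun _ z => f z * h z) _ tt).
by apply: (@BCM R n unit k U (fun _ => f) (fun _ => h)) => //; exact: Ck_BC.
Qed.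

Lemma smooth_pos_div (f h : X -> R) : smooth_pos_on [set: X] f -> smooth_pos_on [set: X] h ->
  smooth_pos_on [set: X] (fun x => f x / h x).
Proof.
move=> [sf pf] [sh ph]; split; last by move=> x _; rewrite divr_gt0 ?pf ?ph.
move=> c k; rewrite -[_ \o chart_inv c]/(fun z => (f \o chart_inv c) z * (h (chart_inv c z))^-1).
apply: (@Ck_mul k _ (f \o chart_inv c) (fun z => (h (chart_inv c z))^-1) (@image_setT c) (sf c k)).
apply: (@BC_Ck R n unit k _ (fun _ z => ((h \o chart_inv c) z)^-1) _ tt).
apply: (@BC_inv R n k _ (h \o chart_inv c) (@image_setT c)); last by apply: Ck_BC; exact: sh.
by move=> z _; rewrite gt_eqF //; exact: ph.
Qed.

Variable g : tensorField X.
Hypothesis hg : hermitian_metric g.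

Definition rescale (v : X -> R) : tensorField X := fun c x a b => v x * g c x a b.

Lemma rescale_hermitian v : smooth_pos_on [set: X] v -> hermitian_metric (rescale v).
Proof.
move=> [sv pv]; split.
- by move=> c x cx _ a u u' w; rewrite /rescale (hermitian_linear hg cx I); ring.
- by move=> c x cx _ u w; rewrite /rescale (hermitian_sym hg cx I).
- by move=> c x cx _ u u0; rewrite mulr_gt0 ?pv // (hermitian_pos hg cx I).
- by move=> c x cx _ u w; rewrite /rescale (hermitian_J hg cx I).
- by move=> c c' x cx cx' _ u w; rewrite /rescale (hermitian_tensor hg cx cx' I).
- move=> c u w k; exact: (@Ck_mul k _ (v \o chart_inv c) (fun z => g c (chart_inv c z) u w)
    (@image_setT c) (sv c k) (hermitian_smooth hg c u w k)).
Qed.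

(** An isometry of [v * g] multiplies [g] by [v / (v \o a)]. This inclusion serves twice, as half of
    the equality and as the maximality statement. *)
Lemma Iso_conformal h : conformal_to h g -> Iso h `<=` Conf g.
Proof.
move=> [v [sv pv] hv] a [[ha ia] pa]; split; first by split.
exists (fun x => v x / v (a x)).
  by apply: smooth_pos_div => //; split; [exact: smooth_pullback|move=> x _; exact: pv].
move=> c c' x cx cx' u w; have := pa c c' x cx cx' u w.
rewrite /cst mul1r (hv c' (a x) cx' I) (hv c x cx I) => E.
have va := pv (a x) I.
by rewrite mulrAC -E mulrC mulKf // gt_eqF.
Qed.

End Conformal.

Section Main.
Context {R : realType} {n : nat} {X : complexManifold R n} {g : tensorField X}.
Hypotheses (n2 : (2 <= n)%N) (Xc : connected [set: X]) (gK : kahler_metric g).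
Let hg : hermitian_metric g := proj1 gK.
Local Notation homothety := (@homothety R n X g).

Lemma Conf_homothety a : Conf g a -> exists l, homothety l a.
Proof.
move=> [[ha _] [f [sf pf] pa]].
(* On the empty manifold any ratio will do; otherwise the constant factor is read at one point. *)
have [[x0 _]|/nonemptyPn X0] := pselect ([set: X] !=set0); last first.
  exists 1; split=> // c c' x; have : [set: X] x by []. by rewrite X0.
exists (Num.sqrt (f x0)); split=> //; first by rewrite sqrtr_gt0 pf.
move=> c c' x cx cx' u w; rewrite (pa c c' x cx cx') /cst sqr_sqrtr ?ltW ?pf //.
by rewrite (factor_constant gK n2 ha sf pa Xc x x0).
Qed.

(** The equation for [v] makes every homothety of [g] an isometry of [v * g]. As [v] is defined on
    all of [X], the covering by [X] alone exhibits the locally conformal Kahler structure. *)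
Lemma invariant_metric v : smooth_pos_on [set: X] v ->
  (forall l a y, biholomorphic a -> homothety l a -> l ^+ 2 * v (a y) = v y) ->
  exists h : tensorField X,
    [/\ lcK_metric h, conformal_to h g, Iso h = Conf g &
        forall h', hermitian_metric h' -> conformal_to h' g -> Iso h' `<=` Iso h].
Proof.
move=> sv Hv.
have cf : conformal_to (rescale g v) g by exists v.
have E : Iso (rescale g v) = Conf g.
  apply/seteqP; split; first exact: Iso_conformal.
  move=> a Ca; have [l hl] := Conf_homothety Ca; have [ba _] := Ca; split=> //.
  have [_ _ pa] := hl; move=> c c' x cx cx' u w; rewrite /rescale (pa c c' x cx cx') /cst mul1r.
  by rewrite mulrA [v _ * _]mulrC (Hv l a x).
exists (rescale g v); split=> //; last by move=> h' _ ch'; rewrite E; exact: Iso_conformal.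
split; first exact: rescale_hermitian.
exists unit, (fun _ => setT), (fun _ => v), (fun _ => g); split => //.
- by move=> _; exact: openT.
- by apply/seteqP; split=> // x _; exists tt.
Qed.

Lemma finite_radius_weight x1 (r1 : R) : ~ @ball_cpt R n X g x1 r1 ->
  exists v, smooth_pos_on [set: X] v /\
  forall l a y, biholomorphic a -> homothety l a -> l ^+ 2 * v (a y) = v y.
Proof.
move=> ncpt.
pose P (w : X -> R) := forall (a : @hom R n X g) y, lam x1 a ^+ 2 * w (sval a y) = w y.
have [x|v [sv pv Hv]] := @positive_combination R n X P.
  have [w [sw w0 wx hw]] := weight_exists hg Xc ncpt x; exists w; split=> //.
exists v; split; first by split.
move=> l a y ba hl; pose b : @hom R n X g := exist _ a (conj ba (ex_intro (fun l => homothety l a) l hl)).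
(* Both numbers are the quotient of [rho] at [a y] by [rho] at [y]. *)
have -> : l = lam x1 b.
  have [ha [a' [ha' aK Ka]]] := ba.
  have := rho_homothety hg Xc ncpt y hl ha' aK Ka.
  rewrite -[a y]/(sval b y) (lam_rho hg Xc ncpt) => /(congr1 (fun t => t / @rho R n X g y)).
  by rewrite !mulfK // gt_eqF // (rho_gt0 hg Xc ncpt).
by apply: Hv => w Pw; exact: (Pw b y).
Qed.

End Main.

Section FlatMaps.
Context {R : realType} {n : nat}.
Local Notation V := (Cspace R n).
Local Notation Y := (flat_space R n).

Lemma mulmx_holomorphic (M : 'M[R[i]]_n) : @holomorphic R n n Y Y (fun u : V => ((u : 'rV_n) *m M : V)).
Proof.
split; first by move=> u; apply: differentiable_continuous; have [] := mulmx_diff M u.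
by move=> c c' u _ _; have [] := mulmx_diff M u.
Qed.

Lemma mulmx_biholomorphic (M : 'M[R[i]]_n) : M \in unitmx ->
  @biholomorphic R n Y Y (fun u : V => ((u : 'rV_n) *m M : V)).
Proof.
move=> uM; split; first exact: mulmx_holomorphic.
exists (fun u : V => ((u : 'rV_n) *m invmx M : V)); split; first exact: mulmx_holomorphic.
  by move=> u; exact: mulmxK.
by move=> u; exact: mulmxKV.
Qed.

End FlatMaps.

(** * A Kahler manifold with a contracting homothety is flat *)

Section Flat.
Context {R : realType} {n : nat} {X : complexManifold R n} {g : tensorField X}.
Hypotheses (hg : hermitian_metric g) (Xc : connected [set: X]).
Local Notation dist := (@dist R n X g).
Local Notation V := (Cspace R n).
Local Notation Y := (flat_space R n).
Local Notation Ng := (gnorm (g := g)).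

Lemma polarization (c c1 : chart X) p x (L : {linear V -> V}) : chart_dom c p -> chart_dom c1 x ->
  (forall u, Ng c p (L u) = Ng c1 x u) -> forall u v, g c p (L u) (L v) = g c1 x u v.
Proof.
move=> cp cx H u v.
have Q w : g c p (L w) (L w) = g c1 x w w by rewrite -(gnorm_sq hg (L w) cp) -(gnorm_sq hg w cx) H.
have := Q (u + v); rewrite linearD (gDl hg cp) !(gDr hg cp) (gDl hg cx) !(gDr hg cx) !Q.
rewrite (gC hg cp (L v)) (gC hg cx v); lra.
Qed.

(** The lower bound makes [F] injective with continuous inverse, and the inverse is holomorphic by
    [diff_inverse], since an isometric differential is injective. Followed by the linear map of
    [hermitian_root], [F] becomes an isometry onto the standard flat space. *)
Lemma isometric_to_flat (c : chart X) p (F : X -> V) : chart_dom c p ->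
  (forall x, {for x, continuous F}) ->
  (forall c1 x, chart_dom c1 x -> differentiable (F \o chart_inv c1) (chart_map c1 x) /\
    forall u, Ng c p ('d (F \o chart_inv c1) (chart_map c1 x) u) = Ng c1 x u) ->
  (exists2 C : R, 0 < C & forall x y, dist x y <= C * Ng c p (F x - F y)) ->
  (forall zeta, exists x, F x = zeta) -> holomorphically_isometric g (@flat_metric R n).
Proof.
move=> cp cF dF [C C0 low] /choice[H FH].
have [m m0 hm] := gnorm_lower hg cp; have [Cu Cu0 hCu] := gnorm_upper hg cp.
have inj x y : F x = F y -> x = y.
  move=> E; apply: (dist_eq0 hg Xc); apply/eqP; rewrite eq_le dist_ge0 // andbT.
  by apply: le_trans (low x y) _; rewrite E subrr (gnorm0 hg cp) mulr0.
have HF : cancel F H by move=> x; apply: inj.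
have cH z : {for z, continuous H}.
  move=> U nU; have [r r0 hr] := (nbhs_distP hg Xc (H z) U).1 nU.
  apply/nbhs_rnP; exists (r / (C * Cu)); first by rewrite divr_gt0 // mulr_gt0.
  move=> z' hz; apply: hr; rewrite distC //; apply: le_lt_trans (low _ _) _; rewrite !FH.
  apply: (@le_lt_trans _ _ (C * (Cu * rn (z' - z)))); first by rewrite ler_pM2l.
  by rewrite mulrA mulrC -ltr_pdivlMr // mulr_gt0.
have dH c1 z : chart_dom c1 (H z) -> differentiable (chart_map c1 \o H) z.
  move=> cz; have [D iso] := dF c1 (H z) cz; have [m1 m10 hm1] := gnorm_lower hg cz.
  have n1 : nbhs z (H @^-1` (chart_dom c1)).
    by apply: cH; apply: open_nbhs_nbhs; split=> //; exact: chart_dom_open.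
  have [d d0 hd] := (nbhs_rnP _ _).1 n1.
  apply: (@diff_inverse R n (F \o chart_inv c1) (chart_map c1 \o H) (chart_map c1 (H z)) z (m1 / Cu) d D _ erefl d0).
  - by rewrite /= chart_mapK.
  - by move=> z' hz; rewrite /= chart_mapK //; exact: hd.
  - by apply: continuous_comp; [exact: cH|exact: chart_map_continuous].
  - exact: divr_gt0.
  - move=> u; rewrite mulrAC ler_pdivrMr //.
    apply: (@le_trans _ _ (Ng c1 (H z) u)); first exact: hm1.
    by rewrite -iso [leRHS]mulrC; exact: hCu.
have holF : @holomorphic R n n X Y F.
  by split=> [x|c1 c' x cx _]; [exact: cF|have [] := dF c1 x cx].
have holH : @holomorphic R n n Y X H.
  by split=> [z|c' c1 z _ cz]; [exact: cH|exact: dH].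
have bF : @biholomorphic R n X Y F by split=> //; exists H.
have [M uM hM] := hermitian_root hg cp.
pose gp : tensorField Y := fun _ _ u v => g c p u v.
have pF : @pullback_scaled R n X Y F gp (cst 1) g.
  move=> c1 c' x cx _ u v; rewrite /cst mul1r; have [_ iso] := dF c1 x cx.
  exact: (polarization (L := 'd (F \o chart_inv c1) (chart_map c1 x)) cp cx iso u v).
have pM : @pullback_scaled R n Y Y (fun u : V => ((u : 'rV_n) *m M : V)) (@flat_metric R n) (cst 1) gp.
  move=> c1 c' z _ _ u v; rewrite /cst mul1r /gp -hM.
  have [_ E] := mulmx_diff M z.
  have Eu : tangent_map (X := Y) (Y := Y) (fun u : V => ((u : 'rV_n) *m M : V)) c1 c' z u = (u : 'rV_n) *m M.
    exact: E.
  have Ev : tangent_map (X := Y) (Y := Y) (fun u : V => ((u : 'rV_n) *m M : V)) c1 c' z v = (v : 'rV_n) *m M.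
    exact: E.
  by rewrite /flat_metric Eu Ev.
exists ((fun u : V => ((u : 'rV_n) *m M : V)) \o F : X -> Y); split.
  exact: (biholomorphic_comp bF (mulmx_biholomorphic uM)).
have [hM' _] := mulmx_biholomorphic uM.
have := pullback_comp holF hM' pF pM.
by congr (pullback_scaled _ _ _ _); apply/funext => x; rewrite /cst mulr1.
Qed.

(** If the ratio exceeds 1, the inverse map is a contraction. The point [x0] is the start of the
    search for its fixed point. *)
Lemma homothety_flat (l : R) (F G : X -> X) (x0 : X) :
  (forall x r, @ball_cpt R n X g x r) -> homothety (g := g) l F -> holomorphic G ->
  cancel F G -> cancel G F -> l != 1 -> holomorphically_isometric g (@flat_metric R n).
Proof.
move=> cpl.
have K l' F' G' : homothety (g := g) l' F' -> holomorphic G' -> cancel F' G' -> cancel G' F' -> l' < 1 ->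
    holomorphically_isometric g (@flat_metric R n).
  move=> hF hG FK GK l1.
  have [p Fp] := contraction_fixed_point hg Xc cpl x0 hF l1.
  have [c cp] := chart_cover p.
  have [E [h1 h2 h3 h4]] := linearization_exists hg Xc cpl hF hG FK GK l1 Fp cp.
  exact: (isometric_to_flat cp h1 h2 h3 h4).
move=> hF hG FK GK; have [hF' l0 _] := hF.
rewrite neq_lt => /orP[l1|l1]; first exact: (K l F G).
by apply: (K l^-1 G F) => //; [exact: homothety_inv hF hG GK|rewrite invf_lt1].
Qed.
End Flat.

Theorem theorem30 (R : realType) (n : nat) (n_ge2 : (2 <= n)%N)
    (X : complexManifold R n) (X_connected : connected [set: X])
    (g : tensorField X) (g_kahler : kahler_metric g)
    (g_not_flat : ~ holomorphically_isometric g (@flat_metric R n)) :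
  exists h : tensorField X,
    [/\ lcK_metric h,
        conformal_to h g,
        Iso h = Conf g &
        forall h' : tensorField X, hermitian_metric h' -> conformal_to h' g ->
          Iso h' `<=` Iso h].
Proof.
have hg : hermitian_metric g by have [] := g_kahler.
suff [v [sv Hv]] : exists v : X -> R, smooth_pos_on [set: X] v /\
    forall l a y, biholomorphic a -> homothety (g := g) l a -> l ^+ 2 * v (a y) = v y.
  exact: (invariant_metric n_ge2 X_connected g_kahler sv Hv).
(* One ball that is not compact makes [rho] finite at every point. *)
have [[x1 [r1 ncpt]]|cpl] := pselect (exists x1 r1, ~ @ball_cpt R n X g x1 r1).
  exact: (finite_radius_weight X_connected g_kahler ncpt).
(* With all balls compact, a homothety of ratio other than 1 would make [X] flat; hence all
   homotheties are isometries and [g] itself is the metric sought. *)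
exists (fun _ => 1); split; first by split; [exact: smooth_cst|move=> x _].
move=> l a y [ha [b [hb aK bK]]] hl; rewrite mulr1.
have [->|l1] := eqVneq l 1; first by rewrite expr1n.
exfalso; apply: g_not_flat; apply: (homothety_flat hg X_connected y _ hl hb aK bK l1) => x r.
by apply: contrapT => h; apply: cpl; exists x, r.
Qed.
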